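(* There exists an absolute constant $C>0$ such that the following holds. Let $\alpha\in\mathbb{R}\setminus\mathbb{Q}$ satisfy $0\le\beta(\alpha)<\infty$, and consider the almost Mathieu operator $H_{\lambda,\alpha,\theta}$. For every real $\lambda$ with $|\lambda|\le e^{-C\beta(\alpha)}$ there exists $m_\star=m_\star(\lambda,\alpha)$ such that $$E_m^+-E_m^-\le|\lambda|^{\frac1C|m|}\qquad\text{for all } m\in\mathbb{Z}\setminus\{0\}\text{ with }|m|\ge m_\star .$$
   Context: For $\lambda,\theta\in\mathbb{R}$ and $\alpha$ irrational, the almost Mathieu operator on $\ell^2(\mathbb{Z})$ is $(H_{\lambda,\alpha,\theta}x)_n=x_{n+1}+x_{n-1}+2\lambda\cos(2\pi(\theta+n\alpha))x_n$. Its spectrum does not depend on $\theta$ and is denoted $\Sigma_{\lambda,\alpha}$. $\beta(\alpha)=\limsup_{k\to\infty}\frac{-\ln\|k\alpha\|_{\mathbb{R}/\mathbb{Z}}}{|k|}$, where $\|x\|_{\mathbb{R}/\mathbb{Z}}=\min_{k\in\mathbb{Z}}|x-k|$. Fibered rotation number: let $S_{\lambda,E}(x)=\begin{pmatrix}E-2\lambda\cos(2\pi x)&-1\\1&0\end{pmatrix}$. For a continuous $A:\mathbb{R}/\mathbb{Z}\to \mathrm{SL}(2,\mathbb{R})$ homotopic to the identity, the map $(x,v)\mapsto(x+\alpha,A(x)v/\|A(x)v\|)$ on $\mathbb{R}/\mathbb{Z}\times S^1$ (with $S^1$ parametrized by $y\mapsto(\cos2\pi y,\sin2\pi y)$) lifts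 to $F(x,y)=(x+\alpha,y+\psi(x,y))$ with $\psi$ continuous and 1-periodic in both variables; the fibered rotation number of $(\alpha,A)$ is $\lim_{n\to\infty}\frac1n\sum_{k=0}^{n-1}\psi(F^k(x,y))$ mod $\mathbb{Z}$ (independent of $(x,y)$ and of the lift). For $A=S_{\lambda,E}$ it has a representative $\rho_{\lambda,\alpha}(E)\in[0,\tfrac12]$, which is a continuous non-increasing surjective function $\mathbb{R}\to[0,\frac12]$ of $E$, equal to $\frac12$ for $E\le\min\Sigma_{\lambda,\alpha}$ and to $0$ for $E\ge\max\Sigma_{\lambda,\alpha}$ (equivalently, $1-2\rho_{\lambda,\alpha}$ is the integrated density of states). For $m\in\mathbb{Z}\setminus\{0\}$, the numbers $E_m^-\le E_m^+$ are defined by $[E_m^-,E_m^+]=\{E\in\mathbb{R}:2\rho_{\lambda,\alpha}(E)=m\alpha \bmod\mathbb{Z}\}$. *)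

(* Defs.v *)
From HB Require Import structures.
From mathcomp Require Import all_boot all_order all_algebra.
From mathcomp Require Import all_classical all_reals all_analysis.
From mathcomp Require Import ring.
Import Order.TTheory GRing.Theory Num.Theory.
Import numFieldNormedType.Exports.

Set Implicit Arguments.
Unset Strict Implicit.
Unset Printing Implicit Defensive.

Local Open Scope classical_set_scope.
Local Open Scope ring_scope.

(* The infimum is attained, so this is the minimum of |x - k| over the
   integers k. *)
Definition dist_to_int (R : realType) (x : R) : R :=
  inf [set `|x - k%:~R| | k in [set: int]].

(* The term k = 0, where division by 0 is involved, does not affect the
   limit superior. *)
Definition beta (R : realType) (alpha : R) : \bar R :=
  limn_esup (fun k : nat => (- ln (dist_to_int (k%:R * alpha)) / k%:R)%:E).

Definition mx22 (R : realType) (a b c d : R) : 'M[R]_2 :=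
  \matrix_(i < 2, j < 2) (nth [::] [:: [:: a; b]; [:: c; d]] i)`_j.

Definition col2 (R : realType) (a b : R) : 'cV[R]_2 :=
  \col_(i < 2) [:: a; b]`_i.

(* The library norm on matrices is the sup norm. *)
Definition eucl_norm2 (R : realType) (v : 'cV[R]_2) : R :=
  Num.sqrt (\sum_(i < 2) v i ord0 ^+ 2).

Definition circle_pt (R : realType) (y : R) : 'cV[R]_2 :=
  col2 (cos (2 * pi * y)) (sin (2 * pi * y)).

Definition almost_mathieu (R : realType) (lambda alpha theta : R)
    (x : int -> R) (n : int) : R :=
  x (n + 1) + x (n - 1)
  + 2 * lambda * cos (2 * pi * (theta + n%:~R * alpha)) * x n.

Definition amo_cocycle (R : realType) (lambda E : R) (x : R) : 'M[R]_2 :=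
  mx22 (E - 2 * lambda * cos (2 * pi * x)) (-1) 1 0.

Lemma amo_cocycleP (R : realType) (lambda alpha theta E : R) (x : int -> R) :
  (forall n, almost_mathieu lambda alpha theta x n = E * x n) <->
  (forall n, col2 (x (n + 1)) (x n) =
     amo_cocycle lambda E (theta + n%:~R * alpha) *m col2 (x n) (x (n - 1))).
Proof.
split=> [H n|H n].
  apply/colP => -[[|[|//]] i2]; rewrite !mxE !big_ord_recl big_ord0 !mxE /=.
    by rewrite mulrBl -(H n) /almost_mathieu; ring.
  by ring.
move/colP/(_ ord0): (H n); rewrite !mxE !big_ord_recl big_ord0 !mxE /=.
by rewrite /almost_mathieu => ->; ring.
Qed.

(* A function on R/Z is represented by a 1-periodic function on R.  For A
   continuous, 1-periodic and SL(2)-valued, such a psi exists iff A is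
   homotopic to the identity. *)
Definition is_fibered_lift (R : realType) (A : R -> 'M[R]_2)
    (psi : R * R -> R) : Prop :=
  [/\ continuous psi,
      forall x y, psi (x + 1, y) = psi (x, y),
      forall x y, psi (x, y + 1) = psi (x, y) &
      forall x y, let v := A x *m circle_pt y in
        (eucl_norm2 v)^-1 *: v = circle_pt (y + psi (x, y))].

Definition fibered_lift_map (R : realType) (alpha : R) (psi : R * R -> R)
    (p : R * R) : R * R :=
  (p.1 + alpha, p.2 + psi p).

(* r is a real representative of the fibered rotation number of (alpha, A),
   which is a class modulo Z: replacing psi by psi + k shifts r by k. *)
Definition is_fibered_rotation_number (R : realType) (alpha : R)
    (A : R -> 'M[R]_2) (r : R) : Prop :=
  exists psi : R * R -> R, is_fibered_lift A psi /\
    forall p : R * R,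
      (fun n : nat => n%:R^-1 *
         \sum_(0 <= k < n) psi (iter k (fibered_lift_map alpha psi) p))
        @ \oo --> r.

(* At most one representative lies in [0, 1/2], an interval of length < 1. *)
Definition rho (R : realType) (lambda alpha E : R) : R :=
  get [set r : R | 0 <= r <= 2^-1 /\
         is_fibered_rotation_number alpha (amo_cocycle lambda E) r].

Definition gap_set (R : realType) (lambda alpha : R) (m : int) : set R :=
  [set E | exists j : int, 2 * rho lambda alpha E = m%:~R * alpha + j%:~R].

Definition gap_edges (R : realType) (lambda alpha : R) (m : int) : R * R :=
  get [set e : R * R | e.1 <= e.2 /\
         [set` `[e.1, e.2]] = gap_set lambda alpha m].

Definition E_minus (R : realType) (lambda alpha : R) (m : int) : R :=
  (gap_edges lambda alpha m).1.

Definition E_plus (R : realType) (lambda alpha : R) (m : int) : R :=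
  (gap_edges lambda alpha m).2.

(* Main.v *)
Require Import Defs.
From mathcomp Require Import all_boot all_order all_algebra.
From mathcomp Require Import all_classical all_reals all_analysis.
From mathcomp Require Import complex ring lra zify.
Import Order.TTheory GRing.Theory Num.Theory.
Import numFieldNormedType.Exports.
Set Implicit Arguments.
Unset Strict Implicit.
Unset Printing Implicit Defensive.
Local Open Scope classical_set_scope.
Local Open Scope ring_scope.

(** Write |lambda| = e^{-h}, and let E be the midpoint of a gap (E1, E2) with label m.

    The rotation number is constant on the gap, so the Wronskian of the two phase flows at E1 and E2 is
    positive along arbitrarily long stretches of orbit, which gives
    ||(H - E) phi|| >= (E2 - E1) / 2 ||phi|| and a Green function g_n(x), the Neumann series in
    ((H - E) / 16)^2.  The identities g_1 (g_1 - 1) = g_0 g_0(. + alpha) and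
    g_1 + g_1(. - alpha) = 1 - (v - E) g_0 prevent g_0 from being uniformly small.  The line spanned by
    the solutions decaying on the left turns m / 2 times when x goes round the circle, since its winding
    is prescribed by the rotation number, and g_0 vanishes when it is vertical: g_0 has about |m| / p
    zeros in every interval of length 3 / p.

    The Fourier coefficients of g_0 are averages of Green functions of the Aubry dual operator.  If the
    dual cocycle grows fast, regular boxes (found by Lagrange interpolation of the determinants at
    phases spread by a best approximation of alpha) show that the dual operator is bounded below near E,
    and the Combes-Thomas argument applies; if it grows slowly, regular boxes give decay at rate h / 1024
    with a constant polynomial in (E2 - E1)^{-1}.  A function with exponentially decaying Fourier
    coefficients and that many zeros is exponentially small in |m|, which is impossible unless E2 - E1
    is itself exponentially small.  Uniformity in m comes from a cluster point of the midpoints. *)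


(** * The chordal distance to the integers *)

(** The obstacle is that the gap to be bounded is also the only control on the resolvent: its norm
    is of order 1 / (E2 - E1), so every constant must either not see the gap or be paid by a power
    of it that the zeros can absorb. When the dual cocycle is fast, the rate of decay is not
    explicit, but the constant does not depend on the gap; when it is slow, the constant is of order
    (E2 - E1)^{-4}, but the rate is a fixed multiple of h. This is why the exponent 1 / C can be
    uniform. In the fast case an approximate eigenvector of the dual operator would decay faster
    than |lambda|^{|n|}; its Fourier series could then be evaluated at a complex phase where the
    almost Mathieu cocycle grows exponentially, and would be nearly zero there, against its mean
    value. All the arithmetic of alpha enters through a lower bound exp(- bt t) for the chord of t
    alpha. Zeros are divided out in pairs, alternately by factors in e(x) and in e(-x): each pair
    then gains the full factor exp(- rate) on all coefficients, which keeps the final exponent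
    proportional to h when h is large. *)

Section Chord.
Variable R : realType.
Implicit Types (x y a v alpha : R).

(** Half the distance between e(x) and 1. Distances between interpolation nodes on the unit circle
    are chords, so products of chords replace products of distances to the integers. *)
Definition sn x : R := `|sin (pi * x)|.

Lemma sn_ge0 x : 0 <= sn x. Proof. exact: normr_ge0. Qed.

Lemma sn_le1 x : sn x <= 1. Proof. exact: sin_max. Qed.

Lemma sn0 : sn 0 = 0. Proof. by rewrite /sn mulr0 sin0 normr0. Qed.

Lemma snN x : sn (- x) = sn x. Proof. by rewrite /sn mulrN sinN normrN. Qed.

Lemma snD_le x y : sn (x + y) <= sn x + sn y.
Proof.
rewrite /sn mulrDr sinD; apply: le_trans (ler_normD _ _) _.
rewrite !normrM; apply: lerD.
  by rewrite -[leRHS]mulr1 ler_wpM2l // cos_max.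
by rewrite -[leRHS]mul1r ler_wpM2r // cos_max.
Qed.

Lemma snB_le x y : sn (x - y) <= sn x + sn y.
Proof. by rewrite -(snN y) snD_le. Qed.

Lemma snDnat x n : sn (x + n%:R) = sn x.
Proof.
elim: n => [|n IH]; first by rewrite addr0.
by rewrite -natr1 addrA -IH /sn mulrDr mulr1 sinDpi normrN.
Qed.

Lemma snDz x (k : int) : sn (x + k%:~R) = sn x.
Proof.
case: k => n; first exact: snDnat.
by rewrite NegzE rmorphN /= -(snDnat (_ - _) n.+1) subrK.
Qed.

Lemma sn_1B x : sn (1 - x) = sn x.
Proof. by rewrite addrC -[1]/(1%:R) snDnat snN. Qed.

Lemma sn_mono a v : 0 <= a -> a <= v -> v <= 1 - a -> sn a <= sn v.
Proof.
move=> a0 av v1.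
wlog vh : v av v1 / v <= 1 / 2.
  move=> H; have [vh|vh] := leP v (1 / 2); first exact: H.
  by rewrite -(sn_1B v); apply: H; lra.
have pi0 := pi_gt0 R.
have E t : 0 <= t -> t <= 1 / 2 -> sn t = sin (pi * t).
  move=> t0 t1; rewrite /sn ger0_norm //; apply: sin_ge0_pi; apply/andP; split; nra.
rewrite !E //; try lra.
have [->//|neq] := eqVneq a v.
apply: ltW; rewrite ltr_sin ?in_itv /=; first by rewrite ltr_pM2l // lt_neqAle neq.
  by apply/andP; split; nra.
by apply/andP; split; nra.
Qed.

Lemma sin_piquarter_ge : 1 / 2 <= sin (pi / 4 : R).
Proof.
have E : cos (pi / 4 : R) = sin (pi / 4).
  by rewrite -cosN -cosBpihalf; congr cos; lra.
have s0 : 0 <= sin (pi / 4 : R).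
  by apply: sin_ge0_pi; have := pi_gt0 R; lra.
by have := cos2Dsin2 (pi / 4 : R); rewrite E => H; nra.
Qed.

Lemma sn_ge x : `|x| <= 1 / 2 -> `|x| <= sn x.
Proof.
wlog x0 : x / 0 <= x.
  move=> H; have [|x0] := leP 0 x; first exact: H.
  rewrite -(snN x) -normrN; apply: H; lra.
rewrite ger0_norm // => xh.
have pi2 := pi_ge2 R; have pi0 := pi_gt0 R.
(* Above 1/4 monotonicity and the value at 1/4 suffice; below it the mean value theorem applies, the
   derivative being at least pi / 2. *)
have [x4|x4] := leP x (1 / 4); last first.
  apply: le_trans (_ : sn (1 / 4) <= _); last by apply: sn_mono; lra.
  apply: le_trans xh _; apply: le_trans sin_piquarter_ge _.
  by rewrite /sn mulrA mulr1 ler_norm.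
have [->|xn0] := eqVneq x 0; first by rewrite sn_ge0.
have xp : 0 < pi * x by apply: mulr_gt0 => //; rewrite lt_neqAle eq_sym xn0.
have [c] := @MVT R sin cos _ _ xp (fun c _ => is_derive_sin c) (continuous_subspaceT (@continuous_sin R)).
rewrite in_itv /= => /andP[c0 cx]; rewrite sin0 !subr0 => E.
apply: le_trans (ler_norm _); rewrite E.
have cc : 1 / 2 <= cos c.
  apply: le_trans sin_piquarter_ge _.
  rewrite -cosBpihalf -(cosN c).
  have -> : pi / 4 - pi / 2 = - (pi / 4) :> R by lra.
  rewrite !cosN.
  have [->//|nc] := eqVneq c (pi / 4).
  apply: ltW; rewrite ltr_cos ?in_itv /=; first by rewrite lt_neqAle nc /=; nra.
    by apply/andP; split; nra.
  by apply/andP; split; nra.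
nra.
Qed.

Lemma sn_le x : sn x <= 4 * `|x|.
Proof.
wlog x0 : x / 0 <= x.
  move=> H; have [|x0] := leP 0 x; first exact: H.
  rewrite -(snN x) -normrN; apply: H; lra.
rewrite (ger0_norm x0).
have pi0 := pi_gt0 R; have pi4 : pi < 4 :> R by have := pihalf_lt2 R; lra.
have [->|xn0] := eqVneq x 0; first by rewrite sn0 mulr0.
have xp : 0 < pi * x by apply: mulr_gt0 => //; rewrite lt_neqAle eq_sym xn0.
have [c _] := @MVT R sin cos _ _ xp (fun c _ => is_derive_sin c) (continuous_subspaceT (@continuous_sin R)).
rewrite sin0 !subr0 /sn => ->; rewrite normrM (ger0_norm (ltW xp)).
have := cos_max c; have := normr_ge0 (cos c); nra.
Qed.

Lemma nearest_int x : exists k : int, `|x - k%:~R| <= 1 / 2.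
Proof.
exists (Num.floor (x + 1 / 2)).
have /andP[] := floor_itv (x + 1 / 2).
rewrite rmorphD /= => h1 h2; rewrite ler_norml; apply/andP; split; lra.
Qed.

Lemma sn_near x (k : int) : `|x - k%:~R| <= 1 / 2 -> `|x - k%:~R| <= sn x.
Proof. by move=> h; rewrite -[sn x](snDz _ (- k)) rmorphN; exact: sn_ge. Qed.

(** The chord increases with the distance to the nearest integer, so minimizing one minimizes the
    other. *)
Lemma sn_lt_near x (k : int) (y : R) (l : int) :
  `|x - k%:~R| < `|y - l%:~R| -> `|y - l%:~R| <= 1 / 2 -> sn x < sn y.
Proof.
have E z (j : int) : `|z - j%:~R| <= 1 / 2 -> sn z = sin (pi * `|z - j%:~R|).
  move=> h; rewrite -[sn z](snDz _ (- j)) rmorphN /=.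
  have pi0 := pi_gt0 R; have n0 := normr_ge0 (z - j%:~R).
  have -> : sn (z - j%:~R) = sn `|z - j%:~R|.
    have [h0|h0] := leP 0 (z - j%:~R); first by rewrite ger0_norm.
    by rewrite ltr0_norm // snN.
  rewrite /sn ger0_norm //; apply: sin_ge0_pi; apply/andP; split; nra.
move=> h1 h2; rewrite (E _ _ h2) (E x k); last by lra.
have pi0 := pi_gt0 R; have n0 := normr_ge0 (x - k%:~R).
rewrite ltr_sin ?in_itv /=; first by rewrite ltr_pM2l.
  by apply/andP; split; nra.
by apply/andP; split; nra.
Qed.

Definition not_rational alpha := forall (n : nat) (k : int), (0 < n)%N -> n%:R * alpha != k%:~R.

Lemma sn_gt0 alpha n : not_rational alpha -> (0 < n)%N -> 0 < sn (n%:R * alpha).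
Proof.
move=> irr n0; have [k hk] := nearest_int (n%:R * alpha).
apply: lt_le_trans (sn_near hk); rewrite normr_gt0 subr_eq0; exact: irr.
Qed.

Lemma snBC x y : sn (x - y) = sn (y - x).
Proof. by rewrite -snN opprB. Qed.

End Chord.

(** * Products of chords over one period of a best approximation *)

Section Block.
Variable R : realType.
Implicit Types (x v : R) (q s t : nat).

Definition Sq q (i : nat) : R := sn (i%:R / q%:R).

(** Its value, q 2^{1-q}, is never computed: upper and lower bounds of block products are both
    expressed through it, and it cancels in their ratio. *)
Definition ref_prod q : R := \prod_(1 <= i < q) Sq q i.

(** Lower bound for the chord on the arc from (s - 1) / q to (s + 2) / q. The arcs that reach an
    integer admit none; their value 1 / (4 q) will come from the separation of orbit points. *)
Definition blo q s : R :=
  if ((s < 2) || (q <= s + 2))%N then (4 * q%:R)^-1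
  else if (s < uphalf q)%N then Sq q (s - 1) else Sq q (s + 2).

Definition bup q s : R :=
  if (s < q./2.-1)%N then Sq q (s + 2)
  else if (q./2.+1 + odd q <= s)%N then Sq q (s - 1) else 1.

Lemma Sq_ge0 q i : 0 <= Sq q i. Proof. exact: sn_ge0. Qed.
Lemma Sq_le1 q i : Sq q i <= 1. Proof. exact: sn_le1. Qed.

Lemma Sq_ge q i : (0 < i < q)%N -> q%:R^-1 <= Sq q i.
Proof.
move=> /andP[i0 iq]; have q0 : 0 < q%:R :> R by rewrite ltr0n; lia.
have i1 : 1 <= i%:R :> R by rewrite ler1n.
have iq1 : i%:R <= q%:R - 1 :> R by rewrite lerBrDr natr1 ler_nat.
have [q1|q2] := leqP q 1; first lia.
have q2' : 2 <= q%:R :> R by rewrite ler_nat.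
apply: le_trans (_ : sn (1 / q%:R) <= _).
  have E : `|1 / q%:R| = q%:R^-1 :> R by rewrite div1r ger0_norm // invr_ge0 ltW.
  by rewrite -[leLHS]E; apply: sn_ge; rewrite E -div1r ler_pdivrMr //; lra.
apply: sn_mono; first by rewrite divr_ge0 // ltW.
  by rewrite ler_pM2r ?invr_gt0.
rewrite -[1 in X in _ <= X - _](@divff _ q%:R) ?gt_eqF // -mulrBl.
by rewrite ler_pM2r ?invr_gt0.
Qed.

Lemma ref_prod_gt0 q : 0 < ref_prod q.
Proof.
rewrite /ref_prod big_nat_cond; apply: prodr_gt0 => i; rewrite andbT => h.
by apply: lt_le_trans (Sq_ge h); rewrite invr_gt0 ltr0n; lia.
Qed.

Lemma blo_ge0 q s : 0 <= blo q s.
Proof.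
by rewrite /blo; case: ifP => _; [rewrite invr_ge0 mulr_ge0|case: ifP => _; rewrite Sq_ge0].
Qed.

Lemma blo_le1 q s : (0 < q)%N -> blo q s <= 1.
Proof.
move=> q0; rewrite /blo; case: ifP => _; last by case: ifP => _; rewrite Sq_le1.
have : 1 <= q%:R :> R by rewrite ler1n.
by move=> h; rewrite invf_le1; lra.
Qed.

Lemma bup_ge q s : (0 < q)%N -> (s < q)%N -> q%:R^-1 <= bup q s.
Proof.
move=> q0 sq; rewrite /bup; case: ifP => h1; first by apply: Sq_ge; lia.
case: ifP => h2; first by apply: Sq_ge; lia.
by rewrite invf_le1 ?ler1n // ltr0n.
Qed.

Lemma prod_le1 (m n : nat) (P : pred nat) (F : nat -> R) :
  (forall i, 0 <= F i <= 1) -> \prod_(m <= i < n | P i) F i <= 1.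
Proof. by move=> h; apply: prodr_ile1 => i _; exact: h. Qed.

(** Four factors are edge values; the others are factors of [ref_prod], of which some middle ones
    are missing, and those are at most 1. *)
Lemma prod_blo q : (0 < q)%N ->
  (4 * q%:R)^-1 ^+ 4 * ref_prod q <= \prod_(0 <= s < q) blo q s.
Proof.
move=> q0; set c := (4 * _)^-1.
have q1 : 1 <= q%:R :> R by rewrite ler1n.
have c0 : 0 <= c by rewrite invr_ge0; lra.
have c1 : c <= 1 by rewrite invf_le1; lra.
have r1 : ref_prod q <= 1 by apply: prod_le1 => i; rewrite Sq_ge0 Sq_le1.
have r0 := ltW (ref_prod_gt0 q).
have [q4|q5] := leqP q 4.
  have -> : \prod_(0 <= s < q) blo q s = \prod_(0 <= s < q) c.
    by apply: eq_big_nat => s h; rewrite /blo ifT //; lia.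
  rewrite prodr_const_nat subn0.
  apply: le_trans (_ : c ^+ 4 <= _); first by rewrite ler_piMr ?exprn_ge0.
  exact: ler_wiXn2l.
rewrite (@big_cat_nat _ _ _ 2) //=; last lia.
rewrite (@big_cat_nat _ _ _ (q - 2) 2) /=; try lia.
have -> : \prod_(0 <= s < 2) blo q s = c ^+ 2.
  rewrite -[c ^+ 2]/(c ^+ (2 - 0)) -prodr_const_nat; apply: eq_big_nat => s h; rewrite /blo ifT //; lia.
have -> : \prod_(q - 2 <= s < q) blo q s = c ^+ 2.
  have -> : c ^+ 2 = c ^+ (q - (q - 2)) by congr (_ ^+ _); lia.
  by rewrite -prodr_const_nat; apply: eq_big_nat => s h; rewrite /blo ifT //; lia.
rewrite mulrCA -exprD mulrC; apply: ler_wpM2r; first exact: exprn_ge0.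
rewrite (@big_cat_nat _ _ _ (uphalf q)) /=; try lia.
have -> : \prod_(2 <= s < uphalf q) blo q s = \prod_(1 <= i < uphalf q - 1) Sq q i.
  rewrite -[2%N]/(1 + 1)%N big_addn; apply: eq_big_nat => s h.
  rewrite /blo ifF; last lia.
  by rewrite ifT; [congr Sq; lia|lia].
have -> : \prod_(uphalf q <= s < q - 2) blo q s = \prod_(uphalf q + 2 <= i < q) Sq q i.
  rewrite big_addn; apply: eq_big_nat => s h.
  rewrite /blo ifF; last lia.
  by rewrite ifF //; lia.
have P0 a b : 0 <= \prod_(a <= i < b) Sq q i by apply: prodr_ge0 => i _; exact: Sq_ge0.
have P1 a b : \prod_(a <= i < b) Sq q i <= 1 by apply: prod_le1 => i; rewrite Sq_ge0 Sq_le1.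
rewrite /ref_prod (@big_cat_nat _ _ _ (uphalf q - 1)) /=; try lia.
apply: ler_wpM2l => //.
rewrite (@big_cat_nat _ _ _ (uphalf q + 2) (uphalf q - 1)) /=; try lia.
by rewrite ler_piMl.
Qed.

(** The product lacks only the factors [Sq q 1] and [Sq q (q - 1)] of [ref_prod], each at least 1 /
    q. *)
Lemma prod_bup q : (0 < q)%N ->
  \prod_(0 <= s < q) bup q s <= q%:R ^+ 2 * ref_prod q.
Proof.
move=> q0; have q1 : 1 <= q%:R :> R by rewrite ler1n.
have P0 a b : 0 <= \prod_(a <= i < b) Sq q i by apply: prodr_ge0 => i _; exact: Sq_ge0.
have P1 a b : \prod_(a <= i < b) Sq q i <= 1 by apply: prod_le1 => i; rewrite Sq_ge0 Sq_le1.
have [q2|q3] := leqP q 1.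
  have -> : q = 1%N by lia.
  by rewrite big_nat1 /ref_prod big_geq // /bup /= mulr1 expr1n.
have h1 : q%:R^-1 <= Sq q 1 by apply: Sq_ge; lia.
have hq : q%:R^-1 <= Sq q (q - 1) by apply: Sq_ge; lia.
have H0 : 0 < q%:R^-1 :> R by rewrite invr_gt0; lra.
pose m := q./2; pose m' := (m + odd q)%N.
have E1 : \prod_(0 <= s < q) bup q s =
  \prod_(2 <= i < m.+1) Sq q i * \prod_(m' <= i < q - 1) Sq q i.
  rewrite (@big_cat_nat _ _ _ m.-1) //=; last by rewrite /m; lia.
  congr (_ * _).
    rewrite -[2%N]/(0 + 2)%N big_addn.
    have -> : (m.+1 - 2 = m.-1)%N by lia.
    by apply: eq_big_nat => s h; rewrite /bup ifT //; rewrite /m in h; lia.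
  rewrite (@big_cat_nat _ _ _ (m'.+1)) /=; try (rewrite /m' /m; lia).
  rewrite big_nat big1 => [|s h]; last first.
    by rewrite /bup ifF ?ifF //; rewrite /m' /m in h *; lia.
  rewrite mul1r -addn1.
  have -> : \prod_(m' <= i < q - 1) Sq q i = \prod_(m' <= i < q - 1) Sq q (i + 1 - 1).
    by apply: eq_bigr => i _; rewrite addnK.
  rewrite -(big_addn m' q 1 xpredT (fun i => Sq q (i - 1))).
  by apply: eq_big_nat => s h; rewrite /bup ifF ?ifT //; rewrite /m' /m in h; lia.
rewrite {}E1.
have E2 : Sq q 1 * Sq q (q - 1) * (\prod_(2 <= i < m.+1) Sq q i * \prod_(m' <= i < q - 1) Sq q i)
   = \prod_(1 <= i < m.+1) Sq q i * \prod_(m' <= i < q) Sq q i.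
  have [qe2|q4] := eqVneq q 2.
    have [-> ->] : m = 1%N /\ m' = 1%N by rewrite /m' /m qe2.
    by rewrite qe2 !big_nat1 !big_geq // !mulr1.
  rewrite [in RHS]big_ltn; last by rewrite /m; lia.
  have -> : \prod_(m' <= i < q) Sq q i = \prod_(m' <= i < q - 1) Sq q i * Sq q (q - 1).
    rewrite (@big_cat_nat _ _ _ (q - 1) m') /=; try (rewrite /m' /m; lia).
    have iE : index_iota (q - 1) q = [:: (q - 1)%N].
      by rewrite /index_iota; have -> : (q - (q - 1) = 1)%N by lia.
    by rewrite iE big_seq1.
  ring.
have E3 : \prod_(1 <= i < m.+1) Sq q i * \prod_(m' <= i < q) Sq q i <= ref_prod q.
  rewrite /ref_prod [leRHS](@big_cat_nat _ _ _ m.+1) /=; try (rewrite /m; lia).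
  apply: ler_wpM2l => //.
  rewrite [leLHS](@big_cat_nat _ _ _ m.+1 m') /=; try (rewrite /m' /m; lia).
  by rewrite ler_piMl.
rewrite -{}E2 in E3.
set X := _ * _ in E3 *.
have X0 : 0 <= \prod_(2 <= i < m.+1) Sq q i * \prod_(m' <= i < q - 1) Sq q i by exact: mulr_ge0.
apply: le_trans (_ : q%:R ^+ 2 * X <= _); last by rewrite ler_wpM2l // exprn_ge0.
rewrite /X mulrA ler_peMl //.
have -> : q%:R ^+ 2 * (Sq q 1 * Sq q (q - 1)) = (q%:R * Sq q 1) * (q%:R * Sq q (q - 1)) by ring.
have g1 : 1 <= q%:R * Sq q 1 by rewrite mulrC -ler_pdivrMr ?div1r //; lra.
have g2 : 1 <= q%:R * Sq q (q - 1) by rewrite mulrC -ler_pdivrMr ?div1r //; lra.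
nra.
Qed.

Lemma blo_le q s v : (1 < s)%N -> (s + 2 < q)%N ->
  (s%:R - 1) / q%:R <= v -> v <= (s%:R + 2) / q%:R -> blo q s <= sn v.
Proof.
move=> s2 sq h1 h2; have q0 : 0 < q%:R :> R by rewrite ltr0n; lia.
rewrite /blo ifF; last lia.
case: ifP => h; rewrite /Sq.
  have sE : (s - 1)%:R = s%:R - 1 :> R by rewrite natrB //; lia.
  have hh : 2 * s%:R + 1 <= q%:R :> R by rewrite -natrM natr1 ler_nat; lia.
  apply: sn_mono; rewrite sE //.
    by apply: divr_ge0; [rewrite subr_ge0 ler1n; lia|exact: ltW].
  apply: le_trans h2 _; rewrite lerBrDr -mulrDl ler_pdivrMr // mul1r; lra.
have hh : q%:R <= 2 * s%:R + 1 :> R by rewrite -natrM natr1 ler_nat; lia.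
rewrite -sn_1B; have sE : (s + 2)%:R = s%:R + 2 :> R by rewrite natrD.
have sq' : s%:R + 2 <= q%:R :> R by rewrite -natrD ler_nat; lia.
apply: sn_mono; rewrite sE.
- by rewrite subr_ge0 ler_pdivrMr // mul1r.
- apply: le_trans h1; rewrite lerBlDr -mulrDl ler_pdivlMr // mul1r; lra.
- lra.
Qed.

Lemma bup_ge_sn q s v : (s < q)%N ->
  (s%:R - 1) / q%:R <= v -> v <= (s%:R + 2) / q%:R -> sn v <= bup q s.
Proof.
move=> sq h1 h2; have q0 : 0 < q%:R :> R by rewrite ltr0n; lia.
have s0 : 0 <= s%:R :> R by [].
have snA z : sn `|z| = sn z :> R.
  by have [z0|z0] := leP 0 z; [rewrite ger0_norm|rewrite ltr0_norm // snN].
have iq : 0 < q%:R^-1 :> R by rewrite invr_gt0.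
have qq : q%:R * q%:R^-1 = 1 :> R by rewrite divff // gt_eqF.
rewrite /bup; case: ifP => h; first rewrite /Sq.
  have hh : 2 * s%:R + 4 <= q%:R :> R by rewrite -natrM -natrD ler_nat; lia.
  rewrite -snA natrD; apply: sn_mono; rewrite ?normr_ge0 //; rewrite ?ler_norml ?lerBrDr.
    apply/andP; split; nra.
  have : `|v| <= (s%:R + 2) / q%:R by rewrite ler_norml; apply/andP; split; nra.
  nra.
case: ifP => h'; last exact: sn_le1.
have sE : (s - 1)%:R = s%:R - 1 :> R by rewrite natrB //; lia.
have hh : q%:R + 2 <= 2 * s%:R :> R by rewrite -natrM -natrD ler_nat; lia.
have sq' : s%:R + 1 <= q%:R :> R by rewrite natr1 ler_nat.
rewrite /Sq -(sn_1B v) -(sn_1B (_ / _)) -snA sE.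
have hn : `|1 - v| <= 1 - (s%:R - 1) / q%:R by rewrite ler_norml; apply/andP; split; nra.
by apply: sn_mono; rewrite ?normr_ge0 //; nra.
Qed.

Variable alpha : R.
Hypothesis irr : not_rational alpha.

Definition best_denom (K q : nat) := (0 < q <= K)%N /\
  forall t, (0 < t <= K)%N -> sn (q%:R * alpha) <= sn (t%:R * alpha).

Lemma best_denom_exists K : (0 < K)%N -> exists q, best_denom K q.
Proof.
case: K => // K _.
case: (@arg_minP _ _ 'I_K.+1 ord0 xpredT (fun i => sn ((i : nat).+1%:R * alpha)) isT) => i _ h.
exists i.+1; split; first by have := ltn_ord i; lia.
move=> t /andP[t0 tK]; have tK' : (t.-1 < K.+1)%N by lia.
by have := h (Ordinal tK') isT; rewrite /= prednK.
Qed.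

Lemma dirichlet K : (0 < K)%N ->
  exists t (k : int), (0 < t <= K)%N /\ `|t%:R * alpha - k%:~R| < K%:R^-1.
Proof.
move=> K0; have K0' : 0 < K%:R :> R by rewrite ltr0n.
pose fr (i : nat) := i%:R * alpha - (Num.floor (i%:R * alpha))%:~R.
have fr01 i : 0 <= fr i < 1.
  by have /andP[] := floor_itv (i%:R * alpha); rewrite rmorphD /fr /=; lra.
pose b (i : nat) : int := Num.floor (K%:R * fr i).
have bP i : (b i)%:~R <= K%:R * fr i < (b i)%:~R + 1.
  by have := floor_itv (K%:R * fr i); rewrite rmorphD.
have bb i : (0 <= b i) && (b i < K%:Z).
  have /andP[f0 f1] := fr01 i; apply/andP; split.
    by rewrite /b floor_ge0 mulr_ge0.
  rewrite -(ltr_int R); have /andP[h _] := bP i; apply: le_lt_trans h _.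
  by rewrite -[ltRHS]mulr1 ltr_pM2l.
have bK i : (absz (b i) < K)%N by have := bb i; lia.
pose f (i : 'I_K.+1) : 'I_K := Ordinal (bK i).
have /injectivePn[i [j ij fE]] : ~~ injectiveb f.
  apply/negP => /injectiveP/leq_card; rewrite !card_ord; lia.
wlog lij : i j ij fE / (i < j)%N.
  move=> H; have [l|l|l] := ltngtP i j; first exact: (H i j).
    by apply: (H j i) => //; rewrite eq_sym.
  by move: ij; rewrite -val_eqE /= l eqxx.
exists (j - i)%N, (Num.floor (j%:R * alpha) - Num.floor (i%:R * alpha)).
split; first by have := ltn_ord j; lia.
have bE : b i = b j.
  by move/(congr1 val): fE => /=; have := bb i; have := bb j; lia.
have -> : (j - i)%:R * alpha - (Num.floor (j%:R * alpha) - Num.floor (i%:R * alpha))%:~R = fr j - fr i.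
  by rewrite natrB; [rewrite rmorphB /fr /=; ring|exact: ltnW].
have := bP i; have := bP j; rewrite bE => /andP[h1 h2] /andP[h3 h4].
have h5 : `|K%:R * (fr j - fr i)| < 1 by rewrite mulrBr ltr_norml; lra.
by rewrite normrM ger0_norm ?ltW // mulrC in h5; rewrite -[ltRHS]div1r ltr_pdivlMr.
Qed.

Lemma best_denom_near K q : best_denom K q -> exists p : int,
  `|q%:R * alpha - p%:~R| <= 1 / 2 /\ `|q%:R * alpha - p%:~R| < K%:R^-1.
Proof.
move=> [/andP[q0 qK] hq]; have [p hp] := nearest_int (q%:R * alpha).
exists p; split => //; rewrite ltNge; apply/negP => hK.
have [t [k [tK hk]]] := @dirichlet K (leq_trans q0 qK).
have := hq t tK; apply/negP; rewrite -ltNge.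
by apply: (@sn_lt_near _ _ k _ p) => //; exact: lt_le_trans hk hK.
Qed.

(** Dividing q and p by a common factor would give a smaller denominator with a strictly smaller
    error. *)
Lemma best_coprime K q (p : int) : best_denom K q ->
  `|q%:R * alpha - p%:~R| <= 1 / 2 -> coprime q `|p|%N.
Proof.
move=> [/andP[q0 qK] hq] hp; rewrite /coprime; apply/negPn/negP => g1.
set g := gcdn q `|p| in g1.
have g0 : (0 < g)%N by rewrite gcdn_gt0 q0.
have /dvdnP[q' qE] : (g %| q)%N by exact: dvdn_gcdl.
have /dvdzP[p' pE] : (g %| p)%Z by rewrite dvdzE /= dvdn_gcdr.
have q'0 : (0 < q')%N by move: q0; rewrite qE; lia.
have g2 : 2 <= g%:R :> R by rewrite ler_nat; lia.
have E : q%:R * alpha - p%:~R = g%:R * (q'%:R * alpha - p'%:~R).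
  by rewrite pE qE !rmorphM /=; ring.
have n0 : 0 < `|q'%:R * alpha - p'%:~R| by rewrite normr_gt0 subr_eq0 irr.
have := hq q'; have -> : (0 < q' <= K)%N by rewrite q'0 /= (leq_trans _ qK) // qE leq_pmulr.
move=> /(_ isT); apply/negP; rewrite -ltNge; apply: (@sn_lt_near _ _ p' _ p) => //.
rewrite E normrM ger0_norm //; nra.
Qed.

(** Either q alpha is far from p and minimality applies, or t alpha is close to t p / q, which by
    coprimality is at distance at least 1 / q from the integers. *)
Lemma best_sep K q t : best_denom K q -> (0 < t < q)%N ->
  (2 * q%:R)^-1 <= sn (t%:R * alpha).
Proof.
move=> bq /andP[t0 tq]; have [p [hp _]] := best_denom_near bq.
have cop := best_coprime bq hp; have [/andP[q0 qK] hq] := bq.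
have q0' : 0 < q%:R :> R by rewrite ltr0n.
have [small|big] := leP `|q%:R * alpha - p%:~R| (2 * q%:R)^-1; last first.
  apply: le_trans (ltW big) _; apply: le_trans (sn_near hp) _; apply: hq; lia.
have [k hk] := nearest_int (t%:R * alpha).
apply: le_trans (sn_near hk).
have E : q%:R * (t%:R * alpha - k%:~R) =
   (t%:Z * p - k * q%:Z)%:~R + t%:R * (q%:R * alpha - p%:~R).
  by rewrite rmorphB !rmorphM /=; ring.
have nz : t%:Z * p - k * q%:Z != 0.
  apply/eqP => e; have : (q %| t * `|p|)%N.
    apply/dvdnP; exists `|k|%N; have : absz (t%:Z * p) = absz (k * q%:Z) by congr absz; lia.
    by rewrite !abszM.
  by rewrite Gauss_dvdl // => /dvdn_leq; lia.
have n1 : 1 <= `|(t%:Z * p - k * q%:Z)%:~R| :> R.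
  by rewrite -intr_norm -[1]/(1%:~R) ler_int; lia.
have tq' : t%:R <= q%:R :> R by rewrite ler_nat; lia.
have sm : t%:R * `|q%:R * alpha - p%:~R| <= 1 / 2.
  apply: le_trans (_ : q%:R * (2 * q%:R)^-1 <= _); first exact: ler_pM.
  by rewrite invfM mulrCA divff ?gt_eqF // mulr1 div1r.
have : 1 / 2 <= `|q%:R * (t%:R * alpha - k%:~R)|.
  rewrite E; apply: le_trans (lerB_normD _ _); rewrite normrM (ger0_norm (ler0n _ _)); lra.
rewrite normrM ger0_norm // -ler_pdivrMl //.
by rewrite invfM mulrC div1r.
Qed.

(** Since q alpha is close to p, the points x + j alpha follow the residues of i0 + j p modulo q,
    each visited once. The slack of 1 on the left and 2 on the right comes from rounding q x down
    and from j |q alpha - p| <= 1. *)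
Lemma block_perm K q x : best_denom K q -> exists f : 'I_q -> 'I_q,
  injective f /\ forall j : 'I_q, exists n : int,
    ((f j)%:R - 1) / q%:R <= x + j%:R * alpha - n%:~R /\
    x + j%:R * alpha - n%:~R <= ((f j)%:R + 2) / q%:R.
Proof.
move=> bq; have [p [hp hpK]] := best_denom_near bq.
have cop := best_coprime bq hp; have [/andP[q0 qK] hq] := bq.
have q0' : 0 < q%:R :> R by rewrite ltr0n.
pose i0 : int := Num.floor (q%:R * x).
pose s (j : nat) : nat := `|((i0 + j%:Z * p) %% q%:Z)%Z|%N.
have sE j : (s j)%:Z = ((i0 + j%:Z * p) %% q%:Z)%Z.
  by rewrite /s gez0_abs // modz_ge0 //; lia.
have sq j : (s j < q)%N.
  by have := @ltz_pmod (i0 + j%:Z * p) q%:Z; rewrite -sE; lia.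
exists (fun j : 'I_q => Ordinal (sq j)); split.
  suff W (i j : 'I_q) : (i <= j)%N -> s i = s j -> i = j.
    move=> i j /(congr1 val) /= e; have [l|l] := leqP i j; first exact: W.
    by apply/esym/W => //; exact: ltnW.
  move=> lij e; have e' : ((i0 + j%:Z * p) %% q%:Z)%Z = ((i0 + i%:Z * p) %% q%:Z)%Z by rewrite -!sE e.
  have : (q %| (j - i) * `|p|)%N.
    have : (q%:Z %| (i0 + j%:Z * p) - (i0 + i%:Z * p))%Z by rewrite -eqz_mod_dvd; apply/eqP.
    have -> : (i0 + j%:Z * p) - (i0 + i%:Z * p) = (j - i)%N%:Z * p by rewrite -subzn //; ring.
    by rewrite dvdzE abszM.
  rewrite Gauss_dvdl // => dv; apply/val_inj/eqP; rewrite eqn_leq lij /= leqNgt.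
  apply/negP => l; have := dvdn_leq (_ : 0 < j - i)%N dv; have := ltn_ord j; lia.
move=> j; exists ((i0 + j%:Z * p) %/ q%:Z)%Z => /=.
set n := (_ %/ _)%Z.
have key : q%:R * (x + j%:R * alpha - n%:~R) =
   (s j)%:R + (q%:R * x - i0%:~R) + j%:R * (q%:R * alpha - p%:~R).
  have := divz_eq (i0 + j%:Z * p) q%:Z; rewrite -/n -sE => /(congr1 (fun z : int => z%:~R : R)).
  rewrite !rmorphD !rmorphM /= => h.
  have -> : (s j)%:R = i0%:~R + j%:R * p%:~R - n%:~R * q%:R :> R.
    by rewrite -[j%:R]/((j%:Z)%:~R) -[q%:R]/((q%:Z)%:~R) -[(s j)%:R]/(((s j)%:Z)%:~R) h; ring.
  ring.
have /andP[f0 f1] : 0 <= q%:R * x - i0%:~R < 1.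
  by have /andP[] := floor_itv (q%:R * x); rewrite rmorphD -/i0 /=; lra.
have e1 : `|j%:R * (q%:R * alpha - p%:~R)| <= 1.
  rewrite normrM ger0_norm //.
  apply: le_trans (_ : K%:R * K%:R^-1 <= _); last first.
    by rewrite divff // pnatr_eq0; lia.
  apply: ler_pM => //; last exact: ltW.
  by rewrite ler_nat; have := ltn_ord j; lia.
rewrite ler_norml in e1; case/andP: e1 => e1 e2.
by split; [rewrite ler_pdivrMr // mulrC key; lra|rewrite ler_pdivlMr // mulrC key; lra].
Qed.

Lemma block_upper K q x (j0 : 'I_q) : best_denom K q ->
  \prod_(j < q | j != j0) sn (x + j%:R * alpha) <= q%:R ^+ 3 * ref_prod q.
Proof.
move=> bq; have [f [finj fP]] := block_perm x bq.
have q0 : (0 < q)%N by have [/andP[]] := bq.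
have q0' : 0 < q%:R :> R by rewrite ltr0n.
apply: le_trans (_ : \prod_(j < q | j != j0) bup q (f j) <= _).
  apply: ler_prod => j _; rewrite sn_ge0 /=.
  have [n [h1 h2]] := fP j; rewrite -(snDz _ (- n)) rmorphN /=.
  exact: bup_ge_sn.
have -> : \prod_(j < q | j != j0) bup q (f j) = \prod_(s < q | s != f j0) bup q s.
  rewrite [RHS](reindex_inj finj) /=; apply: eq_bigl => j; by rewrite (inj_eq finj).
have := @prod_bup q q0; rewrite big_mkord (bigD1 (f j0)) //= => h.
have hb := bup_ge q0 (ltn_ord (f j0)).
rewrite exprS -mulrA -ler_pdivrMl //; apply: le_trans h.
apply: ler_wpM2r => //; apply: prodr_ge0 => s _.
by apply: le_trans (bup_ge q0 (ltn_ord s)); rewrite invr_ge0.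
Qed.

Lemma block_upper_full K q x : best_denom K q ->
  \prod_(j < q) sn (x + j%:R * alpha) <= q%:R ^+ 3 * ref_prod q.
Proof.
move=> bq; have q0 : (0 < q)%N by have [/andP[]] := bq.
rewrite (bigD1 (Ordinal q0)) //=; apply: le_trans (block_upper x (Ordinal q0) bq).
by apply: ler_piMl; [apply: prodr_ge0 => j _; exact: sn_ge0|exact: sn_le1].
Qed.

(** The omitted point is the one closest to the integers; by [best_sep] the chord of any other point
    is then at least 1 / (4 q). *)
Lemma block_lower K q x : best_denom K q -> exists j0 : 'I_q,
  (4 * q%:R)^-1 ^+ 4 * ref_prod q <= \prod_(j < q | j != j0) sn (x + j%:R * alpha).
Proof.
move=> bq; have [f [finj fP]] := block_perm x bq.
have q0 : (0 < q)%N by have [/andP[]] := bq.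
have q0' : 0 < q%:R :> R by rewrite ltr0n.
case: (@arg_minP _ _ 'I_q (Ordinal q0) xpredT (fun i => sn (x + i%:R * alpha)) isT) => j0 _ hmin.
exists j0; apply: le_trans (prod_blo q0) _.
rewrite big_mkord (reindex_inj finj) /= (bigD1 j0) //=.
apply: le_trans (_ : \prod_(j < q | j != j0) blo q (f j) <= _).
  by apply: ler_piMl; [apply: prodr_ge0 => j _; exact: blo_ge0|exact: blo_le1].
apply: ler_prod => j jj0; rewrite blo_ge0 /=.
have [n [h1 h2]] := fP j.
have sE : sn (x + j%:R * alpha) = sn (x + j%:R * alpha - n%:~R).
  by rewrite -[RHS](snDz _ n) subrK.
have [edge|mid] := boolP ((f j < 2) || (q <= f j + 2))%N; last first.
  by rewrite sE; apply: blo_le => //; lia.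
rewrite /blo edge.
have sep : (2 * q%:R)^-1 <= sn (x + j%:R * alpha) + sn (x + j0%:R * alpha).
  apply: le_trans (snB_le _ _).
  have -> : x + j%:R * alpha - (x + j0%:R * alpha) = (j%:R - j0%:R) * alpha by ring.
  have [l|l|l] := ltngtP j j0.
  - rewrite -snN -mulNr opprB -natrB; last exact: ltnW.
    by apply: best_sep bq _; have := ltn_ord j0; lia.
  - by rewrite -natrB; [apply: best_sep bq _; have := ltn_ord j; lia|exact: ltnW].
  - by move: jj0; rewrite -val_eqE /= l eqxx.
have := hmin j isT => hm.
have -> : (4 * q%:R)^-1 = (2 * q%:R)^-1 / 2 :> R by field; rewrite gt_eqF.
lra.
Qed.

End Block.

(** * Characters of the circle and trigonometric interpolation *)

Section Complex.
Variable R : realType.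
Local Notation C := (R[i]).
Implicit Types (x y : R) (z u : C).

Definition nrm z : R := Normc.normc z.

Lemma nrmE z : (nrm z)%:C%C = `|z|. Proof. by case: z. Qed.

Lemma nrm_ge0 z : 0 <= nrm z.
Proof. by rewrite -ler0c nrmE. Qed.

Lemma nrmM z u : nrm (z * u) = nrm z * nrm u. Proof. exact: Normc.normcM. Qed.
Lemma nrmV z : nrm z^-1 = (nrm z)^-1. Proof. exact: Normc.normcV. Qed.
Lemma nrm0 : nrm 0 = 0. Proof. exact: Normc.normc0. Qed.
Lemma nrm1 : nrm 1 = 1. Proof. exact: Normc.normc1. Qed.
Lemma nrmN z : nrm (- z) = nrm z. Proof. exact: normcN. Qed.
Lemma nrmD z u : nrm (z + u) <= nrm z + nrm u. Proof. exact: le_normcD. Qed.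

Lemma nrmB z u : nrm (z - u) <= nrm z + nrm u.
Proof. by rewrite -(nrmN u) nrmD. Qed.

Lemma nrm_eq0 z : (nrm z == 0) = (z == 0).
Proof.
by apply/eqP/eqP => [|->]; [exact: Normc.eq0_normc|exact: nrm0].
Qed.

Lemma nrm_gt0 z : (0 < nrm z) = (z != 0).
Proof. by rewrite lt_neqAle nrm_ge0 andbT eq_sym nrm_eq0. Qed.

Lemma nrm_real x : nrm x%:C%C = `|x|.
Proof. by rewrite /nrm /= expr0n addr0 sqrtr_sqr. Qed.

Lemma nrm_sum (I : Type) (r : seq I) (P : pred I) (F : I -> C) :
  nrm (\sum_(i <- r | P i) F i) <= \sum_(i <- r | P i) nrm (F i).
Proof.
elim/big_rec2: _ => [|i y z _ h]; first by rewrite nrm0.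
by apply: le_trans (nrmD _ _) _; rewrite lerD2l.
Qed.

Lemma nrm_prod (I : Type) (r : seq I) (P : pred I) (F : I -> C) :
  nrm (\prod_(i <- r | P i) F i) = \prod_(i <- r | P i) nrm (F i).
Proof.
by elim/big_rec2: _ => [|i y z _ h]; [rewrite nrm1|rewrite nrmM h].
Qed.

Lemma nrmX z n : nrm (z ^+ n) = nrm z ^+ n.
Proof. by elim: n => [|n IH]; rewrite ?expr0 ?nrm1 // !exprS nrmM IH. Qed.

Lemma nrm_sq z : nrm z ^+ 2 = complex.Re z ^+ 2 + complex.Im z ^+ 2.
Proof. by case: z => a b; rewrite /nrm /= sqr_sqrtr // addr_ge0 // sqr_ge0. Qed.

Definition ex x : C := (cos (2 * pi * x) +i* sin (2 * pi * x))%C.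

Lemma nrm_ex x : nrm (ex x) = 1.
Proof. by rewrite /nrm /= cos2Dsin2 sqrtr1. Qed.

Lemma exD x y : ex (x + y) = ex x * ex y.
Proof.
rewrite /ex mulrDr cosD sinD; apply/eqP; rewrite eq_complex /=; apply/andP; split; apply/eqP; ring.
Qed.

Lemma ex0 : ex 0 = 1.
Proof. by rewrite /ex mulr0 cos0 sin0. Qed.

Lemma ex_neq0 x : ex x != 0.
Proof. by rewrite -nrm_gt0 nrm_ex. Qed.

Lemma exN x : ex (- x) = (ex x)^-1.
Proof. by apply: (mulfI (ex_neq0 x)); rewrite -exD subrr ex0 divff // ex_neq0. Qed.

Lemma exMn x n : ex (n%:R * x) = ex x ^+ n.
Proof.
elim: n => [|n IH]; first by rewrite mul0r ex0 expr0.
by rewrite -natr1 mulrDl mul1r exD IH exprSr.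
Qed.

Lemma ex1 : ex 1 = 1.
Proof. by rewrite /ex mulr1 mulr_natl cos2pi sin2pi. Qed.

Lemma ex_int (k : int) : ex k%:~R = 1.
Proof.
case: k => n; first by rewrite -[_%:~R]mulr1 exMn ex1 expr1n.
rewrite NegzE rmorphN exN.
have -> : ex n.+1%:~R = 1 by rewrite -[_%:~R]mulr1 (exMn 1 n.+1) ex1 expr1n.
exact: invr1.
Qed.

Lemma exDint x (k : int) : ex (x + k%:~R) = ex x.
Proof. by rewrite exD ex_int mulr1. Qed.

Lemma nrm_exB x y : nrm (ex x - ex y) = 2 * sn (x - y).
Proof.
apply: (@pexpIrn _ 2) => //; rewrite ?nnegrE ?nrm_ge0 ?mulr_ge0 ?sn_ge0 //.
rewrite nrm_sq /= exprMn /sn real_normK ?num_real //.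
have -> : pi * (x - y) = pi * x - pi * y by ring.
have -> : 2 * pi * x = (pi * x) *+ 2 by rewrite mulr2n; ring.
have -> : 2 * pi * y = (pi * y) *+ 2 by rewrite mulr2n; ring.
rewrite !cos_mulr2n !sin_mulr2n sinB.
have := cos2Dsin2 (pi * x); have := cos2Dsin2 (pi * y).
move: (cos (pi * x)) (sin (pi * x)) (cos (pi * y)) (sin (pi * y)) => a b c d h1 h2.
have e1 : b ^+ 2 = 1 - a ^+ 2 by rewrite -h2; ring.
have e2 : d ^+ 2 = 1 - c ^+ 2 by rewrite -h1; ring.
transitivity (4 * (a ^+ 2 - c ^+ 2) ^+ 2 + 4 * a ^+ 2 * b ^+ 2 + 4 * c ^+ 2 * d ^+ 2 - 8 * (a * b * c * d)).
  by rewrite !mulr2n; ring.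
transitivity (4 * b ^+ 2 * c ^+ 2 + 4 * a ^+ 2 * d ^+ 2 - 8 * (a * b * c * d)); last by ring.
by rewrite e1 e2; ring.
Qed.

(* Lagrange interpolation on the unit circle; the factors 2 of the chords cancel. *)
Lemma lagrange_bound (I : finType) (X : I -> R) (p : {poly C}) x :
  (size p <= #|I|)%N -> (forall i j, i != j -> 0 < sn (X i - X j)) ->
  nrm p.[ex x] <= \sum_i nrm p.[ex (X i)] *
     \prod_(j | j != i) (sn (x - X j) / sn (X i - X j)).
Proof.
move=> szp hX.
pose z i := ex (X i).
have zinj i j : i != j -> z i - z j != 0.
  by move=> ij; rewrite -nrm_gt0 nrm_exB mulr_gt0 // hX.
pose L i : {poly C} := \prod_(j | j != i) ((z i - z j)^-1 *: ('X - (z j)%:P)).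
have LE i t : (L i).[t] = \prod_(j | j != i) ((z i - z j)^-1 * (t - z j)).
  rewrite /L horner_prod; apply: eq_bigr => j _; by rewrite hornerZ hornerXsubC.
have szL i : (size (L i) <= #|I|)%N.
  rewrite /L scaler_prod; apply: leq_trans (size_scale_leq _ _) _.
  rewrite -big_filter size_prod_XsubC size_filter.
  have <- : size (index_enum I) = #|I| by rewrite -sum1_size -sum1_card; apply: eq_bigl.
  rewrite -(count_predC (pred1 i) (index_enum I)) -addn1 addnC leq_add2r.
  by rewrite -has_count; apply/hasP; exists i; rewrite ?mem_index_enum /=.
have pE : p = \sum_i p.[z i] *: L i.
  apply/eqP; rewrite -subr_eq0; apply/negPn/negP => nz.
  have := @max_poly_roots _ _ [seq z i | i <- enum I] nz.
  have -> : uniq [seq z i | i <- enum I].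
    rewrite map_inj_uniq ?enum_uniq // => i j ij; apply/eqP/negPn/negP => n.
    by have := zinj _ _ n; rewrite ij subrr eqxx.
  have -> : all (root (p - \sum_i p.[z i] *: L i)) [seq z i | i <- enum I].
    apply/allP => _ /mapP[i _ ->]; rewrite /root hornerD hornerN horner_sum (bigD1 i) //=.
    rewrite big1 => [|j ji]; last first.
      rewrite hornerZ LE (bigD1 i) 1?eq_sym //= subrr mulr0 mul0r mulr0 //.
    rewrite hornerZ LE big1 ?mulr1 ?addr0 ?subrr // => j ji.
    by rewrite mulVf // zinj // eq_sym.
  move=> /(_ isT isT); rewrite size_map -cardE; apply/negP; rewrite -leqNgt.
  apply: leq_trans (size_polyD _ _) _; rewrite geq_max szp size_polyN /=.
  apply: leq_trans (size_sum _ _ _) _; apply/bigmax_leqP => i _.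
  exact: leq_trans (size_scale_leq _ _) (szL i).
rewrite {1}pE horner_sum; apply: le_trans (nrm_sum _ _ _) _.
apply: ler_sum => i _; rewrite hornerZ nrmM ler_wpM2l ?nrm_ge0 // LE nrm_prod.
apply: ler_prod => j ji; rewrite nrm_ge0 andTb.
have s0 : sn (X i - X j) != 0 by rewrite gt_eqF // hX // eq_sym.
rewrite nrmM nrmV /z !nrm_exB le_eqVlt; apply/orP; left; apply/eqP.
by field; rewrite s0.
Qed.

End Complex.

Arguments nrm : simpl never.
Arguments ex : simpl never.

(** * Lagrange ratios for nodes on several orbit windows *)

Section Windows.
Variables (R : realType) (alpha : R).
Hypothesis irr : not_rational alpha.
Implicit Types (x eta : R) (q K M j : nat).

Lemma prod_blocks M q (F : nat -> R) :
  \prod_(0 <= j < M * q) F j = \prod_(0 <= b < M) \prod_(j < q) F (b * q + j)%N.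
Proof.
elim: M => [|M IH]; first by rewrite mul0n !big_geq.
rewrite big_nat_recr //= -IH mulSn addnC (@big_cat_nat _ _ _ (M * q)) ?leq_addr //=.
congr (_ * _); rewrite -{1}[(M * q)%N]add0n big_addn addKn big_mkord.
by apply: eq_bigr => j _; rewrite addnC.
Qed.

(** Half a lower bound for the chords between distinct points of a window, so at most one point of
    the window comes closer than this to a given phase. *)
Definition sep_const (q : nat) : R := sn (q%:R * alpha) / 2.

Definition ublock q : R := q%:R ^+ 3 * ref_prod R q.
Definition lblock q : R := (4 * q%:R)^-1 ^+ 4 * ref_prod R q.

Lemma lblock_gt0 q : (0 < q)%N -> 0 < lblock q.
Proof.
by move=> q0; rewrite mulr_gt0 ?ref_prod_gt0 // exprn_gt0 // invr_gt0 mulr_gt0 // ltr0n.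
Qed.

Lemma ublock_ge0 q : 0 <= ublock q.
Proof. by rewrite mulr_ge0 ?exprn_ge0 // ltW // ref_prod_gt0. Qed.

Lemma sep_const_gt0 q : (0 < q)%N -> 0 < sep_const q.
Proof. by move=> q0; rewrite divr_gt0 // sn_gt0. Qed.

Lemma sep_const_le1 q : sep_const q <= 1.
Proof. rewrite /sep_const; have := sn_le1 (q%:R * alpha); lra. Qed.

Lemma window_upper K q M x j0 : best_denom alpha K q ->
  \prod_(0 <= j < M * q | j != j0) sn (x + j%:R * alpha) <= ublock q ^+ M.
Proof.
move=> bq; have q0 : (0 < q)%N by have [/andP[]] := bq.
rewrite big_mkcond prod_blocks -[M in leRHS]subn0 -prodr_const_nat.
apply: ler_prod => b _; apply/andP; split.
  by apply: prodr_ge0 => j _; case: ifP => _ //; exact: sn_ge0.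
have E j : x + (b * q + j)%:R * alpha = (x + (b * q)%:R * alpha) + j%:R * alpha.
  by rewrite natrD; ring.
have [/andP[h1 h2]|h] := boolP ((b * q <= j0) && (j0 < b * q + q))%N.
  have lt : (j0 - b * q < q)%N by lia.
  rewrite -big_mkcond /=; under eq_bigr do rewrite E.
  rewrite (eq_bigl (fun j : 'I_q => j != Ordinal lt)) => [|j].
    exact: block_upper irr _ _ _ _ bq.
  by rewrite -val_eqE /=; lia.
under eq_bigr => j _.
  rewrite ifT; last by have := ltn_ord j; lia.
  rewrite E; over.
exact: block_upper_full irr _ _ _ bq.
Qed.

Lemma sn_diff K q i j : best_denom alpha K q -> i != j -> (i <= j + K)%N -> (j <= i + K)%N ->
  sn (q%:R * alpha) <= sn ((i%:R - j%:R) * alpha).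
Proof.
move=> [_ h] ij h1 h2; have [l|l|l] := ltngtP i j.
- by rewrite -[leRHS]snN -mulNr opprB -natrB ?(ltnW l) //; apply: h; lia.
- by rewrite -natrB ?(ltnW l) //; apply: h; lia.
- by rewrite l eqxx in ij.
Qed.

(** [block_lower] leaves out one point per block; its chord is restored from the minimality of [q],
    at the price of one factor [sep_const] per block. *)
Lemma window_lower_self K q M j0 : best_denom alpha K q -> (M * q <= K)%N -> (j0 < M * q)%N ->
  (lblock q * sep_const q) ^+ M <=
  \prod_(0 <= j < M * q | j != j0) sn ((j%:R - j0%:R) * alpha).
Proof.
move=> bq MK j0M; have q0 : (0 < q)%N by have [/andP[]] := bq.
have L0 := lblock_gt0 q0; have s0 := sep_const_gt0 q0; have s1 := sep_const_le1 q.
rewrite big_mkcond prod_blocks -[M in leLHS]subn0 -prodr_const_nat.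
rewrite big_nat_cond [leRHS]big_nat_cond.
apply: ler_prod => b; rewrite andbT => bM; apply/andP; split; first by rewrite ltW // mulr_gt0.
have E j : ((b * q + j)%:R - j0%:R) * alpha = ((b * q)%:R - j0%:R) * alpha + j%:R * alpha.
  by rewrite natrD; ring.
have [j2 hj2] := block_lower irr (((b * q)%:R - j0%:R) * alpha) bq.
have bq' : (b.+1 * q <= M * q)%N by rewrite leq_mul2r; lia.
have [/andP[h1 h2]|h] := boolP ((b * q <= j0) && (j0 < b * q + q))%N.
  have lt : (j0 - b * q < q)%N by lia.
  rewrite -big_mkcond /=; under eq_bigr do rewrite E.
  rewrite (eq_bigl (fun j : 'I_q => j != Ordinal lt)) => [|j]; last by rewrite -val_eqE /=; lia.
  have [e|ne] := eqVneq j2 (Ordinal lt).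
    by rewrite -e; apply: le_trans hj2; rewrite ler_piMr // ltW.
  (* If the point left out were not [j0], the product would contain the chord of 0. *)
  move: hj2; rewrite (bigD1 (Ordinal lt)) 1?eq_sym //= -E.
  have -> : (b * q + (j0 - b * q))%N = j0 by lia.
  by rewrite subrr mul0r sn0 mul0r leNgt L0.
under eq_bigr => j _.
  rewrite ifT; last by have := ltn_ord j; lia.
  rewrite E; over.
rewrite (bigD1 j2) //= mulrC; apply: ler_pM => //; try exact: ltW.
rewrite -E; apply: le_trans (_ : sn (q%:R * alpha) <= _).
  by rewrite /sep_const; have := sn_ge0 (q%:R * alpha); lra.
by apply: (sn_diff bq); have := ltn_ord j2; lia.
Qed.

(** Two points of the window cannot both have a chord below [sep_const], so [eta] is paid once, in
    the block [bs] of the exceptional point. *)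
Lemma window_lower_other K q M x eta : best_denom alpha K q -> (M * q <= K)%N ->
  0 < eta -> eta <= 1 ->
  (forall j, (j < M * q)%N -> eta <= sn (x + j%:R * alpha)) ->
  (lblock q * sep_const q) ^+ M * eta <= \prod_(0 <= j < M * q) sn (x + j%:R * alpha).
Proof.
move=> bq MK e0 e1 he; have q0 : (0 < q)%N by have [/andP[]] := bq.
have L0 := lblock_gt0 q0; have s0 := sep_const_gt0 q0; have s1 := sep_const_le1 q.
pose bad j := (j < M * q)%N && (sn (x + j%:R * alpha) < sep_const q).
have baduniq i j : bad i -> bad j -> i = j.
  move=> /andP[i1 i2] /andP[j1 j2]; apply/eqP/negPn/negP => ij.
  have := @sn_diff K q i j bq ij; have -> : (i <= j + K)%N by lia.
  have -> : (j <= i + K)%N by lia.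
  move=> /(_ isT isT); apply/negP; rewrite -ltNge.
  have -> : (i%:R - j%:R) * alpha = (x + i%:R * alpha) - (x + j%:R * alpha) by ring.
  apply: le_lt_trans (snB_le _ _) _; rewrite /sep_const in i2 j2; lra.
have LS : 0 < lblock q * sep_const q by rewrite mulr_gt0.
have [bs hbs] : exists bs : nat, forall j, bad j -> (j %/ q)%N = bs.
  have [[j hj]|no] := pselect (exists j, bad j).
    by exists (j %/ q)%N => i hi; rewrite (baduniq i j).
  by exists 0%N => j hj; exfalso; apply: no; exists j.
rewrite prod_blocks.
apply: le_trans (_ : \prod_(0 <= b < M) (lblock q * sep_const q * (if b == bs then eta else 1)) <= _).
  rewrite big_split /= prodr_const_nat subn0; apply: ler_wpM2l.
    by rewrite exprn_ge0 // ltW // mulr_gt0.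
  rewrite -big_mkcond /=; have [h|h] := ltnP bs M.
    rewrite big_mkord (bigD1 (Ordinal h)) ?eqxx //= big1 ?mulr1 // => i /andP[/eqP e].
    by rewrite -val_eqE /= e eqxx.
  rewrite big_nat_cond big1 // => i /andP[/andP[_ hi] /eqP e]; lia.
rewrite big_nat_cond [leRHS]big_nat_cond; apply: ler_prod => b; rewrite andbT => bM; apply/andP; split.
  by rewrite mulr_ge0 ?(ltW LS) //; case: ifP => _ //; exact: ltW.
have E j : x + (b * q + j)%:R * alpha = (x + (b * q)%:R * alpha) + j%:R * alpha.
  by rewrite natrD; ring.
have bq' : (b.+1 * q <= M * q)%N by rewrite leq_mul2r; lia.
have [j2 hj2] := block_lower irr (x + (b * q)%:R * alpha) bq.
rewrite (bigD1 j2) //= [leRHS]mulrC -mulrA; apply: ler_pM => //.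
- exact: ltW.
- by rewrite mulr_ge0 ?(ltW s0) //; case: ifP => _ //; exact: ltW.
- by under eq_bigr do rewrite E.
have jj : (b * q + j2 < M * q)%N by have := ltn_ord j2; lia.
have [hb|hb] := boolP (bad (b * q + j2)%N).
  have -> : b == bs by rewrite -(hbs _ hb) divnMDl // divn_small ?addn0.
  by apply: le_trans (he _ jj); rewrite ler_piMl // ltW.
move: hb; rewrite /bad jj /= -leNgt => h; apply: le_trans h.
by rewrite ler_piMr ?(ltW s0) //; case: ifP.
Qed.

(** After cancellation of [ref_prod] this is q^7 over the chord of q alpha, up to a numerical
    factor. *)
Definition node_const q : R := ublock q / (lblock q * sep_const q).

(** The window of the node itself costs no [eta]; each of the four other windows costs one. *)
Lemma node_ratio K q M x (ph : 'I_5 -> R) eta (i0 : 'I_5) (j0 : 'I_(M * q)) :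
  best_denom alpha K q -> (M * q <= K)%N -> 0 < eta -> eta <= 1 ->
  (forall i i' (j j' : nat), i != i' -> (j < M * q)%N -> (j' < M * q)%N ->
      eta <= sn (ph i + j%:R * alpha - (ph i' + j'%:R * alpha))) ->
  \prod_(m : 'I_5 * 'I_(M * q) | m != (i0, j0))
     (sn (x - (ph m.1 + m.2%:R * alpha)) /
      sn (ph i0 + j0%:R * alpha - (ph m.1 + m.2%:R * alpha)))
  <= node_const q ^+ (5 * M) * eta ^- 4.
Proof.
move=> bq MK e0 e1 he; have q0 : (0 < q)%N by have [/andP[]] := bq.
have L0 := lblock_gt0 q0; have s0 := sep_const_gt0 q0; have s1 := sep_const_le1 q.
have U0 := ublock_ge0 q.
have LS : 0 < lblock q * sep_const q by rewrite mulr_gt0.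
have nc0 : 0 <= node_const q by rewrite divr_ge0 // ltW.
rewrite (eq_bigl (fun m => true && ((m.1, m.2) != (i0, j0)))) => [|[i j] //].
rewrite -(pair_big_dep xpredT (fun (i : 'I_5) (j : 'I_(M * q)) => (i, j) != (i0, j0))
   (fun (i : 'I_5) (j : 'I_(M * q)) =>
   sn (x - (ph i + j%:R * alpha)) / sn (ph i0 + j0%:R * alpha - (ph i + j%:R * alpha)))) /=.
have Hnum i (P : pred nat) j1 : P =1 (fun j => j != j1) ->
    \prod_(j < M * q | P j) sn (x - (ph i + j%:R * alpha)) <= ublock q ^+ M.
  move=> PE; apply: le_trans (@window_upper K q M (ph i - x) j1 bq).
  rewrite big_mkord (eq_bigl _ _ (fun j : 'I_(M * q) => PE j)) le_eqVlt; apply/orP; left; apply/eqP.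
  by apply: eq_bigr => j _; rewrite -snN; congr sn; ring.
rewrite (bigD1 i0) //=.
have -> : node_const q ^+ (5 * M) * eta ^- 4 =
   node_const q ^+ M * (node_const q ^+ M * eta^-1) ^+ 4.
  move: (node_const q) => c.
  by rewrite exprMn -exprM exprVn mulrA -exprD; congr (_ ^+ _ * _); lia.
apply: ler_pM.
- by apply: prodr_ge0 => j _; rewrite divr_ge0 ?sn_ge0.
- by apply: prodr_ge0 => i _; apply: prodr_ge0 => j _; rewrite divr_ge0 ?sn_ge0.
- rewrite (eq_bigl (fun j : 'I_(M * q) => (j : nat) != j0)) => [|j]; last by rewrite xpair_eqE eqxx.
  rewrite prodf_div /node_const expr_div_n; apply: ler_pM.
  + by apply: prodr_ge0 => j _; rewrite sn_ge0.
  + by rewrite invr_ge0; apply: prodr_ge0 => j _; rewrite sn_ge0.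
  + exact: (@Hnum i0 (fun j => j != j0) j0).
  + have := window_lower_self bq MK (ltn_ord j0); rewrite big_mkord => h.
    have e : \prod_(j < M * q | (j : nat) != j0)
       sn (ph i0 + j0%:R * alpha - (ph i0 + j%:R * alpha)) =
       \prod_(j < M * q | (j : nat) != j0) sn ((j%:R - j0%:R) * alpha).
      by apply: eq_bigr => j _; rewrite -snN; congr sn; ring.
    rewrite e lef_pV2 ?posrE ?exprn_gt0 //; apply: lt_le_trans h; exact: exprn_gt0.
have -> : (node_const q ^+ M * eta^-1) ^+ 4 = \prod_(i < 5 | i != i0) (node_const q ^+ M * eta^-1).
  by rewrite prodr_const; congr (_ ^+ _); rewrite cardC1 card_ord.
apply: ler_prod => i ii0; apply/andP; split.
  by apply: prodr_ge0 => j _; rewrite divr_ge0 ?sn_ge0.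
rewrite (eq_bigl (fun j : 'I_(M * q) => (j : nat) != (M * q)%N)) => [|j]; last first.
  by rewrite xpair_eqE (negPf ii0) /= neq_ltn ltn_ord.
rewrite prodf_div /node_const expr_div_n -mulrA; apply: ler_pM.
- by apply: prodr_ge0 => j _; rewrite sn_ge0.
- by rewrite invr_ge0; apply: prodr_ge0 => j _; rewrite sn_ge0.
- exact: (@Hnum i (fun j => j != (M * q)%N) (M * q)%N).
have h : (lblock q * sep_const q) ^+ M * eta <=
   \prod_(0 <= j < M * q) sn (ph i - (ph i0 + j0%:R * alpha) + j%:R * alpha).
  apply: (window_lower_other bq) => // j hj.
  by have := he i i0 j j0 ii0 hj (ltn_ord j0); congr (_ <= sn _); ring.
rewrite big_mkord in h.
have e : \prod_(j < M * q | (j : nat) != (M * q)%N)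
       sn (ph i0 + j0%:R * alpha - (ph i + j%:R * alpha)) =
       \prod_(j < M * q) sn (ph i - (ph i0 + j0%:R * alpha) + j%:R * alpha).
  apply: eq_big => [j|j _]; first by rewrite neq_ltn ltn_ord.
  by rewrite -snN; congr sn; ring.
have g0 : 0 < (lblock q * sep_const q) ^+ M * eta by rewrite mulr_gt0 // exprn_gt0.
by rewrite e -invfM lef_pV2 ?posrE //; exact: lt_le_trans h.
Qed.

End Windows.

Lemma dft (R : realType) (N : nat) (l : int) : (0 < N)%N -> (`|l| < N)%N ->
  \sum_(i < N) ex (i%:R * (l%:~R / N%:R)) = (if l == 0 then N%:R else 0) :> R[i].
Proof.
move=> N0 lN; case: eqP => [->|/eqP l0].
  under eq_bigr do rewrite mul0r mulr0 ex0.
  by rewrite sumr_const card_ord.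
set z := ex (l%:~R / N%:R : R).
under eq_bigr do rewrite exMn -/z.
have N0' : N%:R != 0 :> R by rewrite pnatr_eq0 -lt0n.
have z1 : z - 1 != 0.
  rewrite -nrm_gt0 -ex0 /z nrm_exB subr0 mulr_gt0 //.
  have e : sn (l%:~R / N%:R) = sn (`|l|%:R / N%:R) :> R.
    have [l0'|l0'] := lerP 0 l.
      by rewrite -[in LHS](gez0_abs l0').
    by rewrite -[in LHS](opprK l) -(ltz0_abs l0') rmorphN mulNr snN.
  rewrite e; apply: lt_le_trans (@Sq_ge R N `|l|%N _); first by rewrite invr_gt0 ltr0n.
  by rewrite lN andbT absz_gt0.
apply: (mulfI z1); rewrite mulr0 -subrX1 /z -exMn mulrC divfK // ex_int.
by rewrite subrr.
Qed.

(** * The operator a (S + S^-1) + b1 e(x) + b2 e(-x) and its determinants *)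

Section Model.
Variables (R : realType) (a b1 b2 E alpha : R).
Local Notation C := (R[i]).
Implicit Types (x y : R) (n m k s t : nat).

(** [b1] and [b2] are kept apart for complex phases: an imaginary shift multiplies one by rho and
    the other by 1 / rho. *)
Definition Vx x : C := b1%:C%C * ex x + b2%:C%C * ex (- x) - E%:C%C.

(** Up to signs, the transfer matrix multiplied by the hopping [a], hence of determinant a^2: it
    stays bounded when [a] is small, and the entries of its products are box determinants. *)
Definition trans x : 'M[C]_2 :=
  \matrix_(i, j) if i == ord0 then (if j == ord0 then Vx x else - a%:C%C)
                 else (if j == ord0 then a%:C%C else 0).

Fixpoint cocyc n x : 'M[C]_2 :=
  if n is n'.+1 then trans (x + n'%:R * alpha) *m cocyc n' x else 1%:M.

Definition mnorm (M : 'M[C]_2) : R := \sum_i \sum_j nrm (M i j).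

(** The determinant of the operator minus [E] restricted to [n] consecutive sites, by the three-term
    recursion [dtS]. *)
Definition dt n x : C := cocyc n x ord0 ord0.

(* The determinant on one site less, with the convention that it vanishes on -1 sites. *)
Definition dt1 n x : C := if n is n'.+1 then dt n' x else 0.

Lemma cocycD m n x : cocyc (m + n) x = cocyc n (x + m%:R * alpha) *m cocyc m x.
Proof.
elim: n => [|n IH]; first by rewrite addn0 mul1mx.
rewrite addnS /= IH mulmxA; congr (trans _ *m _ *m _).
by rewrite natrD; ring.
Qed.

Lemma cocycS n x : cocyc n.+1 x = cocyc n (x + alpha) *m trans x.
Proof. have := cocycD 1 n x; rewrite add1n mul1r => ->; congr (_ *m _).
by rewrite /= mul0r addr0 mulmx1. Qed.

Lemma mul2E (A B : 'M[C]_2) i j :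
  (A *m B) i j = A i ord0 * B ord0 j + A i ord_max * B ord_max j.
Proof.
rewrite mxE big_ord_recl big_ord1; congr (_ + A i _ * B _ j); exact: val_inj.
Qed.

Lemma cocyc10 n x : cocyc n x ord_max ord0 = a%:C%C * dt1 n x.
Proof.
by case: n => [|n]; rewrite /= ?mul2E !mxE ?mulr0 //= mul0r addr0.
Qed.

Lemma cocyc01 n x : cocyc n x ord0 ord_max = - a%:C%C * dt1 n (x + alpha).
Proof.
case: n => [|n]; first by rewrite /= !mxE /= mulr0.
by rewrite cocycS mul2E !mxE /= mulr0 addr0 mulrC.
Qed.

Lemma dt0 x : dt 0 x = 1. Proof. by rewrite /dt /= mxE. Qed.

Lemma dtS n x : dt n.+1 x = Vx (x + n%:R * alpha) * dt n x - a%:C%C ^+ 2 * dt1 n x.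
Proof. by rewrite /dt /= mul2E cocyc10 !mxE /=; ring. Qed.

Lemma dtSl n x : dt n.+1 x = Vx x * dt n (x + alpha) - a%:C%C ^+ 2 * dt1 n (x + alpha + alpha).
Proof. by rewrite /dt cocycS mul2E cocyc01 !mxE /=; ring. Qed.

Lemma dt_split m n x : dt (m + n) x =
  dt n (x + m%:R * alpha) * dt m x - a%:C%C ^+ 2 * (dt1 n (x + m%:R * alpha + alpha) * dt1 m x).
Proof. by rewrite /dt cocycD mul2E cocyc01 cocyc10; ring. Qed.

Lemma dt1_split n x : dt1 n.+1 x = dt n x. Proof. by []. Qed.

Section Box.
Variables (x : R) (g : nat -> C).

Definition resid j : C := a%:C%C * (g j.+2 + g j) + Vx (x + j%:R * alpha) * g j.+1.

Fixpoint lsum n : C := if n is n'.+1 then - a%:C%C * lsum n' + dt n' x * resid n' else 0.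

Fixpoint rsum n t : C :=
  if n is n'.+1 then dt n' (x + t.+1%:R * alpha) * resid t - a%:C%C * rsum n' t.+1 else 0.

(** Elimination from the left end: the first n equations combine into one relation between g n, g (n
    + 1) and the boundary value g 0. *)
Lemma left_sweep n :
  dt n x * g n + a%:C%C * dt1 n x * g n.+1 = lsum n + (- a%:C%C) ^+ n * g 0.
Proof.
elim: n => [|n IH]; first by rewrite dt0 /=; ring.
rewrite /= dtS /resid (exprS _ n).
have -> : - a%:C%C * lsum n = - a%:C%C * (dt n x * g n + a%:C%C * dt1 n x * g n.+1 - (- a%:C%C) ^+ n * g 0).
  by rewrite IH; ring.
ring.
Qed.

Lemma right_sweep n t :
  dt n (x + t%:R * alpha) * g t.+1 + a%:C%C * dt1 n (x + t%:R * alpha + alpha) * g t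
   = rsum n t + (- a%:C%C) ^+ n * g (t + n).+1.
Proof.
elim: n t => [|n IH] t; first by rewrite dt0 addn0 /=; ring.
rewrite /= dtSl /resid (exprS _ n).
have xE : x + t.+1%:R * alpha = x + t%:R * alpha + alpha by rewrite -natr1; ring.
have := IH t.+1; rewrite addSnnS xE => IH'.
have -> : - (a%:C%C * rsum n t.+1) = - a%:C%C * (dt n (x + t%:R * alpha + alpha) * g t.+2 +
   a%:C%C * dt1 n (x + t%:R * alpha + alpha + alpha) * g t.+1 - (- a%:C%C) ^+ n * g (t + n.+1).+1).
  by rewrite IH'; ring.
ring.
Qed.

(** Cramer's rule at the site [s.+1] of a box: cofactors split into determinants on either side, and
    the two boundary values enter with powers of [a]. *)
Lemma box_identity s n :
  dt (s.+1 + n) x * g s.+1 =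
  dt s x * dt n (x + s.+1%:R * alpha) * resid s
   - a%:C%C * dt n (x + s.+1%:R * alpha) * (lsum s + (- a%:C%C) ^+ s * g 0)
   - a%:C%C * dt s x * (rsum n s.+1 + (- a%:C%C) ^+ n * g (s.+1 + n).+1).
Proof.
rewrite -left_sweep -right_sweep dt_split dtS dt1_split /resid; ring.
Qed.

Variables (B mu eps : R) (k : nat).
Hypotheses (a1 : `|a| <= 1) (B1 : 1 <= B) (mu0 : 0 <= mu) (e0 : 0 <= eps).
Local Notation G j := (B * expR (j%:R * mu)).
Hypothesis dtG : forall j y, (j <= k)%N -> nrm (dt j y) <= G j.
Hypothesis resid_le : forall j, (j < k)%N -> nrm (resid j) <= eps.

Lemma nrm_a : nrm (a%:C%C : C) = `|a|. Proof. exact: nrm_real. Qed.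

Lemma G_ge0 j : 0 <= G j.
Proof. by rewrite mulr_ge0 ?expR_ge0 // (le_trans ler01). Qed.

Lemma G_mono j : G j <= G j.+1.
Proof.
apply: ler_wpM2l; first exact: le_trans ler01 B1.
by rewrite ler_expR ler_wpM2r // ler_nat.
Qed.

Lemma sweep_step n : n%:R * (G n * eps) + G n * eps <= n.+1%:R * (G n.+1 * eps).
Proof.
have E1 (z : R) : n.+1%:R * z = n%:R * z + z by rewrite -natr1 mulrDl mul1r.
rewrite [leRHS]E1; apply: lerD.
  by apply: ler_wpM2l => //; apply: ler_wpM2r => //; exact: G_mono.
by apply: ler_wpM2r => //; exact: G_mono.
Qed.

Lemma lsum_le n : (n <= k)%N -> nrm (lsum n) <= n%:R * (G n * eps).
Proof.
elim: n => [|n IH] nk; first by rewrite /= nrm0 mul0r.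
apply: le_trans (sweep_step n); rewrite /=.
apply: le_trans (nrmD _ _) _; rewrite !nrmM nrmN nrm_a; apply: lerD.
  by apply: le_trans (IH (ltnW nk)); rewrite ler_piMl ?nrm_ge0.
by apply: ler_pM; rewrite ?nrm_ge0 ?dtG ?resid_le // ltnW.
Qed.

Lemma rsum_le n t : (t + n <= k)%N -> nrm (rsum n t) <= n%:R * (G n * eps).
Proof.
elim: n t => [|n IH] t nk; first by rewrite /= nrm0 mul0r.
apply: le_trans (sweep_step n); rewrite /=.
apply: le_trans (nrmB _ _) _; rewrite !nrmM nrm_a [leLHS]addrC; apply: lerD.
  apply: le_trans (IH t.+1 _); last by rewrite addSnnS.
  by rewrite ler_piMl ?nrm_ge0.
by apply: ler_pM; rewrite ?nrm_ge0 ?dtG ?resid_le //; clear -nk; lia.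
Qed.

Lemma GM s n : (s + n <= k)%N -> G s * G n <= B ^+ 2 * expR (k%:R * mu).
Proof.
move=> h; have -> : G s * G n = B ^+ 2 * expR ((s + n)%:R * mu).
  by rewrite natrD mulrDl expRD; ring.
apply: ler_wpM2l; first by rewrite exprn_ge0 // (le_trans ler01).
by rewrite ler_expR ler_wpM2r // ler_nat.
Qed.

Lemma box_bound s n : (k = s.+1 + n)%N ->
  nrm (dt k x) * nrm (g s.+1) <=
  `|a| ^+ s.+1 * nrm (dt n (x + s.+1%:R * alpha)) * nrm (g 0)
  + `|a| ^+ n.+1 * nrm (dt s x) * nrm (g k.+1) + k%:R * (B ^+ 2 * expR (k%:R * mu) * eps).
Proof.
move=> kE; rewrite -nrmM {1}kE box_identity -kE.
have a0 := normr_ge0 a.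
have sk : (s <= k)%N by rewrite kE; clear; lia.
have nk : (n <= k)%N by rewrite kE; clear; lia.
have hs : nrm (dt s x) <= G s by exact: dtG.
have hn : nrm (dt n (x + s.+1%:R * alpha)) <= G n by exact: dtG.
have hr : nrm (resid s) <= eps by apply: resid_le; rewrite kE; clear; lia.
have hl : nrm (lsum s) <= s%:R * (G s * eps) by exact: lsum_le.
have hrr : nrm (rsum n s.+1) <= n%:R * (G n * eps) by apply: rsum_le; rewrite kE.
have gsn : G s * G n <= B ^+ 2 * expR (k%:R * mu) by apply: GM; rewrite kE; clear; lia.
set Q := B ^+ 2 * expR (k%:R * mu) in gsn *.
apply: le_trans (nrmB _ _) _; apply: le_trans (lerD (nrmB _ _) (lexx _)) _.
have NX m : nrm ((- a%:C%C : C) ^+ m) = `|a| ^+ m by rewrite nrmX nrmN nrm_a.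
have L1 : nrm (lsum s + (- a%:C%C) ^+ s * g 0) <= s%:R * (G s * eps) + `|a| ^+ s * nrm (g 0).
  by apply: le_trans (nrmD _ _) _; rewrite nrmM NX lerD2r.
have L2 : nrm (rsum n s.+1 + (- a%:C%C) ^+ n * g k.+1) <= n%:R * (G n * eps) + `|a| ^+ n * nrm (g k.+1).
  by apply: le_trans (nrmD _ _) _; rewrite nrmM NX lerD2r.
rewrite !nrmM nrm_a.
have p1 : nrm (dt s x) * nrm (dt n (x + s.+1%:R * alpha)) * nrm (resid s) <= Q * eps.
  apply: ler_pM; rewrite ?mulr_ge0 ?nrm_ge0 //.
  by apply: le_trans gsn; apply: ler_pM; rewrite ?nrm_ge0.
have p2 : `|a| * nrm (dt n (x + s.+1%:R * alpha)) * nrm (lsum s + (- a%:C%C) ^+ s * g 0) <=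
    s%:R * (Q * eps) + `|a| ^+ s.+1 * nrm (dt n (x + s.+1%:R * alpha)) * nrm (g 0).
  apply: le_trans (_ : `|a| * nrm (dt n (x + s.+1%:R * alpha)) * (s%:R * (G s * eps) + `|a| ^+ s * nrm (g 0)) <= _).
    by apply: ler_wpM2l => //; rewrite mulr_ge0 ?nrm_ge0.
  rewrite mulrDr (exprS _ s); apply: lerD; last by rewrite le_eqVlt; apply/orP; left; apply/eqP; ring.
  apply: le_trans (_ : G n * (s%:R * (G s * eps)) <= _).
    apply: ler_wpM2r; first by rewrite !mulr_ge0 ?G_ge0 ?expR_ge0 // (le_trans ler01).
    by apply: le_trans hn; rewrite ler_piMl ?nrm_ge0.
  have -> : G n * (s%:R * (G s * eps)) = s%:R * ((G s * G n) * eps) by ring.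
  by apply: ler_wpM2l => //; exact: ler_wpM2r.
have p3 : `|a| * nrm (dt s x) * nrm (rsum n s.+1 + (- a%:C%C) ^+ n * g k.+1) <=
    n%:R * (Q * eps) + `|a| ^+ n.+1 * nrm (dt s x) * nrm (g k.+1).
  apply: le_trans (_ : `|a| * nrm (dt s x) * (n%:R * (G n * eps) + `|a| ^+ n * nrm (g k.+1)) <= _).
    by apply: ler_wpM2l => //; rewrite mulr_ge0 ?nrm_ge0.
  rewrite mulrDr (exprS _ n); apply: lerD; last by rewrite le_eqVlt; apply/orP; left; apply/eqP; ring.
  apply: le_trans (_ : G s * (n%:R * (G n * eps)) <= _).
    apply: ler_wpM2r; first by rewrite !mulr_ge0 ?G_ge0 ?expR_ge0 // (le_trans ler01).
    by apply: le_trans hs; rewrite ler_piMl ?nrm_ge0.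
  have -> : G s * (n%:R * (G n * eps)) = n%:R * ((G s * G n) * eps) by ring.
  by apply: ler_wpM2l => //; exact: ler_wpM2r.
apply: le_trans (lerD (lerD p1 p2) p3) _.
have -> : k%:R = s%:R + 1 + n%:R :> R by rewrite kE natrD -natr1.
rewrite le_eqVlt; apply/orP; left; apply/eqP; ring.
Qed.

End Box.

Lemma mnorm_ge0 (M : 'M[C]_2) : 0 <= mnorm M.
Proof. by apply: sumr_ge0 => i _; apply: sumr_ge0 => j _; exact: nrm_ge0. Qed.

Lemma mnormE (M : 'M[C]_2) : mnorm M =
  nrm (M ord0 ord0) + nrm (M ord0 ord_max) + (nrm (M ord_max ord0) + nrm (M ord_max ord_max)).
Proof.
have e (F : 'I_2 -> R) : \sum_i F i = F ord0 + F ord_max.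
  by rewrite big_ord_recl big_ord1; congr (_ + F _); exact: val_inj.
by rewrite /mnorm !e.
Qed.

Lemma mnormM (A B : 'M[C]_2) : mnorm (A *m B) <= mnorm A * mnorm B.
Proof.
rewrite !mnormE !mul2E.
have H i j : nrm (A i ord0 * B ord0 j + A i ord_max * B ord_max j) <=
   nrm (A i ord0) * nrm (B ord0 j) + nrm (A i ord_max) * nrm (B ord_max j).
  by apply: le_trans (nrmD _ _) _; rewrite !nrmM.
apply: le_trans (lerD (lerD (H _ _) (H _ _)) (lerD (H _ _) (H _ _))) _.
have := (nrm_ge0 (A ord0 ord0), nrm_ge0 (A ord0 ord_max), nrm_ge0 (A ord_max ord0), nrm_ge0 (A ord_max ord_max)).
have := (nrm_ge0 (B ord0 ord0), nrm_ge0 (B ord0 ord_max), nrm_ge0 (B ord_max ord0), nrm_ge0 (B ord_max ord_max)).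
move: (nrm (A _ _)) (nrm (A _ _)) (nrm (A _ _)) (nrm (A _ _)) => p4 p3 p2 p1.
move: (nrm (B _ _)) (nrm (B _ _)) (nrm (B _ _)) (nrm (B _ _)) => q4 q3 q2 q1.
case=> [[[q1_ge0 q2_ge0] q3_ge0] q4_ge0] [[[p1_ge0 p2_ge0] p3_ge0] p4_ge0].
rewrite -subr_ge0.
have -> : (p1 + p2 + (p3 + p4)) * (q1 + q2 + (q3 + q4)) -
  (p1 * q1 + p2 * q3 + (p1 * q2 + p2 * q4) + (p3 * q1 + p4 * q3 + (p3 * q2 + p4 * q4))) =
  p1 * (q3 + q4) + p2 * (q1 + q2) + p3 * (q3 + q4) + p4 * (q1 + q2) by ring.
by rewrite !addr_ge0 // mulr_ge0 // addr_ge0.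
Qed.

Lemma mnorm1 : mnorm 1%:M = 2.
Proof. by rewrite mnormE !mxE /= nrm1 nrm0; ring. Qed.

Definition trans_const : R := 2 + `|b1| + `|b2| + `|E| + 2 * `|a|.

Lemma mnorm_trans x : mnorm (trans x) <= trans_const.
Proof.
rewrite mnormE !mxE /= nrmN nrm0 nrm_a /trans_const.
have : nrm (Vx x) <= `|b1| + `|b2| + `|E|.
  apply: le_trans (nrmB _ _) _; rewrite nrm_real lerD2r.
  by apply: le_trans (nrmD _ _) _; rewrite !nrmM !nrm_real !nrm_ex !mulr1.
lra.
Qed.

Lemma trans_const_ge1 : 1 <= trans_const.
Proof.
rewrite /trans_const; have := normr_ge0 b1; have := normr_ge0 b2.
have := normr_ge0 E; have := normr_ge0 a; lra.
Qed.

Lemma mnorm_cocyc_le n x : mnorm (cocyc n x) <= 2 * trans_const ^+ n.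
Proof.
elim: n => [|n IH]; first by rewrite /= mnorm1 expr0 mulr1.
rewrite /= exprS mulrCA; apply: le_trans (mnormM _ _) _.
by apply: ler_pM; rewrite ?mnorm_ge0 ?mnorm_trans.
Qed.

Lemma dt_le_mnorm n x : nrm (dt n x) <= mnorm (cocyc n x).
Proof.
rewrite mnormE /dt; have := nrm_ge0 (cocyc n x ord0 ord_max).
have := nrm_ge0 (cocyc n x ord_max ord0); have := nrm_ge0 (cocyc n x ord_max ord_max); lra.
Qed.

(** Submultiplicativity: the bound over [j] steps is iterated, and the remainder of the division by
    [j] goes into the constant. The energy enters this constant through [trans_const] only, so it is
    locally uniform. *)
Lemma upper_of_one (j : nat) (nu : R) : (0 < j)%N -> 0 <= nu ->
  (forall x, mnorm (cocyc j x) <= expR (j%:R * nu)) ->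
  forall n x, mnorm (cocyc n x) <= 4 * trans_const ^+ j * expR (n%:R * nu).
Proof.
move=> j0 nu0 H n x.
have B1 := trans_const_ge1.
have Ht t y : mnorm (cocyc (t * j) y) <= 2 * expR ((t * j)%:R * nu).
  elim: t y => [|t IH] y; first by rewrite mul0n /= mnorm1 mul0r expR0 mulr1.
  rewrite mulSn addnC cocycD; apply: le_trans (mnormM _ _) _.
  have -> : (t * j + j)%:R * nu = j%:R * nu + (t * j)%:R * nu by rewrite natrD; ring.
  by rewrite expRD mulrCA; apply: ler_pM; rewrite ?mnorm_ge0.
rewrite (divn_eq n j) cocycD; apply: le_trans (mnormM _ _) _.
rewrite mulrC.
apply: le_trans (_ : (2 * expR ((n %/ j * j)%:R * nu)) * (2 * trans_const ^+ j) <= _).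
  apply: ler_pM; rewrite ?mnorm_ge0 ?Ht //.
  apply: le_trans (mnorm_cocyc_le _ _) _; rewrite ler_pM2l //.
  by apply: ler_weXn2l => //; rewrite ltnW // ltn_mod.
have -> : (n %/ j * j + n %% j)%:R * nu = (n %/ j * j)%:R * nu + (n %% j)%:R * nu.
  by rewrite natrD; ring.
rewrite expRD.
have e1 : 1 <= expR ((n %% j)%:R * nu) by rewrite -[leLHS]expR0 ler_expR mulr_ge0.
have e2 := expR_gt0 ((n %/ j * j)%:R * nu).
have e3 : 0 <= trans_const ^+ j by rewrite exprn_ge0 //; lra.
have -> : 2 * expR ((n %/ j * j)%:R * nu) * (2 * trans_const ^+ j) =
  4 * trans_const ^+ j * expR ((n %/ j * j)%:R * nu) by ring.
rewrite mulrA ler_peMr // !mulr_ge0 //; exact: ltW.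
Qed.

Definition growth n : R := sup [set mnorm (cocyc n x) | x in [set: R]].

Lemma growth_has_sup n : has_sup [set mnorm (cocyc n x) | x in [set: R]].
Proof.
split; first by exists (mnorm (cocyc n 0)); exists 0.
by exists (2 * trans_const ^+ n) => _ [x _ <-]; exact: mnorm_cocyc_le.
Qed.

Lemma le_growth n x : mnorm (cocyc n x) <= growth n.
Proof. by apply: ub_le_sup; [have [] := growth_has_sup n|exists x]. Qed.

Lemma growth_attained n (t : R) : t < growth n -> exists x, t < mnorm (cocyc n x).
Proof.
move=> h; have p : 0 < growth n - t by rewrite subr_gt0.
have [_ [x _ <-]] := sup_adherent p (growth_has_sup n).
by rewrite -/(growth n) opprB addrC subrK => q; exists x.
Qed.

(** The Lyapunov exponent as the infimum of [ln (growth j) / j]: with an infimum, the lower bound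
    holds at every length without a constant. *)
Lemma growth_exponent (mu : R) : 0 <= mu ->
  (forall j, (0 < j)%N -> expR (j%:R * mu) <= growth j) ->
  exists l, [/\ mu <= l, forall n, (0 < n)%N -> expR (n%:R * l) <= growth n &
    forall eps, 0 < eps -> exists B, 1 <= B /\
      forall n x, mnorm (cocyc n x) <= B * expR (n%:R * (l + eps))].
Proof.
move=> mu0 H; pose S := [set ln (growth j) / j%:R | j in [set j : nat | (0 < j)%N]].
have g0 j : (0 < j)%N -> 0 < growth j by move=> j0; apply: lt_le_trans (H j j0); exact: expR_gt0.
have lb : lbound S mu.
  move=> _ [j j0 <-]; rewrite ler_pdivlMr ?ltr0n //.
  by rewrite mulrC -[leLHS]expRK ler_ln ?posrE ?expR_gt0 ?g0 ?H.
have S0 : S !=set0 by exists (ln (growth 1) / 1%:R); exists 1%N.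
have hi : has_inf S by split=> //; exists mu.
exists (inf S); split.
- exact: lb_le_inf.
- move=> n n0; rewrite -[leRHS](lnK (g0 n n0)) ler_expR mulrC -ler_pdivlMr ?ltr0n //.
  by apply: ge_inf; [exists mu|exists n].
- move=> eps eps0; have [_ [j j0 <-] hj] := inf_adherent eps0 hi.
  have l0 : 0 <= inf S + eps by apply: addr_ge0; [exact: le_trans mu0 (lb_le_inf _ _)|exact: ltW].
  exists (4 * trans_const ^+ j); split.
    have := exprn_ege1 j trans_const_ge1; lra.
  apply: upper_of_one => // x; apply: le_trans (le_growth _ _) _.
  rewrite -[leLHS](lnK (g0 j j0)) ler_expR mulrC -ler_pdivrMr ?ltr0n //; exact: ltW.
Qed.

(** The four entries of the cocycle are determinants on N, N - 1 and N - 2 sites, up to factors of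
    modulus at most 1. One of them carries a quarter of the norm, and the supremum is approached
    within a factor 2. *)
Lemma dt_large N (t : R) : `|a| <= 1 -> (2 <= N)%N -> 0 < t -> t <= growth N ->
  exists k x, [/\ (N - 2 <= k)%N, (k <= N)%N & t / 8 <= nrm (dt k x)].
Proof.
case: N => [//|[//|N]] a1 _ t0 ht.
have a0 := normr_ge0 a.
have [x hx] : exists x, t / 2 < mnorm (cocyc N.+2 x) by apply: growth_attained; lra.
move: hx; rewrite mnormE.
have e11 : nrm (cocyc N.+2 x ord_max ord_max) <= nrm (dt N (x + alpha)).
  rewrite /= mul2E -/(cocyc N.+1 x) cocyc01 !mxE /= mul0r addr0 mulrA nrmM nrmM nrmN nrm_a.
  rewrite ler_piMl ?nrm_ge0 //; nra.
have e10 : nrm (cocyc N.+2 x ord_max ord0) <= nrm (dt N.+1 x).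
  by rewrite cocyc10 nrmM nrm_a ler_piMl ?nrm_ge0.
have e01 : nrm (cocyc N.+2 x ord0 ord_max) <= nrm (dt N.+1 (x + alpha)).
  by rewrite cocyc01 nrmM nrmN nrm_a ler_piMl ?nrm_ge0.
rewrite -/(dt N.+2 x) => hx.
have [h|h1] := leP (t / 8) (nrm (dt N.+2 x)); first by exists N.+2, x; rewrite !subSS subn0 leqnn leqW ?leqnSn; split.
have [h|h2] := leP (t / 8) (nrm (dt N.+1 x)); first by exists N.+1, x; rewrite !subSS subn0 !leqnSn; split.
have [h|h3] := leP (t / 8) (nrm (dt N.+1 (x + alpha))); first by exists N.+1, (x + alpha); rewrite !subSS subn0 !leqnSn; split.
have [h|h4] := leP (t / 8) (nrm (dt N (x + alpha))); first by exists N, (x + alpha); rewrite !subSS subn0 leqnn leqW ?leqnSn; split.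
lra.
Qed.

(** [dt n x] times e(n x) is a polynomial of degree 2n in e(x). The second component is the previous
    polynomial, since the recursion has two terms. *)
Fixpoint dpoly n : {poly C} * {poly C} :=
  if n is n'.+1 then
    (((b1%:C%C * ex (n'%:R * alpha)) *: 'X^2 + (b2%:C%C * ex (- (n'%:R * alpha)))%:P - E%:C%C *: 'X)
       * (dpoly n').1 - (a%:C%C ^+ 2) *: 'X^2 * (dpoly n').2, (dpoly n').1)
  else (1, 0).

Lemma dpolyE n x : (dpoly n).1.[ex x] = ex x ^+ n * dt n x /\
  (dpoly n).2.[ex x] * ex x = ex x ^+ n * dt1 n x.
Proof.
elim: n => [|n [IH1 IH2]]; first by rewrite /= dt0 !hornerE ?mul0r ?mulr0 ?mulr1.
split; last by rewrite /= IH1 exprS; ring.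
rewrite /= dtS hornerD hornerN !hornerM !hornerZ !hornerD hornerN !hornerZ !hornerXn hornerC hornerX IH1.
rewrite /Vx opprD !exD (exprS _ n).
have -> : a%:C%C ^+ 2 * ex x ^+ 2 * (dpoly n).2.[ex x] = a%:C%C ^+ 2 * ex x * (ex x ^+ n * dt1 n x).
  by rewrite -IH2; ring.
by rewrite (exN x); field; exact: ex_neq0.
Qed.

Lemma nrm_dpoly n x : nrm (dpoly n).1.[ex x] = nrm (dt n x).
Proof. by have [-> _] := dpolyE n x; rewrite nrmM nrmX nrm_ex expr1n mul1r. Qed.

Lemma size_dpoly n : (size (dpoly n).1 <= (2 * n).+1)%N /\ (size (dpoly n).2 <= (2 * n).-1)%N
  /\ nrm (dpoly n).1`_(2 * n) = `|b1| ^+ n.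
Proof.
elim: n => [|n [IH1 [IH2 IH3]]].
  split; first by rewrite size_poly1.
  by split; [rewrite size_poly0|rewrite muln0 coef1 nrm1 expr0].
have s1 : (size ((b1%:C%C * ex (n%:R * alpha)) *: 'X^2 + (b2%:C%C * ex (- (n%:R * alpha)))%:P - E%:C%C *: 'X : {poly C})%R <= 3)%N.
  apply: leq_trans (size_polyD _ _) _; rewrite geq_max size_polyN; apply/andP; split.
    apply: leq_trans (size_polyD _ _) _; rewrite geq_max; apply/andP; split.
      by apply: leq_trans (size_scale_leq _ _) _; rewrite size_polyXn.
    by apply: leq_trans (size_polyC_leq1 _) _.
  by apply: leq_trans (size_scale_leq _ _) _; rewrite size_polyX.
have s2 : (size ((a%:C%C ^+ 2) *: 'X^2 * (dpoly n).2 : {poly C})%R <= (2 * n).+1)%N.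
  have [->|nz] := eqVneq (dpoly n).2 0; first by rewrite mulr0 size_poly0.
  apply: leq_trans (size_polyMleq _ _) _.
  have h3 : (size ((a%:C%C ^+ 2) *: 'X^2 : {poly C})%R <= 3)%N.
    by apply: leq_trans (size_scale_leq _ _) _; rewrite size_polyXn.
  have : (0 < size (dpoly n).2)%N by rewrite size_poly_gt0.
  lia.
split; last split.
- rewrite /=; apply: leq_trans (size_polyD _ _) _; rewrite geq_max size_polyN; apply/andP; split.
    apply: leq_trans (size_polyMleq _ _) _; rewrite -subn1 leq_subLR.
    by apply: leq_trans (leq_add s1 IH1) _; lia.
  by apply: leq_trans s2 _; lia.
- by rewrite /=; apply: leq_trans IH1 _; lia.
- rewrite /= coefB [X in _ - X]nth_default ?subr0; last by apply: leq_trans s2 _; lia.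
  have -> : ((b1%:C%C * ex (n%:R * alpha)) *: 'X^2 + (b2%:C%C * ex (- (n%:R * alpha)))%:P - E%:C%C *: 'X)
     * (dpoly n).1 = (b1%:C%C * ex (n%:R * alpha)) *: ((dpoly n).1 * 'X^2)
       + (b2%:C%C * ex (- (n%:R * alpha))) *: (dpoly n).1 - E%:C%C *: ((dpoly n).1 * 'X).
    by rewrite !mulrDl -!scalerAl mulNr -scalerAl mul_polyC ['X * _]mulrC ['X^2 * _]mulrC.
  rewrite coefB coefD !coefZ coefMXn coefMX.
  have -> : ((2 * n.+1)%N < 2)%N = false by lia.
  have -> : (2 * n.+1 - 2 = 2 * n)%N by lia.
  rewrite [X in _ + _ * X - _]nth_default ?mulr0 ?addr0; last by apply: leq_trans IH1 _; lia.
  have -> : ((2 * n.+1)%N == 0) = false by lia.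
  rewrite [X in _ - _ * X]nth_default ?mulr0 ?subr0; last by apply: leq_trans IH1 _; lia.
  by rewrite !nrmM IH3 nrm_real nrm_ex mulr1 exprS.
Qed.

(* The top Fourier coefficient of the determinant has modulus |b1|^n. *)
Lemma herman n : exists x, `|b1| ^+ n <= nrm (dt n x).
Proof.
apply: contrapT => /forallNP H.
have [szp [_ cf]] := size_dpoly n.
set p := (dpoly n).1 in szp cf.
pose N := (2 * n).+1; pose z (i : nat) : R := i%:R / N%:R.
have N0 : N%:R != 0 :> R by rewrite pnatr_eq0.
have key : \sum_(i < N) p.[ex (z i)] * ex (- ((2 * n)%:R * z i)) = N%:R * p`_(2 * n).
  have E1 (i : 'I_N) : p.[ex (z i)] * ex (- ((2 * n)%:R * z i)) =
     \sum_(l < N) p`_l * ex (i%:R * ((l%:Z - (2 * n)%:Z)%:~R / N%:R)).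
    rewrite (horner_coef_wide _ szp) mulr_suml; apply: eq_bigr => l _.
    rewrite -mulrA -exMn -exD; congr (_ * ex _); rewrite /z rmorphB /=; ring.
  rewrite (eq_bigr _ (fun i _ => E1 i)) exchange_big /=.
  have E2 (l : 'I_N) : \sum_(i < N) p`_l * ex (i%:R * ((l%:Z - (2 * n)%:Z)%:~R / N%:R)) =
     p`_l * (if l%:Z - (2 * n)%:Z == 0 then N%:R else 0).
    by rewrite -mulr_sumr dft //; have := ltn_ord l; rewrite /N; lia.
  rewrite (eq_bigr _ (fun l _ => E2 l)) (bigD1 ord_max) //= big1 => [|l ln].
    by rewrite addr0 subrr eqxx mulrC.
  rewrite ifF ?mulr0 //; apply/negbTE; rewrite subr_eq0; apply: contra ln => /eqP[e].
  by apply/eqP/val_inj.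
have : nrm (N%:R * p`_(2 * n)) < N%:R * `|b1| ^+ n.
  rewrite -key; apply: le_lt_trans (nrm_sum _ _ _) _.
  have -> : N%:R * `|b1| ^+ n = \sum_(i < N) `|b1| ^+ n.
    by rewrite sumr_const card_ord mulr_natl.
  apply: ltr_sum; first by apply/hasP; exists ord0; rewrite ?mem_index_enum.
  move=> i _; rewrite nrmM nrm_ex mulr1 nrm_dpoly ltNge; apply/negP; exact: H.
rewrite nrmM cf -[N%:R](rmorph_nat (real_complex R)) nrm_real ger0_norm // ltxx.
by [].
Qed.

End Model.

(** * Singular phases *)

Section Scale.
Variables (R : realType) (alpha : R).
Hypothesis irr : not_rational alpha.

Lemma min_sn_gt0 (q0 : nat) : exists2 d : R, 0 < d &
  forall t, (0 < t <= q0)%N -> d <= sn (t%:R * alpha).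
Proof.
elim: q0 => [|q [d d0 h]]; first by exists 1 => // t; lia.
exists (Num.min d (sn (q.+1%:R * alpha))); first by rewrite lt_min d0 sn_gt0.
move=> t /andP[t0 tq]; rewrite ge_min; have [->|ne] := eqVneq t q.+1; first by rewrite lexx orbT.
by rewrite h //; lia.
Qed.

Lemma archi_nat (y : R) : exists n : nat, y < n%:R.
Proof.
exists (Num.truncn `|y|).+1; apply: le_lt_trans (ler_norm y) _.
by have /andP[] := truncn_itv (normr_ge0 y).
Qed.

(** A bounded best denominator would keep the chord of q alpha away from 0, while this chord is
    below 4 / K. *)
Lemma best_denom_large (q0 : nat) : exists K0, forall K q, (K0 <= K)%N ->
  best_denom alpha K q -> (q0 <= q)%N.
Proof.
have [d d0 hd] := min_sn_gt0 q0; have [n hn] := archi_nat (4 / d).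
have n0 : (0 < n)%N by rewrite -(ltr_nat R); apply: lt_trans hn; rewrite divr_gt0.
exists n => K q nK bq; rewrite leqNgt; apply/negP => lq.
have [p [_ hp]] := best_denom_near bq; have [/andP[q_gt0 qK] _] := bq.
have h1 : d <= sn (q%:R * alpha) by apply: hd; lia.
have h2 : sn (q%:R * alpha) <= 4 * `|q%:R * alpha - p%:~R|.
  by rewrite -(snDz _ (- p)) rmorphN; exact: sn_le.
have K0' : 0 < K%:R :> R by rewrite ltr0n; lia.
have h3 : 4 * K%:R^-1 < d.
  rewrite ltr_pdivrMr // mulrC -ltr_pdivrMr //; apply: lt_le_trans hn _; by rewrite ler_nat.
lra.
Qed.

Lemma exprn_le_expR (x : R) (d : nat) : 0 <= x -> x ^+ d.+1 <= d.+1%:R ^+ d.+1 * expR x.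
Proof.
move=> x0; have d0 : d.+1%:R != 0 :> R by rewrite pnatr_eq0.
have -> : x = d.+1%:R * (x / d.+1%:R) by rewrite mulrC divfK.
set y := x / _; have y0 : 0 <= y by rewrite divr_ge0.
rewrite exprMn expRM_natl; apply: ler_wpM2l; first exact: exprn_ge0.
apply: lerXn2r; rewrite ?nnegrE ?expR_ge0 //.
by apply: le_trans (expR_ge1Dx y); rewrite lerDr.
Qed.

Lemma exp_dominates_poly (c C : R) (d : nat) : 0 < c ->
  exists n0 : nat, forall n, (n0 <= n)%N -> C * n%:R ^+ d <= expR (c * n%:R).
Proof.
move=> c0; set D : R := d.+1%:R ^+ d.+1.
have D0 : 0 < D by rewrite exprn_gt0 // ltr0n.
have [n0 hn0] := archi_nat (`|C| * D / c ^+ d.+1).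
exists n0.+1 => n nn.
have n1 : 0 < n%:R :> R by rewrite ltr0n; lia.
have cd : 0 < c ^+ d.+1 by exact: exprn_gt0.
have h : C * D <= n%:R * c ^+ d.+1.
  rewrite -ler_pdivrMr //; apply: le_trans (_ : n0%:R <= _); last by rewrite ler_nat; lia.
  apply: le_trans (ltW hn0); rewrite ler_pM2r ?invr_gt0 // ler_pM2r //; exact: ler_norm.
have hh : (c * n%:R) ^+ d.+1 <= D * expR (c * n%:R).
  by apply: exprn_le_expR; rewrite mulr_ge0 // ltW.
rewrite -(ler_pM2l D0); apply: le_trans hh; rewrite exprMn (exprS n%:R).
have -> : D * (C * n%:R ^+ d) = C * D * n%:R ^+ d by ring.
have -> : c ^+ d.+1 * (n%:R * n%:R ^+ d) = n%:R * c ^+ d.+1 * n%:R ^+ d by ring.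
by apply: ler_wpM2r => //; apply: exprn_ge0; exact: ltW.
Qed.

(** The form in which [beta] is used: it holds for every [bt] above the limit superior. *)
Definition beta_bound (bt : R) := exists T0 : nat, forall t, (T0 <= t)%N ->
  expR (- (bt * t%:R)) <= sn (t%:R * alpha).

Definition good_scale (c : R) (K q M : nat) :=
  [/\ best_denom alpha K q, (M * q <= K)%N, (K <= 2 * (M * q))%N, (4 <= M * q)%N &
    forall k, (2 * (M * q) - 2 <= k <= 2 * (M * q))%N ->
     (5 * (M * q))%:R * (node_const alpha q ^+ (5 * M) * expR (- (c * k%:R / 8)) ^- 4)
        * expR (- (c * k%:R)) < 1].

Lemma node_const_expr : exists2 D : R, 0 <= D & forall q, (0 < q)%N ->
  node_const alpha q = D * q%:R ^+ 7 / sn (q%:R * alpha).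
Proof.
exists (2 * 4 ^+ 4) => [|q q0]; first by rewrite mulr_ge0 // exprn_ge0.
have r0 := ref_prod_gt0 R q; have e0 := sn_gt0 irr q0.
have q1 : 0 < q%:R :> R by rewrite ltr0n.
have n1 : ref_prod R q != 0 by rewrite gt_eqF.
have n2 : sn (q%:R * alpha) != 0 by rewrite gt_eqF.
have n3 : q%:R != 0 :> R by rewrite gt_eqF.
by rewrite /node_const /ublock /lblock /sep_const; field; rewrite n1 n2 n3.
Qed.

(** [q] is the best denominator up to [K], and [M] the number of its periods that fit. The budget
    for [node_const] is exp(c q / 60): half of it pays for q^7 and half for the chord of q alpha,
    whence [120 * bt <= c]. *)
Lemma good_scale_exists (c bt : R) : 0 < c -> 0 <= bt -> 120 * bt <= c -> beta_bound bt ->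
  exists K0, forall K, (K0 <= K)%N -> exists q M, good_scale c K q M.
Proof.
move=> c0 bt0 cbt [T0 hT].
have [c512 c512_ge0 c512E] := node_const_expr.
have c24 : 0 < c / 120 by rewrite divr_gt0.
have [n1 hn1] := exp_dominates_poly c512 7 c24.
have c4 : 0 < c / 4 by rewrite divr_gt0.
have [n2 hn2] := exp_dominates_poly (6 * expR c) 1 c4.
have [K1 hK1] := best_denom_large (maxn T0 n1).
exists (maxn K1 (maxn (2 * n2) 8)) => K hK.
have K_gt0 : (0 < K)%N by lia.
have [q bq] := @best_denom_exists R alpha K K_gt0.
exists q, (K %/ q)%N; have [/andP[q0 qK] _] := bq.
have qb : (maxn T0 n1 <= q)%N by apply: hK1 bq; lia.
set M := (K %/ q)%N; have w1 : (M * q <= K)%N by exact: leq_divM.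
  have w2 : (K <= 2 * (M * q))%N.
    have := divn_eq K q; rewrite -/M; have := ltn_mod K q; rewrite q0.
    have : (0 < M)%N by rewrite divn_gt0.
    nia.
  have w4 : (4 <= M * q)%N by lia.
  split=> // k /andP[k1 k2].
  set w := (M * q)%N in w1 w2 w4 k1 k2 *.
  have snq : expR (- (bt * q%:R)) <= sn (q%:R * alpha) by apply: hT; lia.
  have q1 : 0 < q%:R :> R by rewrite ltr0n.
  have nc0 : 0 <= node_const alpha q.
    by rewrite /node_const divr_ge0 ?ublock_ge0 // mulr_ge0 ?(ltW (lblock_gt0 _ _)) // divr_ge0 ?sn_ge0.
  have ncE : node_const alpha q <= expR (c / 12 / 5 * q%:R).
    have r0 := ref_prod_gt0 R q.
    have e0 : 0 < sn (q%:R * alpha) by apply: sn_gt0.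
    have -> : node_const alpha q = c512 * q%:R ^+ 7 / sn (q%:R * alpha).
      exact: c512E.
    have -> : c / 12 / 5 * q%:R = c / 120 * q%:R + c / 120 * q%:R by field.
    rewrite expRD; apply: ler_pM.
    + by rewrite mulr_ge0 // exprn_ge0 // ltW.
    + by rewrite invr_ge0 ltW.
    + by apply: hn1; exact: leq_trans (leq_maxr _ _) qb.
    + rewrite -[leRHS]invrK lef_pV2 ?posrE ?invr_gt0 ?expR_gt0 // -expRN.
      apply: le_trans snq; rewrite ler_expR lerN2.
      by apply: ler_wpM2r; [exact: ltW|lra].
  have w0 : 0 < w%:R :> R by rewrite ltr0n; exact: leq_trans w4.
  have E1 : node_const alpha q ^+ (5 * M) <= expR (c / 12 * w%:R).
    have -> : c / 12 * w%:R = (5 * M)%:R * (c / 12 / 5 * q%:R) :> R by rewrite /w !natrM; field.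
    by rewrite expRM_natl; apply: lerXn2r; rewrite ?nnegrE ?expR_ge0.
  have E2 : expR (- (c * k%:R / 8)) ^- 4 = expR (c * k%:R / 2).
    by rewrite -expRM_natl -expRN; congr expR; field.
  have E3 : (5 * w)%:R < expR (c / 4 * w%:R - c).
    rewrite expRD mulrC expRN -ltr_pdivrMl ?invr_gt0 ?expR_gt0 // invrK.
    have wn : (n2 <= w)%N by clear -hK w2; lia.
    apply: lt_le_trans (hn2 w wn); rewrite expr1 natrM.
    have e0 := expR_gt0 c; nra.
  rewrite {}E2.
  apply: lt_le_trans (_ : expR (c / 4 * w%:R - c) * (expR (c / 12 * w%:R) * expR (c * k%:R / 2) * expR (- (c * k%:R))) <= _).
    rewrite -[ltLHS]mulrA; apply: le_lt_trans (_ : (5 * w)%:R * (expR (c / 12 * w%:R) * expR (c * k%:R / 2) * expR (- (c * k%:R))) < _).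
      apply: ler_wpM2l => //; rewrite ler_pM2r ?expR_gt0 // ler_pM2r ?expR_gt0 //.
    by rewrite ltr_pM2r // !mulr_gt0 ?expR_gt0.
  (* As k >= 2 w - 2, the remaining decay c k / 2 exceeds c w / 4 + c w / 12; the term - c absorbs
     the 2. *)
  rewrite -!expRD -[leRHS]expR0 ler_expR.
  have k1' : 2 * w%:R - 2 <= k%:R :> R by rewrite lerBlDr -natrM -natrD ler_nat; clear -k1; lia.
  nra.
Qed.

Lemma arc_count (N : nat) (y eta : R) : (0 < N)%N -> 0 < eta ->
  (#|[pred i : 'I_N | sn (i%:R / N%:R - y) < eta]|)%:R <= 2 * eta * N%:R + 2.
Proof.
move=> N0 e0; have N0' : 0 < N%:R :> R by rewrite ltr0n.
have pos : 0 <= 2 * eta * N%:R by rewrite !mulr_ge0 // ltW.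
set A := [pred i : 'I_N | _].
have near (i : 'I_N) : {n : int | `|i%:R / N%:R - y - n%:~R| <= 1 / 2}.
  exact: cid (nearest_int _).
pose L : int := Num.floor (N%:R * y - N%:R * eta).
pose v (i : 'I_N) : int := i%:Z - N%:Z * sval (near i) - L.
pose m := (Num.truncn (2 * eta * N%:R)).+2.
have vb (i : 'I_N) : i \in A -> (0 <= v i) /\ (`|v i| < m)%N.
  rewrite inE => hi; have hn := svalP (near i); have := sn_near hn; set n := sval (near i) in hn *.
  move=> hs; have ha : `|i%:R / N%:R - y - n%:~R| < eta by exact: le_lt_trans hi.
  have hb : `|i%:R - N%:R * y - N%:R * n%:~R| < N%:R * eta.
    have -> : i%:R - N%:R * y - N%:R * n%:~R = N%:R * (i%:R / N%:R - y - n%:~R) by field; rewrite gt_eqF.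
    by rewrite normrM gtr0_norm // ltr_pM2l.
  move: hb; rewrite ltr_norml => /andP[b1 b2].
  have /andP[f1 f2] := floor_itv (N%:R * y - N%:R * eta).
  have vE : (v i)%:~R = i%:R - N%:R * n%:~R - L%:~R :> R by rewrite /v !rmorphB rmorphM.
  have v1 : (-1)%:~R < (v i)%:~R :> R by rewrite vE; move: f1; rewrite -/L; lra.
  have v2 : (v i)%:~R < 2 * eta * N%:R + 1 :> R.
    by rewrite vE; move: f2; rewrite -/L rmorphD /=; lra.
  have v0 : 0 <= v i by move: v1; rewrite ltr_int; clear; lia.
  split=> //; rewrite /m -(ltr_nat R) -[`|v i|%:R]/(`|v i|%:Z%:~R) gez0_abs //.
  apply: lt_le_trans v2 _.
  have -> : (Num.truncn (2 * eta * N%:R)).+2%:R = (Num.truncn (2 * eta * N%:R)).+1%:R + 1 :> R by rewrite natr1.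
  rewrite lerD2r.
  by apply: ltW; have /andP[_] := truncn_itv pos.
have m0 : (0 < m)%N by [].
pose f (i : 'I_N) : 'I_m := insubd (Ordinal m0) `|v i|%N.
have finj : {in A &, injective f}.
  move=> i j iA jA /(congr1 val); rewrite !val_insubd.
  have [vi0 vim] := vb i iA; have [vj0 vjm] := vb j jA; rewrite vim vjm => e.
  have e' : v i = v j by rewrite -(gez0_abs vi0) -(gez0_abs vj0) e.
  apply/val_inj => /=; move: e'; rewrite /v.
  have := ltn_ord i; have := ltn_ord j.
  move: (sval (near i)) (sval (near j)) => a b hj hi ab.
  have {}ab : i%:Z - j%:Z = N%:Z * (a - b) by rewrite mulrBr; move: ab; clear; lia.
  by have [l|l|l] := ltgtP a b; move: l ab hi hj; clear; nia.
have : (#|A| <= m)%N.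
  by rewrite -(card_in_imset finj) -[m in leqRHS]card_ord; exact: max_card.
rewrite -(ler_nat R) /m => h; apply: le_trans h _.
rewrite -addn2 natrD lerD2r.
by have /andP[] := truncn_itv pos.
Qed.

End Scale.

Section Singular.
Variables (R : realType) (a b1 b2 E alpha : R).
Hypothesis irr : not_rational alpha.
Local Notation C := (R[i]).
Local Notation dt := (dt a b1 b2 E alpha).
Variables (c Lam : R) (K q M k : nat).
Hypothesis c0 : 0 < c.
Hypothesis Lam0 : 0 < Lam.
Hypothesis gs : good_scale alpha c K q M.
Hypothesis kw : (2 * (M * q) - 2 <= k <= 2 * (M * q))%N.
Hypothesis big : exists x, Lam <= nrm (dt k x).

(** A phase that is not singular has in its window the start of a box with a large determinant, to
    which Cramer's rule applies. *)
Definition sing (x : R) := forall j, (j < M * q)%N ->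
  nrm (dt k (x + j%:R * alpha)) < expR (- (c * k%:R)) * Lam.

(** With the exponent 1/8, the four factors 1 / eta of [node_ratio] cost half of the smallness exp(-
    c k). *)
Definition eta_k : R := expR (- (c * k%:R / 8)).

Definition resonant (x y : R) := exists j j', [/\ (j < M * q)%N, (j' < M * q)%N &
  sn (x + j%:R * alpha - (y + j'%:R * alpha)) < eta_k].

Lemma resonant_sym x y : resonant x y -> resonant y x.
Proof. by move=> [j [j' [h1 h2 h]]]; exists j', j; rewrite snBC. Qed.

(** The determinant of length [k] has degree 2k <= 4 M q in e(x), and five windows contain more
    nodes than that. If no two of them resonated, interpolation would make the determinant small
    everywhere, against [big]. *)
Lemma five_singular (ph : 'I_5 -> R) : (forall i, sing (ph i)) ->
  exists i i', i != i' /\ resonant (ph i) (ph i').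
Proof.
move=> hs; apply: contrapT => H.
have [bq wK Kw w4 hsc] := gs; have hk := hsc k kw.
have kw' := kw; pose w := (M * q)%N; rewrite -/w in kw' wK w4 hk.
have e0 : 0 < eta_k := expR_gt0 _.
have e1 : eta_k <= 1.
  by rewrite /eta_k -[leRHS]expR0 ler_expR oppr_le0 !mulr_ge0 // ltW.
have nres i i' (j j' : nat) : i != i' -> (j < w)%N -> (j' < w)%N ->
    eta_k <= sn (ph i + j%:R * alpha - (ph i' + j'%:R * alpha)).
  move=> ii hj hj'; rewrite leNgt; apply/negP => h; apply: H; exists i, i'; split=> //.
  by exists j, j'.
pose X (m : 'I_5 * 'I_w) := ph m.1 + m.2%:R * alpha.
have Xsep m m' : m != m' -> 0 < sn (X m - X m').
  case: m m' => [i j] [i' j'] ne; have [e|ii] := eqVneq i i'; last first.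
    by apply: lt_le_trans (nres i i' j j' ii (ltn_ord j) (ltn_ord j')).
  move: ne; rewrite {}e xpair_eqE eqxx /= => jj; rewrite /X /=.
  have -> : ph i' + j%:R * alpha - (ph i' + j'%:R * alpha) = (j%:R - j'%:R) * alpha by ring.
  apply: lt_le_trans (sn_diff bq jj _ _).
  - by apply: sn_gt0 => //; have [/andP[]] := bq.
  - by apply: leq_trans (ltnW (ltn_ord j)) _; exact: leq_trans wK (leq_addl _ _).
  - by apply: leq_trans (ltnW (ltn_ord j')) _; exact: leq_trans wK (leq_addl _ _).
have [x hx] := big.
have szp : (size (dpoly a b1 b2 E alpha k).1 <= #|{: 'I_5 * 'I_w}|)%N.
  have [h _] := size_dpoly a b1 b2 E alpha k.
  by apply: leq_trans h _; rewrite card_prod !card_ord; lia.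
have := lagrange_bound x szp Xsep; rewrite nrm_dpoly => hl.
have : Lam < Lam; last by rewrite ltxx.
apply: le_lt_trans hx _; apply: le_lt_trans hl _.
set r := node_const alpha q ^+ (5 * M) * eta_k ^- 4.
have r0 : 0 <= r.
  apply: mulr_ge0; last by rewrite invr_ge0 exprn_ge0 // ltW.
  by rewrite exprn_ge0 // /node_const divr_ge0 ?ublock_ge0 // mulr_ge0 ?divr_ge0 ?sn_ge0 // ltW // lblock_gt0 //; have [/andP[]] := bq.
apply: le_lt_trans (_ : \sum_(m : 'I_5 * 'I_w) (expR (- (c * k%:R)) * Lam) * r < _).
  apply: ler_sum => m _; rewrite nrm_dpoly; apply: ler_pM.
  - exact: nrm_ge0.
  - by apply: prodr_ge0 => j _; rewrite divr_ge0 ?sn_ge0.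
  - by apply: ltW; apply: hs; exact: ltn_ord.
  - by case: m => i0 j0; exact: (@node_ratio R alpha irr K q M x ph eta_k i0 j0 bq wK e0 e1 nres).
rewrite sumr_const card_prod !card_ord -[ltLHS]mulr_natl.
have -> : (5 * w)%:R * (expR (- (c * k%:R)) * Lam * r) = ((5 * w)%:R * r * expR (- (c * k%:R))) * Lam by ring.
by rewrite gtr_pMl.
Qed.

(** A maximal set of pairwise non-resonant singular phases has at most four elements, by
    [five_singular]. *)
Lemma sing_cover : exists s : seq R, (size s <= 4)%N /\ forall x, sing x -> exists2 y, y \in s & resonant x y.
Proof.
pose P (n : nat) := `[< exists s : seq R, [/\ size s = n, (forall i, (i < n)%N -> sing (nth 0 s i)) &
   forall i i', (i < n)%N -> (i' < n)%N -> i != i' -> ~ resonant (nth 0 s i) (nth 0 s i')] >].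
have P0 : P 0%N by apply/asboolP; exists [::]; split.
have P4 n : P n -> (n <= 4)%N.
  move=> /asboolP[s [sz hs hr]]; rewrite leqNgt; apply/negP => n5.
  have [|i [i' [ii h]]] := @five_singular (fun i => nth 0 s i).
    by move=> i; apply: hs; have := ltn_ord i; lia.
  by apply: (hr i i') h => //; [have := ltn_ord i; lia|have := ltn_ord i'; lia].
have exP : exists i, P i by exists 0%N.
case: (ex_maxnP exP P4) => n /asboolP[s [sz hs hr]] nmax.
exists s; split; first by rewrite sz P4 //; apply/asboolP; exists s.
move=> x hx; apply: contrapT => H.
have : P n.+1; last by move=> /nmax; rewrite ltnn.
have nr i : (i < n)%N -> ~ resonant x (nth 0 s i).
  by move=> hi h; apply: H; exists (nth 0 s i) => //; rewrite mem_nth // sz.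
apply/asboolP; exists (x :: s); split; first by rewrite /= sz.
- by case=> [|i] //= hi; exact: hs.
- case=> [|i] [|i'] //=.
  + by move=> _ hi' _; exact: nr.
  + by move=> hi _ _ /resonant_sym; exact: nr.
  + by move=> hi hi' ne; apply: hr => //; move: ne; rewrite eqSS.
Qed.

Lemma sing_count (N : nat) (x0 : R) : (0 < N)%N ->
  (#|[pred i : 'I_N | `[< sing (i%:R / N%:R + x0) >]]|)%:R <=
   4 * (M * q)%:R ^+ 2 * (2 * eta_k * N%:R + 2).
Proof.
move=> N0; have [s [sz hs]] := sing_cover; set w := (M * q)%N.
set A := [pred i : 'I_N | _].
pose B (m : 'I_(size s) * ('I_w * 'I_w)) := [pred i : 'I_N |
  sn (i%:R / N%:R - (nth 0 s m.1 - x0 + (m.2.2%:R - m.2.1%:R) * alpha)) < eta_k].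
have cE (P : pred 'I_N) : #|P| = (\sum_(i < N) P i)%N.
  by rewrite -sum1_card big_mkcond; apply: eq_bigr => i _; rewrite unfold_in; case: (P i).
have h : (#|A|)%:R <= \sum_m (#|B m|)%:R :> R.
  rewrite -natr_sum ler_nat; under eq_bigr do rewrite cE.
  rewrite exchange_big cE /=; apply: leq_sum => i _.
  case: asboolP => [/hs[y /(nthP 0)[l ls ly] [j [j' [hj hj' hsn]]]]|//].
  rewrite (bigD1 (Ordinal ls, (Ordinal hj, Ordinal hj'))) //=.
  suff -> : sn (i%:R / N%:R - (nth 0 s l - x0 + (j'%:R - j%:R) * alpha)) < eta_k by [].
  by rewrite ly; move: hsn; congr (sn _ < _); ring.
apply: le_trans h _.
apply: le_trans (_ : \sum_(m : 'I_(size s) * ('I_w * 'I_w)) (2 * eta_k * N%:R + 2) <= _).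
  by apply: ler_sum => m _; exact: (arc_count _ N0 (expR_gt0 _)).
rewrite sumr_const !card_prod !card_ord -[leLHS]mulr_natl; apply: ler_wpM2r.
  by rewrite addr_ge0 // !mulr_ge0 // expR_ge0.
by rewrite -natrX -natrM ler_nat; nia.
Qed.

(** The shift keeps the given phase at distance about k / 4 at least from both ends of every box
    that starts in the window. *)
Definition box_base (x : R) := x - ((M * q)./2 + (M * q)).-1%:R * alpha.

Lemma regular_bound (x : R) (f : int -> C) (mu B eps : R) :
  `|a| <= 1 -> 1 <= B -> 0 <= mu -> 0 <= eps ->
  (forall j y, (j <= k)%N -> nrm (dt j y) <= B * expR (j%:R * mu)) ->
  ~ sing (box_base x) ->
  (forall n : int, (`|n| <= k)%N ->
     nrm (a%:C%C * (f (n + 1) + f (n - 1)) + Vx b1 b2 E (x + n%:~R * alpha) * f n) <= eps) ->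
  exists s n : nat, [/\ k = (s.+1 + n)%N, ((M * q)./2 <= s)%N, ((M * q)./2 <= n.+2)%N &
    nrm (f 0) <= expR (c * k%:R) / Lam *
     (B * `|a| ^+ s.+1 * expR (n%:R * mu) * nrm (f (- s.+1%:Z))
      + B * `|a| ^+ n.+1 * expR (s%:R * mu) * nrm (f n.+1%:Z)
      + k%:R * (B ^+ 2 * expR (k%:R * mu) * eps))].
Proof.
move=> a1 B1 mu0 eps0 hdt /existsNP[j /not_implyP[hj /negP]].
have kw' := kw; have [_ _ _ w4 _] := gs.
pose w := (M * q)%N; rewrite -/w in kw' w4 hj *; rewrite -leNgt => hbig hres.
pose s := ((w./2 + w).-1 - j)%N; pose n := (k - s.+1)%N.
have kE : k = (s.+1 + n)%N by rewrite /n /s; clear -kw' w4 hj; lia.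
exists s, n; split=> //.
- by rewrite /s; clear -hj; lia.
- by rewrite /n /s; clear -kw' w4 hj; lia.
pose y := x - s%:R * alpha.
have yE : box_base x + j%:R * alpha = y.
  rewrite /box_base /y -/w /s natrB; first by ring.
  by clear -hj; lia.
rewrite {}yE in hbig.
pose g (i : nat) := f (i%:Z - s.+1%:Z).
have hr i : (i < k)%N -> nrm (resid a b1 b2 E alpha y g i) <= eps.
  move=> ik; have /hres : (`|i%:Z - s%:Z| <= k)%N by rewrite kE in ik *; clear -ik; lia.
  congr (nrm _ <= _); rewrite /resid /g.
  congr (_ * (f _ + f _) + Vx b1 b2 E _ * f _); try by clear; lia.
  by rewrite /y rmorphB /=; ring.
have := box_bound a1 B1 mu0 eps0 hdt hr kE.
have -> : g s.+1 = f 0 by rewrite /g subrr.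
have -> : g 0%N = f (- s.+1%:Z) by rewrite /g sub0r.
have -> : g k.+1 = f n.+1%:Z by rewrite /g kE; congr f; clear; lia.
move=> hb.
have P0 : expR (- (c * k%:R)) * Lam > 0 by rewrite mulr_gt0 ?expR_gt0.
have hinv : expR (c * k%:R) / Lam = (expR (- (c * k%:R)) * Lam)^-1.
  by rewrite invfM expRN invrK.
rewrite hinv ler_pdivlMl //.
apply: le_trans (ler_wpM2r (nrm_ge0 _) hbig) _; apply: le_trans hb _.
rewrite lerD2r; apply: lerD; apply: ler_wpM2r; rewrite ?nrm_ge0 //.
  rewrite [B * _]mulrC -mulrA; apply: ler_wpM2l; first exact: exprn_ge0.
  by apply: hdt; rewrite kE; clear; lia.
rewrite [B * _]mulrC -mulrA; apply: ler_wpM2l; first exact: exprn_ge0.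
by apply: hdt; rewrite kE; clear; lia.
Qed.

End Singular.

(** * Decay of averaged Green functions when the dual growth is small *)

Section SmallGrowth.
Variables (R : realType) (alpha : R).
Hypothesis irr : not_rational alpha.
Local Notation C := (R[i]).

Lemma mean_split (N : nat) (P : pred 'I_N) (f : 'I_N -> R) (M0 r : R) :
  (0 < N)%N -> 0 <= M0 -> 0 <= r -> (forall i, f i <= M0) -> (forall i, ~~ P i -> f i <= r) ->
  N%:R^-1 * (\sum_(i < N) f i) <= r + M0 * ((#|P|)%:R / N%:R).
Proof.
move=> N0 M00 r0 h1 h2; have N0' : 0 < N%:R :> R by rewrite ltr0n.
rewrite mulrC ler_pdivrMr // mulrDl -mulrA divfK ?gt_eqF //.
rewrite (bigID P) /= addrC; apply: lerD.
  apply: le_trans (_ : \sum_(i < N) r <= _).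
    rewrite [leRHS](bigID P) /= -[leLHS]add0r; apply: lerD; first exact: sumr_ge0.
    by apply: ler_sum => i /h2.
  by rewrite sumr_const card_ord -[leLHS]mulr_natr.
apply: le_trans (_ : \sum_(i < N | P i) M0 <= _); first exact: ler_sum.
rewrite sumr_const -[leLHS]mulr_natr.
by have -> : #|[pred i | P i]| = #|P| by apply: eq_card.
Qed.

(** For a non-singular phase, a box around [l] that avoids the source at 0 gains |lam| per site
    between [l] and its boundary and loses only exp(h / 6) per site on the other side. Singular
    phases admit only the bound [M0], but they are exponentially few: the decay is that of an
    average over the phase. *)
Lemma small_growth_decay (h bt B : R) : 0 < h -> 0 <= bt -> 120 * bt <= h / 32 -> beta_bound alpha bt ->
  1 <= B ->
  exists D l0, 0 <= D /\ forall (lam E : R), `|lam| = expR (- h) ->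
   (forall j y, nrm (dt lam 1 1 E alpha j y) <= B * expR (j%:R * (h / 6))) ->
   forall l : int, (l0 <= `|l|)%N -> exists Cl N1, 0 <= Cl /\
   forall (F : R -> int -> C) (M0 eps : R), 0 <= M0 -> 0 <= eps ->
   (forall t n, nrm (F t n) <= M0) ->
   (forall t (n : int), n != 0 -> nrm (lam%:C%C * (F t (n + 1) + F t (n - 1))
        + Vx 1 1 E (t + n%:~R * alpha) * F t n) <= eps) ->
   forall N, (N1 <= N)%N -> N%:R^-1 * (\sum_(i < N) nrm (F (i%:R / N%:R) l)) <=
     M0 * D * expR (- (h / 1024 * (`|l|)%:R)) + Cl * eps.
Proof.
move=> h0 bt0 cbt hb B1.
have c0 : 0 < h / 32 by rewrite divr_gt0.

have [K0 hK0] := good_scale_exists irr c0 bt0 cbt hb.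
have c1 : 0 < h / 512 := divr_gt0 h0 (ltr0Sn R 511).
have [n0 hn0] := exp_dominates_poly (16 : R) 2 c1.
pose D := (2 * B * expR (2 * h) + 1) * expR h.
have B0 : 0 <= B := le_trans ler01 B1.
have D0 : 0 <= D by rewrite /D mulr_ge0 ?expR_ge0 // addr_ge0 // !mulr_ge0 ?expR_ge0.
exists D, (2 * maxn K0 (n0 + 4) + 2)%N; split=> // lam E lamE hdt l hl.
(* Boxes have length [k <= 2 * K < |l|], so they avoid the site 0, and [k >= K]: the rate h / 512
   per unit of [k] becomes h / 1024 per unit of |l|. *)
pose K := (`|l|.-1)./2.
have KK0 : (maxn K0 (n0 + 4) <= K)%N by rewrite /K; clear -hl; lia.
have Kl : (2 * K < `|l|)%N by rewrite /K; clear -hl; lia.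
have lK : (`|l| <= 2 * K + 2)%N by rewrite /K; clear -hl; lia.
have [q [M gs]] := hK0 K (leq_trans (leq_maxl _ _) KK0).
have [_ wK Kw w4 _] := gs; set w := (M * q)%N in wK Kw w4.
pose k := (2 * w)%N.
have kw : (2 * w - 2 <= k <= 2 * w)%N by rewrite /k; clear; lia.
have kl : (k < `|l|)%N by rewrite /k; clear -wK Kl; lia.
have kK : (K <= k)%N by rewrite /k.
(* With [b1 = 1] the top coefficient has modulus 1, so the determinant reaches modulus 1 at every
   length and energy. *)
have big : exists x, 1 <= nrm (dt lam 1 1 E alpha k x).
  by have [x hx] := herman lam 1 1 E alpha k; exists x; rewrite normr1 expr1n in hx.
pose eta := eta_k (h / 32) k.
have eta0 : 0 < eta by exact: expR_gt0.
have [N1 hN1] := archi_nat (eta^-1).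
pose Cl := expR (h / 32 * k%:R) / 1 * (k%:R * (B ^+ 2 * expR (k%:R * (h / 6)))).
have Cl0 : 0 <= Cl by rewrite /Cl !mulr_ge0 ?expR_ge0 ?exprn_ge0.
exists Cl, N1.+1; split=> // F M0 eps M00 eps0 hM hF N hN.
have N0 : (0 < N)%N by exact: leq_trans hN.
have a1 : `|lam| <= 1 by rewrite lamE -[leRHS]expR0 ler_expR oppr_le0 ltW.
have mu0 : 0 <= h / 6 by rewrite divr_ge0 // ltW.
pose r := M0 * (2 * B * expR (2 * h) * expR (- (h / 512 * k%:R))) + Cl * eps.
have r0 : 0 <= r by rewrite /r addr_ge0 ?mulr_ge0 ?expR_ge0.
pose x0 := l%:~R * alpha - ((M * q)./2 + (M * q)).-1%:R * alpha.
pose P := [pred i : 'I_N | `[< sing lam 1 1 E alpha (h / 32) 1 q M k (i%:R / N%:R + x0) >]].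
have hreg (i : 'I_N) : ~~ P i -> nrm (F (i%:R / N%:R) l) <= r.
  move=> /asboolP hP; set t := i%:R / N%:R in hP *.
  have hP' : ~ sing lam 1 1 E alpha (h / 32) 1 q M k (box_base alpha q M (t + l%:~R * alpha)).
    by rewrite /box_base -addrA.
  have hres (n : int) : (`|n| <= k)%N ->
     nrm (lam%:C%C * (F t (l + (n + 1)) + F t (l + (n - 1))) + Vx 1 1 E (t + l%:~R * alpha + n%:~R * alpha) * F t (l + n)) <= eps.
    move=> nk; have ln : l + n != 0.
      by move: nk kl; clear; lia.
    have := hF t (l + n) ln; congr (nrm (_ * (F t _ + F t _) + Vx 1 1 E _ * _) <= _).
    - by rewrite addrA.
    - by rewrite addrA.
    - by rewrite rmorphD /=; ring.
  have [s [n [kE s2 n2]]] := @regular_bound R lam 1 1 E alpha (h / 32) 1 K q M k ltr01 gs kw _ (fun j => F t (l + j)) (h / 6) B eps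
      a1 B1 mu0 eps0 (fun j y _ => hdt j y) hP' hres.
  rewrite addr0 => hb'; apply: le_trans hb' _.
  have G (d e : nat) : (k = d.+1 + e)%N -> (w./2 <= d.+2)%N ->
     expR (h / 32 * k%:R) / 1 * (B * `|lam| ^+ d.+1 * expR (e%:R * (h / 6)) * M0) <=
     M0 * (B * expR (2 * h) * expR (- (h / 512 * k%:R))).
    move=> kde dw; rewrite divr1 lamE -expRM_natl.
    have -> : expR (h / 32 * k%:R) * (B * expR (d.+1%:R * - h) * expR (e%:R * (h / 6)) * M0) =
      M0 * (B * (expR (h / 32 * k%:R) * expR (d.+1%:R * - h) * expR (e%:R * (h / 6)))) by ring.
    rewrite -[B * _ * _]mulrA -!expRD; apply: ler_wpM2l => //; apply: ler_wpM2l => //.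
    rewrite ler_expR.
    have k_le : k%:R <= 4 * d.+1%:R + 6 :> R.
      by rewrite -natrM -natrD ler_nat /k; move: dw; clear; lia.
    have kR : k%:R = d.+1%:R + e%:R :> R by rewrite kde natrD.
    (* The gain 7/6 per unit of [d.+1] outweighs k (1/32 + 1/6 + 1/512) because k <= 4 (d + 1) + 6;
       the 2 on the right pays for the 6. *)
    have e_le : k%:R / 32 + (d.+1%:R * -1 + e%:R / 6) + k%:R / 512 <= 2 :> R.
      by move: k_le kR; move: (k%:R : R) (d.+1%:R : R) (e%:R : R) (ler0n R d.+1); clear; intros; lra.
    have -> : h / 32 * k%:R + d.+1%:R * - h + e%:R * (h / 6) =
      h * (k%:R / 32 + (d.+1%:R * -1 + e%:R / 6) + k%:R / 512) - h / 512 * k%:R by ring.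
    by rewrite lerD2r mulrC; apply: ler_wpM2r => //; exact: ltW.
  have hX : expR (h / 32 * k%:R) / 1 *
     (B * `|lam| ^+ s.+1 * expR (n%:R * (h / 6)) * nrm (F t (l + - s.+1%:Z)) +
      B * `|lam| ^+ n.+1 * expR (s%:R * (h / 6)) * nrm (F t (l + n.+1%:Z)) +
      k%:R * (B ^+ 2 * expR (k%:R * (h / 6)) * eps)) <=
     expR (h / 32 * k%:R) / 1 * (B * `|lam| ^+ s.+1 * expR (n%:R * (h / 6)) * M0)
    + expR (h / 32 * k%:R) / 1 * (B * `|lam| ^+ n.+1 * expR (s%:R * (h / 6)) * M0) + Cl * eps.
    rewrite -mulrDr /Cl.
    have -> : expR (h / 32 * k%:R) / 1 * (k%:R * (B ^+ 2 * expR (k%:R * (h / 6)))) * eps =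
       expR (h / 32 * k%:R) / 1 * (k%:R * (B ^+ 2 * expR (k%:R * (h / 6)) * eps)) by ring.
    rewrite -mulrDr; apply: ler_wpM2l; first by rewrite mulr_ge0 ?expR_ge0.
    rewrite lerD2r; apply: lerD; apply: ler_wpM2l => //.
      by rewrite !mulr_ge0 ?exprn_ge0 ?expR_ge0.
    by rewrite !mulr_ge0 ?exprn_ge0 ?expR_ge0.
  apply: le_trans hX _; rewrite /r lerD2r.
  have g1 := G s n kE (leq_trans s2 (leqW (leqnSn _))).
  have kE' : (k = n.+1 + s)%N by rewrite kE; clear; lia.
  have g2 := G n s kE' n2.
  apply: le_trans (lerD g1 g2) _; rewrite le_eqVlt; apply/orP; left; apply/eqP; ring.
have := mean_split N0 M00 r0 (fun i => hM (i%:R / N%:R) l) hreg.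
move=> hm; apply: le_trans hm _.
have hc := sing_count irr c0 ltr01 gs kw big x0 N0.
have N0' : 0 < N%:R :> R by rewrite ltr0n.
have hfrac : (#|P|)%:R / N%:R <= 16 * k%:R ^+ 2 * eta.
  rewrite ler_pdivrMr //; apply: le_trans hc _; rewrite -/eta -/w.
  have hN' : 1 <= eta * N%:R.
    rewrite -ler_pdivrMl // mulr1; apply: ltW; apply: lt_le_trans hN1 _.
    by rewrite ler_nat; exact: ltnW.
  have wk : w%:R ^+ 2 <= k%:R ^+ 2 :> R.
    by apply: lerXn2r; rewrite ?nnegrE // ler_nat /k; clear; lia.
  apply: le_trans (_ : 4 * k%:R ^+ 2 * (4 * (eta * N%:R)) <= _); last by rewrite le_eqVlt; apply/orP; left; apply/eqP; ring.
  apply: ler_pM => //; rewrite ?mulr_ge0 ?exprn_ge0 //.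
  - by rewrite addr_ge0 // !mulr_ge0 // ltW.
  - by apply: ler_wpM2l.
  - by rewrite -mulrA; move: hN'; clear; lra.
(* Here eta = exp(- h k / 256); half of this decay absorbs 16 k^2. *)
have hpoly : 16 * k%:R ^+ 2 * eta <= expR (- (h / 512 * k%:R)).
  have kn0 : (n0 <= k)%N by apply: leq_trans kK; apply: leq_trans KK0; apply: leq_trans (leq_maxr _ _); exact: leq_addr.
  apply: le_trans (ler_wpM2r (ltW eta0) (hn0 k kn0)) _.
  rewrite /eta /eta_k -expRD ler_expR; clear; lra.
have hk : expR (- (h / 512 * k%:R)) <= expR h * expR (- (h / 1024 * `|l|%:R)).
  rewrite -expRD ler_expR.
  have : `|l|%:R <= 2 * k%:R + 2 :> R.
    by rewrite -natrM -natrD ler_nat; move: lK kK; clear; lia.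
  move: (h0); move: (k%:R : R) (`|l|%:R : R); move: (h); clear => {}h {}k {}l h0 lk.
  have -> : - (h / 512 * k) = h + - (h / 1024 * l) - h * (1 - l / 1024 + k / 512) by field.
  rewrite gerBl; apply: mulr_ge0; [exact: ltW|lra].
rewrite /r.
have f1 := le_trans hfrac hpoly.
apply: le_trans (_ : M0 * ((2 * B * expR (2 * h) + 1) * expR (- (h / 512 * k%:R))) + Cl * eps <= _).
  have f2 := ler_wpM2l M00 f1.
  have -> : M0 * ((2 * B * expR (2 * h) + 1) * expR (- (h / 512 * k%:R))) + Cl * eps =
     M0 * (2 * B * expR (2 * h) * expR (- (h / 512 * k%:R))) + Cl * eps + M0 * expR (- (h / 512 * k%:R)) by ring.
  by rewrite lerD2l.
rewrite lerD2r /D -[leRHS]mulrA; apply: ler_wpM2l => //; rewrite -[leRHS]mulrA; apply: ler_wpM2l => //.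
by rewrite addr_ge0 // !mulr_ge0 ?expR_ge0.
Qed.

End SmallGrowth.

(** * A determinant of exponential growth *)

Section LargeGrowth.
Variables (R : realType) (a b1 b2 E alpha : R).
Hypothesis irr : not_rational alpha.
Local Notation C := (R[i]).
Local Notation dt := (dt a b1 b2 E alpha).
Variables (l B e c : R) (K q M : nat).
Hypotheses (a1 : `|a| <= 1) (l0 : 0 <= l) (B1 : 1 <= B) (e0 : 0 <= e) (c0 : 0 < c).
Hypothesis lower : forall n, (0 < n)%N -> expR (n%:R * l) <= growth a b1 b2 E alpha n.
Hypothesis upper : forall n x, mnorm (cocyc a b1 b2 E alpha n x) <= B * expR (n%:R * (l + e)).
Hypothesis gs : good_scale alpha c K q M.

(** Here [Lam] is exp(l times twice the window) / 8, that is, the exact exponent is compared with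
    itself: each boundary value at distance d carries exp(- d l) |a|^d, and the discrepancies cost
    exp((c + e) k). *)
Lemma regular_decay : exists k Lam, [/\ (2 * (M * q) - 2 <= k <= 2 * (M * q))%N, 0 < Lam,
  (exists x, Lam <= nrm (dt k x)) &
  forall x (f : int -> C) r, 0 <= r -> ~ sing a b1 b2 E alpha c Lam q M k (box_base alpha q M x) ->
   (forall n : int, (`|n| <= k)%N ->
     nrm (a%:C%C * (f (n + 1) + f (n - 1)) + Vx b1 b2 E (x + n%:~R * alpha) * f n) <= r) ->
   exists d1 d2 : nat, [/\ (0 < d1)%N && (0 < d2)%N, (d1 + d2 = k.+1)%N, (k <= 4 * d1 + 6)%N, (k <= 4 * d2 + 6)%N &
    nrm (f 0) <= 8 * B ^+ 2 * expR ((c + e) * k%:R) *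
     (expR (- (d1%:R * l)) * `|a| ^+ d1 * nrm (f (- d1%:Z)) +
      expR (- (d2%:R * l)) * `|a| ^+ d2 * nrm (f d2%:Z) + k%:R * r)]].
Proof.
have [_ _ _ w4 _] := gs; set w := (M * q)%N in w4 *.
have B0 : 0 <= B := le_trans ler01 B1.
have N2 : (2 <= 2 * w)%N by clear -w4; lia.
have t0 : 0 < expR ((2 * w)%:R * l) by exact: expR_gt0.
have [|k [x0 [k1 k2 hbig]]] := @dt_large R a b1 b2 E alpha (2 * w) _ a1 N2 t0 _.
  by apply: lower; exact: ltnW.
have kw : (2 * w - 2 <= k <= 2 * w)%N by rewrite k1 k2.
set Lam := _ / 8 in hbig; have Lam0 : 0 < Lam by rewrite /Lam divr_gt0.
exists k, Lam; split=> //; first by exists x0.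
move=> x f r r0 hns hres.
have le0 : 0 <= l + e by rewrite addr_ge0.
have hdt j y : (j <= k)%N -> nrm (dt j y) <= B * expR (j%:R * (l + e)).
  by move=> _; apply: le_trans (dt_le_mnorm _ _ _ _ _ _ _) (upper _ _).
have [s [n [kE s2 n2 hb]]] := @regular_bound R a b1 b2 E alpha c Lam K q M k Lam0 gs kw x f (l + e) B r a1 B1 le0 r0 hdt hns hres.
exists s.+1, n.+1; split.
- by [].
- by rewrite kE; clear; lia.
- by move: s2 k2; rewrite -/w; clear; lia.
- by move: n2 k2; rewrite -/w; clear; lia.
apply: le_trans hb _.
have kk : k%:R * l <= (2 * w)%:R * l by rewrite ler_wpM2r // ler_nat.
have LamV : Lam^-1 <= 8 * expR (- (k%:R * l)).
  rewrite /Lam invfM invrK mulrC -expRN; apply: ler_wpM2l => //.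
  by rewrite ler_expR lerN2.
have X0 : 0 <= expR (c * k%:R) * (8 * expR (- (k%:R * l))) by rewrite !mulr_ge0 ?expR_ge0.
apply: le_trans (_ : expR (c * k%:R) * (8 * expR (- (k%:R * l))) *
   (B * `|a| ^+ s.+1 * expR (n%:R * (l + e)) * nrm (f (- s.+1%:Z)) +
    B * `|a| ^+ n.+1 * expR (s%:R * (l + e)) * nrm (f n.+1%:Z) +
    k%:R * (B ^+ 2 * expR (k%:R * (l + e)) * r)) <= _).
  apply: ler_wpM2r; last by apply: ler_wpM2l => //; exact: expR_ge0.
  by rewrite !addr_ge0 ?mulr_ge0 ?nrm_ge0 ?expR_ge0 ?exprn_ge0.
have G (d p : nat) z : (k = d.+1 + p)%N -> 0 <= z ->
  expR (c * k%:R) * (8 * expR (- (k%:R * l))) * (B * `|a| ^+ d.+1 * expR (p%:R * (l + e)) * z) <=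
  8 * B ^+ 2 * expR ((c + e) * k%:R) * (expR (- (d.+1%:R * l)) * `|a| ^+ d.+1 * z).
  move=> kd z0.
  have -> : expR (c * k%:R) * (8 * expR (- (k%:R * l))) * (B * `|a| ^+ d.+1 * expR (p%:R * (l + e)) * z) =
    8 * B * (expR (c * k%:R) * expR (- (k%:R * l)) * expR (p%:R * (l + e))) * (`|a| ^+ d.+1 * z) by ring.
  have -> : 8 * B ^+ 2 * expR ((c + e) * k%:R) * (expR (- (d.+1%:R * l)) * `|a| ^+ d.+1 * z) =
    8 * B ^+ 2 * (expR ((c + e) * k%:R) * expR (- (d.+1%:R * l))) * (`|a| ^+ d.+1 * z) by ring.
  apply: ler_wpM2r; first by rewrite mulr_ge0 ?exprn_ge0.
  apply: ler_pM; rewrite ?mulr_ge0 ?expR_ge0 //.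
    by apply: ler_wpM2l => //; rewrite expr2 ler_peMr.
  rewrite -!expRD ler_expR.
  have -> : (c * k%:R + - (k%:R * l) + p%:R * (l + e)) = c * k%:R + - (d.+1%:R * l) + p%:R * e.
    by rewrite kd natrD; ring.
  have -> : (c + e) * k%:R + - (d.+1%:R * l) = c * k%:R + - (d.+1%:R * l) + k%:R * e by ring.
  by rewrite lerD2l ler_wpM2r // ler_nat kd; clear; lia.
have E3 (z0 z1 z2 z3 : R) : z0 * (z1 + z2 + z3) = z0 * z1 + z0 * z2 + z0 * z3 by ring.
rewrite [leLHS]E3 [leRHS]E3; apply: lerD; first apply: lerD.
- exact: (G s n _ kE (nrm_ge0 _)).
- have kE' : (k = n.+1 + s)%N by rewrite kE; clear; lia.
  exact: (G n s _ kE' (nrm_ge0 _)).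
- rewrite le_eqVlt; apply/orP; left; apply/eqP.
  have -> : (c + e) * k%:R = c * k%:R - k%:R * l + k%:R * (l + e) by ring.
  by rewrite [in RHS]expRD [in RHS]expRD; ring.
Qed.

End LargeGrowth.

(** * Sums over symmetric windows, and Aubry duality at a complex phase *)

Section FiniteSums.
Variables (V : nmodType).

Definition zsum (W : nat) (F : int -> V) : V := \sum_(i < (2 * W).+1) F (i%:Z - W%:Z).

Lemma zsum_shift W (F : int -> V) : F (- W%:Z) = 0 -> F (W%:Z + 1) = 0 ->
  zsum W (fun n => F (n + 1)) = zsum W F.
Proof.
move=> h1 h2; rewrite /zsum big_ord_recr [RHS]big_ord_recl /=.
have -> : (2 * W)%N%:Z - W%:Z + 1 = W%:Z + 1 by clear; lia.
rewrite sub0r h1 h2 addr0 add0r; apply: eq_bigr => i _; congr F.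
by rewrite /= /bump leq0n; clear; lia.
Qed.

Lemma zsumD W (F G : int -> V) : zsum W (fun n => F n + G n) = zsum W F + zsum W G.
Proof. exact: big_split. Qed.

Lemma eq_zsum W (F G : int -> V) : (forall n, (`|n| <= W)%N -> F n = G n) -> zsum W F = zsum W G.
Proof.
move=> h; apply: eq_bigr => i _; apply: h; have := ltn_ord i; clear; lia.
Qed.

End FiniteSums.

Lemma nrm_zsum (R : realType) W (F : int -> R[i]) (b : R) :
  (forall n, (`|n| <= W)%N -> nrm (F n) <= b) -> nrm (zsum W F) <= (2 * W).+1%:R * b.
Proof.
move=> h; apply: le_trans (nrm_sum _ _ _) _.
apply: le_trans (_ : \sum_(i < (2 * W).+1) b <= _).
  by apply: ler_sum => i _; apply: h; have := ltn_ord i; clear; lia.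
by rewrite sumr_const card_ord -[leLHS]mulr_natl.
Qed.

Section Fourier.
Variables (R : realType) (lam E alpha theta rho : R) (phi : int -> R[i]) (W : nat).
Hypothesis rho0 : rho != 0.
Local Notation C := (R[i]).
Hypothesis phi0 : forall n, (W <= `|n|)%N -> phi n = 0.

(** The Aubry dual operator minus [E]: the coupling sits on the hopping and the potential is 2
    cos. *)
Definition resid1 (n : int) : C :=
  lam%:C%C * (phi (n + 1) + phi (n - 1)) + Vx 1 1 E (theta + n%:~R * alpha) * phi n.

Definition Fser (f : int -> C) (x : R) : C := zsum W (fun n => f n * (rho ^ n)%:C%C * ex (n%:~R * x)).

(** Multiplication by e(x) shifts the coefficients and a translation by alpha multiplies them by e(n
    alpha), so hopping and potential exchange roles. The weight [rho], an imaginary part of the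
    phase, makes the two coefficients of the potential unequal. *)
Lemma Fser_eq x :
  ex theta * Fser phi (x + alpha) + ex (- theta) * Fser phi (x - alpha) +
   Vx (lam * rho) (lam / rho) E x * Fser phi x = Fser resid1 x.
Proof.
have mulz (z : C) F : z * zsum W F = zsum W (fun n => z * F n) by exact: mulr_sumr.
have s1 : (lam * rho)%:C%C * ex x * Fser phi x =
   zsum W (fun n => lam%:C%C * phi (n - 1) * (rho ^ n)%:C%C * ex (n%:~R * x)).
  rewrite -(@zsum_shift _ W (fun n => lam%:C%C * phi (n - 1) * (rho ^ n)%:C%C * ex (n%:~R * x))).
  - rewrite /Fser mulz; apply: eq_zsum => n _; rewrite addrK expfzDr // expr1z.
    by rewrite rmorphD /= mulrDl mul1r exD !rmorphM /=; ring.
  - by rewrite phi0 ?mulr0 ?mul0r //; clear; lia.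
  - by rewrite addrK phi0 ?mulr0 ?mul0r.
have s2 : (lam / rho)%:C%C * ex (- x) * Fser phi x =
   zsum W (fun n => lam%:C%C * phi (n + 1) * (rho ^ n)%:C%C * ex (n%:~R * x)).
  rewrite /Fser -(@zsum_shift _ W (fun n => phi n * (rho ^ n)%:C%C * ex (n%:~R * x))).
  - rewrite mulz; apply: eq_zsum => n _; rewrite expfzDr // expr1z.
    rewrite rmorphD /= mulrDl mul1r exD !rmorphM /=.
    have e1 : ex (- x) * ex x = 1 by rewrite -exD addNr ex0.
    have e2 : (rho^-1)%:C%C * rho%:C%C = 1 :> C by rewrite -rmorphM /= mulVf.
    have -> : lam%:C%C * (rho^-1)%:C%C * ex (- x) * (phi (n + 1) * ((rho ^ n)%:C%C * rho%:C%C) * (ex (n%:~R * x) * ex x))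
      = lam%:C%C * phi (n + 1) * (rho ^ n)%:C%C * ex (n%:~R * x) * ((rho^-1)%:C%C * rho%:C%C) * (ex (- x) * ex x) by ring.
    by rewrite e1 e2 !mulr1.
  - by rewrite phi0 ?mul0r //; clear; lia.
  - by rewrite phi0 ?mul0r //; clear; lia.
rewrite /Vx mulrBl mulrDl s1 s2 /Fser !mulz.
have zN (F : int -> C) : - zsum W F = zsum W (fun n => - F n) by rewrite /zsum -sumrN.
rewrite zN -!zsumD; apply: eq_zsum => n _.
rewrite /resid1 /Vx !mulrDr !mulrN !exD !exN ?exD.
have t1 : ex (n%:~R * (x + alpha)) = ex (n%:~R * x) * ex (n%:~R * alpha) by rewrite mulrDr exD.
have t2 : ex (n%:~R * (x - alpha)) = ex (n%:~R * x) / ex (n%:~R * alpha) by rewrite mulrBr exD exN.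
have := (ex_neq0 theta, ex_neq0 (n%:~R * alpha)) => -[z1 z2].
rewrite ?t1 ?t2 rmorph1; field; exact/andP.
Qed.

Lemma Fser_mean N : (2 * W < N)%N -> \sum_(i < N) Fser phi (i%:R / N%:R) = N%:R * phi 0.
Proof.
move=> WN; rewrite /Fser /zsum exchange_big /=.
have N0 : (0 < N)%N by exact: leq_trans WN.
have W1 : (W < (2 * W).+1)%N by clear; lia.
rewrite (bigD1 (Ordinal W1)) //= subrr [X in _ + X]big1 ?addr0.
  rewrite (eq_bigr (fun=> phi 0)) => [|i _]; last by rewrite mul0r ex0 expr0z rmorph1 !mulr1.
  by rewrite sumr_const card_ord mulr_natl.
move=> i io; rewrite -mulr_sumr.
have -> : \sum_(j < N) ex ((i%:Z - W%:Z)%:~R * (j%:R / N%:R)) =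
   \sum_(j < N) ex (j%:R * ((i%:Z - W%:Z)%:~R / N%:R)) :> C.
  by apply: eq_bigr => j _; congr ex; ring.
rewrite dft //; last by have := ltn_ord i; move: WN; clear; lia.
case: eqP => [e|]; rewrite ?mulr0 //.
by case/eqP: io; apply/val_inj => /=; move: e; clear; lia.
Qed.

End Fourier.

Lemma nrm_nat (R : realType) (n : nat) : nrm (n%:R : R[i]) = n%:R.
Proof. by rewrite -(rmorph_nat (real_complex R)) nrm_real ger0_norm. Qed.

(** * The dual operator has no fast decaying approximate eigenvectors *)

Section NoLocalized.
Variables (R : realType) (alpha : R).
Hypothesis irr : not_rational alpha.
Local Notation C := (R[i]).

Lemma expR_int_le (p : R) (n : int) : 0 <= p -> `|expR p ^ n| <= expR (`|n|%:R * p).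
Proof.
move=> p0; have e1 m : `|expR p ^+ m| = expR (m%:R * p).
  by rewrite expRM_natl ger0_norm // exprn_ge0 // expR_ge0.
case: n => n /=; first by rewrite -exprnP e1.
rewrite NegzE -exprnN normfV e1 -expRN ler_expR.
by apply: le_trans (_ : 0 <= _); rewrite ?oppr_le0 mulr_ge0.
Qed.

(** The decay rate nu of [phi] exceeds h, so its Fourier series stays under control at the complex
    phase [rho = exp p], with h < p < nu. There the leading coefficient of the potential has modulus
    exp(u / 2) > 1, so the cocycle grows, and regular boxes force the series, an approximate
    solution along every orbit, to be tiny except at few phases. But its mean over the circle is
    [phi 0 = 1]. *)
Lemma no_localized (v u h bt lam E : R) (T A : nat) :
  0 < v -> 0 <= h -> 16 * (16 * v) <= u -> 0 <= bt -> 120 * bt <= 8 * v -> beta_bound alpha bt ->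
  `|lam| = expR (- h) ->
  let p := h + u / 2 in let nu := h + 3 * u / 4 in
  nu + v <= v * T%:R -> 32 * v * T%:R + nu + v <= u / 4 * A%:R ->
  exists a0 : nat, forall a, (a0 <= a)%N -> forall theta (phi : int -> C),
   (forall n, (A * a < `|n|)%N -> phi n = 0) ->
   (forall n, nrm (phi n) <= 3 * expR (- (nu * (`|n|%:R - a%:R)))) ->
   (forall n, nrm (resid1 lam E alpha theta phi n) <= 8 * expR (- (nu * (A%:R * a%:R - a%:R)))) ->
   phi 0 = 1 -> False.
Proof.
move=> v0 h0 uv bt0 cbt hb lamE p nu hT hA.
have u0 : 0 < u by apply: lt_le_trans uv; rewrite !mulr_gt0.
have p0 : 0 < p by rewrite /p ltr_wpDl // divr_gt0.
have pnu : p <= nu by rewrite /p /nu lerD2l; clear -u0; lra.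
have nu0 : 0 < nu := lt_le_trans p0 pnu.
pose rho := expR p; have rho0 : rho != 0 by rewrite gt_eqF // expR_gt0.
pose b1 := lam * rho; pose b2 := lam / rho.
have b1E : `|b1| = expR (u / 2).
  rewrite normrM lamE (ger0_norm (expR_ge0 _)) /rho -expRD /p; congr expR; ring.
have mu0 : 0 <= u / 2 by rewrite divr_ge0 // ltW.
have hgr j : (0 < j)%N -> expR (j%:R * (u / 2)) <= growth 1 b1 b2 E alpha j.
  move=> _; have [x hx] := herman 1 b1 b2 E alpha j.
  rewrite b1E -expRM_natl in hx.
  by apply: le_trans hx _; apply: le_trans (dt_le_mnorm _ _ _ _ _ _ _) (le_growth _ _ _ _ _ _ _).
have [l [ul lower upper']] := growth_exponent mu0 hgr.
have c0 : 0 < 8 * v by rewrite mulr_gt0.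
have [B [B1 upper]] := upper' _ c0.
have l0 : 0 <= l := le_trans mu0 ul.
have [K0 hK0] := good_scale_exists irr c0 bt0 cbt hb.
have B0 : 0 <= B := le_trans ler01 B1.
pose Q := (2 * A + 3)%:R * (48 * B ^+ 2 * expR (u + 2 * v) + 128 * T%:R * B ^+ 2 * expR p + 192 * T%:R ^+ 2 * expR (2 * v)).
have [n1 hn1] := exp_dominates_poly (2 * Q) 3 v0.
exists (maxn K0 n1).+1 => a ha theta phi hsupp hphi hres phi0.
have a1 : (0 < a)%N by clear -ha; lia.
have a1R : 1 <= a%:R :> R by rewrite ler1n.
have T0 : (0 < T)%N.
  rewrite lt0n; apply/eqP => T0; move: hT; rewrite T0 mulr0; clear -nu0 v0; lra.
(* Boxes have length at least about T a, so that exp(- v k) beats the size exp(nu a) of the series;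
   this is the purpose of [nu + v <= v * T]. *)
have [q [M gs]] := hK0 (T * a)%N (leq_trans (leq_trans (leq_maxl _ _) (ltnW ha)) (leq_pmull _ T0)).
have [_ wK Kw w4 _] := gs.
have n11 : `|1 : R| <= 1 by rewrite normr1.
have [k [Lam [kw Lam0 big hreg]]] := regular_decay n11 l0 B1 (ltW c0) lower upper gs.
set w := (M * q)%N in wK Kw w4 kw.
have k1 : (T * a <= k + 2)%N by clear -kw Kw; lia.
have k2 : (k <= 2 * (T * a))%N by clear -kw wK; lia.
pose W := (A * a).+1; pose W1 : R := (2 * W).+1%:R.
have phiW n : (W <= `|n|)%N -> phi n = 0 by exact: hsupp.
pose Phi x := Fser rho W phi x.
pose S := W1 * (3 * expR (nu * a%:R)).
have W10 : 0 <= W1 by [].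
have hS x : nrm (Phi x) <= S.
  apply: nrm_zsum => n _; rewrite !nrmM nrm_ex mulr1 nrm_real.
  apply: le_trans (_ : 3 * expR (- (nu * (`|n|%:R - a%:R))) * expR (`|n|%:R * p) <= _).
    by apply: ler_pM; rewrite ?nrm_ge0 ?normr_ge0 // expR_int_le // ltW.
  rewrite -mulrA -expRD; apply: ler_wpM2l => //; rewrite ler_expR.
  have := ler_wpM2l (ler0n R `|n|) pnu; clear; lra.
have S0 : 0 <= S := le_trans (nrm_ge0 _) (hS 0).
pose R' := W1 * (8 * expR (- (nu * (A%:R * a%:R - a%:R))) * expR (W%:R * p)).
have R'0 : 0 <= R' by rewrite /R' !mulr_ge0 ?expR_ge0.
have hR x : nrm (Fser rho W (resid1 lam E alpha theta phi) x) <= R'.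
  apply: nrm_zsum => n nW; rewrite !nrmM nrm_ex mulr1 nrm_real.
  apply: ler_pM; rewrite ?nrm_ge0 ?normr_ge0 //.
  apply: le_trans (expR_int_le _ (ltW p0)) _; rewrite ler_expR ler_wpM2r ?(ltW p0) //.
  by rewrite ler_nat.
(* Along an orbit, the twisted series solves the almost Mathieu equation at a complex phase up to
   the truncation error. *)
pose F x (j : int) := ex (j%:~R * theta) * Phi (x + j%:~R * alpha).
have hF x j : nrm ((1 : R)%:C%C * (F x (j + 1) + F x (j - 1)) + Vx b1 b2 E (x + j%:~R * alpha) * F x j) <= R'.
  have -> : (1 : R)%:C%C * (F x (j + 1) + F x (j - 1)) + Vx b1 b2 E (x + j%:~R * alpha) * F x j =
     ex (j%:~R * theta) * Fser rho W (resid1 lam E alpha theta phi) (x + j%:~R * alpha).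
    rewrite -(Fser_eq _ _ _ _ rho0 phiW) -/(Phi _) -/(Phi _) -/(Phi _) /F.
    have -> : x + (j + 1)%:~R * alpha = x + j%:~R * alpha + alpha by rewrite rmorphD /=; ring.
    have -> : x + (j - 1)%:~R * alpha = x + j%:~R * alpha - alpha by rewrite rmorphB /=; ring.
    have -> : (j + 1)%:~R * theta = j%:~R * theta + theta by rewrite rmorphD /=; ring.
    have -> : (j - 1)%:~R * theta = j%:~R * theta - theta by rewrite rmorphB /=; ring.
    by rewrite !(exD (j%:~R * theta)) rmorph1 mul1r; ring.
  by rewrite nrmM nrm_ex mul1r.
pose r := 8 * B ^+ 2 * expR ((8 * v + 8 * v) * k%:R) * (2 * (expR (u - u / 8 * k%:R) * S) + k%:R * R').
have r0 : 0 <= r.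
  rewrite /r; apply: mulr_ge0; first by rewrite !mulr_ge0 ?expR_ge0 ?exprn_ge0.
  by apply: addr_ge0; rewrite !mulr_ge0 ?expR_ge0.
pose x0 := - (((M * q)./2 + (M * q)).-1%:R * alpha).
pose N := (2 * W + Num.truncn (eta_k (8 * v) k)^-1).+1.
have N0 : (0 < N)%N by [].
pose P := [pred i : 'I_N | `[< sing 1 b1 b2 E alpha (8 * v) Lam q M k (i%:R / N%:R + x0) >]].
have hreg' (i : 'I_N) : ~~ P i -> nrm (Phi (i%:R / N%:R)) <= r.
  move=> /asboolP hP; have := hreg (i%:R / N%:R) (F (i%:R / N%:R)) R' R'0 hP (fun n _ => hF _ n).
  move=> [d1 [d2 [/andP[d10 d20] dE kd1 kd2 hb']]].
  rewrite {1}/F mul0r ex0 mul1r mul0r addr0 in hb'; apply: le_trans hb' _.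
  apply: ler_wpM2l; first by rewrite !mulr_ge0 ?expR_ge0 ?exprn_ge0.
  rewrite lerD2r mulr2n mulrDl !mul1r.
  have G (d : nat) z : (k <= 4 * d + 6)%N -> nrm z <= S ->
      expR (- (d%:R * l)) * `|1 : R| ^+ d * nrm z <= expR (u - u / 8 * k%:R) * S.
    move=> kd zS; rewrite normr1 expr1n mulr1; apply: ler_pM; rewrite ?expR_ge0 ?nrm_ge0 //.
    rewrite ler_expR; apply: le_trans (_ : - (d%:R * (u / 2)) <= _).
      by rewrite lerN2; exact: ler_wpM2l.
    have kdR : k%:R <= 4 * d%:R + 6 :> R by rewrite -natrM -natrD ler_nat.
    move: u0 kdR; move: (k%:R : R) (d%:R : R) (u); clear => k d u u0 kd.
    rewrite -subr_ge0; have -> : u - u / 8 * k - - (d * (u / 2)) = u * (1 - k / 8 + d / 2) by field.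
    by apply: mulr_ge0; [exact: ltW|lra].
  by apply: lerD; apply: G => //; rewrite nrmM nrm_ex mul1r.
have key : 1 <= r + S * (#|P|%:R / N%:R).
  apply: le_trans (mean_split N0 S0 r0 (fun i => hS (i%:R / N%:R)) hreg').
  have WN : (2 * W < N)%N by rewrite ltnS leq_addr.
  have := @Fser_mean R rho phi W N WN.
  rewrite phi0 mulr1 => hm.
  rewrite ler_pdivlMl ?ltr0n // mulr1.
  by apply: le_trans (nrm_sum _ _ _); rewrite hm nrm_nat.
pose eta := eta_k (8 * v) k.
have eta0 : 0 < eta by exact: expR_gt0.
have N0' : 0 < N%:R :> R by rewrite ltr0n.
have hc := sing_count irr c0 Lam0 gs kw big x0 N0.
have hfrac : (#|P|)%:R / N%:R <= 16 * k%:R ^+ 2 * eta.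
  rewrite ler_pdivrMr //; apply: le_trans hc _; rewrite -/eta -/w.
  have hN' : 1 <= eta * N%:R.
    rewrite -ler_pdivrMl // mulr1; apply: ltW.
    have etaV : 0 <= eta^-1 by rewrite invr_ge0 ltW.
    have /andP[_ t2] := truncn_itv etaV.
    by apply: lt_le_trans t2 _; rewrite ler_nat /N ltnS leq_addl.
  have wk : w%:R ^+ 2 <= k%:R ^+ 2 :> R.
    by apply: lerXn2r; rewrite ?nnegrE // ler_nat; clear -kw w4; lia.
  apply: le_trans (_ : 4 * k%:R ^+ 2 * (4 * (eta * N%:R)) <= _); last by rewrite le_eqVlt; apply/orP; left; apply/eqP; ring.
  apply: ler_pM => //; rewrite ?mulr_ge0 ?exprn_ge0 //.
  - by rewrite addr_ge0 // !mulr_ge0 // ltW.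
  - by apply: ler_wpM2l.
  - by rewrite -mulrA; move: hN'; clear; lra.
have etaE : eta = expR (- (v * k%:R)).
  by rewrite /eta /eta_k; congr expR; field.
rewrite {}etaE in hfrac.
have kR1 : T%:R * a%:R <= k%:R + 2 :> R by rewrite -natrM -natrD ler_nat.
have kR2 : k%:R <= 2 * (T%:R * a%:R) :> R by rewrite -!natrM ler_nat.
have W1a : W1 <= (2 * A + 3)%:R * a%:R.
  by rewrite /W1 -natrM ler_nat /W; move: a1; clear; nia.
have eS : expR (- (v * k%:R)) * S <= W1 * 3 * (expR (2 * v) * expR (- (v * a%:R))).
  rewrite /S; have -> : expR (- (v * k%:R)) * (W1 * (3 * expR (nu * a%:R))) =
     W1 * 3 * (expR (- (v * k%:R)) * expR (nu * a%:R)) by ring.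
  apply: ler_wpM2l; first by rewrite mulr_ge0.
  rewrite -!expRD ler_expR.
  have t1 := ler_wpM2l (ltW v0) kR1.
  have t2 := ler_wpM2r (ler0n R a) hT.
  move: t1 t2; clear; lra.
have ek : expR ((8 * v + 8 * v) * k%:R) * expR (u - u / 8 * k%:R) <= expR u * expR (- (v * k%:R)).
  rewrite -!expRD ler_expR.
  have t1 := ler_wpM2r (ler0n R k) uv.
  have t2 := mulr_ge0 (ltW v0) (ler0n R k).
  move: t1 t2; clear; lra.
(* As p = nu - u / 4, the weight exp(p A a) leaves exp(- u A a / 4) of the residual; [A] is chosen
   so that this wins over exp(16 v k) and exp(nu a). *)
have eR : expR ((8 * v + 8 * v) * k%:R) * R' <= W1 * 8 * (expR p * expR (- (v * a%:R))).
  rewrite /R'; have -> : expR ((8 * v + 8 * v) * k%:R) * (W1 * (8 * expR (- (nu * (A%:R * a%:R - a%:R))) * expR (W%:R * p))) =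
     W1 * 8 * (expR ((8 * v + 8 * v) * k%:R) * expR (- (nu * (A%:R * a%:R - a%:R))) * expR (W%:R * p)) by ring.
  apply: ler_wpM2l; first by rewrite mulr_ge0.
  rewrite -!expRD ler_expR.
  have -> : W%:R = A%:R * a%:R + 1 :> R by rewrite /W -natr1 natrM.
  have t1 := ler_wpM2l (ltW v0) kR2.
  have t2 := ler_wpM2r (ler0n R a) hA.
  have -> : p = nu - u / 4 by rewrite /p /nu; field.
  move: t1 t2; clear; lra.
have kk0 : 0 <= k%:R :> R := ler0n _ _.
have a3 : a%:R <= a%:R ^+ 3 :> R by rewrite -[leLHS]expr1 ler_weXn2l.
have a23 : a%:R ^+ 2 <= a%:R ^+ 3 :> R by rewrite ler_weXn2l.
pose Z := expR (- (v * a%:R)).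
have Z0 : 0 <= Z by exact: expR_ge0.
have A0 : 0 <= (2 * A + 3)%:R :> R := ler0n _ _.
have T1 : 8 * B ^+ 2 * expR ((8 * v + 8 * v) * k%:R) * (2 * (expR (u - u / 8 * k%:R) * S)) <=
   (2 * A + 3)%:R * (48 * B ^+ 2 * expR (u + 2 * v)) * (a%:R ^+ 3 * Z).
  have -> : 8 * B ^+ 2 * expR ((8 * v + 8 * v) * k%:R) * (2 * (expR (u - u / 8 * k%:R) * S)) =
     16 * B ^+ 2 * (expR ((8 * v + 8 * v) * k%:R) * expR (u - u / 8 * k%:R) * S) by ring.
  have s1 : expR ((8 * v + 8 * v) * k%:R) * expR (u - u / 8 * k%:R) * S <=
       expR u * ((2 * A + 3)%:R * a%:R ^+ 3 * 3 * (expR (2 * v) * Z)).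
    apply: le_trans (ler_wpM2r S0 ek) _; rewrite -[leLHS]mulrA; apply: ler_wpM2l; first exact: expR_ge0.
    apply: le_trans eS _; apply: ler_wpM2r; first by rewrite mulr_ge0 ?expR_ge0.
    apply: ler_wpM2r => //; apply: le_trans W1a _; exact: ler_wpM2l.
  apply: le_trans (ler_wpM2l _ s1) _; first by rewrite mulr_ge0 ?exprn_ge0.
  by rewrite expRD le_eqVlt; apply/orP; left; apply/eqP; ring.
have T2 : 8 * B ^+ 2 * expR ((8 * v + 8 * v) * k%:R) * (k%:R * R') <=
   (2 * A + 3)%:R * (128 * T%:R * B ^+ 2 * expR p) * (a%:R ^+ 3 * Z).
  have -> : 8 * B ^+ 2 * expR ((8 * v + 8 * v) * k%:R) * (k%:R * R') =
    8 * B ^+ 2 * (k%:R * (expR ((8 * v + 8 * v) * k%:R) * R')) by ring.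
  have s1 : k%:R * (expR ((8 * v + 8 * v) * k%:R) * R') <=
      2 * (T%:R * a%:R) * ((2 * A + 3)%:R * a%:R * 8 * (expR p * Z)).
    apply: ler_pM => //; first by rewrite mulr_ge0 ?expR_ge0.
    apply: le_trans eR _; apply: ler_wpM2r; first by rewrite mulr_ge0 ?expR_ge0.
    exact: ler_wpM2r.
  apply: le_trans (ler_wpM2l _ s1) _; first by rewrite mulr_ge0 ?exprn_ge0.
  have -> : 8 * B ^+ 2 * (2 * (T%:R * a%:R) * ((2 * A + 3)%:R * a%:R * 8 * (expR p * Z))) =
     (2 * A + 3)%:R * (128 * T%:R * B ^+ 2 * expR p) * (a%:R ^+ 2 * Z) by ring.
  apply: ler_wpM2l; first by rewrite !mulr_ge0 ?exprn_ge0 ?expR_ge0.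
  exact: ler_wpM2r.
have T3 : S * (#|P|%:R / N%:R) <= (2 * A + 3)%:R * (192 * T%:R ^+ 2 * expR (2 * v)) * (a%:R ^+ 3 * Z).
  apply: le_trans (ler_wpM2l S0 hfrac) _.
  have -> : S * (16 * k%:R ^+ 2 * expR (- (v * k%:R))) = 16 * (k%:R ^+ 2 * (expR (- (v * k%:R)) * S)) by ring.
  have s1 : k%:R ^+ 2 * (expR (- (v * k%:R)) * S) <= (2 * (T%:R * a%:R)) ^+ 2 * ((2 * A + 3)%:R * a%:R * 3 * (expR (2 * v) * Z)).
    apply: ler_pM; rewrite ?exprn_ge0 ?mulr_ge0 ?expR_ge0 //.
      by apply: lerXn2r; rewrite ?nnegrE ?mulr_ge0.
    apply: le_trans eS _; apply: ler_wpM2r; first by rewrite mulr_ge0 ?expR_ge0.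
    exact: ler_wpM2r.
  apply: le_trans (ler_wpM2l _ s1) _ => //.
  rewrite le_eqVlt; apply/orP; left; apply/eqP; ring.
have : 1 <= Q * (a%:R ^+ 3 * Z).
  apply: le_trans key _; rewrite /r mulrDr; apply: le_trans (lerD (lerD T1 T2) T3) _.
  by rewrite /Q le_eqVlt; apply/orP; left; apply/eqP; ring.
have n1a : (n1 <= a)%N by clear -ha; lia.
have := ler_wpM2r Z0 (hn1 a n1a); rewrite -[leRHS]expRD subrr expR0.
have -> : 2 * Q * a%:R ^+ 3 * Z = Q * (a%:R ^+ 3 * Z) + Q * (a%:R ^+ 3 * Z) by ring.
by move=> t1 t2; have := le_trans (lerD t2 t2) t1; rewrite gerDl ler10.
Qed.

End NoLocalized.

(** The step is iterated: two factors 1/4 make 1/2, so the trivial bound 1 is halved at each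
    iteration and [tau] accumulates to [2 * tau]. Jumps out of the interval are harmless, the
    claimed bound being at least 1 there. *)
Lemma annulus_decay (R : realType) (f : int -> R) (nu tau : R) (P Q : int) :
  0 <= nu -> 0 <= tau -> (forall n, 0 <= f n <= 1) ->
  (forall n, P < n -> n < Q -> exists d1 d2 : nat,
     f n <= expR (- (nu * d1%:R)) / 4 * f (n - d1%:Z) + expR (- (nu * d2%:R)) / 4 * f (n + d2%:Z) + tau) ->
  forall n, f n <= expR (- (nu * (n - P)%:~R)) + expR (- (nu * (Q - n)%:~R)) + 2 * tau.
Proof.
move=> nu0 tau0 f01 H.
pose gP n := expR (- (nu * (n - P)%:~R)); pose gQ n := expR (- (nu * (Q - n)%:~R)).
have gP0 n : 0 <= gP n by exact: expR_ge0.
have gQ0 n : 0 <= gQ n by exact: expR_ge0.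
have E0 (d : nat) : 0 <= expR (- (nu * d%:R)) <= 1.
  by rewrite expR_ge0 -[leRHS]expR0 ler_expR oppr_le0 mulr_ge0.
have mono (x y : int) : x <= y -> expR (- (nu * y%:~R)) <= expR (- (nu * x%:~R)).
  by move=> xy; rewrite ler_expR lerN2 ler_wpM2l // ler_int.
have shiftP n (d : nat) : expR (- (nu * d%:R)) * gP (n - d%:Z) = gP n.
  by rewrite /gP -expRD; congr expR; rewrite !rmorphB /=; ring.
have shiftQ n (d : nat) : expR (- (nu * d%:R)) * gQ (n + d%:Z) = gQ n.
  by rewrite /gQ -expRD; congr expR; rewrite !rmorphB !rmorphD /=; ring.
have key j : forall n, f n <= gP n + gQ n + 2 * tau + (2 ^+ j)^-1.
  elim: j => [|j IH] n.
    rewrite expr0 invr1; apply: le_trans (_ : 1 <= _); first by case/andP: (f01 n).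
    by rewrite lerDr !addr_ge0 ?mulr_ge0.
  set z := (2 ^+ j.+1)^-1; have z0 : 0 <= z by rewrite invr_ge0 exprn_ge0.
  have zE : (2 ^+ j)^-1 = 2 * z by rewrite /z (exprS _ j) invfM mulrA divff ?mul1r // pnatr_eq0.
  have [nP|Pn] := leP n P.
    have : 1 <= gP n by rewrite -[leLHS]expR0 ler_expR oppr_ge0 mulr_ge0_le0 // lerz0 subr_le0.
    by have := f01 n; have := gQ0 n; lra.
  have [Qn|nQ] := leP Q n.
    have : 1 <= gQ n by rewrite -[leLHS]expR0 ler_expR oppr_ge0 mulr_ge0_le0 // lerz0 subr_le0.
    by have := f01 n; have := gP0 n; lra.
  have [d1 [d2 h]] := H n Pn nQ.
  have /andP[e10 e11] := E0 d1; have /andP[e20 e21] := E0 d2.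
  have h1 := ler_wpM2l e10 (IH (n - d1%:Z)); have h2 := ler_wpM2l e20 (IH (n + d2%:Z)).
  rewrite zE in h1 h2.
  have m1 : expR (- (nu * d1%:R)) * gQ (n - d1%:Z) <= gQ n.
    apply: le_trans (_ : gQ (n - d1%:Z) <= _); first by rewrite ler_piMl.
    by apply: mono; clear; lia.
  have m2 : expR (- (nu * d2%:R)) * gP (n + d2%:Z) <= gP n.
    apply: le_trans (_ : gP (n + d2%:Z) <= _); first by rewrite ler_piMl.
    by apply: mono; clear; lia.
  have t1 : expR (- (nu * d1%:R)) * (2 * tau + 2 * z) <= 2 * tau + 2 * z.
    by rewrite ler_piMl // addr_ge0 // mulr_ge0.
  have t2 : expR (- (nu * d2%:R)) * (2 * tau + 2 * z) <= 2 * tau + 2 * z.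
    by rewrite ler_piMl // addr_ge0 // mulr_ge0.
  have sP := shiftP n d1; have sQ := shiftQ n d2.
  move: h h1 h2 m1 m2 t1 t2 sP sQ (gP0 n) (gQ0 n).
  move: (expR (- (nu * d1%:R))) (expR (- (nu * d2%:R))) => x1 x2.
  rewrite !mulrDr.
  by clear; move: (gP n) (gQ n) (gP _) (gP _) (gQ _) (gQ _) (f n) (f _) (f _) z (tau) => *; lra.
move=> n; rewrite leNgt; apply/negP => hlt.
set g := _ + 2 * tau in hlt; have d0 : 0 < f n - g by rewrite subr_gt0.
have [m hm] := archi_nat (f n - g)^-1.
have := key m n; rewrite -/(gP n) -/(gQ n) -/g -lerBlDl leNgt => /negP; apply.
rewrite -[ltRHS]invrK ltf_pV2 ?posrE ?invr_gt0 ?exprn_gt0 //.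
apply: lt_trans hm _; rewrite -natrX ltr_nat; exact: ltn_expl.
Qed.

(** * Lower bound for the dual operator when its cocycle grows fast *)

Section DualBelow.
Variables (R : realType) (alpha : R).
Hypothesis irr : not_rational alpha.
Local Notation C := (R[i]).

(** Otherwise [phi], centred and normalized at its maximum, is an approximate solution [psi] with
    value 1 at 0 and modulus at most 1. Among five concentric annuli one contains no singular phase;
    crossing it gives decay at rate nu, and a cutoff in its middle produces the vector excluded by
    [no_localized]. *)
Lemma dual_bounded_below (v u h bt lam E : R) (T A : nat) :
  0 < v -> 0 <= h -> 32 * (16 * v) <= u -> 0 <= bt -> 120 * bt <= 8 * v -> beta_bound alpha bt ->
  `|lam| = expR (- h) ->
  let nu := h + 3 * u / 4 in
  nu + v <= v * T%:R -> 32 * v * T%:R + nu + v <= u / 4 * A%:R -> (0 < A)%N ->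
  bt * (3 * (2 * A) ^ 10)%:R <= v ->
  (forall j, (0 < j)%N -> expR (j%:R * u) <= growth lam 1 1 E alpha j) ->
  exists kappa, 0 < kappa /\ forall theta (phi : int -> C) (W : nat),
   (forall n, (W < `|n|)%N -> phi n = 0) ->
   (forall n, nrm (resid1 lam E alpha theta phi n) <= kappa) ->
   forall n, nrm (phi n) <= 1.
Proof.
move=> v0 h0 uv bt0 cbt hb lamE nu hT hA A0 hbt hgr.
have uv' : 16 * (16 * v) <= u.
  by apply: le_trans uv; move: v0; clear; lra.
have [a0 hloc] := @no_localized R alpha irr v u h bt lam E T A v0 h0 uv' bt0 cbt hb lamE hT hA.
have u0 : 0 <= u by apply: le_trans uv; rewrite !mulr_ge0 // ltW.
have nu0 : 0 <= nu by rewrite /nu addr_ge0 // divr_ge0 // mulr_ge0.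
have lam1 : `|lam| <= 1 by rewrite lamE -[leRHS]expR0 ler_expR oppr_le0.
have [l [ul lower upper']] := growth_exponent u0 hgr.
have c0 : 0 < 8 * v by rewrite mulr_gt0.
have [B [B1 upper]] := upper' _ c0.
have l0 : 0 <= l := le_trans u0 ul.
have B0 : 0 <= B := le_trans ler01 B1.
have [K0 hK0] := good_scale_exists irr c0 bt0 cbt hb.
have [T0 hT0] := hb.
have [n1 hn1] := exp_dominates_poly (32 * B ^+ 2 * expR (6 * u / 16)) 0 (mulr_gt0 (ltr0n R 16 : 0 < 16) v0).
pose K := (maxn K0 (maxn T0 (maxn n1 a0)) + 4)%N.
have [|q [M gs]] := hK0 (2 * K)%N; first by rewrite /K; clear; lia.
have [_ wK Kw w4 _] := gs.
have [k [Lam [kw Lam0 big hreg]]] := regular_decay lam1 l0 B1 (ltW c0) lower upper gs.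
set w := (M * q)%N in wK Kw w4 kw.
have wK' : (K <= w)%N by clear -Kw; lia.
have wk : (w <= k)%N by clear -kw w4; lia.
pose Q := 8 * B ^+ 2 * expR ((8 * v + 8 * v) * k%:R).
have Q0 : 0 <= Q by rewrite /Q !mulr_ge0 ?exprn_ge0 ?expR_ge0.
have [AA AAE] : exists AA, AA = (2 * A)%N by exists (2 * A)%N.
pose Z := expR (- (nu * (A%:R * (w * AA ^ 9)%:R))).
have Z0 : 0 < Z by exact: expR_gt0.
(* Below the residual that [no_localized] tolerates even for the largest radius w (2 A)^9, and so
   small that the accumulated error [2 * tau] is below it too. *)
pose kappa := Z / (1 + 2 * (Q * k%:R)).
have kap1 : 1 <= 1 + 2 * (Q * k%:R) by rewrite lerDl !mulr_ge0.
have kap1' : 0 < 1 + 2 * (Q * k%:R) := lt_le_trans ltr01 kap1.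
have kap0 : 0 < kappa by rewrite /kappa divr_gt0.
have kapZ : kappa <= Z by rewrite /kappa ler_pdivrMr // ler_peMr // ltW.
pose tau := Q * (k%:R * kappa).
have tau0 : 0 <= tau by apply: mulr_ge0 => //; apply: mulr_ge0 => //; exact: ltW.
have tauZ : 2 * tau <= Z.
  rewrite /tau /kappa.
  have -> : 2 * (Q * (k%:R * (Z / (1 + 2 * (Q * k%:R))))) = 2 * (Q * k%:R) * Z / (1 + 2 * (Q * k%:R)) by ring.
  by rewrite ler_pdivrMr // mulrC ler_pM2l // lerDr.
exists kappa; split=> // theta phi W hW hphi n0.
rewrite leNgt; apply/negP => hn0.
pose F (i : 'I_(2 * W).+1) := nrm (phi (i%:Z - W%:Z)).
have [i _ hi] := @arg_maxP _ _ _ (ord0 : 'I_(2 * W).+1) predT F isT.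
pose ns := i%:Z - W%:Z.
have hmax n : nrm (phi n) <= nrm (phi ns).
  have [nW|Wn] := leqP `|n| W; last by rewrite hW // nrm0 nrm_ge0.
  pose m : int := n + W%:Z.
  have nW' : (`|m| < (2 * W).+1)%N by rewrite /m; move: nW; clear; lia.
  have := hi (Ordinal nW') isT; rewrite /F /=.
  by have -> : `|m|%N%:Z - W%:Z = n by rewrite /m; move: nW; clear; lia.
have ns1 : 1 < nrm (phi ns) := lt_le_trans hn0 (hmax n0).
have nsn0 : phi ns != 0 by rewrite -nrm_gt0; apply: lt_trans ns1.
pose th := theta + ns%:~R * alpha.
pose psi n := phi (ns + n) / phi ns.
have psi0 : psi 0 = 1 by rewrite /psi addr0 divff.
have psi1 n : 0 <= nrm (psi n) <= 1.
  by rewrite nrm_ge0 /psi nrmM nrmV ler_pdivrMr ?mul1r ?hmax // (lt_trans ltr01).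
have psires n : nrm (resid1 lam E alpha th psi n) <= kappa.
  have -> : resid1 lam E alpha th psi n = resid1 lam E alpha theta phi (ns + n) / phi ns.
    rewrite /resid1 /psi /th !addrA.
    have -> : theta + (ns + n)%:~R * alpha = theta + ns%:~R * alpha + n%:~R * alpha by rewrite rmorphD /=; ring.
    by ring.
  rewrite nrmM nrmV ler_pdivrMr ?(lt_trans ltr01) //.
  apply: le_trans (hphi _) _; rewrite ler_peMr //; exact: ltW.
(* The annuli r < |n| < 2 A r are so far apart that a resonance between two of them occurs at a time
   between [w] and 3 w (2 A)^10, where the last hypothesis on [bt] excludes it. *)
pose rr (i : nat) := (w * AA ^ (2 * i).+1)%N.
have AA2 : (2 <= AA)%N by rewrite AAE; clear -A0; lia.
have [j jI hj] : exists2 j, (j < 5)%N & forall n : int, (rr j < `|n|)%N -> (`|n| < AA * rr j)%N ->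
    ~ sing lam 1 1 E alpha (8 * v) Lam q M k (box_base alpha q M (th + n%:~R * alpha)).
  apply: contrapT => /forall2NP H.
  have H' (i5 : 'I_5) : exists n : int, [/\ (rr i5 < `|n|)%N, (`|n| < AA * rr i5)%N &
     sing lam 1 1 E alpha (8 * v) Lam q M k (box_base alpha q M (th + n%:~R * alpha))].
    have [[]|] := H i5; first exact: ltn_ord.
    move=> /existsNP[n /not_implyP[h1 /not_implyP[h2 /contrapT h3]]]; by exists n.
  have [g hg] := choice H'.
  have hs i5 : sing lam 1 1 E alpha (8 * v) Lam q M k (box_base alpha q M (th + (g i5)%:~R * alpha)).
    by case: (hg i5).
  have [i1 [i2 [ne [j1 [j2 [hj1 hj2 hres]]]]]] := five_singular irr c0 Lam0 gs kw big hs.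
  pose m : int := g i1 - g i2 + j1%:Z - j2%:Z.
  have hsn : sn (`|m|%:R * alpha) < eta_k (8 * v) k.
    move: hres; rewrite /box_base /th.
    have -> : theta + ns%:~R * alpha + (g i1)%:~R * alpha - ((M * q)./2 + M * q).-1%:R * alpha + j1%:R * alpha -
      (theta + ns%:~R * alpha + (g i2)%:~R * alpha - ((M * q)./2 + M * q).-1%:R * alpha + j2%:R * alpha) = m%:~R * alpha.
      have -> : m%:~R = (g i1)%:~R - (g i2)%:~R + j1%:R - j2%:R :> R by rewrite /m !intrD !intrN.
      ring.
    have [m0|m0] := lerP 0 m; first by rewrite -{1}(gez0_abs m0).
    by rewrite -snN -mulNr -rmorphN -(ltz0_abs m0).
  have [hl hu] : (w <= `|m|)%N /\ (`|m| <= 3 * (w * AA ^ 10))%N.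
    have rrle (i5 i6 : nat) : (i5 < i6)%N -> (AA * (AA * rr i5) <= rr i6)%N.
      move=> ii; rewrite /rr [(AA * (w * _))%N]mulnCA mulnCA -!expnS leq_mul2l leq_exp2l //.
      by apply/orP; right; clear -ii; lia.
    have rrw (i5 : nat) : (2 * w <= rr i5)%N.
      have h2 : (2 <= AA ^ (2 * i5).+1)%N.
        by apply: (leq_trans AA2); rewrite expnS leq_pmulr // expn_gt0 (ltnW AA2).
      by rewrite /rr [(2 * w)%N]mulnC leq_mul2l h2 orbT.
    have rrW (i5 : 'I_5) : (AA * rr i5 <= w * AA ^ 10)%N.
      rewrite /rr mulnCA -expnS leq_mul2l leq_exp2l //; apply/orP; right.
      by have := ltn_ord i5; clear; lia.
    have [g1 g2 _] := hg i1; have [g3 g4 _] := hg i2.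
    have b1 := rrW i1; have b2 := rrW i2; have b3 := rrw i1; have b4 := rrw i2.
    have b5 : (w <= w * AA ^ 10)%N by rewrite leq_pmulr // expn_gt0; clear -AA2; lia.
    rewrite -/w in hj1 hj2.
    split; last first.
      move: (g1) (g2) (g3) (g4) b1 b2 hj1 hj2 b5; rewrite /m; clear.
      move: (w * AA ^ 10)%N (AA * rr i1)%N (AA * rr i2)%N (rr i1) (rr i2) (g i1) (g i2); clear; lia.
    have : (i1 < i2)%N \/ (i2 < i1)%N.
      by move: ne; rewrite -val_eqE /= neq_ltn => /orP.
    case=> /rrle h1.
      move: (leq_mul2r (AA * rr i1) 2 AA); rewrite AA2 orbT => h2.
      move: (g1) (g2) (g3) (g4) h1 h2 b3 b4 hj1 hj2; rewrite /m; clear.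
      move: (AA * rr i1)%N => X; move: (AA * X)%N (AA * rr i2)%N (rr i1) (rr i2) (g i1) (g i2); clear; lia.
    move: (leq_mul2r (AA * rr i2) 2 AA); rewrite AA2 orbT => h2.
    move: (g1) (g2) (g3) (g4) h1 h2 b3 b4 hj1 hj2; rewrite /m; clear.
    move: (AA * rr i2)%N => X; move: (AA * X)%N (AA * rr i1)%N (rr i1) (rr i2) (g i1) (g i2); clear; lia.
  have mT : (T0 <= `|m|)%N by apply: leq_trans hl; apply: leq_trans wK'; rewrite /K; clear; lia.
  have := le_lt_trans (hT0 _ mT) hsn; rewrite ltr_expR ltNge => /negP; apply.
  rewrite lerN2.
  have -> : 8 * v * k%:R / 8 = v * k%:R by field.
  apply: le_trans (_ : bt * (3 * (w * AA ^ 10))%:R <= _); first by rewrite ler_wpM2l // ler_nat.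
  have -> : (3 * (w * AA ^ 10))%:R = (3 * AA ^ 10)%:R * w%:R :> R by rewrite -natrM; congr _%:R; ring.
  rewrite mulrA; apply: ler_pM; rewrite ?mulr_ge0 ?ler_nat //.
  by move: hbt; rewrite AAE.
pose r := rr j.
have wr : (w <= r)%N by rewrite /r /rr leq_pmulr // expn_gt0; clear -AA2; lia.
have r9 : (r <= w * AA ^ 9)%N.
  by rewrite /r /rr leq_mul2l leq_exp2l //; apply/orP; right; clear -jI; lia.
have hstep (n : int) : (r < `|n|)%N -> (`|n| < AA * r)%N -> exists d1 d2 : nat,
     nrm (psi n) <= expR (- (nu * d1%:R)) / 4 * nrm (psi (n - d1%:Z)) + expR (- (nu * d2%:R)) / 4 * nrm (psi (n + d2%:Z)) + tau.
  move=> n1' n2'.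
  have hres (i' : int) : (`|i'| <= k)%N ->
     nrm (lam%:C%C * (psi (n + (i' + 1)) + psi (n + (i' - 1))) + Vx 1 1 E (th + n%:~R * alpha + i'%:~R * alpha) * psi (n + i')) <= kappa.
    move=> _; have := psires (n + i'); rewrite /resid1; congr (nrm (_ * (psi _ + psi _) + Vx 1 1 E _ * _) <= _).
    - by rewrite addrA.
    - by rewrite addrA.
    - by rewrite rmorphD /=; ring.
  have [d1 [d2 [_ _ kd1 kd2 hb']]] := hreg _ (fun i' => psi (n + i')) kappa (ltW kap0) (hj n n1' n2') hres.
  exists d1, d2; rewrite addr0 in hb'; apply: le_trans hb' _; rewrite -/Q mulrDr lerD2r mulrDr.
  have G (d : nat) z : (k <= 4 * d + 6)%N -> 0 <= z -> Q * (expR (- (d%:R * l)) * `|lam| ^+ d * z) <= expR (- (nu * d%:R)) / 4 * z.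
    move=> kd z0; rewrite !mulrA; apply: ler_wpM2r => //.
    rewrite ler_pdivlMr // lamE -expRM_natl.
    have -> : Q * expR (- (d%:R * l)) * expR (d%:R * - h) * 4 =
       32 * B ^+ 2 * (expR ((8 * v + 8 * v) * k%:R) * expR (- (d%:R * l)) * expR (d%:R * - h)) by rewrite /Q; ring.
    have hn := hn1 k (leq_trans (leq_trans (leq_maxl _ _) (leq_trans (leq_maxr _ _) (leq_trans (leq_maxr _ _) (leq_addr _ _)))) (leq_trans wK' wk)).
    rewrite expr0 mulr1 in hn.
    apply: le_trans (_ : 32 * B ^+ 2 * (expR (6 * u / 16) * (expR (- (nu * d%:R)) * expR (- (16 * v * k%:R)))) <= _).
      apply: ler_wpM2l; first by rewrite mulr_ge0 ?exprn_ge0.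
      rewrite -!expRD ler_expR /nu.
      have kdR : k%:R <= 4 * d%:R + 6 :> R by rewrite -natrM -natrD ler_nat.
      have t1 := ler_wpM2r (ler0n R k) uv.
      have t2 := ler_wpM2l u0 kdR.
      have t3 := ler_wpM2l (ler0n R d) ul.
      move: t1 t2 t3; clear; lra.
    move: (expR (- (nu * d%:R))) (expR_ge0 (- (nu * d%:R))) => x x_ge0.
    have y0 := expR_ge0 (- (16 * v * k%:R)).
    have := ler_wpM2r (mulr_ge0 x_ge0 y0) hn.
    have -> : expR (16 * v * k%:R) * (x * expR (- (16 * v * k%:R))) = x * (expR (16 * v * k%:R) * expR (- (16 * v * k%:R))) by ring.
    by rewrite -expRD subrr expR0 mulr1 -[leLHS]mulrA.
  by apply: lerD; apply: G => //; exact: nrm_ge0.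
have decay n : nrm (psi n) <= expR (- (nu * (`|n|%:R - r%:R))) + expR (- (nu * ((AA * r)%:R - `|n|%:R))) + 2 * tau.
  have [n0'|n0'] := lerP 0 n.
    have h1 := @annulus_decay R (fun n => nrm (psi n)) nu tau r%:Z (AA * r)%N%:Z nu0 tau0 psi1 _ n.
    have -> : `|n|%:R - r%:R = (n - r%:Z)%:~R :> R by rewrite rmorphB /= -[in RHS](gez0_abs n0').
    have -> : (AA * r)%:R - `|n|%:R = ((AA * r)%N%:Z - n)%:~R :> R by rewrite rmorphB /= -[in RHS](gez0_abs n0').
    by apply: h1 => n' h2 h3; apply: hstep; move: h2 h3; clear; lia.
  have h1 := @annulus_decay R (fun n => nrm (psi n)) nu tau (- (AA * r)%N%:Z) (- r%:Z) nu0 tau0 psi1 _ n.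
  have nE : `|n|%:R = - n%:~R :> R by rewrite -intrN -(ltz0_abs n0').
  have -> : `|n|%:R - r%:R = (- r%:Z - n)%:~R :> R by rewrite nE intrD !intrN addrC.
  have -> : (AA * r)%:R - `|n|%:R = (n - - (AA * r)%N%:Z)%:~R :> R.
    by rewrite nE intrD !intrN !opprK addrC.
  rewrite [X in X + _]addrC.
  by apply: h1 => n' h2 h3; apply: hstep; move: h2 h3; clear; lia.
have ra0 : (a0 <= r)%N by apply: leq_trans wr; apply: leq_trans wK'; rewrite /K; clear; lia.
have r2 : (4 <= r)%N := leq_trans w4 wr.
have decay3 n : (`|n| <= (A * r).+1)%N -> nrm (psi n) <= 3 * expR (- (nu * (`|n|%:R - r%:R))).
  move=> nA; apply: le_trans (decay n) _.
  have -> : 3 * expR (- (nu * (`|n|%:R - r%:R))) = expR (- (nu * (`|n|%:R - r%:R))) + expR (- (nu * (`|n|%:R - r%:R))) + expR (- (nu * (`|n|%:R - r%:R))) by ring.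
  rewrite -addrA -[leRHS]addrA lerD2l; apply: lerD.
    rewrite ler_expR lerN2; apply: ler_wpM2l => //.
    have : (`|n| + `|n|)%:R <= (AA * r + r)%:R :> R by rewrite ler_nat AAE; move: nA r2; clear; lia.
    rewrite !natrD; clear; lra.
  apply: le_trans tauZ _; rewrite /Z ler_expR lerN2; apply: ler_wpM2l => //.
  apply: le_trans (_ : (A * r)%:R <= _); last by rewrite -natrM ler_nat leq_mul2l r9 orbT.
  by rewrite lerBlDr -natrD ler_nat; move: nA r2; clear; lia.
pose ph n := if (`|n| <= A * r)%N then psi n else 0.
apply: (hloc r ra0 th ph).
- by move=> n hn; rewrite /ph leqNgt hn.
- move=> n; rewrite /ph; case: leqP => hn; first by apply: decay3; exact: leqW.
  by rewrite nrm0 mulr_ge0 ?expR_ge0.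
- move=> n; rewrite -natrM.
  pose Y := expR (- (nu * ((A * r)%:R - r%:R))).
  have Y0 : 0 <= Y by exact: expR_ge0.
  have kapY : kappa <= Y.
    apply: le_trans kapZ _; rewrite /Z ler_expR lerN2; apply: ler_wpM2l => //.
    apply: le_trans (_ : (A * r)%:R <= _); last by rewrite -natrM ler_nat leq_mul2l r9 orbT.
    by rewrite gerBl.
  have edge (n' : int) (b b' : bool) : ((A * r <= `|n'|)%N || (b == b')) -> (`|n'| <= (A * r).+1)%N || (b == b') ->
      nrm ((b%:R - b'%:R) * psi n') <= 3 * Y.
    case: eqP => [->|_]; first by rewrite subrr mul0r nrm0 mulr_ge0.
    rewrite !orbF => e1 e2; apply: le_trans (_ : nrm (psi n') <= _).
      rewrite nrmM ler_piMl ?nrm_ge0 //.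
      by case: b b' => [] [] /=; rewrite ?subrr ?subr0 ?sub0r ?nrmN ?nrm0 ?nrm1.
    apply: le_trans (decay3 n' e2) _; apply: ler_wpM2l => //.
    by rewrite ler_expR lerN2; apply: ler_wpM2l => //; rewrite lerD2r ler_nat.
  pose ch (n : int) : bool := (`|n| <= A * r)%N.
  have phE n' : ph n' = (ch n')%:R * psi n' by rewrite /ph /ch; case: leqP => _; rewrite ?mul1r ?mul0r.
  (* The cutoff commutes with the potential; its commutator with the hopping lives at the edge,
     where [psi] is already small. *)
  have -> : resid1 lam E alpha th ph n = (ch n)%:R * resid1 lam E alpha th psi n +
     (lam%:C%C * (((ch (n + 1))%:R - (ch n)%:R) * psi (n + 1)) + lam%:C%C * (((ch (n - 1))%:R - (ch n)%:R) * psi (n - 1))).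
    by rewrite /resid1 !phE; ring.
  have hA1 : (0 < A * r)%N by rewrite muln_gt0 A0; exact: leq_trans r2.
  have e1 : nrm (((ch (n + 1))%:R - (ch n)%:R) * psi (n + 1)) <= 3 * Y.
    by apply: edge; rewrite /ch; move: hA1; clear; lia.
  have e2 : nrm (((ch (n - 1))%:R - (ch n)%:R) * psi (n - 1)) <= 3 * Y.
    by apply: edge; rewrite /ch; move: hA1; clear; lia.
  have e3 : nrm ((ch n)%:R * resid1 lam E alpha th psi n) <= Y.
    apply: le_trans kapY; apply: le_trans (psires n); rewrite nrmM ler_piMl ?nrm_ge0 //.
    by case: (ch n); rewrite ?nrm1 ?nrm0.
  apply: le_trans (nrmD _ _) _; apply: le_trans (lerD e3 (nrmD _ _)) _.
  have lamM z : nrm (lam%:C%C * z) <= nrm z by rewrite nrmM nrm_real ler_piMl ?nrm_ge0.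
  apply: le_trans (lerD (lexx Y) (lerD (le_trans (lamM _) e1) (le_trans (lamM _) e2))) _.
  by move: Y0; rewrite -/Y; clear; lra.
- by rewrite /ph absz0.
Qed.

End DualBelow.

(** * Rotation numbers and solutions *)

Section Topology.
Variable R : realType.
Implicit Types (f : R -> R).

Lemma ivt_interval f (a b v : R) : a <= b -> continuous f -> (f a <= v <= f b) || (f b <= v <= f a) ->
  exists t, a <= t <= b /\ f t = v.
Proof.
move=> ab cf h; have [|c] := @IVT R f a b v ab (continuous_subspaceT cf).
  by rewrite ge_min le_max; case/orP: h => /andP[-> ->]; rewrite ?orbT.
by rewrite in_itv /= => ? e; exists c.
Qed.

Lemma ivt_between f (a b v : R) : continuous f -> f a <= v <= f b -> exists t, f t = v.
Proof.
move=> cf h; have [ab|/ltW ba] := leP a b.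
  by have [|t [_ e]] := @ivt_interval f a b v ab cf; [rewrite h|exists t].
by have [|t [_ e]] := @ivt_interval f b a v ba cf; [rewrite h orbT|exists t].
Qed.

Lemma int_valued_const f : continuous f -> (forall t, exists k : int, f t = k%:~R) -> forall a b, f a = f b.
Proof.
move=> cf hf; suff H a b : ~ (f a < f b).
  move=> a b; apply/eqP; rewrite eq_le !leNgt; apply/andP; split; apply/negP; exact: H.
move=> ab; have [k ka] := hf a; have [l lb] := hf b.
move: ab; rewrite ka lb ltr_int => kl.
have [|t ft] := @ivt_between f a b (k%:~R + 1 / 2) cf.
  have : (k + 1)%:~R <= l%:~R :> R by rewrite ler_int; move: kl; clear; lia.
  rewrite ka lb intrD; clear; lra.
have [j hj] := hf t; move: ft; rewrite hj => e.
have e2 : (2 * j)%:~R = (2 * k + 1)%:~R :> R by rewrite !intrD !intrM e; field.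
by move/intr_inj: e2; clear; lia.
Qed.

Lemma cont_id : continuous (fun t : R => t). Proof. by move=> t. Qed.

Lemma cont_cst (c : R) : continuous (fun _ : R => c). Proof. exact: cst_continuous. Qed.

Lemma contD f f' : continuous f -> continuous f' -> continuous (fun t => f t + f' t).
Proof. by move=> c1 c2 t; exact: (@continuousD _ _ _ f f' t (c1 t) (c2 t)). Qed.

Lemma contB f f' : continuous f -> continuous f' -> continuous (fun t => f t - f' t).
Proof. by move=> c1 c2 t; exact: (@continuousB _ _ _ f f' t (c1 t) (c2 t)). Qed.

Lemma contM f f' : continuous f -> continuous f' -> continuous (fun t => f t * f' t).
Proof. by move=> c1 c2 t; exact: (@continuousM _ _ f f' t (c1 t) (c2 t)). Qed.

Lemma cont_comp f f' : continuous f -> continuous f' -> continuous (fun t => f (f' t)).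
Proof. by move=> c1 c2 t; apply: (@continuous_comp _ _ _ f' f); [exact: c2|exact: c1]. Qed.

Lemma cont_cos2pi f : continuous f -> continuous (fun t => cos (2 * pi * f t)).
Proof.
move=> cf; apply: cont_comp; first exact: continuous_cos.
by apply: contM => //; exact: cont_cst.
Qed.

Lemma continuous_pair_comp (g : R * R -> R) f f' : continuous g -> continuous f -> continuous f' ->
  continuous (fun t => g (f t, f' t)).
Proof.
move=> cg c1 c2 t.
apply: (@cvg_comp _ _ _ (fun t => (f t, f' t)) g _ (nbhs (f t, f' t))); last exact: cg.
exact: (cvg_pair (c1 t) (c2 t)).
Qed.

Lemma sin_pi_eq0 (d : R) : sin (pi * d) = 0 -> exists k : int, d = k%:~R.
Proof.
move=> h; have [k hk] := nearest_int d; exists k; apply/eqP; rewrite -subr_eq0 -normr_le0.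
by apply: le_trans (sn_near hk) _; rewrite /sn h normr0.
Qed.

Lemma cos_2pi_eq1 (d : R) : cos (2 * pi * d) = 1 -> exists k : int, d = k%:~R.
Proof.
move=> h; apply: sin_pi_eq0; apply/eqP; rewrite -sqrf_eq0.
have E : 2 * pi * d = (pi * d) *+ 2 by rewrite -[RHS]mulr_natl mulrA.
move: h; rewrite E cos_mulr2n -[_ ^+ 2 *+ 2]mulr_natl => h.
by have := cos2Dsin2 (pi * d) => h2; apply/eqP; lra.
Qed.

Lemma sin_2piD (d : R) (k : int) : sin (2 * pi * (d + k%:~R)) = sin (2 * pi * d).
Proof. by have := exDint d k; rewrite /ex => -[]. Qed.

Lemma cos_2piD (d : R) (k : int) : cos (2 * pi * (d + k%:~R)) = cos (2 * pi * d).
Proof. by have := exDint d k; rewrite /ex => -[]. Qed.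

Lemma sin_2pi_half (d : R) : sin (2 * pi * (d + 1 / 2)) = - sin (2 * pi * d).
Proof. by have -> : 2 * pi * (d + 1 / 2) = 2 * pi * d + pi :> R; [by field|rewrite sinDpi]. Qed.

Lemma cos_2pi_half (d : R) : cos (2 * pi * (d + 1 / 2)) = - cos (2 * pi * d).
Proof. by have -> : 2 * pi * (d + 1 / 2) = 2 * pi * d + pi :> R; [by field|rewrite cosDpi]. Qed.

Lemma sin_2pi_gt0 (d : R) : 0 < d < 1 / 2 -> 0 < sin (2 * pi * d).
Proof.
move=> /andP[d0 d1]; apply: sin_gt0_pi; have p := pi_gt0 R; apply/andP; split.
  by rewrite !mulr_gt0.
nra.
Qed.

Lemma sin_2pi_le0 (d : R) : 1 / 2 <= d <= 1 -> sin (2 * pi * d) <= 0.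
Proof.
move=> /andP[d0 d1]; have -> : d = d - 1 / 2 + 1 / 2 by rewrite subrK.
rewrite sin_2pi_half oppr_le0; apply: sin_ge0_pi; have p := pi_gt0 R; apply/andP; split; nra.
Qed.

End Topology.

Section Lift.
Variables (R : realType) (lam E : R) (psi : R * R -> R).
Hypothesis hpsi : is_fibered_lift (amo_cocycle lam E) psi.

Definition pot (x : R) : R := E - 2 * lam * cos (2 * pi * x).
Definition lmap (x y : R) : R := y + psi (x, y).

Lemma lift_eq x y : exists2 r, 0 < r &
  pot x * cos (2 * pi * y) - sin (2 * pi * y) = r * cos (2 * pi * lmap x y) /\
  cos (2 * pi * y) = r * sin (2 * pi * lmap x y).
Proof.
have [_ _ _ /(_ x y) /=] := hpsi; set v := _ *m _ => h.
have v0 : v ord0 ord0 = pot x * cos (2 * pi * y) - sin (2 * pi * y).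
  by rewrite /v !mxE !big_ord_recl big_ord0 !mxE /= /pot; ring.
have v1 : v (lift ord0 ord0) ord0 = cos (2 * pi * y).
  by rewrite /v !mxE !big_ord_recl big_ord0 !mxE /=; ring.
have n0 : 0 < eucl_norm2 v.
  rewrite /eucl_norm2 sqrtr_gt0 !big_ord_recl big_ord0 addr0 v0 v1.
  have := cos2Dsin2 (2 * pi * y); set cc := cos _; set ss := sin _ => e.
  rewrite lt_neqAle addr_ge0 ?sqr_ge0 // andbT eq_sym paddr_eq0 ?sqr_ge0 // !sqrf_eq0.
  apply/negP => /andP[/eqP e1 /eqP e2]; move: e1 e; rewrite e2 mulr0 sub0r => /eqP.
  by rewrite oppr_eq0 => /eqP ->; rewrite expr0n addr0 => /eqP; rewrite eq_sym oner_eq0.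
exists (eucl_norm2 v) => //; rewrite -v0 -v1.
have e (i : 'I_2) : v i ord0 = eucl_norm2 v * circle_pt (lmap x y) i ord0.
  by rewrite -h [X in _ * X]mxE mulVKf // gt_eqF.
by rewrite !e !mxE.
Qed.

(** The matrix has determinant 1 and preserves the cross product of two vectors; normalization only
    changes it by a positive factor. *)
Lemma lift_cross x y y' : exists2 r, 0 < r &
  r * sin (2 * pi * (lmap x y' - lmap x y)) = sin (2 * pi * (y' - y)).
Proof.
have [r r0 [e1 e2]] := lift_eq x y; have [r' r0' [e1' e2']] := lift_eq x y'.
exists (r * r'); first exact: mulr_gt0.
rewrite !mulrBr !sinB.
have -> : r * r' * (sin (2 * pi * lmap x y') * cos (2 * pi * lmap x y) -
    cos (2 * pi * lmap x y') * sin (2 * pi * lmap x y)) =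
  (r' * sin (2 * pi * lmap x y')) * (r * cos (2 * pi * lmap x y)) -
  (r' * cos (2 * pi * lmap x y')) * (r * sin (2 * pi * lmap x y)) by ring.
rewrite -e1 -e2 -e1' -e2'; ring.
Qed.

Lemma lmap_continuous (f f' : R -> R) : continuous f -> continuous f' -> continuous (fun t => lmap (f t) (f' t)).
Proof.
move=> cf cf'; have [cpsi _ _ _] := hpsi.
by apply: contD => //; exact: (continuous_pair_comp cpsi cf cf').
Qed.

(** Opposite vectors have opposite images, so psi(x, y + 1/2) - psi(x, y) is a constant integer; two
    half turns make a period, so it is 0. *)
Lemma lift_half x y : psi (x, y + 1 / 2) = psi (x, y).
Proof.
have [cpsi _ per _] := hpsi.
pose h y := psi (x, y + 1 / 2) - psi (x, y).
have ch : continuous h.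
  apply: contB; apply: (continuous_pair_comp cpsi); try exact: cont_cst; last exact: cont_id.
  by apply: contD; [exact: cont_id|exact: cont_cst].
have hz t : exists k : int, h t = k%:~R.
  have [r r0 [e1 e2]] := lift_eq x t; have [r' r0' [e1' e2']] := lift_eq x (t + 1 / 2).
  move: e1' e2'; rewrite cos_2pi_half sin_2pi_half mulrN -opprB opprK [X in - X](_ : _ = pot x * cos (2 * pi * t) - sin (2 * pi * t)); last ring.
  rewrite e1 e2 => e1' e2'.
  have hd : lmap x (t + 1 / 2) - (lmap x t + 1 / 2) = h t by rewrite /lmap /h; ring.
  apply: cos_2pi_eq1; rewrite -hd mulrBr cosB cos_2pi_half sin_2pi_half.
  set c1 := cos (2 * pi * lmap x t) in e1' *; set s1 := sin (2 * pi * lmap x t) in e2' *.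
  set c2 := cos (2 * pi * lmap x (t + 1 / 2)) in e1' *; set s2 := sin (2 * pi * lmap x (t + 1 / 2)) in e2' *.
  have n1 : c1 ^+ 2 + s1 ^+ 2 = 1 by exact: cos2Dsin2.
  have n2 : c2 ^+ 2 + s2 ^+ 2 = 1 by exact: cos2Dsin2.
  have rr : r = r'.
    apply/eqP; rewrite -(eqrXn2 (n := 2)) ?ltW //; apply/eqP.
    have -> : r ^+ 2 = (r * c1) ^+ 2 + (r * s1) ^+ 2 by rewrite !exprMn -mulrDr n1 mulr1.
    have -> : r' ^+ 2 = (r' * c2) ^+ 2 + (r' * s2) ^+ 2 by rewrite !exprMn -mulrDr n2 mulr1.
    by rewrite -e1' -e2' !sqrrN.
  have rn : r != 0 by rewrite gt_eqF.
  have -> : c2 = - c1 by apply: (mulfI rn); rewrite mulrN e1' rr.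
  have -> : s2 = - s1 by apply: (mulfI rn); rewrite mulrN e2' rr.
  by rewrite -n1; ring.
have e : h (y + 1 / 2) + h y = 0.
  rewrite /h; have -> : y + 1 / 2 + 1 / 2 = y + 1 by field.
  by rewrite per; ring.
move: e; rewrite (int_valued_const ch hz (y + 1 / 2) y) /h; lra.
Qed.

Lemma lift_half_int x y (k : int) : psi (x, y + k%:~R / 2) = psi (x, y).
Proof.
have hn (n : nat) y' : psi (x, y' + n%:R / 2) = psi (x, y').
  elim: n y' => [|n IH] y'; first by rewrite mul0r addr0.
  have -> : y' + n.+1%:R / 2 = y' + n%:R / 2 + 1 / 2 by rewrite -natr1; ring.
  by rewrite lift_half IH.
case: k => n; first exact: hn.
by rewrite -(hn n.+1 (y + _)) NegzE intrN mulNr subrK.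
Qed.

Lemma lmap_half_int x y (k : int) : lmap x (y + k%:~R / 2) = lmap x y + k%:~R / 2.
Proof. by rewrite /lmap lift_half_int; ring. Qed.

(** The sine of the angle difference stays positive for 0 < t < 1/2, so the difference, which starts
    at 0, cannot become negative without crossing - 1/4. *)
Lemma lmap_lt_near x y t : 0 < t < 1 / 2 -> lmap x y < lmap x (y + t).
Proof.
move=> /andP[t0 t1]; pose d t := lmap x (y + t) - lmap x y.
have cd : continuous d.
  apply: contB; last exact: cont_cst.
  apply: lmap_continuous; first exact: cont_cst.
  by apply: contD; [exact: cont_cst|exact: cont_id].
have pos s : 0 < s < 1 / 2 -> 0 < sin (2 * pi * d s).
  move=> hs; have [r r0 e] := lift_cross x y (y + s).
  have : 0 < r * sin (2 * pi * d s) by rewrite /d e addrC addKr; exact: sin_2pi_gt0.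
  by rewrite pmulr_rgt0.
suff : 0 < d t by rewrite subr_gt0.
rewrite ltNge; apply/negP => dt0.
have := pos t; rewrite t0 t1 => /(_ isT) dt1.
have dlt : d t < - (1 / 2).
  rewrite ltNge; apply/negP => h.
  have : sin (2 * pi * (d t + 1%:~R)) <= 0 by apply: sin_2pi_le0; lra.
  by rewrite sin_2piD leNgt dt1.
have d0 : d 0 = 0 by rewrite /d addr0 subrr.
have [|s [/andP[s0 s1] hs]] := @ivt_interval R d 0 t (- (1 / 4)) (ltW t0) cd.
  by rewrite d0; apply/orP; right; apply/andP; split; lra.
have s0' : 0 < s.
  rewrite lt_neqAle s0 andbT; apply/negP => /eqP s00; move: hs; rewrite -s00 d0; lra.
have := pos s; rewrite s0' (le_lt_trans s1 t1) => /(_ isT); rewrite hs.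
have -> : - (1 / 4) = 3 / 4 + (-1)%:~R :> R by field.
rewrite sin_2piD => h; have : sin (2 * pi * (3 / 4)) <= 0 :> R by apply: sin_2pi_le0; lra.
by rewrite leNgt h.
Qed.

Lemma lmap_lt x y y' : y < y' -> lmap x y < lmap x y'.
Proof.
move=> yy; pose k : int := Num.floor (2 * (y' - y)).
have /andP[k1 k2] := floor_itv (2 * (y' - y)); rewrite -/k intrD in k1 k2.
have k0 : 0 <= k.
  have : -1 < k%:~R :> R by lra.
  by rewrite (ltr_int R (-1)); clear; lia.
pose t := y' - y - k%:~R / 2.
have -> : y' = y + t + k%:~R / 2 by rewrite /t; ring.
rewrite lmap_half_int.
have t0 : 0 <= t < 1 / 2 by rewrite /t; apply/andP; split; lra.
have [tz|tnz] := eqVneq t 0.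
  rewrite tz addr0 ltrDl divr_gt0 // ltr0z lt_neqAle k0 andbT eq_sym; apply/negP => /eqP kz.
  by move: tz yy; rewrite /t kz mul0r subr0 => /eqP; rewrite subr_eq0 => /eqP ->; rewrite ltxx.
have := @lmap_lt_near x y t; rewrite lt_neqAle eq_sym tnz; case/andP: t0 => -> -> /(_ isT) h.
by apply: lt_le_trans h _; rewrite lerDl divr_ge0 // ler0z.
Qed.

Lemma lmap_le x y y' : y <= y' -> lmap x y <= lmap x y'.
Proof. by rewrite le_eqVlt => /orP[/eqP ->//|/lmap_lt h]; exact: ltW. Qed.

End Lift.

Lemma cvg_dist (R : realType) (u : nat -> R) (l e : R) : u @ \oo --> l -> 0 < e ->
  exists N, forall n, (N <= n)%N -> `|u n - l| < e.
Proof.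
move=> /cvgrPdist_lt h e0; have [N _ hN] := h e e0.
by exists N => n Nn; rewrite distrC; exact: hN.
Qed.

Section Orbit.
Variables (R : realType) (alpha : R) (psi : R * R -> R).

Definition orb (n : nat) (x y : R) : R := (iter n (fibered_lift_map alpha psi) (x, y)).2.

Lemma iter_fst n x y : (iter n (fibered_lift_map alpha psi) (x, y)).1 = x + n%:R * alpha.
Proof.
elim: n => [|n IH]; first by rewrite mul0r addr0.
by rewrite iterS /= IH -natr1; ring.
Qed.

Lemma orbS n x y : orb n.+1 x y = lmap psi (x + n%:R * alpha) (orb n x y).
Proof.
rewrite /orb iterS /= /lmap -(iter_fst n x y).
by case: (iter n _ _).
Qed.

Lemma orb_sum n x y : \sum_(0 <= k < n) psi (iter k (fibered_lift_map alpha psi) (x, y)) = orb n x y - y.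
Proof.
elim: n => [|n IH]; first by rewrite big_nil /orb /= subrr.
by rewrite big_nat_recr //= IH /orb iterS /=; ring.
Qed.

End Orbit.

(** * Two energies with the same rotation number *)

Section TwoEnergies.
Variables (R : realType) (alpha lam E1 E2 : R) (psi1 psi2 : R * R -> R).
Hypothesis hp1 : is_fibered_lift (amo_cocycle lam E1) psi1.
Hypothesis hp2 : is_fibered_lift (amo_cocycle lam E2) psi2.
Hypothesis E12 : E1 < E2.

(** The two matrices differ only in the corner entry, by E2 - E1. *)
Lemma two_cross x y : exists2 r, 0 < r &
  r * sin (2 * pi * (lmap psi1 x y - lmap psi2 x y)) = (E2 - E1) * cos (2 * pi * y) ^+ 2.
Proof.
have [r r0 [e1 e2]] := lift_eq hp1 x y; have [r' r0' [e1' e2']] := lift_eq hp2 x y.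
exists (r * r'); first exact: mulr_gt0.
rewrite mulrBr sinB.
have -> : r * r' * (sin (2 * pi * lmap psi1 x y) * cos (2 * pi * lmap psi2 x y) -
    cos (2 * pi * lmap psi1 x y) * sin (2 * pi * lmap psi2 x y)) =
  (r * sin (2 * pi * lmap psi1 x y)) * (r' * cos (2 * pi * lmap psi2 x y)) -
  (r * cos (2 * pi * lmap psi1 x y)) * (r' * sin (2 * pi * lmap psi2 x y)) by ring.
rewrite -e1 -e2 -e1' -e2' /pot; ring.
Qed.

Lemma frac_const (f : R -> R) (a b : R) (k : int) : continuous f ->
  (forall t, exists k : int, k%:~R <= f t < k%:~R + 1 / 2) ->
  k%:~R <= f a < k%:~R + 1 / 2 -> k%:~R <= f b < k%:~R + 1 / 2.
Proof.
move=> cf hf /andP[a1 a2]; have [j /andP[b1 b2]] := hf b.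
have no (i : int) t : f t <> i%:~R - 1 / 4.
  move=> e; have [i' /andP[h1 h2]] := hf t; rewrite e in h1 h2.
  have l1 : i'%:~R < i%:~R :> R by lra.
  have l2 : (i - 1)%:~R < i'%:~R :> R by rewrite intrD; lra.
  move: l1 l2; rewrite !ltr_int; clear; lia.
have [jk|kj|<-] := ltgtP j k; last by rewrite b1 b2.
  have jk' : (j + 1)%:~R <= k%:~R :> R by rewrite ler_int; move: jk; clear; lia.
  rewrite intrD in jk'.
  have [|t /no//] := @ivt_between R f b a (k%:~R - 1 / 4) cf.
  by apply/andP; split; lra.
have jk' : (k + 1)%:~R <= j%:~R :> R by rewrite ler_int; move: kj; clear; lia.
rewrite intrD in jk'.
have [|t /no//] := @ivt_between R f a b (j%:~R - 1 / 4) cf.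
by apply/andP; split; lra.
Qed.

(** A nonnegative sine puts the difference in [k, k + 1/2]. At the endpoint k + 1/2 the vector would
    be vertical, but both matrices send a vertical vector to the same image. *)
Lemma lift_gap_at x y : exists k : int, k%:~R <= lmap psi1 x y - lmap psi2 x y < k%:~R + 1 / 2 /\
  (cos (2 * pi * y) != 0 -> k%:~R < lmap psi1 x y - lmap psi2 x y).
Proof.
set e := lmap psi1 x y - lmap psi2 x y.
have [r r0 hr] := two_cross x y; rewrite -/e in hr.
have dE : 0 < E2 - E1 by rewrite subr_gt0.
have se0 : 0 <= sin (2 * pi * e).
  by rewrite -(pmulr_rge0 _ r0) hr mulr_ge0 ?sqr_ge0 // ltW.
pose k : int := Num.floor e; have /andP[k1 k2] := floor_itv e; rewrite -/k intrD in k1 k2.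
have ek : sin (2 * pi * e) = sin (2 * pi * (e - k%:~R)).
  by rewrite -(sin_2piD (e - k%:~R) k) subrK.
have sin0 : sin (2 * pi * e) = 0 -> cos (2 * pi * y) = 0.
  move=> s0; move: hr; rewrite s0 mulr0 => /esym/eqP; rewrite mulf_eq0 gt_eqF //= sqrf_eq0.
  by move/eqP.
exists k; split; last first.
  move=> cy; rewrite lt_neqAle k1 andbT; apply/negP => /eqP ke.
  by move/eqP: cy; apply; apply: sin0; rewrite ek ke subrr mulr0 sin0.
rewrite k1 /= ltNge; apply/negP => h.
have s0 : sin (2 * pi * e) = 0.
  apply/eqP; rewrite eq_le se0 andbT ek; apply: sin_2pi_le0; lra.
have cy := sin0 s0.
have [e12|ne] := eqVneq e (k%:~R + 1 / 2); last first.
  have : 0 < sin (2 * pi * (e - k%:~R - 1 / 2)).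
    by apply: sin_2pi_gt0; move: ne h; rewrite neq_lt => /orP[]; lra.
  have := sin_2pi_half (e - k%:~R - 1 / 2); rewrite subrK -ek s0 => /eqP.
  by rewrite eq_sym oppr_eq0 => /eqP ->; rewrite ltxx.
have [r1 r10 [a1 a2]] := lift_eq hp1 x y; have [r2 r20 [b1 b2]] := lift_eq hp2 x y.
rewrite cy in a1 a2 b1 b2.
have : cos (2 * pi * e) = -1.
  rewrite e12 cos_2pi_half; congr (- _); by rewrite -[k%:~R]add0r cos_2piD mulr0 cos0.
rewrite /e mulrBr cosB.
have -> : sin (2 * pi * lmap psi1 x y) = 0.
  by move/esym/eqP: a2; rewrite mulf_eq0 gt_eqF //= => /eqP.
rewrite mul0r addr0 => hc.
have : 0 <= (r1 * cos (2 * pi * lmap psi1 x y)) * (r2 * cos (2 * pi * lmap psi2 x y)).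
  by rewrite -a1 -b1 !mulr0; exact: sqr_ge0.
have -> : r1 * cos (2 * pi * lmap psi1 x y) * (r2 * cos (2 * pi * lmap psi2 x y)) =
   r1 * r2 * (cos (2 * pi * lmap psi1 x y) * cos (2 * pi * lmap psi2 x y)) by ring.
by rewrite hc mulrN1 oppr_ge0 leNgt mulr_gt0.
Qed.

Lemma lift_gap : exists k : int, forall x y, k%:~R <= lmap psi1 x y - lmap psi2 x y < k%:~R + 1 / 2 /\
  (cos (2 * pi * y) != 0 -> k%:~R < lmap psi1 x y - lmap psi2 x y).
Proof.
have [k [hk _]] := lift_gap_at 0 0; exists k => x y.
pose f t := lmap psi1 (x * t) (y * t) - lmap psi2 (x * t) (y * t).
have c1 z : continuous (fun t : R => z * t) by apply: contM; [exact: cont_cst|exact: cont_id].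
have cf : continuous f by apply: contB; [apply: (lmap_continuous hp1)|apply: (lmap_continuous hp2)]; exact: c1.
have h : k%:~R <= f 1 < k%:~R + 1 / 2.
  apply: (@frac_const f 0 1) => //; last by rewrite /f !mulr0.
  by move=> t; have [j [hj _]] := lift_gap_at (x * t) (y * t); exists j.
rewrite /f !mulr1 in h; split=> // cy.
have [j [/andP[j1 j2] /(_ cy) j3]] := lift_gap_at x y.
suff -> : k = j by [].
case/andP: h => h1 h2.
have l1 : (k - 1)%:~R < j%:~R :> R by rewrite intrD; lra.
have l2 : (j - 1)%:~R < k%:~R :> R by rewrite intrD; lra.
by move: l1 l2; rewrite !ltr_int; clear; lia.
Qed.

Variables (x0 r : R).
Hypothesis lim1 : (fun n : nat => n%:R^-1 *
   \sum_(0 <= k < n) psi1 (iter k (fibered_lift_map alpha psi1) (x0, 0))) @ \oo --> r.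
Hypothesis lim2 : (fun n : nat => n%:R^-1 *
   \sum_(0 <= k < n) psi2 (iter k (fibered_lift_map alpha psi2) (x0, 0))) @ \oo --> r.

Local Notation Y1 n := (orb alpha psi1 n x0 0).
Local Notation Y2 n := (orb alpha psi2 n x0 0).

Lemma orb_diff_small (e : R) : 0 < e -> exists N, forall n, (N <= n)%N -> `|Y1 n - Y2 n| <= e * n%:R.
Proof.
move=> e0; have e2 : 0 < e / 2 by rewrite divr_gt0.
have [N1 h1] := cvg_dist lim1 e2; have [N2 h2] := cvg_dist lim2 e2.
exists (maxn N1 N2).+1 => n hn.
have n1 : (N1 <= n)%N by clear -hn; lia.
have n2 : (N2 <= n)%N by clear -hn; lia.
have n0 : 0 < n%:R :> R by rewrite ltr0n; clear -hn; lia.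
have := ltrD (h1 n n1) (h2 n n2); rewrite !orb_sum !subr0 -splitr => h.
rewrite -ler_pdivrMr // -[X in _ / X](gtr0_norm n0) -normfV -normrM.
apply: le_trans (ltW h); apply: le_trans (ler_normB _ _).
by rewrite le_eqVlt; apply/orP; left; apply/eqP; congr (`|_|); ring.
Qed.

(** An integer k other than 0 would make the two orbits drift apart linearly, against the common
    rotation number. *)
Lemma lift_gap0 : forall x y, 0 <= lmap psi1 x y - lmap psi2 x y < 1 / 2 /\
  (cos (2 * pi * y) != 0 -> 0 < lmap psi1 x y - lmap psi2 x y).
Proof.
have [k hk] := lift_gap; suff k0 : k = 0 by move: hk; rewrite k0 add0r.
have bnd n : k%:~R * n%:R <= Y1 n - Y2 n <= (k%:~R + 1 / 2) * n%:R.
  elim: n => [|n /andP[h1 h2]]; first by rewrite /orb /= subrr !mulr0 lexx.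
  rewrite !orbS; set x := x0 + _.
  have [/andP[g1 g2] _] := hk x (Y2 n).
  apply/andP; split.
    have : lmap psi1 x (Y2 n + (2 * k * n%:Z)%:~R / 2) <= lmap psi1 x (Y1 n).
      apply: (lmap_le hp1); rewrite !intrM; lra.
    rewrite (lmap_half_int hp1) !intrM -natr1; move: (lmap psi1 x _) (lmap psi1 x _) (lmap psi2 x _) g1 => *; lra.
  have : lmap psi1 x (Y1 n) <= lmap psi1 x (Y2 n + ((2 * k + 1) * n%:Z)%:~R / 2).
    apply: (lmap_le hp1); rewrite !(intrD, intrM); lra.
  have nE : n.+1%:R = n%:R + 1 :> R by rewrite -natr1.
  by rewrite (lmap_half_int hp1) !(intrD, intrM) nE; move: (lmap psi1 x _) (lmap psi1 x _) (lmap psi2 x _) g2 => *; lra.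
have q0 : 0 < 1 / 4 :> R by lra.
have [N hN] := orb_diff_small q0.
have := hN N.+1 (leqnSn N); have := bnd N.+1.
have n0 : 0 < N.+1%:R :> R by rewrite ltr0n.
rewrite ler_norml => /andP[b1 b2] /andP[b3 b4].
have l1 : k%:~R <= 1 / 4 :> R by rewrite -(ler_pM2r n0); lra.
have l2 : - (1 / 4) <= k%:~R + 1 / 2 :> R by rewrite -(ler_pM2r n0); lra.
have l3 : k%:~R < 1%:~R :> R by lra.
have l4 : (-1)%:~R < k%:~R :> R by lra.
by move: l3 l4; rewrite !ltr_int; clear; lia.
Qed.

(** Half turns by which the orbit at E1 is ahead of the orbit at E2. This count never decreases and
    grows sublinearly, hence is constant on arbitrarily long stretches. *)
Definition turns n : int := Num.floor (2 * (Y1 n - Y2 n)).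

Lemma turnsP n : (turns n)%:~R / 2 <= Y1 n - Y2 n < (turns n)%:~R / 2 + 1 / 2.
Proof.
have /andP[] := floor_itv (2 * (Y1 n - Y2 n)); rewrite -/(turns n) intrD => h1 h2.
by apply/andP; split; lra.
Qed.

Lemma turnsS n : turns n <= turns n.+1.
Proof.
have /andP[h1 h2] := turnsP n; have /andP[h3 h4] := turnsP n.+1.
move: h3 h4; rewrite !orbS; set x := x0 + _ => h3 h4.
have [/andP[g1 g2] _] := lift_gap0 x (Y2 n).
have : lmap psi1 x (Y2 n + (turns n)%:~R / 2) <= lmap psi1 x (Y1 n).
  by apply: (lmap_le hp1); lra.
rewrite (lmap_half_int hp1) => h5.
have : (turns n)%:~R < (turns n.+1 + 1)%:~R :> R by rewrite intrD; lra.
by rewrite ltr_int; clear; lia.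
Qed.

Lemma turns_mono m n : (m <= n)%N -> turns m <= turns n.
Proof.
move=> /subnKC <-; elim: (n - m)%N => [|d IH]; first by rewrite addn0.
by rewrite addnS; apply: le_trans IH (turnsS _).
Qed.

Lemma turns_stretch (L : nat) : exists s, turns (s + L) = turns s.
Proof.
apply: contrapT => /forallNP H.
have [L0|L0] := posnP L; first by apply: (H 0%N); rewrite L0.
have t0 : turns 0 = 0 by rewrite /turns /orb /= subrr mulr0 floor0.
have key (j : nat) : j%:Z <= turns (j * L).
  elim: j => [|j IH]; first by rewrite mul0n t0.
  have := turns_mono (leq_addr L (j * L)); rewrite mulSn addnC => h.
  have := H (j * L)%N; rewrite addnC; move: IH h; clear; lia.
have Lr : 0 < L%:R :> R by rewrite ltr0n.
have e0 : 0 < (4 * L%:R)^-1 :> R by rewrite invr_gt0 mulr_gt0.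
have [N hN] := orb_diff_small e0.
pose j := N.+1; have jL : (N <= j * L)%N.
  by apply: leq_trans (leqnSn N) _; rewrite leq_pmulr.
have h1 := hN _ jL; have /andP[h2 _] := turnsP (j * L).
have h3 : j%:R <= (turns (j * L))%:~R :> R by rewrite -[j%:R]/(j%:Z%:~R) ler_int.
have h4 : (4 * L%:R)^-1 * (j * L)%:R = j%:R / 4 :> R by rewrite natrM; field; rewrite gt_eqF.
rewrite h4 in h1; have := le_trans (ler_norm _) h1.
have j1 : 1 <= j%:R :> R by rewrite ler1n.
lra.
Qed.

(** Subtracting the constant number of half turns leaves a difference in [0, 1/2). It is positive
    from the second step on: it can stay 0 only through a vertical vector, whose image is
    horizontal. *)
Lemma long_stretch (L : nat) : exists s (z1 z2 : nat -> R), [/\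
  forall n, z1 n.+1 = lmap psi1 (x0 + (s + n)%:R * alpha) (z1 n),
  forall n, z2 n.+1 = lmap psi2 (x0 + (s + n)%:R * alpha) (z2 n),
  forall n, (n <= L)%N -> 0 <= z1 n - z2 n < 1 / 2 &
  forall n, (2 <= n <= L)%N -> 0 < z1 n - z2 n].
Proof.
have [s hs] := turns_stretch L.
pose b := turns s.
have bn n : (n <= L)%N -> turns (s + n) = b.
  move=> nL; apply/eqP; rewrite eq_le (turns_mono (leq_addr _ _)) andbT.
  by rewrite /b -hs; apply: turns_mono; rewrite leq_add2l.
pose z1 n := Y1 (s + n) - b%:~R / 2; pose z2 n := Y2 (s + n).
have r1 n : z1 n.+1 = lmap psi1 (x0 + (s + n)%:R * alpha) (z1 n).
  rewrite /z1 addnS orbS.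
  have -> : - (b%:~R / 2) = (- b)%:~R / 2 :> R by rewrite intrN; ring.
  by rewrite (lmap_half_int hp1).
have r2 n : z2 n.+1 = lmap psi2 (x0 + (s + n)%:R * alpha) (z2 n) by rewrite /z2 addnS orbS.
have d n : (n <= L)%N -> 0 <= z1 n - z2 n < 1 / 2.
  move=> nL; have := turnsP (s + n); rewrite bn // /z1 /z2 => /andP[h1 h2]; apply/andP; split; lra.
exists s, z1, z2; split=> //.
have step n : 0 < z1 n - z2 n -> 0 < z1 n.+1 - z2 n.+1.
  move=> h; rewrite r1 r2; have [/andP[g1 _] _] := lift_gap0 (x0 + (s + n)%:R * alpha) (z2 n).
  have : lmap psi1 (x0 + (s + n)%:R * alpha) (z2 n) < lmap psi1 (x0 + (s + n)%:R * alpha) (z1 n).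
    by apply: (lmap_lt hp1); rewrite -subr_gt0.
  lra.
have cosgt n : z1 n = z2 n -> cos (2 * pi * z2 n) != 0 -> 0 < z1 n.+1 - z2 n.+1.
  by move=> e cn; rewrite r1 r2 e; have [_ h] := lift_gap0 (x0 + (s + n)%:R * alpha) (z2 n); exact: h.
move=> n /andP[n2 nL]; have L2 : (2 <= L)%N := leq_trans n2 nL.
have pos_or (i : nat) : (i <= L)%N -> 0 < z1 i - z2 i \/ z1 i = z2 i.
  move=> iL; have /andP[h _] := d i iL; have [->|ne] := eqVneq (z1 i) (z2 i); first by right.
  by left; rewrite lt_neqAle h andbT eq_sym subr_eq0.
have base : 0 < z1 2%N - z2 2%N.
  have [/step/step//|e0] := pos_or 0%N isT.
  have [/step//|e1] := pos_or 1%N (ltnW L2).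
  have c0 : cos (2 * pi * z2 0%N) = 0.
    by apply/eqP; apply/negPn/negP => /(cosgt 0%N e0); rewrite e1 subrr ltxx.
  apply: cosgt => //; have [r' r0' [_ e2']] := lift_eq hp2 (x0 + (s + 0)%:R * alpha) (z2 0%N).
  move: e2'; rewrite -r2 c0 => /esym/eqP; rewrite mulf_eq0 gt_eqF //= => /eqP s0.
  apply/negP => /eqP cc; have := cos2Dsin2 (2 * pi * z2 1%N).
  by rewrite s0 cc expr0n addr0 => /eqP; rewrite eq_sym oner_eq0.
by rewrite -(subnKC n2); elim: (n - 2)%N => [|i IH]; [rewrite addn0|rewrite addnS; exact: step].
Qed.

End TwoEnergies.

(** * Positive Wronskians and the lower bound for H - E in a gap *)

Section Window.
Variable R : realType.

(** A factorization of the form (H - E1)(H - E2): each summand is a square over the product of two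
    consecutive Wronskians plus the increment of [t], which vanishes at both ends together with
    [phi]. *)
Lemma wronskian_window (u v w phi : nat -> R) (E1 E2 : R) (M : nat) : E1 < E2 ->
  (forall i, u i.+2 = (E1 - w i.+1) * u i.+1 - u i) ->
  (forall i, v i.+2 = (E2 - w i.+1) * v i.+1 - v i) ->
  (forall i, (2 <= i <= M)%N -> 0 < u i * v i.+1 - u i.+1 * v i) ->
  (2 <= M)%N -> phi 2%N = 0 -> phi 3%N = 0 -> phi M = 0 -> phi M.+1 = 0 ->
  0 <= \sum_(2 <= i < M) (phi i.+2 + phi i + (w i.+1 - E1) * phi i.+1) *
                         (phi i.+2 + phi i + (w i.+1 - E2) * phi i.+1).
Proof.
move=> E12 hu hv hW M2 p2 p3 pM pM1.
pose W i := u i * v i.+1 - u i.+1 * v i.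
pose t i := (E2 - E1) * (phi i.+1 * u i - phi i * u i.+1) * (phi i.+1 * v i - phi i * v i.+1) / W i.
have t2 : t 2%N = 0 by rewrite /t p2 p3 !(mul0r, subr0, mulr0).
have tM : t M = 0 by rewrite /t pM pM1 !(mul0r, subr0, mulr0).
have tel : \sum_(2 <= i < M) (t i.+1 - t i) = 0 by rewrite telescope_sumr // t2 tM subrr.
rewrite -[leLHS]tel big_nat [leRHS]big_nat; apply: ler_sum => i /andP[i2 iM].
have W0 : 0 < W i by apply: hW; rewrite i2 ltnW.
have W1 : 0 < W i.+1 by apply: hW; rewrite iM (leq_trans i2).
have W0' : W i != 0 by rewrite gt_eqF.
have W1' : W i.+1 != 0 by rewrite gt_eqF.
pose c := phi i.+2 * W i + phi i * W i.+1 - phi i.+1 * (u i * v i.+2 - u i.+2 * v i).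
have -> : (phi i.+2 + phi i + (w i.+1 - E1) * phi i.+1) * (phi i.+2 + phi i + (w i.+1 - E2) * phi i.+1) =
   c ^+ 2 / (W i * W i.+1) + (t i.+1 - t i).
  move: W0' W1'; rewrite /c /t /W hu hv.
  move: (u i) (u i.+1) (v i) (v i.+1) (phi i) (phi i.+1) (phi i.+2) (w i.+1) => u0 u1 v0 v1 q0 q1 q2 w1 W0' W1'.
  by field; rewrite W0' W1'.
by rewrite lerDr divr_ge0 ?sqr_ge0 // mulr_ge0 // ltW.
Qed.

Lemma zsumS (V : nmodType) W (F : int -> V) : zsum W.+1 F = F (- W.+1%:Z) + zsum W F + F W.+1%:Z.
Proof.
rewrite /zsum; have -> : (2 * W.+1).+1 = (2 * W).+3 by clear; lia.
rewrite big_ord_recr big_ord_recl /= sub0r; congr (F _ + _ + F _).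
  by apply: eq_bigr => i _; congr F; rewrite /= /bump leq0n; clear; lia.
by clear; lia.
Qed.

Lemma zsum_widen (V : nmodType) W W' (F : int -> V) : (W <= W')%N ->
  (forall n, (W < `|n|)%N -> F n = 0) -> zsum W' F = zsum W F.
Proof.
move=> /subnKC <- h; elim: (W' - W)%N => [|d IH]; first by rewrite addn0.
rewrite addnS zsumS IH !h ?addr0 ?add0r //; clear; lia.
Qed.

Lemma cont_zsum W (F : R -> int -> R) : (forall n, continuous (F^~ n)) -> continuous (fun t => zsum W (F t)).
Proof.
move=> cF; rewrite /zsum; elim: (2 * W).+1 => [|m IH].
  have -> : (fun t => \sum_(i < 0) F t (i%:Z - W%:Z)) = (fun=> 0) by apply: funext => t; rewrite big_ord0.
  exact: cont_cst.
have -> : (fun t => \sum_(i < m.+1) F t (i%:Z - W%:Z)) = (fun t => \sum_(i < m) F t (i%:Z - W%:Z) + F t (m%:Z - W%:Z)).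
  by apply: funext => t; rewrite big_ord_recr.
by apply: contD => //; exact: cF.
Qed.

(** For a Dirichlet denominator q, multiples of q alpha advance by a step smaller than e and sweep
    the circle in a number of steps that does not depend on y; [sg] is the direction of the
    sweep. *)
Lemma dense_orbit (alpha : R) (e : R) : not_rational alpha -> 0 < e ->
  exists N, forall y, exists n (k : int), (n <= N)%N /\ `|y - n%:R * alpha - k%:~R| < e.
Proof.
move=> irr e0; have [K hK] := archi_nat e^-1.
have K0 : (0 < K)%N by rewrite -(ltr_nat R); apply: lt_trans hK; rewrite invr_gt0.
have [q [p [/andP[q0 qK] hqp]]] := @dirichlet R alpha K K0.
set d := q%:R * alpha - p%:~R in hqp.
have dne : d != 0 by rewrite subr_eq0; exact: irr.
have d0 : 0 < `|d| by rewrite normr_gt0.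
have de : `|d| < e.
  apply: lt_trans hqp _; rewrite -[ltRHS]invrK ltf_pV2 ?posrE ?invr_gt0 ?ltr0n //.
have [m hm] := archi_nat (`|d|^-1).
exists (m * q)%N => y.
pose sg : R := Num.sg d; have dE : d = sg * `|d| by rewrite -numEsg.
have sg1 : sg = 1 \/ sg = -1.
  by rewrite /sg; case: sgrP dne => // _ _; [left|right].
pose k : int := Num.floor (sg * y).
have /andP[k1 k2] := floor_itv (sg * y); rewrite -/k intrD in k1 k2.
pose yf := sg * y - k%:~R.
have yf0 : 0 <= yf / `|d| by rewrite divr_ge0 // /yf subr_ge0.
pose j := Num.truncn (yf / `|d|).
have /andP[j1 j2] := truncn_itv yf0; rewrite -/j in j1 j2.
have jm : (j <= m)%N.
  rewrite -ltnS -(ltr_nat R); apply: le_lt_trans j1 _; apply: lt_trans (_ : m%:R < _); last by rewrite ltr_nat.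
  apply: le_lt_trans hm; rewrite ler_pdivrMr // mulVf ?gt_eqF //; rewrite /yf; lra.
rewrite ler_pdivlMr // in j1; rewrite ltr_pdivrMr // -natr1 mulrDl mul1r in j2.
have hf : `|yf - j%:R * `|d| | < e.
  by rewrite ger0_norm ?subr_ge0 //; apply: lt_trans de; rewrite ltrBlDl.
pose sz : int := if sg == 1 then 1 else -1.
have szE : sz%:~R = sg by rewrite /sz; case: sg1 => ->; rewrite ?eqxx //; case: eqP => // h; move: h; lra.
exists (j * q)%N, (sz * k - j%:Z * p); split; first by rewrite leq_mul2r jm orbT.
have -> : y - (j * q)%:R * alpha - (sz * k - j%:Z * p)%:~R = sg * (yf - j%:R * `|d|).
  have ss : sg * sg = 1 by case: sg1 => ->; ring.
  rewrite intrD intrN !intrM szE natrM.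
  have -> : sg * (yf - j%:R * `|d|) = (sg * sg) * y - sg * k%:~R - j%:R * (sg * `|d|) by rewrite /yf; ring.
  by rewrite -dE ss /d; ring.
by rewrite normrM; case: sg1 => ->; rewrite ?normrN normr1 mul1r.
Qed.

Lemma solution_of_orbit (lam E : R) (psi : R * R -> R) (x z : nat -> R) :
  is_fibered_lift (amo_cocycle lam E) psi -> (forall n, z n.+1 = lmap psi (x n) (z n)) ->
  exists u P : nat -> R, (forall n, u n.+2 = pot lam E (x n) * u n.+1 - u n) /\
   forall n, [/\ 0 < P n, u n.+1 = P n * cos (2 * pi * z n) & u n = P n * sin (2 * pi * z n)].
Proof.
move=> hp hz.
pose st := fix st n : R * R := if n is n'.+1 then (pot lam E (x n') * (st n').1 - (st n').2, (st n').1)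
   else (cos (2 * pi * z 0%N), sin (2 * pi * z 0%N)).
have hst n : exists P, [/\ 0 < P, (st n).1 = P * cos (2 * pi * z n) & (st n).2 = P * sin (2 * pi * z n)].
  elim: n => [|n [P [P0 e1 e2]]]; first by exists 1; rewrite !mul1r.
  have [r r0 [f1 f2]] := lift_eq hp (x n) (z n); rewrite -hz in f1 f2.
  exists (P * r); split; first exact: mulr_gt0.
    have -> : (st n.+1).1 = pot lam E (x n) * (st n).1 - (st n).2 by [].
    by rewrite e1 e2 -[RHS]mulrA -f1; ring.
  have -> : (st n.+1).2 = (st n).1 by [].
  by rewrite e1 f2 mulrA.
have [P hP] := choice hst.
exists (fun n => (st n).2), P; split=> // n.
Qed.

End Window.

Section GapBound.
Variables (R : realType) (alpha lam E1 E2 : R) (psi1 psi2 : R * R -> R) (x0 r : R).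
Hypothesis irr : not_rational alpha.
Hypothesis hp1 : is_fibered_lift (amo_cocycle lam E1) psi1.
Hypothesis hp2 : is_fibered_lift (amo_cocycle lam E2) psi2.
Hypothesis E12 : E1 < E2.
Hypothesis lim1 : (fun n : nat => n%:R^-1 *
   \sum_(0 <= k < n) psi1 (iter k (fibered_lift_map alpha psi1) (x0, 0))) @ \oo --> r.
Hypothesis lim2 : (fun n : nat => n%:R^-1 *
   \sum_(0 <= k < n) psi2 (iter k (fibered_lift_map alpha psi2) (x0, 0))) @ \oo --> r.

Lemma wronskian_stretch L : exists s (u v : nat -> R), [/\
  forall n, u n.+2 = pot lam E1 (x0 + (s + n)%:R * alpha) * u n.+1 - u n,
  forall n, v n.+2 = pot lam E2 (x0 + (s + n)%:R * alpha) * v n.+1 - v n &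
  forall n, (2 <= n <= L)%N -> 0 < u n * v n.+1 - u n.+1 * v n].
Proof.
have [s [z1 [z2 [h1 h2 h3 h4]]]] := long_stretch hp1 hp2 E12 lim1 lim2 L.
have [u [P [hu hP]]] := solution_of_orbit (x := fun n => x0 + (s + n)%:R * alpha) hp1 h1.
have [v [Q [hv hQ]]] := solution_of_orbit (x := fun n => x0 + (s + n)%:R * alpha) hp2 h2.
exists s, u, v; split=> // n /andP[n2 nL].
have [P0 e1 e2] := hP n; have [Q0 f1 f2] := hQ n.
rewrite e1 e2 f1 f2.
have -> : P n * sin (2 * pi * z1 n) * (Q n * cos (2 * pi * z2 n)) - P n * cos (2 * pi * z1 n) * (Q n * sin (2 * pi * z2 n))
  = P n * Q n * sin (2 * pi * (z1 n - z2 n)) by rewrite mulrBr sinB; ring.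
rewrite !mulr_gt0 //; apply: sin_2pi_gt0.
have /andP[_ ->] := h3 n nL; rewrite andbT; apply: h4; by rewrite n2.
Qed.

Definition gap_form (phi : int -> R) (x : R) (n : int) : R :=
  (almost_mathieu lam alpha x phi n - E1 * phi n) * (almost_mathieu lam alpha x phi n - E2 * phi n).

(** Positivity is available only where the Wronskian is positive, on stretches of one orbit. A
    negative value would persist at phases near x, and a long enough stretch contains a translate of
    the support at such a phase. *)
Lemma gap_form_ge0 (phi : int -> R) (W : nat) (x : R) : (forall n, (W < `|n|)%N -> phi n = 0) ->
  0 <= zsum W.+1 (gap_form phi x).
Proof.
move=> hphi; rewrite leNgt; apply/negP => hneg.
pose f y := zsum W.+1 (gap_form phi y).
have cf : continuous f.
  apply: cont_zsum => n; have c1 E : continuous (fun y => almost_mathieu lam alpha y phi n - E * phi n).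
    apply: contB; last exact: cont_cst.
    apply: contD; first exact: cont_cst.
    apply: contM; last exact: cont_cst.
    apply: contM; first exact: cont_cst.
    by apply: cont_cos2pi; apply: contD; [exact: cont_id|exact: cont_cst].
  by apply: contM; exact: c1.
have fper y (k : int) : f (y + k%:~R) = f y.
  apply: eq_zsum => n _; rewrite /gap_form /almost_mathieu.
  by have -> : y + k%:~R + n%:~R * alpha = y + n%:~R * alpha + k%:~R; [ring|rewrite cos_2piD].
have fpos_d : 0 < - f x by rewrite oppr_gt0.
have [e /= e0 he] : exists2 e, 0 < e & forall y, `|x - y| < e -> f y < 0.
  have /cvgrPdist_lt/(_ _ fpos_d) := cf x.
  move=> /nbhs_ballP[e /= e0 he]; exists e => // y xy.
  have := he y xy; rewrite /= ltr_norml => /andP[h _]; move: h; rewrite opprK; lra.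
have [N hN] := dense_orbit irr e0.
pose L := (2 * (W + 6 + N))%N.
have [s [u [v [hu hv hW]]]] := wronskian_stretch L.
have [i [k [iN hik]]] := hN (x - x0 - (s + W + 5)%:R * alpha).
pose c := (W + 6 + i)%N; pose y := x0 + (s + W + 5 + i)%:R * alpha.
have fy : f y < 0.
  rewrite -(fper y k); apply: he.
  have -> : x - (y + k%:~R) = x - x0 - (s + W + 5)%:R * alpha - i%:R * alpha - k%:~R; last by [].
  by rewrite /y natrD; ring.
pose w (j : nat) := 2 * lam * cos (2 * pi * (x0 + (s + j.-1)%:R * alpha)).
pose M := (2 * (c - 3) + 3)%N.
pose ph (j : nat) := phi (j%:Z - c%:Z).
have ph0 j : (j + W < c)%N || (c + W < j)%N -> ph j = 0.
  by move=> h; apply: hphi; move: h; clear; lia.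
have := @wronskian_window R u v w ph E1 E2 M E12 hu hv.
have cW : (W + 6 <= c)%N by rewrite /c leq_addr.
have cM : (c <= W + 6 + N)%N by rewrite /c leq_add2l.
have -> : \sum_(2 <= i < M) (ph i.+2 + ph i + (w i.+1 - E1) * ph i.+1) * (ph i.+2 + ph i + (w i.+1 - E2) * ph i.+1) = f y.
  rewrite /f -(@zsum_widen _ W.+1 (c - 3)); [|by clear -cW; lia|].
    rewrite /zsum -{1}[2%N]add0n big_addn big_mkord.
    have -> : (M - 2)%N = (2 * (c - 3)).+1 by rewrite /M; clear -cW; lia.
    apply: eq_bigr => j _; rewrite /gap_form /almost_mathieu /ph.
    have e1 : (j + 2).+2%:Z - c%:Z = j%:Z - (c - 3)%N%:Z + 1 by clear -cW; lia.
    have e2 : (j + 2)%N%:Z - c%:Z = j%:Z - (c - 3)%N%:Z - 1 by clear -cW; lia.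
    have e3 : (j + 2).+1%:Z - c%:Z = j%:Z - (c - 3)%N%:Z by clear -cW; lia.
    have e4 : x0 + (s + (j + 2).+1.-1)%:R * alpha = y + (j%:Z - (c - 3)%N%:Z)%:~R * alpha.
      have -> : (j%:Z - (c - 3)%N%:Z)%:~R = (s + (j + 2))%:R - (s + W + 5 + i)%:R :> R.
        have -> : j%:Z - (c - 3)%N%:Z = (s + (j + 2))%N%:Z - (s + W + 5 + i)%N%:Z by rewrite /c; clear; lia.
        by rewrite intrD intrN.
      rewrite /y -[(j + 2).+1.-1]/(j + 2)%N.
      by move: ((s + (j + 2))%:R : R) ((s + W + 5 + i)%:R : R) => p1 p2; ring.
    by rewrite e1 e2 e3 /w e4; ring.
  move=> n hn; rewrite /gap_form /almost_mathieu !hphi ?mulr0 ?addr0 ?mul0r ?subr0 ?mulr0 //; move: hn; clear; lia.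
have ML : (M <= L)%N by rewrite /M /L; move: cM cW; clear; lia.
move=> h; have : 0 <= f y; last by rewrite leNgt fy.
apply: h.
- by move=> j /andP[j2 jM]; apply: hW; rewrite j2 (leq_trans jM).
- by rewrite /M; clear; lia.
- by apply: ph0; move: cW; clear; lia.
- by apply: ph0; move: cW; clear; lia.
- by apply: ph0; rewrite /M; move: cW; clear; lia.
- by apply: ph0; rewrite /M; move: cW; clear; lia.
Qed.

(** With E the midpoint, (H - E1)(H - E2) = (H - E)^2 - ((E2 - E1) / 2)^2. *)
Lemma gap_lower_bound (phi : int -> R) (W : nat) (x : R) : (forall n, (W < `|n|)%N -> phi n = 0) ->
  ((E2 - E1) / 2) ^+ 2 * zsum W.+1 (fun n => phi n ^+ 2) <=
  zsum W.+1 (fun n => (almost_mathieu lam alpha x phi n - (E1 + E2) / 2 * phi n) ^+ 2).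
Proof.
move=> hphi; rewrite -subr_ge0; have := gap_form_ge0 x hphi.
congr (0 <= _); rewrite /zsum mulr_sumr -sumrB; apply: eq_bigr => i _.
by rewrite /gap_form; field.
Qed.

End GapBound.

(** * Rotation at energies of modulus above 4 *)

Section Cone.
Variables (R : realType) (alpha lam E : R) (psi : R * R -> R) (r : R).
Hypothesis hp : is_fibered_lift (amo_cocycle lam E) psi.
Hypothesis lam1 : `|lam| <= 1.
Hypothesis E4 : 4 < `|E|.
Hypothesis lim : (fun n : nat => n%:R^-1 *
   \sum_(0 <= k < n) psi (iter k (fibered_lift_map alpha psi) (0, 0))) @ \oo --> r.

Lemma sin_le_cos (y : R) : `|y| <= 1 / 8 -> `|sin (2 * pi * y)| <= cos (2 * pi * y) /\ 0 < cos (2 * pi * y).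
Proof.
move=> y8; have p0 := pi_gt0 R.
have hy : `|2 * pi * y| <= pi / 4.
  rewrite normrM ger0_norm; last by rewrite mulr_ge0 // ltW.
  by have := ler_wpM2l (ltW p0) y8; lra.
have c0 : 0 < cos (2 * pi * y).
  by apply: cos_gt0_pihalf; move: hy; rewrite ler_norml => /andP[]; lra.
split=> //; rewrite -ler_sqr ?nnegrE ?normr_ge0 ?(ltW c0) // real_normK ?num_real //.
have c4 : 0 <= cos (2 * pi * y *+ 2).
  apply: cos_ge0_pihalf; move: hy; rewrite ler_norml => /andP[h1 h2]; rewrite -mulr_natl; lra.
have := cos2Dsin2 (2 * pi * y); move: c4; rewrite cos_mulr2n -[_ ^+ 2 *+ 2]mulr_natl; lra.
Qed.

Lemma pot_big x : 2 < `|pot lam E x|.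
Proof.
have h : `|2 * lam * cos (2 * pi * x)| <= 2.
  rewrite !normrM [`|2|]ger0_norm // -mulrA ler_piMr //.
  by rewrite mulr_ile1 // cos_max.
rewrite /pot; have := ler_normD (E - 2 * lam * cos (2 * pi * x)) (2 * lam * cos (2 * pi * x)).
by rewrite subrK; move: h E4; lra.
Qed.

(** The diagonal entry exceeds 2 in modulus, so a vector within 1/8 turn of the horizontal axis
    returns to that cone up to a half turn. *)
Lemma cone_step x y : `|y| <= 1 / 8 -> 0 < cos (2 * pi * (2 * lmap psi x y)).
Proof.
move=> y8; have [sc c0] := sin_le_cos y8; have [s s0 [e1 e2]] := lift_eq hp x y.
set z := lmap psi x y in e1 e2 *.
have -> : 2 * pi * (2 * z) = (2 * pi * z) *+ 2 by rewrite -[RHS]mulr_natl; ring.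
rewrite cos_mulr2n -[_ ^+ 2 *+ 2]mulr_natl.
have h : `|s * sin (2 * pi * z)| < `|s * cos (2 * pi * z)|.
  rewrite -e1 -e2 (ger0_norm (ltW c0)).
  have h1 := pot_big x; have := ler_normB (pot lam E x * cos (2 * pi * y) - sin (2 * pi * y)) (- sin (2 * pi * y)).
  rewrite opprK subrK normrN normrM (ger0_norm (ltW c0)).
  have : 2 * cos (2 * pi * y) < `|pot lam E x| * cos (2 * pi * y) by rewrite ltr_pM2r.
  move: sc; lra.
rewrite !normrM (gtr0_norm s0) ltr_pM2l // in h.
have h2 : sin (2 * pi * z) ^+ 2 < cos (2 * pi * z) ^+ 2.
  by rewrite -[ltLHS]real_normK ?num_real // -[ltRHS]real_normK ?num_real // ltr_sqr ?nnegrE.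
have := cos2Dsin2 (2 * pi * z); move: h2; lra.
Qed.

Lemma cos_pos_frac (q : R) : 0 < cos (2 * pi * q) -> exists k : int, k%:~R <= q + 1 / 4 < k%:~R + 1 / 2.
Proof.
move=> c0; exists (Num.floor (q + 1 / 4)).
have /andP[h1 h2] := floor_itv (q + 1 / 4); set k := Num.floor _ in h1 h2 *; rewrite intrD in h2.
rewrite h1 /= ltNge; apply/negP => h.
have : 0 < sin (2 * pi * (q + 1 / 4 - k%:~R)).
  have -> : q + 1 / 4 - k%:~R = q + 1 / 4 + (- k)%:~R by rewrite intrN.
  rewrite sin_2piD; have -> : 2 * pi * (q + 1 / 4) = 2 * pi * q + pi / 2 by field.
  by rewrite sinDpihalf.
by rewrite ltNge sin_2pi_le0 //; apply/andP; split; lra.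
Qed.

(** By connectedness the number [J] of half turns is the same everywhere on the cone, so an orbit in
    it rotates by J / 2 per step up to a bounded error. Such an energy cannot lie in a gap with a
    nonzero label. *)
Lemma cone_rotation : exists j : int, 2 * r = j%:~R.
Proof.
have y00 : `|0 : R| <= 1 / 8 by rewrite normr0.
have [J hJ] := cos_pos_frac (cone_step 0 y00).
have hcone x y : `|y| <= 1 / 8 -> `|lmap psi x y - J%:~R / 2| <= 1 / 8.
  (* The sine runs through the segment from the origin to (x, y) without leaving the cone, by a
     function continuous on the whole line. *)
  move=> y8; pose f t := 2 * lmap psi (x * sin t) (y * sin t) + 1 / 4.
  have cs z : continuous (fun t : R => z * sin t).
    by apply: contM; [exact: cont_cst|exact: continuous_sin].
  have cf : continuous f.
    apply: contD; last exact: cont_cst.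
    by apply: contM; [exact: cont_cst|apply: (lmap_continuous hp); exact: cs].
  have : J%:~R <= f (pi / 2) < J%:~R + 1 / 2.
    apply: (@frac_const R f 0 (pi / 2) J cf).
      move=> t; apply: cos_pos_frac; apply: cone_step.
      rewrite normrM; apply: le_trans y8; rewrite ler_piMr //.
      exact: sin_max.
    by rewrite /f sin0 !mulr0.
  by rewrite /f sin_pihalf !mulr1 ler_norml => /andP[h1 h2]; apply/andP; split; lra.
have horb n : `|orb alpha psi n 0 0 - (n%:Z * J)%:~R / 2| <= 1 / 8.
  elim: n => [|n IH]; first by rewrite /orb /= mul0r mul0r subrr normr0.
  rewrite orbS; set x := 0 + _; have := hcone x _ IH.
  have -> : - ((n%:Z * J)%:~R / 2) = (- (n%:Z * J))%:~R / 2 :> R by rewrite intrN; ring.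
  rewrite (lmap_half_int hp) intrN !intrM -[n.+1%:Z%:~R]/(n.+1%:R) -natr1.
  by congr (`|_| <= _); ring.
exists J; apply/eqP; rewrite -subr_eq0 -normr_le0 leNgt; apply/negP => h.
set e := `|_| in h.
have e8 : 0 < e / 8 by rewrite divr_gt0.
have [N1 hN1] := cvg_dist lim e8.
have [N2 hN2] := archi_nat (e^-1).
pose n := (maxn N1 N2).+1.
have n1 : (N1 <= n)%N by rewrite /n; clear; lia.
have n0 : 0 < n%:R :> R by rewrite ltr0n.
have := hN1 n n1; rewrite orb_sum subr0 => g1.
have g2 := horb n.
have g3 : `|n%:R^-1 * orb alpha psi n 0 0 - J%:~R / 2| <= n%:R^-1 / 8.
  have -> : n%:R^-1 * orb alpha psi n 0 0 - J%:~R / 2 = n%:R^-1 * (orb alpha psi n 0 0 - (n%:Z * J)%:~R / 2).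
    by rewrite intrM; field; rewrite gt_eqF.
  by rewrite normrM gtr0_norm ?invr_gt0 // ler_pM2l ?invr_gt0 //; move: g2; rewrite mul1r.
have g4 : n%:R^-1 <= e.
  rewrite -[leRHS]invrK lef_pV2 ?posrE ?invr_gt0 //.
  by apply: le_trans (ltW hN2) _; rewrite ler_nat /n; clear; lia.
have : e <= 2 * (`|n%:R^-1 * orb alpha psi n 0 0 - r| + `|n%:R^-1 * orb alpha psi n 0 0 - J%:~R / 2|).
  rewrite /e; move: (n%:R^-1 * orb alpha psi n 0 0) (J%:~R : R) => z z'.
  have -> : 2 * r - z' = 2 * (- (z - r) + (z - z' / 2)) by field.
  rewrite normrM [`|2|]ger0_norm // ler_pM2l // -[X in _ <= X + _]normrN; exact: ler_normD.
move: g1 g3 g4 h; lra.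
Qed.

End Cone.

(** * Labelled gaps and the values of the rotation number *)

Section GapSet.
Variables (R : realType) (alpha : R).
Hypothesis irr : not_rational alpha.

Lemma irr_int (m j : int) : m != 0 -> m%:~R * alpha + j%:~R != 0.
Proof.
move=> m0; apply/eqP => h; have am : (0 < `|m|)%N by rewrite absz_gt0.
have [mp|mn] := lerP 0 m.
  have := irr (- j) am; rewrite -[`|m|%:R]/(`|m|%:Z%:~R) gez0_abs // intrN => /eqP; apply; lra.
have := irr j am; rewrite -[`|m|%:R]/(`|m|%:Z%:~R) ltz0_abs // intrN => /eqP; apply; lra.
Qed.

(** [rho] takes the default value 0 when no rotation number exists; this default and the endpoints 0
    and 1/2 are excluded because m alpha is not an integer. *)
Lemma gap_rho (lam : R) (m : int) (E : R) : m != 0 -> gap_set lam alpha m E ->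
  exists r (j : int) psi, [/\ r = rho lam alpha E, 0 < r < 1 / 2, 2 * r = m%:~R * alpha + j%:~R,
    is_fibered_lift (amo_cocycle lam E) psi &
    forall p : R * R, (fun n : nat => n%:R^-1 *
         \sum_(0 <= k < n) psi (iter k (fibered_lift_map alpha psi) p)) @ \oo --> r].
Proof.
move=> m0 [j hj]; pose S := [set r : R | 0 <= r <= 2^-1 /\
         is_fibered_rotation_number alpha (amo_cocycle lam E) r].
have [S0|S0] := pselect (S !=set0); last first.
  have r0 : rho lam alpha E = 0.
    rewrite /rho -/S; rewrite getPN // => x Sx; apply: S0; by exists x.
  by have := irr_int j m0; rewrite -hj r0 mulr0 eqxx.
have [/andP[h1 h2] [psi [hl hc]]] : S (rho lam alpha E) := getPex S0.
exists (rho lam alpha E), j, psi; split=> //.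
apply/andP; split; rewrite lt_neqAle.
  rewrite h1 andbT eq_sym; apply/negP => /eqP r0.
  by have := irr_int j m0; rewrite -hj r0 mulr0 eqxx.
have -> : 1 / 2 = 2^-1 :> R by rewrite mul1r.
rewrite h2 andbT; apply/negP => /eqP r0.
by have := irr_int (j - 1) m0; rewrite intrD intrN addrA -hj r0 divff ?subrr ?eqxx.
Qed.

Lemma gap_same_rho (lam : R) (m : int) (E1 E2 : R) : m != 0 ->
  gap_set lam alpha m E1 -> gap_set lam alpha m E2 -> rho lam alpha E1 = rho lam alpha E2.
Proof.
move=> m0 /(gap_rho m0)[r1 [j1 [_ [-> /andP[a1 a2] e1 _ _]]]] /(gap_rho m0)[r2 [j2 [_ [-> /andP[b1 b2] e2 _ _]]]].
have h1 : j1%:~R < (j2 + 1)%:~R :> R by rewrite intrD; lra.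
have h2 : j2%:~R < (j1 + 1)%:~R :> R by rewrite intrD; lra.
have : j1 = j2 by move: h1 h2; rewrite !ltr_int; clear; lia.
by move=> e; move: e2; rewrite -e => e2; lra.
Qed.

Lemma gap_sets_disjoint (lam : R) (m m' : int) (E : R) : gap_set lam alpha m E -> gap_set lam alpha m' E -> m = m'.
Proof.
move=> [j hj] [j' hj']; apply/eqP; rewrite -subr_eq0; apply/negPn/negP => h.
have := irr_int (j - j') h; rewrite !intrD !intrN => /eqP; apply; lra.
Qed.

(** A positive length rules out the default value of [get], whose two components are equal. *)
Lemma gap_edgesP (lam : R) (m : int) : 0 < E_plus lam alpha m - E_minus lam alpha m ->
  forall E, E_minus lam alpha m <= E <= E_plus lam alpha m -> gap_set lam alpha m E.
Proof.
rewrite /E_plus /E_minus /gap_edges; set S := [set e : R * R | _] => h E hE.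
have [S0|S0] := pselect (S !=set0); last first.
  move: h; rewrite getPN ?subrr ?ltxx // => x Sx; apply: S0; by exists x.
have [_ <-] : S (get S) := getPex S0.
by rewrite /= in_itv.
Qed.

Lemma gap_energy_bound (lam E : R) (m : int) : m != 0 -> `|lam| <= 1 -> gap_set lam alpha m E -> `|E| <= 4.
Proof.
move=> m0 lam1 /(gap_rho m0)[r [j [psi [_ _ e hl hc]]]]; rewrite leNgt; apply/negP => E4.
have [k hk] := cone_rotation hl lam1 E4 (hc (0, 0)).
by have := irr_int (j - k) m0; rewrite intrD intrN addrA -e hk subrr eqxx.
Qed.

Lemma gap_lower (lam : R) (m : int) (E1 E2 : R) : m != 0 -> E1 < E2 ->
  gap_set lam alpha m E1 -> gap_set lam alpha m E2 ->
  forall (phi : int -> R) (W : nat) (x : R), (forall n, (W < `|n|)%N -> phi n = 0) ->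
  ((E2 - E1) / 2) ^+ 2 * zsum W.+1 (fun n => phi n ^+ 2) <=
  zsum W.+1 (fun n => (almost_mathieu lam alpha x phi n - (E1 + E2) / 2 * phi n) ^+ 2).
Proof.
move=> m0 E12 g1 g2.
have [r1 [j1 [p1 [e1 _ _ l1 c1]]]] := gap_rho m0 g1.
have [r2 [j2 [p2 [e2 _ _ l2 c2]]]] := gap_rho m0 g2.
have e : r1 = r2 by rewrite e1 e2; exact: gap_same_rho m0 g1 g2.
by move: c2; rewrite -e => c2; exact: (gap_lower_bound irr l1 l2 E12 (c1 (0, 0)) (c2 (0, 0))).
Qed.

End GapSet.

(** * The resolvent in a gap *)

Section Dot.
Variable R : realType.
Implicit Types (phi psi chi : int -> R) (W V : nat).

Definition supp_in V (phi : int -> R) := forall n, (V < `|n|)%N -> phi n = 0.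

Definition dot W phi psi : R := zsum W (fun n => phi n * psi n).

Lemma supp_inW V W phi : (V <= W)%N -> supp_in V phi -> supp_in W phi.
Proof. by move=> VW h n hn; apply: h; exact: leq_ltn_trans hn. Qed.

Lemma dotC W phi psi : dot W phi psi = dot W psi phi.
Proof. by apply: eq_zsum => n _; rewrite mulrC. Qed.

Lemma dotDl W phi psi chi : dot W (fun n => phi n + psi n) chi = dot W phi chi + dot W psi chi.
Proof. by rewrite /dot -zsumD; apply: eq_zsum => n _; rewrite mulrDl. Qed.

Lemma dotZl W (c : R) phi chi : dot W (fun n => c * phi n) chi = c * dot W phi chi.
Proof. by rewrite /dot /zsum mulr_sumr; apply: eq_bigr => n _; rewrite mulrA. Qed.

Lemma dot_ge0 W phi : 0 <= dot W phi phi.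
Proof. by apply: sumr_ge0 => i _; rewrite -expr2 sqr_ge0. Qed.

Lemma sqr_le_dot V phi (n : int) : supp_in V phi -> phi n ^+ 2 <= dot V phi phi.
Proof.
move=> h; have [nV|Vn] := leqP `|n| V; last by rewrite h // expr0n dot_ge0.
have i0 : (`|(n + V%:Z)%R| < (2 * V).+1)%N by move: nV; clear; lia.
rewrite /dot /zsum (bigD1 (Ordinal i0)) //=.
have -> : `|(n + V%:Z)%R|%N%:Z - V%:Z = n by move: nV; clear; lia.
by rewrite -expr2 lerDl; apply: sumr_ge0 => i _; rewrite -expr2 sqr_ge0.
Qed.

Definition delta0 : int -> R := fun n => (n == 0)%:R.

Lemma supp_delta0 : supp_in 0 delta0.
Proof. by move=> n; rewrite absz_gt0 /delta0 => /negPf ->. Qed.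

Lemma dot_shift W V phi psi : supp_in V phi -> supp_in V psi -> (V < W)%N ->
  dot W (fun n => phi (n + 1)) psi = dot W phi (fun n => psi (n - 1)).
Proof.
move=> h1 h2 VW; rewrite /dot -(@zsum_shift _ W (fun n => phi n * psi (n - 1))).
- by apply: eq_zsum => n _; rewrite addrK.
- by rewrite h1 ?mul0r //; move: VW; clear; lia.
- by rewrite h1 ?mul0r //; move: VW; clear; lia.
Qed.

End Dot.

Section Neumann.
Variables (R : realType) (lam alpha E kap : R).
Hypotheses (lam1 : `|lam| <= 1) (E4 : `|E| <= 4) (kap0 : 0 < kap) (kap4 : kap <= 4).
Hypothesis low : forall (phi : int -> R) (W : nat) (x : R), supp_in W phi ->
  kap ^+ 2 * zsum W.+1 (fun n => phi n ^+ 2) <=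
  zsum W.+1 (fun n => (almost_mathieu lam alpha x phi n - E * phi n) ^+ 2).

(** The factor 1/16 brings the norm below 1, both in l^2 and in the sup norm, since |lam| <= 1 and
    |E| <= 4. *)
Definition Top (x : R) (phi : int -> R) (n : int) : R := 16^-1 * (almost_mathieu lam alpha x phi n - E * phi n).

(** H - E has no sign in a gap, so the geometric series is formed with its square: 1 - T^2 is a form
    between 0 and [rate]. *)
Definition Bop (x : R) (phi : int -> R) (n : int) : R := phi n - Top x (Top x phi) n.

Definition rate : R := 1 - kap ^+ 2 / 16 ^+ 2.

Lemma rate_gt0 : 0 < rate.
Proof. by rewrite /rate; have : kap ^+ 2 <= 4 ^+ 2; [rewrite ler_sqr ?nnegrE // ltW|lra]. Qed.

Lemma rate_lt1 : rate < 1.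
Proof. by rewrite /rate gtrBl divr_gt0 // exprn_gt0. Qed.

Lemma TopE x phi n : Top x phi n =
  16^-1 * (phi (n + 1) + phi (n - 1) + (2 * lam * cos (2 * pi * (x + n%:~R * alpha)) - E) * phi n).
Proof. by rewrite /Top /almost_mathieu; ring. Qed.

Lemma potE x (n : int) : `|2 * lam * cos (2 * pi * (x + n%:~R * alpha)) - E| <= 6.
Proof.
apply: le_trans (ler_normB _ _) _.
have : `|2 * lam * cos (2 * pi * (x + n%:~R * alpha))| <= 2.
  rewrite !normrM [`|2|]ger0_norm // -mulrA ler_piMr //.
  by rewrite mulr_ile1 // cos_max.
by move: E4; lra.
Qed.

Lemma supp_Top V x phi : supp_in V phi -> supp_in V.+1 (Top x phi).
Proof. by move=> h n hn; rewrite TopE !h ?mulr0 ?addr0 ?mulr0 //; move: hn; clear; lia. Qed.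

Lemma supp_Bop V x phi : supp_in V phi -> supp_in V.+2 (Bop x phi).
Proof.
move=> h n hn; rewrite /Bop h; last by move: hn; clear; lia.
by rewrite (supp_Top x (supp_Top x h)) // subr0.
Qed.

Lemma Top_sup x phi (M : R) (n : int) : (forall n, `|phi n| <= M) -> `|Top x phi n| <= M.
Proof.
move=> h; rewrite TopE normrM [`|16^-1|]ger0_norm ?invr_ge0 // ler_pdivrMl //.
apply: le_trans (ler_normD _ _) _; apply: le_trans (lerD (ler_normD _ _) (lexx _)) _.
rewrite normrM; have h3 := ler_pM (normr_ge0 _) (normr_ge0 _) (potE x n) (h n).
have := h (n + 1); have := h (n - 1); have := h n; have := normr_ge0 (phi n); move: h3; lra.
Qed.

Lemma TopD x phi psi n : Top x (fun k => phi k + psi k) n = Top x phi n + Top x psi n.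
Proof. by rewrite !TopE; ring. Qed.

Lemma TopB x phi psi n : Top x (fun k => phi k - psi k) n = Top x phi n - Top x psi n.
Proof. by rewrite !TopE; ring. Qed.

Lemma TopZ x (c : R) phi n : Top x (fun k => c * phi k) n = c * Top x phi n.
Proof. by rewrite !TopE; ring. Qed.

Lemma Top_dot W x phi psi : dot W (Top x phi) psi = 16^-1 *
  (dot W (fun n => phi (n + 1)) psi + dot W (fun n => phi (n - 1)) psi +
   dot W (fun n => (2 * lam * cos (2 * pi * (x + n%:~R * alpha)) - E) * phi n) psi).
Proof. by rewrite -!dotDl -dotZl; apply: eq_zsum => n _; rewrite TopE. Qed.

Lemma Top_sym V W x phi psi : supp_in V phi -> supp_in V psi -> (V < W)%N ->
  dot W (Top x phi) psi = dot W phi (Top x psi).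
Proof.
move=> h1 h2 VW; rewrite [RHS]dotC !Top_dot (dot_shift h1 h2 VW) (dot_shift h2 h1 VW).
rewrite [dot W phi _]dotC [dot W psi (fun n => phi _)]dotC; congr (_ * (_ + _)); first by rewrite addrC.
by apply: eq_zsum => n _; rewrite mulrAC.
Qed.

Lemma dot_Top_le V W x phi : supp_in V phi -> (V < W)%N -> dot W (Top x phi) (Top x phi) <= dot W phi phi.
Proof.
move=> h VW.
have n1 : dot W (fun n => phi (n + 1)) (fun n => phi (n + 1)) = dot W phi phi.
  rewrite /dot -(@zsum_shift _ W (fun n => phi n * phi n)) //; rewrite h ?mul0r //; move: VW; clear; lia.
have n2 : dot W (fun n => phi (n - 1)) (fun n => phi (n - 1)) = dot W phi phi.
  rewrite /dot -[LHS](@zsum_shift _ W (fun n => phi (n - 1) * phi (n - 1))).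
  - by apply: eq_zsum => n _; rewrite addrK.
  - by rewrite h ?mul0r //; move: VW; clear; lia.
  - by rewrite h ?mul0r //; move: VW; clear; lia.
have : dot W (Top x phi) (Top x phi) <= 3 / 256 * (dot W (fun n => phi (n + 1)) (fun n => phi (n + 1)) +
   dot W (fun n => phi (n - 1)) (fun n => phi (n - 1)) + 36 * dot W phi phi).
  rewrite /dot /zsum mulr_sumr -!big_split mulr_sumr /=; apply: ler_sum => i _.
  move: (i%:Z - W%:Z) => n; rewrite TopE; have := potE x n.
  move: (phi (n + 1)) (phi (n - 1)) (phi n) (2 * lam * cos _ - E) => a b c w w6.
  have ww : w ^+ 2 <= 36.
    have -> : 36 = 6 ^+ 2 :> R by ring.
    by rewrite -[leLHS]real_normK ?num_real // ler_sqr ?nnegrE.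
  have wc : 0 <= c ^+ 2 * (36 - w ^+ 2) by rewrite mulr_ge0 ?sqr_ge0 // subr_ge0.
  have := sqr_ge0 (a - b); have := sqr_ge0 (a - w * c); have := sqr_ge0 (b - w * c).
  have -> : 16^-1 * (a + b + w * c) * (16^-1 * (a + b + w * c)) = (a + b + w * c) ^+ 2 / 256 by field.
  move: wc; rewrite -!expr2; nra.
rewrite n1 n2; have := dot_ge0 W phi; lra.
Qed.

(** From the form to the norm by Cauchy-Schwarz for q, here as q(f, f) >= 0 at f = phi - Bop phi /
    rate. *)
Lemma dot_Bop V W x phi : supp_in V phi -> (V.+3 < W)%N ->
  dot W (Bop x phi) (Bop x phi) <= rate ^+ 2 * dot W phi phi.
Proof.
move=> h VW.
have r0 := rate_gt0.
pose q f f' := dot W f f' - dot W (Top x f) (Top x f').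
have qE f f' U : supp_in U f -> supp_in U f' -> (U.+1 < W)%N -> dot W (Bop x f) f' = q f f'.
  move=> s1 s2 UW; rewrite /q -(@Top_sym U.+1) //; last 2 first.
  - exact: supp_Top.
  - exact: supp_inW s2.
  have -> : dot W (Bop x f) f' = dot W (fun n => f n + (-1) * Top x (Top x f) n) f'.
    by apply: eq_zsum => n _; rewrite /Bop mulN1r.
  by rewrite dotDl dotZl mulN1r.
have q_ge0 f : supp_in V.+2 f -> 0 <= q f f.
  by move=> s; rewrite subr_ge0; apply: (dot_Top_le x s); move: VW; clear; lia.
have q_le f : supp_in V.+2 f -> q f f <= rate * dot W f f.
  move=> s; have hl : kap ^+ 2 * zsum W (fun n => f n ^+ 2) <= zsum W (fun n => (almost_mathieu lam alpha x f n - E * f n) ^+ 2).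
    by case: (W) VW => // U VU; apply: low; apply: supp_inW s; move: VU; clear; lia.
  rewrite /q /rate mulrBl mul1r lerD2l lerN2.
  have -> : dot W (Top x f) (Top x f) = zsum W (fun n => (almost_mathieu lam alpha x f n - E * f n) ^+ 2) / 16 ^+ 2.
    rewrite /dot /zsum mulr_suml; apply: eq_bigr => i _; by rewrite /Top; field.
  rewrite mulrAC ler_pM2r ?invr_gt0 ?exprn_gt0 //.
pose chi := Bop x phi; have sc : supp_in V.+2 chi by exact: supp_Bop.
have sp : supp_in V.+2 phi by apply: supp_inW h; clear; lia.
have bpx : dot W chi chi = q phi chi by apply: (qE _ _ V.+2).
pose t := rate^-1; have t0 : 0 < t by rewrite invr_gt0.
pose f n := phi n + (- t) * chi n.
have sf : supp_in V.+2 f by move=> n hn; rewrite /f sp // sc // mulr0 addr0.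
have TfE : Top x f = fun n => Top x phi n + (- t) * Top x chi n.
  by apply: funext => n; rewrite /f TopD TopZ.
have lin g1 g2 : dot W (fun n => g1 n + - t * g2 n) (fun n => g1 n + - t * g2 n) =
    dot W g1 g1 - 2 * t * dot W g1 g2 + t ^+ 2 * dot W g2 g2.
  rewrite dotDl dotZl [dot W g1 _]dotC [dot W g2 _]dotC !dotDl !dotZl [dot W g2 g1]dotC; ring.
have := q_ge0 f sf; rewrite /q TfE /f !lin => hq.
have h2 := q_le phi sp; have h3 := q_le chi sc.
have tr : t * rate = 1 by rewrite /t mulVf // gt_eqF.
have h4 : t ^+ 2 * q chi chi <= t * dot W chi chi.
  rewrite expr2 -mulrA ler_pM2l // -[leRHS]mul1r -tr -mulrA ler_pM2l //.
have h5 : t * dot W chi chi <= rate * dot W phi phi.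
  have m1 : t * dot W phi chi - t * dot W (Top x phi) (Top x chi) = t * dot W chi chi by rewrite -mulrBr [in RHS]bpx.
  move: hq h2 h4 m1; rewrite /q.
  by rewrite mulrBr -!mulrA; lra.
have := ler_wpM2l (ltW r0) h5; rewrite mulrA [rate * t]mulrC tr mul1r.
by rewrite [rate * (_ * _)]mulrA -expr2.
Qed.

Lemma Bop_Top x phi : Bop x (Top x phi) = Top x (Bop x phi).
Proof. by apply: funext => n; rewrite [in RHS]/Bop TopB. Qed.

Definition bvec j x : int -> R := iter j (Bop x) (@delta0 R).

Lemma supp_iter V j x phi : supp_in V phi -> supp_in (V + 2 * j) (iter j (Bop x) phi).
Proof.
move=> h; elim: j => [|j IH]; first by rewrite addn0.
by rewrite iterS; have := supp_Bop x IH; congr supp_in; lia.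
Qed.

Lemma supp_bvec j x : supp_in (2 * j) (bvec j x).
Proof. by rewrite -[(2 * j)%N]add0n; exact: supp_iter (@supp_delta0 R). Qed.

Lemma bvec_dot j x : dot (2 * j) (bvec j x) (bvec j x) <= rate ^+ (2 * j).
Proof.
have H W : (2 * j + 2 < W)%N -> dot W (bvec j x) (bvec j x) <= rate ^+ (2 * j).
  elim: j => [|j IH] hW.
    rewrite /dot (@zsum_widen _ 0); [|by []|by move=> n hn; rewrite /bvec /= supp_delta0 // mul0r].
    by rewrite /zsum big_ord1 /= /bvec /= /delta0 !mulr1 muln0 expr0.
  rewrite /bvec iterS -/(bvec j x).
  apply: le_trans (dot_Bop x (@supp_bvec j x) _) _; first by move: hW; clear; lia.
  have -> : (2 * j.+1)%N = (2 + 2 * j)%N by clear; lia.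
  rewrite exprD; apply: ler_wpM2l; first exact: sqr_ge0.
  by apply: IH; move: hW; clear; lia.
rewrite -[leLHS](@zsum_widen _ (2 * j) (2 * j + 3)%N) ?leq_addr //; first by apply: H; rewrite ltn_add2l.
by move=> n hn; rewrite supp_bvec // mul0r.
Qed.

Lemma bvec_le j x n : `|bvec j x n| <= rate ^+ j.
Proof.
have r0 := rate_gt0.
rewrite -ler_sqr ?nnegrE ?exprn_ge0 ?(ltW r0) // real_normK ?num_real //.
apply: le_trans (sqr_le_dot n (@supp_bvec j x)) _.
by rewrite -exprM [(j * 2)%N]mulnC; exact: bvec_dot.
Qed.

(** T^{-1} = T (T^2)^{-1} with T^2 = 1 - Bop: these are the terms of the Neumann series of (H -
    E)^{-1} applied to [delta0]. *)
Definition uvec j x (n : int) : R := 16^-1 * Top x (bvec j x) n.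

Lemma uvec_supp j x n : (2 * j + 1 < `|n|)%N -> uvec j x n = 0.
Proof. by move=> h; rewrite /uvec (supp_Top x (@supp_bvec j x)) ?mulr0 // -addn1. Qed.

Lemma uvec_le j x n : `|uvec j x n| <= rate ^+ j.
Proof.
rewrite /uvec normrM [`|16^-1|]ger0_norm ?invr_ge0 //.
have := Top_sup x n (fun k => bvec_le j x k); have := exprn_ge0 j (ltW rate_gt0); lra.
Qed.

Lemma uvec_eq J x n :
  almost_mathieu lam alpha x (fun k => \sum_(j < J) uvec j x k) n - E * (\sum_(j < J) uvec j x n) =
  delta0 R n - bvec J x n.
Proof.
elim: J => [|J IH].
  rewrite !big_ord0 /almost_mathieu !big_ord0 /bvec /=; ring.
have -> : (fun k => \sum_(j < J.+1) uvec j x k) = fun k => \sum_(j < J) uvec j x k + uvec J x k.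
  by apply: funext => k; rewrite big_ord_recr.
have e : almost_mathieu lam alpha x (uvec J x) n - E * uvec J x n = bvec J x n - bvec J.+1 x n.
  have -> : bvec J.+1 x n = bvec J x n - Top x (Top x (bvec J x)) n by [].
  have -> : Top x (Top x (bvec J x)) n = Top x (fun k => 16 * uvec J x k) n.
    congr (Top x _ n); apply: funext => k; rewrite /uvec; by field.
  by rewrite TopZ /Top; field.
have -> : delta0 R n - bvec J.+1 x n = (delta0 R n - bvec J x n) + (bvec J x n - bvec J.+1 x n) by ring.
by rewrite -e -IH big_ord_recr /= /almost_mathieu; ring.
Qed.

Lemma iter_Bop_sym V W j x phi psi : supp_in V phi -> supp_in V psi -> (V + 2 * j + 2 < W)%N ->
  dot W (iter j (Bop x) phi) psi = dot W phi (iter j (Bop x) psi).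
Proof.
elim: j V phi psi => [//|j IH] V phi psi h1 h2 hW.
rewrite iterS iterSr -(IH V.+2); [| |exact: supp_Bop|by move: hW; clear; lia]; last first.
  by apply: supp_inW h1; clear; lia.
have s1 := @supp_iter V j x phi h1; have s2 : supp_in (V + 2 * j) psi by apply: supp_inW h2; exact: leq_addr.
have e f f' U : supp_in U f -> supp_in U f' -> (U.+1 < W)%N -> dot W (Bop x f) f' = dot W f f' - dot W (Top x f) (Top x f').
  move=> t1 t2 UW; rewrite -(@Top_sym U.+1) //; last 2 first.
  - exact: supp_Top.
  - exact: supp_inW t2.
  have -> : dot W (Bop x f) f' = dot W (fun n => f n + (-1) * Top x (Top x f) n) f'.
    by apply: eq_zsum => n _; rewrite /Bop mulN1r.
  by rewrite dotDl dotZl mulN1r.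
rewrite (e _ _ (V + 2 * j)%N) //; last by move: hW; clear; lia.
rewrite [RHS]dotC (e _ _ (V + 2 * j)%N) //; last by move: hW; clear; lia.
by rewrite dotC [X in _ - X]dotC.
Qed.

Lemma iter_Bop_Top j x phi : iter j (Bop x) (Top x phi) = Top x (iter j (Bop x) phi).
Proof. by elim: j => [//|j IH]; rewrite !iterS IH Bop_Top. Qed.

Lemma Top_translate x (m : int) phi n :
  Top x (fun k => phi (k - m)) n = Top (x + m%:~R * alpha) phi (n - m).
Proof.
rewrite !TopE.
have -> : n + 1 - m = n - m + 1 by ring.
have -> : n - 1 - m = n - m - 1 by ring.
by have -> : x + m%:~R * alpha + (n - m)%:~R * alpha = x + n%:~R * alpha by rewrite intrD intrN; ring.
Qed.

Lemma iter_Bop_translate j x (m : int) phi :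
  iter j (Bop x) (fun k => phi (k - m)) = fun n => iter j (Bop (x + m%:~R * alpha)) phi (n - m).
Proof.
have TF f : Top x (fun k => f (k - m)) = fun n => Top (x + m%:~R * alpha) f (n - m).
  by apply: funext => n; rewrite Top_translate.
elim: j => [//|j IH]; rewrite !iterS IH; apply: funext => n; rewrite /Bop.
by rewrite (TF (iter j (Bop (x + m%:~R * alpha)) phi)) Top_translate.
Qed.

(** Symmetry of the operator exchanges the sites 0 and n; covariance brings n back to 0 at the price
    of a translated phase. *)
Lemma uvec_sym j x n : uvec j x n = uvec j (x + n%:~R * alpha) (- n).
Proof.
pose dn : int -> R := fun k => delta0 R (k - n).
pose V := (`|n|)%N; pose W := (V + 2 * j + 10)%N.
have sd : supp_in V (@delta0 R) by apply: supp_inW (@supp_delta0 R).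
have sdn : supp_in V dn.
  by move=> k hk; rewrite /dn /delta0; case: eqP => // e; move: hk; rewrite /V; move: e; clear; lia.
have pick (f : int -> R) (m : int) : (`|m| <= W)%N -> dot W f (fun k => delta0 R (k - m)) = f m.
  move=> mW; have i0 : (`|(m + W%:Z)%R| < (2 * W).+1)%N by move: mW; clear; lia.
  have iE : `|(m + W%:Z)%R|%N%:Z - W%:Z = m by move: mW; clear; lia.
  rewrite /dot /zsum (bigD1 (Ordinal i0)) //= iE subrr /delta0 eqxx mulr1 big1 ?addr0 // => i ne.
  case: eqP; rewrite ?mulr0 // => e; case/eqP: ne; apply/val_inj => /=.
  by move: e iE; clear; lia.
rewrite /uvec; congr (_ * _).
have nW : (`|n| <= W)%N by rewrite /W /V; clear; lia.
rewrite -[LHS](pick _ n nW) -/dn /bvec -iter_Bop_Top.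
rewrite (@iter_Bop_sym V.+1 W) ?(@Top_sym (V + 2 * j)); first last.
- by rewrite /W; clear; lia.
- exact: supp_inW sdn.
- exact: supp_Top.
- by rewrite /W; clear; lia.
- exact: supp_iter.
- by apply: supp_inW sd; exact: leq_addr.
have p0 f : dot W (delta0 R) f = f 0.
  rewrite dotC -[RHS](pick f 0) //; apply: eq_zsum => k _; by rewrite subr0.
rewrite p0 /dn iter_Bop_translate.
have -> : Top x (fun k => iter j (Bop (x + n%:~R * alpha)) (delta0 R) (k - n)) 0 =
  Top (x + n%:~R * alpha) (iter j (Bop (x + n%:~R * alpha)) (delta0 R)) (0 - n) by rewrite Top_translate.
by rewrite sub0r.
Qed.

Lemma bvec_cont j n : continuous (fun x => bvec j x n).
Proof.
elim: j n => [|j IH] n; first exact: cont_cst.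
have cT (f : R -> int -> R) : (forall k, continuous (f^~ k)) -> forall k, continuous (fun x => Top x (f x) k).
  move=> cf k; have -> : (fun x => Top x (f x) k) = fun x =>
    16^-1 * (f x (k + 1) + f x (k - 1) + (2 * lam * cos (2 * pi * (x + k%:~R * alpha)) - E) * f x k).
    by apply: funext => x; rewrite TopE.
  apply: contM; first exact: cont_cst.
  apply: contD; first by apply: contD; exact: cf.
  apply: contM; last exact: cf.
  apply: contB; last exact: cont_cst.
  apply: contM; first exact: cont_cst.
  by apply: cont_cos2pi; apply: contD; [exact: cont_id|exact: cont_cst].
apply: contB; first exact: IH.
by apply: (cT (fun x => Top x (bvec j x))); apply: (cT (fun x => bvec j x)).
Qed.

Lemma uvec_cont j n : continuous (fun x => uvec j x n).
Proof.
have -> : (fun x => uvec j x n) = fun x => 16^-1 * (16^-1 * (bvec j x (n + 1) + bvec j x (n - 1) +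
   (2 * lam * cos (2 * pi * (x + n%:~R * alpha)) - E) * bvec j x n)).
  by apply: funext => x; rewrite /uvec TopE.
apply: contM; first exact: cont_cst.
apply: contM; first exact: cont_cst.
apply: contD; first by apply: contD; exact: bvec_cont.
apply: contM; last exact: bvec_cont.
apply: contB; last exact: cont_cst.
apply: contM; first exact: cont_cst.
by apply: cont_cos2pi; apply: contD; [exact: cont_id|exact: cont_cst].
Qed.

Lemma uvec_per j x (k : int) n : uvec j (x + k%:~R) n = uvec j x n.
Proof.
have eT f : Top (x + k%:~R) f = Top x f.
  apply: funext => i; rewrite !TopE.
  by have -> : x + k%:~R + i%:~R * alpha = x + i%:~R * alpha + k%:~R; [ring|rewrite cos_2piD].
have eB : Bop (x + k%:~R) = Bop x.
  by apply: funext => f; apply: funext => i; rewrite /Bop !eT.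
by rewrite /uvec /bvec eB eT.
Qed.

End Neumann.

Lemma geom_limit (R : realType) (u : nat -> R) (r : R) : 0 <= r -> r < 1 -> (forall j, `|u j| <= r ^+ j) ->
  exists g, forall J, `|g - \sum_(j < J) u j| <= r ^+ J / (1 - r).
Proof.
move=> r0 r1 hu.
have cs : cvgn (series u).
  apply: normed_cvg; apply: series_le_cvg (is_cvg_geometric_series (a := 1) (z := r) _).
  - by move=> n /=.
  - by move=> n; rewrite /geometric /= mul1r exprn_ge0.
  - by move=> n; rewrite /geometric /= mul1r.
  - by rewrite ger0_norm.
pose g := limn (series u); have cg : series u @ \oo --> g by [].
have r1' : 0 < 1 - r by rewrite subr_gt0.
have sumE J : \sum_(j < J) u j = series u J by rewrite /series /= big_mkord.
have tail J m : `|series u (J + m)%N - series u J| <= r ^+ J / (1 - r).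
  rewrite -!sumE big_split_ord /= addrAC subrr add0r.
  apply: le_trans (ler_norm_sum _ _ _) _.
  apply: le_trans (_ : \sum_(i < m) r ^+ J * r ^+ i <= _).
    by apply: ler_sum => i _; rewrite -exprD.
  rewrite -mulr_sumr; apply: ler_wpM2l; first exact: exprn_ge0.
  rewrite -[leRHS]mul1r ler_pdivlMr // mulrC.
  have := subrX1 r m; rewrite -opprB -[X in _ = X * _]opprB mulNr => /oppr_inj <-.
  by rewrite gerBl exprn_ge0.
exists g => J; rewrite sumE; apply/ler_addgt0Pr => e e0.
have [N hN] := cvg_dist cg e0.
have := hN (J + N)%N (leq_addl _ _); have := tail J N.
have -> : g - series u J = (series u (J + N)%N - series u J) - (series u (J + N)%N - g) by ring.
move=> h1 h2; apply: le_trans (ler_normB _ _) _; apply: lerD => //; exact: ltW.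
Qed.

(** * Lifts of maps to the circle *)

Section Compactness.
Variable R : realType.

Lemma cluster_point (u : nat -> R) (B : R) : (forall n, `|u n| <= B) ->
  exists l, forall e N, 0 < e -> exists n, (N <= n)%N /\ `|u n - l| < e.
Proof.
move=> hB; pose S := [set t : R | forall N, exists n, (N <= n)%N /\ t <= u n].
have uB n : - B <= u n <= B by rewrite -ler_norml.
have S0 : S !=set0.
  by exists (- B) => N; exists N; split=> //; case/andP: (uB N).
have ubS : ubound S B.
  by move=> t /(_ 0%N)[n [_ h]]; apply: le_trans h _; case/andP: (uB n).
have hs : has_sup S by split=> //; exists B.
exists (sup S) => e N e0.
have [t St ht] := sup_adherent e0 hs.
have nS : ~ S (sup S + e).
  by move=> h; have := ub_le_sup (ex_intro _ _ ubS : has_ubound S) h; rewrite gerDl leNgt e0.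
move/existsNP: nS => [N' hN'].
have [n [nN tn]] := St (maxn N N').
exists n; split; first by move: nN; clear; lia.
rewrite ltr_norml; apply/andP; split; first by move: ht tn; lra.
rewrite ltrBlDr addrC ltNge; apply/negP => h; apply: hN'; exists n; split=> //.
by move: nN; clear; lia.
Qed.

Lemma periodic_unif_cont (f : R -> R) : continuous f -> (forall x (k : int), f (x + k%:~R) = f x) ->
  forall e, 0 < e -> exists2 d, 0 < d & forall x y, `|x - y| < d -> `|f x - f y| < e.
Proof.
move=> cf per e e0; apply: contrapT => H.
have bad (n : nat) : exists p : R * R, [/\ `|p.1| <= 1, `|p.1 - p.2| < n.+1%:R^-1 & e <= `|f p.1 - f p.2|].
  apply: contrapT => H2; apply: H; exists n.+1%:R^-1; first by rewrite invr_gt0.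
  move=> x y xy; rewrite ltNge; apply/negP => h; apply: H2.
  have /andP[k1 k2] := floor_itv x; set k := Num.floor x in k1 k2; rewrite intrD in k2.
  exists (x + (- k)%:~R, y + (- k)%:~R); split=> /=.
  - by rewrite intrN ler_norml; apply/andP; split; move: k1 k2; lra.
  - by have -> : x + (- k)%:~R - (y + (- k)%:~R) = x - y by ring.
  - by rewrite !per.
have [p hp] := choice bad.
have [l hl] := @cluster_point (fun n => (p n).1) 1 (fun n => let: And3 h _ _ := hp n in h).
have e2 : 0 < e / 2 by rewrite divr_gt0.
have /cvgrPdist_lt/(_ _ e2) := cf l; move=> /nbhs_ballP[d /= d0 hd].
have d2 : 0 < d / 2 by rewrite divr_gt0.
have [N hN] := archi_nat ((d / 2)^-1).
have [n [nN nl]] := hl (d / 2) N d2.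
have [_ h1 h2] := hp n.
have h3 : n.+1%:R^-1 < d / 2.
  rewrite -[ltRHS]invrK ltf_pV2 ?posrE ?invr_gt0 //; apply: lt_le_trans hN _.
  by rewrite ler_nat; exact: leq_trans nN (leqnSn _).
have b1 : `|f l - f (p n).1| < e / 2 by apply: hd; rewrite /ball /= distrC; move: nl d0; lra.
have b2 : `|f l - f (p n).2| < e / 2.
  apply: hd; rewrite /ball /=; have -> : l - (p n).2 = ((p n).1 - (p n).2) - ((p n).1 - l) by ring.
  apply: le_lt_trans (ler_normB _ _) _; rewrite [ltRHS]splitr.
  by apply: ltrD => //; exact: lt_trans h1 h3.
have : `|f (p n).1 - f (p n).2| < e.
  have -> : f (p n).1 - f (p n).2 = (f l - f (p n).2) - (f l - f (p n).1) by ring.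
  by apply: le_lt_trans (ler_normB _ _) _; move: b1 b2; lra.
by rewrite ltNge h2.
Qed.

End Compactness.

Section AngleLift.
Variables (R : realType) (X Y : R -> R).
Hypotheses (cX : continuous X) (cY : continuous Y).
Hypotheses (pX : forall x (k : int), X (x + k%:~R) = X x) (pY : forall x (k : int), Y (x + k%:~R) = Y x).
Hypothesis circ : forall x, X x ^+ 2 + Y x ^+ 2 = 1.

Lemma angle_exists (a b : R) : a ^+ 2 + b ^+ 2 = 1 -> exists t, cos t = a /\ sin t = b.
Proof.
move=> h; have a1 : -1 <= a <= 1.
  by rewrite -ler_norml -ler_sqr ?nnegrE // real_normK ?num_real // expr1n -h lerDl sqr_ge0.
have ca : cos (acos a) = a by apply: acosK; rewrite in_itv.
have s2 : sin (acos a) ^+ 2 = b ^+ 2 by have := cos2Dsin2 (acos a); rewrite ca -h => /addrI.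
have /orP[/eqP e|/eqP e] : (sin (acos a) == b) || (sin (acos a) == - b) by rewrite -eqf_sqr s2.
  by exists (acos a).
by exists (- acos a); rewrite cosN sinN e opprK.
Qed.

Definition stepc (x y : R) : R := X x * X y + Y x * Y y.
Definition steps (x y : R) : R := X x * Y y - Y x * X y.

Lemma step_circ x y : stepc x y ^+ 2 + steps x y ^+ 2 = 1.
Proof.
rewrite /stepc /steps; have -> : 1 = (X x ^+ 2 + Y x ^+ 2) * (X y ^+ 2 + Y y ^+ 2) by rewrite !circ mulr1.
ring.
Qed.

Definition clip (L x : R) : R := Num.max (- L) (Num.min x L).

Lemma clip_id L x : `|x| <= L -> clip L x = x.
Proof. by rewrite ler_norml => /andP[h1 h2]; rewrite /clip min_l // max_r. Qed.

Lemma clip_le L x : 0 <= L -> `|clip L x| <= L.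
Proof.
move=> L0; rewrite ler_norml /clip le_max lexx /= ge_max.
by rewrite ge_min lexx orbT andbT; move: L0; lra.
Qed.

Lemma clip_cont L : continuous (clip L).
Proof.
move=> x; apply: (@continuous_max _ _ (fun=> - L) (fun x => Num.min x L)); first exact: cst_continuous.
by apply: (@continuous_min _ _ id (fun=> L)) => //; exact: cst_continuous.
Qed.

Lemma steps_small : exists2 d, 0 < d & forall x y, `|x - y| < d -> 0 < stepc x y.
Proof.
have e0 : 0 < 1 / 2 :> R by lra.
have [d1 d10 h1] := periodic_unif_cont cX pX e0; have [d2 d20 h2] := periodic_unif_cont cY pY e0.
exists (Num.min d1 d2); first by rewrite lt_min d10.
move=> x y; rewrite lt_min => /andP[/h1 g1 /h2 g2].
have n1 : (X x - X y) ^+ 2 < 1 / 4.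
  have -> : 1 / 4 = (1 / 2) ^+ 2 :> R by field.
  by rewrite -[ltLHS]real_normK ?num_real // ltr_sqr ?nnegrE //; lra.
have n2 : (Y x - Y y) ^+ 2 < 1 / 4.
  have -> : 1 / 4 = (1 / 2) ^+ 2 :> R by field.
  by rewrite -[ltLHS]real_normK ?num_real // ltr_sqr ?nnegrE //; lra.
have := circ x; have := circ y; move: n1 n2; rewrite /stepc !sqrrB; nra.
Qed.

(** The segment from 0 to x is cut into steps so short that each angle increment is below a quarter
    turn, where [asin] recovers it. [clip] makes the formula continuous on the whole line with a
    fixed number of steps. *)
Lemma local_lift (t0 : R) (L : nat) : cos t0 = X 0 -> sin t0 = Y 0 -> exists y : R -> R, [/\ continuous y, y 0 = t0 &
   forall x, `|x| <= L%:R -> cos (y x) = X x /\ sin (y x) = Y x].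
Proof.
move=> c0 s0; have [d d0 hd] := steps_small.
have [N hN] := archi_nat (L%:R / d).
have N0 : 0 < N%:R :> R by apply: le_lt_trans hN; rewrite divr_ge0 // ltW.
pose pt x (i : nat) := clip L%:R x * (i%:R / N%:R).
pose y x := t0 + \sum_(i < N) asin (steps (pt x i) (pt x i.+1)).
have ptd x i : `|pt x i - pt x i.+1| < d.
  have -> : pt x i - pt x i.+1 = - (clip L%:R x / N%:R) by rewrite /pt -natr1; ring.
  rewrite normrN normrM [`|N%:R^-1|]gtr0_norm ?invr_gt0 // ltr_pdivrMr //.
  apply: le_lt_trans (clip_le x (ler0n _ L)) _.
  by move: hN; rewrite ltr_pdivrMr // mulrC.
have pos x i : 0 < stepc (pt x i) (pt x i.+1) by exact: hd.
have sb x i : -1 < steps (pt x i) (pt x i.+1) < 1.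
  rewrite -ltr_norml -ltr_sqr ?nnegrE // real_normK ?num_real // expr1n.
  by rewrite -(step_circ (pt x i) (pt x i.+1)) ltrDr exprn_gt0.
have cpt i : continuous (fun x => pt x i).
  by apply: contM; [exact: clip_cont|exact: cont_cst].
have casin i : continuous (fun x => asin (steps (pt x i) (pt x i.+1))).
  move=> x; apply: (@continuous_comp _ _ _ (fun x => steps (pt x i) (pt x i.+1)) (@asin R)); last first.
    by apply: continuous_asin; exact: sb.
  have cc (f : R -> R) j : continuous f -> continuous (fun x => f (pt x j)) by move=> cf; apply: cont_comp.
  by apply: contB; apply: contM; apply: cc.
exists y; split.
- apply: contD; first exact: cont_cst.
  elim: (N) => [|m IH].
    have -> : (fun x => \sum_(i < 0) asin (steps (pt x i) (pt x i.+1))) = (fun=> 0) by apply: funext => x; rewrite big_ord0.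
    exact: cont_cst.
  have -> : (fun x => \sum_(i < m.+1) asin (steps (pt x i) (pt x i.+1))) =
     fun x => \sum_(i < m) asin (steps (pt x i) (pt x i.+1)) + asin (steps (pt x m) (pt x m.+1)).
    by apply: funext => x; rewrite big_ord_recr.
  by apply: contD.
- have c00 : clip L%:R 0 = 0 :> R by apply: clip_id; rewrite normr0.
  rewrite /y big1 ?addr0 // => i _; rewrite /pt c00 !mul0r /steps mulrC subrr.
  rewrite -[X in asin X](@sin0 R) sinK // in_itv /=; have := pi_gt0 R; lra.
- move=> x xL.
  have key m : cos (t0 + \sum_(i < m) asin (steps (pt x i) (pt x i.+1))) = X (pt x m) /\
               sin (t0 + \sum_(i < m) asin (steps (pt x i) (pt x i.+1))) = Y (pt x m).
    elim: m => [|m [IH1 IH2]]; first by rewrite big_ord0 addr0 /pt mul0r mulr0.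
    rewrite big_ord_recr addrA /= cosD [sin (_ + asin _)]sinD IH1 IH2.
    have sb' : -1 <= steps (pt x m) (pt x m.+1) <= 1 by have /andP[/ltW -> /ltW ->] := sb x m.
    rewrite cos_asin // asinK ?in_itv //.
    have -> : Num.sqrt (1 - steps (pt x m) (pt x m.+1) ^+ 2) = stepc (pt x m) (pt x m.+1).
      by rewrite -(step_circ (pt x m) (pt x m.+1)) addrK sqrtr_sqr gtr0_norm.
    rewrite /stepc /steps; move: (circ (pt x m)).
    move: (X (pt x m)) (Y (pt x m)) (X (pt x m.+1)) (Y (pt x m.+1)) => a b a' b' ab; split.
      by rewrite -[RHS]mul1r -ab; ring.
    by rewrite -[RHS]mul1r -ab; ring.
  have [k1 k2] := key N; rewrite /y k1 k2 /pt clip_id // divff ?mulr1 //; by rewrite gt_eqF.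
Qed.

(** Two local lifts agree on their common domain, since their difference over 2 pi is a continuous
    integer that vanishes at 0. *)
Lemma angle_lift : exists y : R -> R, continuous y /\ forall x, X x = cos (2 * pi * y x) /\ Y x = sin (2 * pi * y x).
Proof.
have [t0 [c0 s0]] := angle_exists (circ 0).
have [f hf] := choice (fun L => @local_lift t0 L c0 s0).
have agree (L L' : nat) x : `|x| <= L%:R -> `|x| <= L'%:R -> f L x = f L' x.
  move=> xL xL'; have [c1 z1 l1] := hf L; have [c2 z2 l2] := hf L'.
  pose h t := (f L (x * sin t) - f L' (x * sin t)) / (2 * pi).
  have p0 : 2 * pi != 0 :> R by rewrite mulf_neq0 // gt_eqF // pi_gt0.
  have cs : continuous (fun t : R => x * sin t) by apply: contM; [exact: cont_cst|exact: continuous_sin].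
  have ch : continuous h.
    by apply: contM; [apply: contB; apply: cont_comp|exact: cont_cst].
  have hz t : exists k : int, h t = k%:~R.
    have xs M : `|x| <= M -> `|x * sin t| <= M.
      by apply: le_trans; rewrite normrM ler_piMr // sin_max.
    have [a1 b1] := l1 _ (xs _ xL); have [a2 b2] := l2 _ (xs _ xL').
    apply: cos_2pi_eq1; rewrite /h mulrC divfK // cosB a1 b1 a2 b2 -!expr2; exact: circ.
  have := int_valued_const ch hz 0 (pi / 2).
  rewrite /h sin0 sin_pihalf mulr0 mulr1 z1 z2 subrr mul0r => /esym/eqP.
  by rewrite mulf_eq0 invr_eq0 (negPf p0) orbF subr_eq0 => /eqP.
pose y x := f (Num.truncn `|x|).+1 x.
have xtr (x : R) : `|x| <= (Num.truncn `|x|).+1%:R by have /andP[_ /ltW] := truncn_itv (normr_ge0 x).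
have yE M x : `|x| <= M%:R -> y x = f M x by move=> xM; apply: agree.
have cy : continuous y.
  move=> x; pose M := (Num.truncn `|x|).+2.
  have xM : `|x| + 1 <= M%:R.
    have -> : M%:R = (Num.truncn `|x|).+1%:R + 1 :> R by rewrite natr1.
    by rewrite lerD2r.
  have [cM _ _] := hf M.
  apply/cvgrPdist_lt => e e0; have /cvgrPdist_lt/(_ _ e0)/nbhs_ballP[d /= d0 hd] := cM x.
  apply/nbhs_ballP; exists (Num.min d 1); first by rewrite /= lt_min d0 ltr01.
  move=> t; rewrite /ball /= lt_min => /andP[td t1].
  have tM : `|t| <= M%:R.
    have -> : t = x - (x - t) by ring.
    by apply: le_trans (ler_normB _ _) _; move: t1 xM; lra.
  rewrite (yE M x) ?(yE M t) //; first exact: hd.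
  by move: xM; lra.
have p0 : 2 * pi != 0 :> R by rewrite mulf_neq0 // gt_eqF // pi_gt0.
exists (fun x => y x / (2 * pi)); split; first by apply: contM => //; exact: cont_cst.
move=> x; rewrite mulrC divfK //.
by have [_ _ /(_ x (xtr x))[-> ->]] := hf (Num.truncn `|x|).+1.
Qed.

End AngleLift.

(** * Zeros of the diagonal Green function *)

Section Green.
Variables (R : realType) (lam alpha E : R) (g : int -> R -> R).
Hypotheses (lam1 : `|lam| <= 1) (E4 : `|E| <= 4).
Hypothesis gE : forall n x, g (n + 1) x + g (n - 1) x +
  (2 * lam * cos (2 * pi * (x + n%:~R * alpha)) - E) * g n x = (n == 0)%:R.
Hypothesis gS : forall n x, g n x = g (- n) (x + n%:~R * alpha).
Hypothesis gD : forall x e, 0 < e -> exists N : nat, forall n : int, (N <= `|n|)%N -> `|g n x| <= e.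
Hypothesis gC : forall n, continuous (g n).
Hypothesis gP : forall n x (k : int), g n (x + k%:~R) = g n x.

(** The Wronskian is constant to the left of [N] and tends to 0 at minus infinity. *)
Lemma left_wronskian (phi psi w : int -> R) (N : int) :
  (forall n, n <= N -> phi (n + 1) + phi (n - 1) + w n * phi n = 0) ->
  (forall n, n <= N -> psi (n + 1) + psi (n - 1) + w n * psi n = 0) ->
  (forall e, 0 < e -> exists M : nat, forall n : int, (M <= `|n|)%N -> `|phi n| <= e) ->
  (forall e, 0 < e -> exists M : nat, forall n : int, (M <= `|n|)%N -> `|psi n| <= e) ->
  phi (N + 1) * psi N = phi N * psi (N + 1).
Proof.
move=> h1 h2 d1 d2; pose Wr n := phi (n + 1) * psi n - phi n * psi (n + 1).
have Wc (j : nat) : Wr (N - j%:Z) = Wr N.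
  elim: j => [|j IH]; first by rewrite subr0.
  rewrite -IH /Wr; have nj : N - j%:Z <= N by clear; lia.
  have e1 := h1 _ nj; have e2 := h2 _ nj.
  have -> : N - j.+1%:Z + 1 = N - j%:Z by clear; lia.
  have -> : N - j.+1%:Z = N - j%:Z - 1 by clear; lia.
  move: e1 e2; move: (phi _) (phi _) (phi _) (psi _) (psi _) (psi _) (w _) => a b c a' b' c' v e1 e2.
  have -> : c = - b - v * a by move: e1; lra.
  have -> : c' = - b' - v * a' by move: e2; lra.
  ring.
apply/eqP; rewrite -subr_eq0 -/(Wr N) -normr_le0; apply/ler_addgt0Pr => e e0; rewrite add0r.
pose e' := Num.min 1 (e / 2); have e'0 : 0 < e' by rewrite lt_min ltr01 divr_gt0.
have [M1 hM1] := d1 _ e'0; have [M2 hM2] := d2 _ e'0.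
pose j := (M1 + M2 + `|N| + 2)%N; rewrite -(Wc j) /Wr.
have b1 (n : int) : (M1 + M2 <= `|n|)%N -> `|phi n| <= e' /\ `|psi n| <= e'.
  by move=> hn; split; [apply: hM1|apply: hM2]; move: hn; clear; lia.
have [p1 q1] := b1 (N - j%:Z + 1) (ltac:(rewrite /j; clear; lia)).
have [p2 q2] := b1 (N - j%:Z) (ltac:(rewrite /j; clear; lia)).
apply: le_trans (ler_normB _ _) _; rewrite !normrM [leRHS]splitr.
have ee : e' * e' <= e / 2.
  apply: le_trans (_ : 1 * (e / 2) <= _); last by rewrite mul1r.
  by apply: ler_pM; rewrite ?(ltW e'0) // ge_min lexx ?orbT.
by apply: lerD; apply: le_trans ee; apply: ler_pM.
Qed.

(** The full Green function: [g] is its column at the site 0, and covariance gives the other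
    columns. *)
Definition G2 (x : R) (n m : int) : R := g (n - m) (x + m%:~R * alpha).

Lemma G2_eq x n m : G2 x (n + 1) m + G2 x (n - 1) m +
  (2 * lam * cos (2 * pi * (x + n%:~R * alpha)) - E) * G2 x n m = (n == m)%:R.
Proof.
rewrite /G2; have := gE (n - m) (x + m%:~R * alpha).
have -> : n - m + 1 = n + 1 - m by ring.
have -> : n - m - 1 = n - 1 - m by ring.
have -> : x + m%:~R * alpha + (n - m)%:~R * alpha = x + n%:~R * alpha by rewrite intrD intrN; ring.
by rewrite subr_eq0.
Qed.

Lemma G2_decay x m e : 0 < e -> exists M : nat, forall n : int, (M <= `|n|)%N -> `|G2 x n m| <= e.
Proof.
move=> e0; have [N hN] := gD (x + m%:~R * alpha) e0; exists (N + `|m|)%N => n hn.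
by apply: hN; move: hn; clear; lia.
Qed.

(** To the left of its source, every column m >= 0 is a solution decaying on the left, and such
    solutions are proportional. *)
Lemma G2_par x (m m' : int) : 0 <= m -> 0 <= m' -> G2 x 0 m * G2 x (-1) m' = G2 x (-1) m * G2 x 0 m'.
Proof.
move=> m0 m'0; have h (k : int) : 0 <= k -> forall n, n <= -1 -> G2 x (n + 1) k + G2 x (n - 1) k +
  (2 * lam * cos (2 * pi * (x + n%:~R * alpha)) - E) * G2 x n k = 0.
  by move=> k0 n n1; rewrite G2_eq; case: eqP => // e; move: n1 k0; rewrite e; clear; lia.
by have := left_wronskian (h m m0) (h m' m'0) (G2_decay x m) (G2_decay x m'); rewrite addNr.
Qed.

Lemma g_cont2 n (c : R) : continuous (fun x => g n (x + c)).
Proof. by apply: cont_comp => //; apply: contD; [exact: cont_id|exact: cont_cst]. Qed.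

Lemma G2_00 x : G2 x 0 0 = g 0 x. Proof. by rewrite /G2 subrr mul0r addr0. Qed.
Lemma G2_m0 x : G2 x (-1) 0 = g (-1) x. Proof. by rewrite /G2 subr0 mul0r addr0. Qed.
Lemma G2_01 x : G2 x 0 1 = g 1 x.
Proof. by rewrite /G2 sub0r (gS 1) mul1r. Qed.

(** Proportionality of the columns 0 and 1 at the sites 0 and -1, with the values at -1 eliminated
    by the equation at the site 0. *)
Lemma green_product x : g 1 x * (g 1 x - 1) = g 0 x * g 0 (x + alpha).
Proof.
have par := @G2_par x 0 1 (lexx 0) ler01.
have e0 := G2_eq x 0 0; have e1 := G2_eq x 0 1.
rewrite !add0r eqxx in e0; rewrite !add0r in e1.
move: par e0 e1; rewrite !G2_00 !G2_01 !G2_m0.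
have -> : G2 x 1 0 = g 1 x by rewrite /G2 subr0 mul0r addr0.
have -> : G2 x 1 1 = g 0 (x + alpha) by rewrite /G2 subrr mul1r.
rewrite (_ : (0 == 1 :> int) = false) //.
move: (g 1 x) (g 0 x) (g (-1) x) (G2 x (-1) 1) (g 0 (x + alpha)) (2 * lam * cos _ - E) => a b c d f w par e0 e1.
have dE : d = - f - w * a by move: e1; rewrite /=; lra.
have cE : c = 1 - a - w * b by move: e0; rewrite /=; lra.
by move: par; rewrite dE cE; lra.
Qed.

Lemma green_sum x : g 1 x + g 1 (x - alpha) = 1 - (2 * lam * cos (2 * pi * x) - E) * g 0 x.
Proof.
have := gE 0 x; rewrite add0r sub0r eqxx mul0r addr0 (gS (-1)) opprK mulN1r /=; lra.
Qed.

(** If g_0 were small, g_1 would be near 0 or near 1 by [green_product], always on the same side of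
    1/2 by continuity; but g_1(x) + g_1(x - alpha) is close to 1 by [green_sum]. *)
Lemma green_large : exists x, 1 / 100 <= `|g 0 x|.
Proof.
apply: contrapT => /forallNP H.
have small x : `|g 0 x| <= 1 / 100 by rewrite leNgt; apply/negP => /ltW; exact: H.
have prod x : `|g 1 x * (g 1 x - 1)| <= 1 / 100 * (1 / 100).
  by rewrite green_product normrM; apply: ler_pM.
have sum x : `|g 1 x + g 1 (x - alpha) - 1| <= 6 / 100.
  rewrite green_sum addrAC subrr sub0r normrN normrM.
  have := potE alpha lam1 E4 x 0; rewrite mul0r addr0 => h.
  have := ler_pM (normr_ge0 _) (normr_ge0 _) h (small x); lra.
have nohalf x : g 1 x <> 1 / 2.
  move=> e; have := prod x; rewrite e ler_norml => /andP[]; lra.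
have side x : g 1 x < 1 / 2 -> `|g 1 x| <= 1 / 10.
  move=> h; have := prod x; rewrite !ler_norml => /andP[h1 h2]; apply/andP; split; nra.
have side' x : 1 / 2 < g 1 x -> `|g 1 x - 1| <= 1 / 10.
  move=> h; have := prod x; rewrite !ler_norml => /andP[h1 h2]; apply/andP; split; nra.
have := sum 0; have [lt|ge] := ltP (g 1 0) (1 / 2).
  have lt' x : g 1 x < 1 / 2.
    rewrite ltNge; apply/negP => h.
    by have [|t /nohalf//] := @ivt_between R (g 1) 0 x (1 / 2) (@gC 1); rewrite (ltW lt).
  have := side _ lt; have := side _ (lt' (0 - alpha)); rewrite !ler_norml.
  by move=> /andP[? ?] /andP[? ?] /andP[? ?]; lra.
have gt0 : 1 / 2 < g 1 0 by rewrite lt_neqAle ge andbT eq_sym; apply/eqP; exact: nohalf.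
have gt' x : 1 / 2 < g 1 x.
  rewrite ltNge; apply/negP => h.
  by have [|t /nohalf//] := @ivt_between R (g 1) x 0 (1 / 2) (@gC 1); rewrite h (ltW gt0).
have := side' _ gt0; have := side' _ (gt' (0 - alpha)); rewrite !ler_norml.
by move=> /andP[? ?] /andP[? ?] /andP[? ?]; lra.
Qed.

(** (c, s) is parallel to (f(0), f(-1)) for a solution f decaying on the left. Two columns are
    tested because one of them may vanish at both sites. *)
Definition on_line (x c s : R) := G2 x 0 0 * s = G2 x (-1) 0 * c /\ G2 x 0 1 * s = G2 x (-1) 1 * c.

Lemma line_nonzero x : ~ [/\ G2 x 0 0 = 0, G2 x (-1) 0 = 0 & G2 x 0 1 = 0].
Proof.
move=> [h1 h2 h3]; have := G2_eq x 0 0; rewrite add0r sub0r h1 h2 eqxx mulr0 !addr0.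
have -> : G2 x 1 0 = g 1 x by rewrite /G2 subr0 mul0r addr0.
by rewrite -G2_01 h3 => /eqP; rewrite eq_sym oner_eq0.
Qed.

Lemma line_any x c s m : 0 <= m -> on_line x c s -> G2 x 0 m * s = G2 x (-1) m * c.
Proof.
move=> m0 [h1 h2]; have p1 := @G2_par x 0 m (lexx 0) m0; have p2 := @G2_par x 1 m ler01 m0.
have nz := @line_nonzero x.
move: h1 h2 p1 p2 nz; move: (G2 x 0 0) (G2 x (-1) 0) (G2 x 0 1) (G2 x (-1) 1) (G2 x 0 m) (G2 x (-1) m).
move=> a1 b1 a2 b2 q p h1 h2 p1 p2 nz.
have aux a b : a * s = b * c -> a * p = b * q -> a != 0 -> q * s = p * c.
  move=> e1 e2 a0; apply: (mulfI a0); rewrite mulrCA e1 mulrCA [in RHS]mulrA e2; ring.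
have aux' a b : a * s = b * c -> a * p = b * q -> b != 0 -> q * s = p * c.
  move=> e1 e2 b0; apply: (mulfI b0); rewrite mulrA -e2 -mulrA [in RHS]mulrCA -e1; ring.
have [a10|] := eqVneq a1 0; last exact: (aux a1 b1).
have [b10|] := eqVneq b1 0; last exact: (aux' a1 b1).
have [a20|] := eqVneq a2 0; last exact: (aux a2 b2).
by case: nz.
Qed.

Lemma line_step x c s : on_line x c s -> on_line (x + alpha) (pot lam E x * c - s) c.
Proof.
move=> h.
have tr n m : G2 (x + alpha) n m = G2 x (n + 1) (m + 1).
  rewrite /G2; have -> : n + 1 - (m + 1) = n - m by ring.
  by congr (g _ _); rewrite intrD; ring.
have key m : 1 <= m -> G2 x 1 m * c = G2 x 0 m * (pot lam E x * c - s).
  move=> m1; have m0 : 0 <= m by apply: le_trans m1.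
  have e := G2_eq x 0 m; rewrite add0r sub0r mul0r addr0 in e.
  have e0 : (0 == m) = false by move: m1; clear; lia.
  rewrite e0 in e; have := line_any m0 h; rewrite /pot; move: e; rewrite /=.
  move: (G2 x 1 m) (G2 x (-1) m) (G2 x 0 m) => a b d e k.
  have -> : a = - b - (2 * lam * cos (2 * pi * x) - E) * d by lra.
  by rewrite mulrBr mulrBl mulNr -k; ring.
by split; rewrite !tr add0r addNr; apply: key.
Qed.

(** A line has an angle modulo a half turn, so the continuous object is the doubled angle: the
    square of a vector, read as a complex number, forgets its sign, and the sum of the squares of
    two parallel columns, not both zero, does not vanish. *)
Definition line_size x : R := g 0 x ^+ 2 + g (-1) x ^+ 2 + g (-1) (x + alpha) ^+ 2 + g (-2) (x + alpha) ^+ 2.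
Definition line_cos x : R := (g 0 x ^+ 2 - g (-1) x ^+ 2 + g (-1) (x + alpha) ^+ 2 - g (-2) (x + alpha) ^+ 2) / line_size x.
Definition line_sin x : R := (2 * (g 0 x * g (-1) x + g (-1) (x + alpha) * g (-2) (x + alpha))) / line_size x.

Lemma G2_01' x : G2 x 0 1 = g (-1) (x + alpha). Proof. by rewrite /G2 sub0r mul1r. Qed.
Lemma G2_m1 x : G2 x (-1) 1 = g (-2) (x + alpha). Proof. by rewrite /G2 mul1r. Qed.

Lemma line_size_gt0 x : 0 < line_size x.
Proof.
rewrite lt_neqAle /line_size !addr_ge0 ?sqr_ge0 // andbT eq_sym; apply/negP => /eqP h.
have := @line_nonzero x; apply; rewrite G2_00 G2_m0 G2_01'.
have := sqr_ge0 (g 0 x); have := sqr_ge0 (g (-1) x); have := sqr_ge0 (g (-1) (x + alpha)); have := sqr_ge0 (g (-2) (x + alpha)).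
move=> h1 h2 h3 h4; split; apply/eqP; rewrite -sqrf_eq0 eq_le ?h1 ?h2 ?h3 ?h4 ?andbT; lra.
Qed.

Lemma line_circ x : line_cos x ^+ 2 + line_sin x ^+ 2 = 1.
Proof.
have s0 := line_size_gt0 x; have s1 : line_size x != 0 by rewrite gt_eqF.
have par := @G2_par x 0 1 (lexx 0) ler01; rewrite G2_00 G2_m0 G2_01' G2_m1 in par.
rewrite /line_cos /line_sin !expr_div_n -mulrDl.
apply: (mulIf (expf_neq0 2 s1)); rewrite divfK ?expf_neq0 // mul1r /line_size.
move: par; move: (g 0 x) (g (-1) x) (g (-1) (x + alpha)) (g (-2) (x + alpha)) => a b c d par.
have -> : (a ^+ 2 + b ^+ 2 + c ^+ 2 + d ^+ 2) ^+ 2 =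
  (a ^+ 2 - b ^+ 2 + c ^+ 2 - d ^+ 2) ^+ 2 + (2 * (a * b + c * d)) ^+ 2 + 4 * (a * d - b * c) ^+ 2 by ring.
by rewrite par subrr expr0n mulr0 addr0.
Qed.

Lemma line_size_cont : continuous line_size.
Proof.
have h n c : continuous (fun x => g n (x + c) ^+ 2) by exact: (contM (@g_cont2 n c) (@g_cont2 n c)).
have h0 n : continuous (fun x => g n x ^+ 2) by exact: (contM (@gC n) (@gC n)).
by apply: contD => //; apply: contD => //; apply: contD.
Qed.

Lemma line_sizeV_cont : continuous (fun x => (line_size x)^-1).
Proof.
move=> x; apply: (@continuousV _ _ line_size); last exact: line_size_cont.
by rewrite gt_eqF // line_size_gt0.
Qed.

Lemma line_cos_cont : continuous line_cos.
Proof.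
have h n c : continuous (fun x => g n (x + c) ^+ 2) by exact: (contM (@g_cont2 n c) (@g_cont2 n c)).
have h0 n : continuous (fun x => g n x ^+ 2) by exact: (contM (@gC n) (@gC n)).
by apply: contM line_sizeV_cont; apply: contB => //; apply: contD => //; apply: contB.
Qed.

Lemma line_sin_cont : continuous line_sin.
Proof.
apply: contM line_sizeV_cont; apply: contM; first exact: cont_cst.
by apply: contD; apply: contM; first [exact: g_cont2 | exact: gC].
Qed.

Lemma line_per x (k : int) : [/\ line_size (x + k%:~R) = line_size x, line_cos (x + k%:~R) = line_cos x & line_sin (x + k%:~R) = line_sin x].
Proof.
have e : x + k%:~R + alpha = x + alpha + k%:~R by ring.
by rewrite /line_cos /line_sin /line_size !e !gP.
Qed.

(** The doubled angle is lifted and then halved, so [y] is canonical only modulo 1/2. *)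
Lemma line_angle : exists y : R -> R, [/\ continuous y,
   forall x, on_line x (cos (2 * pi * y x)) (sin (2 * pi * y x)) &
   forall x x', on_line x (cos (2 * pi * x')) (sin (2 * pi * x')) -> exists k : int, 2 * (y x - x') = k%:~R].
Proof.
have [z [cz hz]] := angle_lift line_cos_cont line_sin_cont (fun x k => let: And3 _ h _ := line_per x k in h)
   (fun x k => let: And3 _ _ h := line_per x k in h) line_circ.
have onl x : on_line x (cos (2 * pi * (z x / 2))) (sin (2 * pi * (z x / 2))).
  have [zc zs] := hz x; have s0 := line_size_gt0 x.
  set c := cos _; set s := sin _.
  have p2 : 2 * pi * z x = (2 * pi * (z x / 2)) *+ 2 by rewrite -[RHS]mulr_natl; field.
  have c2 : line_cos x = c ^+ 2 - s ^+ 2.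
    rewrite zc p2 cos_mulr2n -[_ ^+ 2 *+ 2]mulr_natl -/c.
    have := cos2Dsin2 (2 * pi * (z x / 2)); rewrite -/c -/s; lra.
  have s2 : line_sin x = 2 * (s * c).
    by rewrite zs p2 sin_mulr2n -[LHS]mulr_natl -/s -/c; ring.
  have n1 : c ^+ 2 + s ^+ 2 = 1 by exact: cos2Dsin2.
  have e1 : g 0 x ^+ 2 - g (-1) x ^+ 2 + g (-1) (x + alpha) ^+ 2 - g (-2) (x + alpha) ^+ 2 = line_size x * (c ^+ 2 - s ^+ 2).
    by rewrite -c2 /line_cos mulrC divfK // gt_eqF.
  have e2 : 2 * (g 0 x * g (-1) x + g (-1) (x + alpha) * g (-2) (x + alpha)) = line_size x * (2 * (s * c)).
    by rewrite -s2 /line_sin [line_size x * _]mulrC divfK // gt_eqF.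
  rewrite /on_line G2_00 G2_m0 G2_01' G2_m1.
  have : (g 0 x * s - g (-1) x * c) ^+ 2 + (g (-1) (x + alpha) * s - g (-2) (x + alpha) * c) ^+ 2 = 0.
    move: e1 e2; rewrite /line_size; move: (g 0 x) (g (-1) x) (g (-1) (x + alpha)) (g (-2) (x + alpha)) => a b a' b' e1 e2.
    have -> : (a * s - b * c) ^+ 2 + (a' * s - b' * c) ^+ 2 =
      ((a ^+ 2 + b ^+ 2 + a' ^+ 2 + b' ^+ 2) * (c ^+ 2 + s ^+ 2) - (a ^+ 2 - b ^+ 2 + a' ^+ 2 - b' ^+ 2) * (c ^+ 2 - s ^+ 2)
        - 2 * (a * b + a' * b') * (2 * (s * c))) / 2 by field.
    rewrite e1 e2 n1.
    have -> : (a ^+ 2 + b ^+ 2 + a' ^+ 2 + b' ^+ 2) * 1 - (a ^+ 2 + b ^+ 2 + a' ^+ 2 + b' ^+ 2) * (c ^+ 2 - s ^+ 2) * (c ^+ 2 - s ^+ 2) -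
       (a ^+ 2 + b ^+ 2 + a' ^+ 2 + b' ^+ 2) * (2 * (s * c)) * (2 * (s * c)) =
       (a ^+ 2 + b ^+ 2 + a' ^+ 2 + b' ^+ 2) * (1 - (c ^+ 2 + s ^+ 2) ^+ 2) by ring.
    by rewrite n1 expr1n subrr mulr0 mul0r.
  move/eqP; rewrite paddr_eq0 ?sqr_ge0 // !sqrf_eq0 !subr_eq0 => /andP[/eqP -> /eqP ->]; by [].
exists (fun x => z x / 2); split=> //.
  by apply: contM => //; exact: cont_cst.
move=> x x' h; apply: sin_pi_eq0.
have -> : pi * (2 * (z x / 2 - x')) = 2 * pi * (z x / 2) - 2 * pi * x' by ring.
rewrite sinB; have := onl x; have nz := @line_nonzero x; move: h nz => [h1 h2] nz [h3 h4].
move: nz h1 h2 h3 h4; move: (G2 x 0 0) (G2 x (-1) 0) (G2 x 0 1) (G2 x (-1) 1) => a b a' b' nz.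
move: (sin _) (cos _) (sin _) (cos _) => s' c' s c h1 h2 h3 h4.
have aux p q : p * s = q * c -> p * s' = q * c' -> p != 0 -> s' * c - c' * s = 0.
  move=> e1 e2 p0; apply: (mulfI p0); rewrite mulr0.
  have -> : p * (s' * c - c' * s) = (p * s') * c - c' * (p * s) by ring.
  by rewrite e1 e2; ring.
have aux' p q : p * s = q * c -> p * s' = q * c' -> q != 0 -> s' * c - c' * s = 0.
  move=> e1 e2 q0; apply: (mulfI q0); rewrite mulr0.
  have -> : q * (s' * c - c' * s) = s' * (q * c) - (q * c') * s by ring.
  by rewrite -e1 -e2; ring.
have [a0|] := eqVneq a 0; last exact: (aux a b).
have [b0|] := eqVneq b 0; last exact: (aux' a b).
have [a1|] := eqVneq a' 0; last exact: (aux a' b').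
by case: nz.
Qed.

End Green.

(** * Winding of the line of left-decaying solutions *)

Section Winding.
Variables (R : realType) (lam alpha E : R) (psi : R * R -> R) (y : R -> R) (r : R) (m j : int).
Hypothesis irr : not_rational alpha.
Hypothesis hp : is_fibered_lift (amo_cocycle lam E) psi.
Hypothesis lim : forall p : R * R, (fun n : nat => n%:R^-1 *
         \sum_(0 <= k < n) psi (iter k (fibered_lift_map alpha psi) p)) @ \oo --> r.
Hypothesis rE : 2 * r = m%:~R * alpha + j%:~R.
Hypothesis cy : continuous y.
Hypothesis y_step : forall x, exists k : int, 2 * (y (x + alpha) - lmap psi x (y x)) = k%:~R.
Hypothesis y_per : forall x, exists k : int, 2 * (y (x + 1) - y x) = k%:~R.

Let cyD c : continuous (fun x => y (x + c)).
Proof. by apply: cont_comp => //; apply: contD; [exact: cont_id|exact: cont_cst]. Qed.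

Lemma step_const : exists k : int, forall x, y (x + alpha) = lmap psi x (y x) + k%:~R / 2.
Proof.
have [k hk] := y_step 0; exists k => x.
have cf : continuous (fun x => 2 * (y (x + alpha) - lmap psi x (y x))).
  apply: contM; first exact: cont_cst.
  by apply: contB => //; apply: (lmap_continuous hp) => //; exact: cont_id.
have := int_valued_const cf y_step x 0; rewrite hk; lra.
Qed.

Lemma per_const : exists M : int, forall x, y (x + 1) = y x + M%:~R / 2.
Proof.
have [k hk] := y_per 0; exists k => x.
have cf : continuous (fun x : R => 2 * (y (x + 1) - y x)).
  by apply: contM; [exact: cont_cst|apply: contB].
have := int_valued_const cf y_per x 0; rewrite hk; lra.
Qed.

(** If y gains M / 2 per turn, then y(x) - M x / 2 is bounded, so 2 r = M alpha - k; comparison with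
    the label gives M = m, alpha being irrational. *)
Lemma winding : forall x, y (x + 1) = y x + m%:~R / 2.
Proof.
have [k hk] := step_const; have [M hM] := per_const.
suff -> : m = M by [].
pose c x := y x - M%:~R / 2 * x.
have cc : continuous c.
  by apply: contB => //; apply: contM; [exact: cont_cst|exact: cont_id].
have c1 x (n : nat) : c (x + n%:R) = c x.
  elim: n => [|n IH]; first by rewrite addr0.
  rewrite -IH /c; have -> : x + n.+1%:R = x + n%:R + 1 by rewrite -natr1; ring.
  by rewrite hM; field.
have cz x (n : int) : c (x + n%:~R) = c x.
  by case: n => n; [exact: c1|rewrite NegzE -(c1 _ n.+1) intrN subrK].
have [a _ ha] := EVT_max ler01 (continuous_subspaceT cc).
have [b _ hb] := EVT_min ler01 (continuous_subspaceT cc).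
have cb x : c b <= c x <= c a.
  have /andP[k1 k2] := floor_itv x; rewrite intrD in k2.
  have -> : c x = c (x - (Num.floor x)%:~R) by rewrite -intrN cz.
  have fr : x - (Num.floor x)%:~R \in `[0, 1] by rewrite in_itv /=; apply/andP; split; lra.
  by rewrite ha // hb.
pose K := `|c a| + `|c b|.
have cK x : `|c x| <= K.
  have /andP[h1 h2] := cb x; rewrite ler_norml /K; apply/andP; split.
    have := ler_normB 0 (c b); have := ler_norm (- c b); rewrite normrN; have := normr_ge0 (c a); lra.
  have := ler_norm (c a); have := normr_ge0 (c b); lra.
have orbE n : orb alpha psi n 0 (y 0) = y (n%:R * alpha) - n%:R * k%:~R / 2.
  elim: n => [|n IH]; first by rewrite !mul0r subr0.
  rewrite orbS IH add0r.
  have -> : y (n%:R * alpha) - n%:R * k%:~R / 2 = y (n%:R * alpha) + (- (n%:Z * k))%:~R / 2 by rewrite intrN intrM; ring.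
  rewrite (lmap_half_int hp); have -> : n.+1%:R * alpha = n%:R * alpha + alpha by rewrite -natr1; ring.
  by rewrite hk intrN intrM -natr1; ring.
have r2 : 2 * r = M%:~R * alpha + (- k)%:~R.
  apply/eqP; rewrite -subr_eq0 -normr_le0 leNgt; apply/negP => h.
  set e := `|_| in h; have e4 : 0 < e / 4 by rewrite divr_gt0.
  have [N1 hN1] := cvg_dist (lim (0, y 0)) e4.
  have [N2 hN2] := archi_nat ((2 * K + 1) * 4 / e).
  pose n := (maxn N1 N2).+1.
  have n1 : (N1 <= n)%N by rewrite /n; clear; lia.
  have n0 : 0 < n%:R :> R by rewrite ltr0n.
  have := hN1 n n1; rewrite orb_sum orbE => g1.
  have g2 : 2 * K < n%:R * (e / 4).
    apply: lt_le_trans (_ : N2%:R * (e / 4) <= _); last first.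
      by apply: ler_wpM2r; [exact: ltW|rewrite ler_nat /n; clear; lia].
    move: hN2; rewrite ltr_pdivrMr //; lra.
  have : e <= 2 * (`|n%:R^-1 * (y (n%:R * alpha) - n%:R * k%:~R / 2 - y 0) - r| + `|n%:R^-1 * (c (n%:R * alpha) - c 0)|).
    rewrite /e; have -> : 2 * r - (M%:~R * alpha + (- k)%:~R) =
       2 * (- (n%:R^-1 * (y (n%:R * alpha) - n%:R * k%:~R / 2 - y 0) - r) + n%:R^-1 * (c (n%:R * alpha) - c 0)).
      by rewrite /c intrN; field; rewrite gt_eqF.
    rewrite normrM [`|2|]ger0_norm // ler_pM2l // -[X in _ <= X + _]normrN; exact: ler_normD.
  have g3 : `|n%:R^-1 * (c (n%:R * alpha) - c 0)| < e / 4.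
    rewrite normrM gtr0_norm ?invr_gt0 // ltr_pdivrMl //; apply: le_lt_trans g2.
    apply: le_trans (ler_normB _ _) _; have := cK (n%:R * alpha); have := cK 0; lra.
  move: g1 g3 h; lra.
apply/eqP; rewrite -subr_eq0; apply/negPn/negP => h.
have := irr_int irr (j + k) h; rewrite !intrD !intrN => /eqP; apply.
move: rE r2; rewrite intrN; lra.
Qed.

(** A vertical vector has a horizontal image whatever x is, so psi(x, 1/4) does not depend on x;
    monotonicity over half a turn does the rest. *)
Lemma psi_osc : exists c0, forall x z, `|psi (x, z) - c0| <= 1 / 2.
Proof.
pose f x := 2 * lmap psi x (1 / 4).
have cf : continuous f.
  apply: contM; first exact: cont_cst.
  by apply: (lmap_continuous hp); [exact: cont_id|exact: cont_cst].
have q4 : 2 * pi * (1 / 4) = pi / 2 :> R by field.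
have fz x : exists k : int, f x = k%:~R.
  have [s s0 [_ e2]] := lift_eq hp x (1 / 4).
  apply: sin_pi_eq0; rewrite /f; have -> : pi * (2 * lmap psi x (1 / 4)) = 2 * pi * lmap psi x (1 / 4) by ring.
  by move: e2; rewrite q4 cos_pihalf => /esym/eqP; rewrite mulf_eq0 gt_eqF //= => /eqP.
exists (psi (0, 1 / 4)) => x z.
have e0 : psi (x, 1 / 4) = psi (0, 1 / 4) by have := int_valued_const cf fz x 0; rewrite /f /lmap; lra.
rewrite -e0.
pose k : int := Num.floor (2 * (z - 1 / 4)).
have /andP[k1 k2] := floor_itv (2 * (z - 1 / 4)); rewrite -/k intrD in k1 k2.
have h1 : lmap psi x (1 / 4 + k%:~R / 2) <= lmap psi x z by apply: (lmap_le hp); lra.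
have h2 : lmap psi x z <= lmap psi x (1 / 4 + (k + 1)%:~R / 2) by apply: (lmap_le hp); rewrite intrD; lra.
move: h1 h2; rewrite !(lmap_half_int hp) intrD /lmap ler_norml => h1 h2; apply/andP; split; lra.
Qed.

(** Some interval of length 1 / p carries at least |m| / (2 p) of the total increment. A translation
    by alpha changes this amount by at most 1, by [psi_osc], so after at most N translations into
    the prescribed interval enough of it is left for k crossings. *)
Lemma crossings (p N k : nat) (z : R) : (0 < p)%N ->
  (forall w, exists n (i : int), (n <= N)%N /\ `|w - n%:R * alpha - i%:~R| < p%:R^-1) ->
  (k + 2 * N + 2)%:R <= (`|m|)%:R / p%:R :> R ->
  exists t : nat -> R, [/\ forall i, (i < k)%N -> z <= t i <= z + 3 / p%:R,
     forall i, (i < k)%N -> cos (2 * pi * y (t i)) = 0 &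
     forall i i', (i < k)%N -> (i' < k)%N -> t i = t i' -> i = i'].
Proof.
move=> p0 dense hk.
have pR : 0 < p%:R :> R by rewrite ltr0n.
have [c0 hc0] := psi_osc; have [k' hk'] := step_const.
pose D x := y (x + p%:R^-1) - y x.
have Dstep x : `|D (x + alpha) - D x| <= 1.
  rewrite /D; have -> : x + alpha + p%:R^-1 = x + p%:R^-1 + alpha by ring.
  rewrite !hk' /lmap.
  have -> : y (x + p%:R^-1) + psi (x + p%:R^-1, y (x + p%:R^-1)) + k'%:~R / 2 - (y x + psi (x, y x) + k'%:~R / 2) - (y (x + p%:R^-1) - y x)
     = (psi (x + p%:R^-1, y (x + p%:R^-1)) - c0) - (psi (x, y x) - c0) by ring.
  apply: le_trans (ler_normB _ _) _; have := hc0 (x + p%:R^-1) (y (x + p%:R^-1)); have := hc0 x (y x); lra.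
have Dn x n : `|D (x + n%:R * alpha)| >= `|D x| - n%:R.
  elim: n => [|n IH]; first by rewrite mul0r addr0 subr0.
  have := Dstep (x + n%:R * alpha); have -> : x + n.+1%:R * alpha = x + n%:R * alpha + alpha by rewrite -natr1; ring.
  have := ler_normB (D (x + n%:R * alpha + alpha)) (D (x + n%:R * alpha + alpha) - D (x + n%:R * alpha)).
  rewrite opprB addrC subrK -natr1; lra.
have w1 := winding.
have Dz x (i : int) : D (x + i%:~R) = D x.
  have n1 x' (n : nat) : D (x' + n%:R) = D x'.
    elim: n => [|n IH]; first by rewrite addr0.
    rewrite -IH /D; have -> : x' + n.+1%:R + p%:R^-1 = x' + n%:R + p%:R^-1 + 1 by rewrite -natr1; ring.
    have -> : x' + n.+1%:R = x' + n%:R + 1 by rewrite -natr1; ring.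
    by rewrite !w1; ring.
  by case: i => n; [exact: n1|rewrite NegzE -(n1 _ n.+1) intrN subrK].
have [i0 hi0] : exists i : nat, (`|m|)%:R / p%:R / 2 <= `|D (i%:R / p%:R)|.
  apply: contrapT => /forallNP H.
  have H' i : `|D (i%:R / p%:R)| < (`|m|)%:R / p%:R / 2 by rewrite ltNge; apply/negP; exact: H.
  have tel : \sum_(i < p) D (i%:R / p%:R) = m%:~R / 2.
    rewrite -(big_mkord xpredT (fun i => D (i%:R / p%:R))).
    rewrite (eq_bigr (fun i => y (i.+1%:R / p%:R) - y (i%:R / p%:R))); last first.
      by move=> i _; rewrite /D -natr1 mulrDl mul1r.
    rewrite telescope_sumr // divff ?gt_eqF // mul0r -[X in y X]add0r w1; ring.
  have : `|\sum_(i < p) D (i%:R / p%:R)| < \sum_(i < p) ((`|m|)%:R / p%:R / 2 : R).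
    apply: le_lt_trans (ler_norm_sum _ _ _) _; apply: ltr_sum => //.
    by apply/hasP; exists (Ordinal p0); rewrite ?mem_index_enum.
  rewrite tel sumr_const card_ord -[X in _ < X]mulr_natl normrM [`|2^-1|]ger0_norm ?invr_ge0 //.
  have -> : p%:R * (`|m|%:R / p%:R / 2) = `|m|%:R / 2 :> R by field; rewrite gt_eqF.
  have -> : `|m%:~R| = `|m|%:R :> R by rewrite -intr_norm -abszE.
  by rewrite ltxx.
have [n [i [nN hni]]] := dense (z + p%:R^-1 - i0%:R / p%:R).
pose x := i0%:R / p%:R + n%:R * alpha + i%:~R.
have hx : `|z + p%:R^-1 - x| < p%:R^-1.
  by have -> : z + p%:R^-1 - x = z + p%:R^-1 - i0%:R / p%:R - n%:R * alpha - i%:~R by rewrite /x; ring.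
have Dx : (k + 1)%:R / 2 <= `|D x|.
  have hk2 : k%:R + 2 * N%:R + 2 <= `|m|%:R / p%:R :> R by rewrite -natrM -!natrD.
  rewrite /x Dz; apply: le_trans (Dn _ _); move: hi0 hk2; rewrite natrD.
  have : n%:R <= N%:R :> R by rewrite ler_nat.
  move: (`|m|%:R / p%:R : R) (`|D _|) (n%:R : R) (N%:R : R) (k%:R : R); intros; lra.
have px : 0 <= p%:R^-1 :> R by rewrite invr_ge0 ltW.
have /andP[x1 x2] : z <= x <= z + 2 / p%:R by move: hx; rewrite ltr_norml => /andP[]; lra.
pose lo := Num.min (y x) (y (x + p%:R^-1)).
have hlo v : lo <= v <= lo + `|D x| -> exists t, z <= t <= z + 3 / p%:R /\ y t = v.
  move=> hv; have xp : x <= x + p%:R^-1 by rewrite lerDl.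
  have [|t [/andP[t1 t2] ht]] := @ivt_interval R y x (x + p%:R^-1) v xp cy.
    move: hv; rewrite /lo /D; have [h|h] := leP (y x) (y (x + p%:R^-1)).
      by rewrite ger0_norm ?subr_ge0 // => /andP[h1 h2]; apply/orP; left; apply/andP; split; lra.
    by rewrite ltr0_norm ?subr_lt0 // => /andP[h1 h2]; apply/orP; right; apply/andP; split; lra.
  by exists t; split=> //; apply/andP; split; lra.
(* The line is vertical at the angles 1/4 + j / 2; [j0] gives the first of them above [lo]. *)
pose j0 : int := Num.floor (2 * (lo - 1 / 4)) + 1.
have /andP[f1 f2] := floor_itv (2 * (lo - 1 / 4)).
pose v (i : nat) : R := 1 / 4 + (j0 + i%:Z)%:~R / 2.
have vb (i' : nat) : (i' < k)%N -> lo <= v i' <= lo + `|D x|.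
  move=> ik; have ik' : i'%:R + 1 <= k%:R :> R by rewrite natr1 ler_nat.
  rewrite natrD in Dx; rewrite /v intrD /j0; move: f1 f2; rewrite !intrD => f1 f2.
  have i0' : 0 <= i'%:R :> R by [].
  by rewrite -[i'%:Z%:~R]/(i'%:R); apply/andP; split; lra.
have ht (i' : nat) : exists t, (i' < k)%N -> z <= t <= z + 3 / p%:R /\ y t = v i'.
  have [ik|ki] := ltnP i' k; last by exists 0.
  by have [t h] := hlo _ (vb _ ik); exists t.
have [t hh] := choice ht; exists t; split.
- by move=> i' /hh[].
- move=> i' /hh[_ ->]; rewrite /v.
  have -> : 2 * pi * (1 / 4 + (j0 + i'%:Z)%:~R / 2) = pi * (j0 + i'%:Z)%:~R + pi / 2 :> R by field.
  have : sn ((j0 + i'%:Z)%:~R : R) = 0 by rewrite -[X in sn X]add0r snDz sn0.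
  by rewrite /sn => /eqP; rewrite normr_eq0 cosDpihalf => /eqP ->; rewrite oppr0.
- move=> i1 i2 k1 k2 e; have [_ e1] := hh _ k1; have [_ e2] := hh _ k2.
  have : (j0 + i1%:Z)%:~R = (j0 + i2%:Z)%:~R :> R.
    by move: e1; rewrite e e2 /v; move: ((j0 + i1%:Z)%:~R : R) ((j0 + i2%:Z)%:~R : R); intros; lra.
  by move/intr_inj; clear; lia.
Qed.

End Winding.

(** * Trigonometric polynomials with many zeros *)

Section Trig.
Variables (R : realType) (kap : R).
Hypothesis kap0 : 0 < kap.
Local Notation C := (R[i]).
Implicit Types (c : int -> C) (D k : nat) (x : R).

Definition csupp D c := forall n : int, (D < `|n|)%N -> c n = 0.

Definition trig D c x : C := zsum D (fun n => c n * ex (n%:~R * x)).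

Let e1 : R := expR (- kap).
Let e1_gt0 : 0 < e1. Proof. exact: expR_gt0. Qed.
Let e1_lt1 : e1 < 1. Proof. by rewrite /e1 -[ltRHS]expR0 ltr_expR oppr_lt0. Qed.
Let e1B : 0 < 1 - e1. Proof. by rewrite subr_gt0. Qed.

Lemma geom_sum_le (n : nat) : \sum_(i < n) e1 ^+ i <= (1 - e1)^-1.
Proof.
rewrite -[leRHS]mul1r ler_pdivlMr // mulrC.
have := subrX1 e1 n; rewrite -opprB -[X in _ = X * _]opprB mulNr => /oppr_inj <-.
by rewrite gerBl exprn_ge0 // ltW.
Qed.

(** Division by e(x) - z1. The recursion for the coefficients is solved from plus infinity for n >=
    0 and from minus infinity for n < 0; the mismatch at n = 0 is the value at the point divided out
    ([quot_rec0]). *)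
Definition quot_coef D (z1 : C) c (n : int) : C :=
  if 0 <= n then \sum_(k < D) c (n + 1 + k%:Z) * z1 ^+ k
  else - \sum_(k < D.+1) c (n - k%:Z) * z1^-1 ^+ k.+1.

Lemma quot_supp D z1 c : csupp D c -> csupp D (quot_coef D z1 c).
Proof.
move=> h n hn; rewrite /quot_coef; case: lerP => n0; rewrite big1 ?oppr0 // => k _; rewrite h ?mul0r //; move: hn n0; clear; lia.
Qed.

Lemma quot_rec D z1 c (n : int) : z1 != 0 -> csupp D c -> n != 0 ->
  quot_coef D z1 c (n - 1) - z1 * quot_coef D z1 c n = c n.
Proof.
move=> z0 h n0; rewrite /quot_coef; have [np|nn] := lerP 0 n.
  have -> : 0 <= n - 1 by move: np n0; clear; lia.
  rewrite subrK mulr_sumr -sumrB.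
  rewrite (eq_bigr (fun k : 'I_D => - (c (n + k.+1%:Z) * z1 ^+ k.+1 - c (n + k%:Z) * z1 ^+ k))); last first.
    move=> k _; rewrite opprB (exprS z1 k); congr (_ - _); rewrite mulrCA; congr (c _ * _); clear; lia.
  rewrite -(big_mkord xpredT (fun k => - (c (n + k.+1%:Z) * z1 ^+ k.+1 - c (n + k%:Z) * z1 ^+ k))).
  rewrite sumrN telescope_sumr // (h (n + D%:Z)); last by move: np n0; clear; lia.
  by rewrite mul0r sub0r opprK addr0 expr0 mulr1.
have -> : (0 <= n - 1) = false by move: nn; clear; lia.
rewrite mulrN opprK mulr_sumr addrC -sumrB.
rewrite (eq_bigr (fun k : 'I_D.+1 => - (c (n - k.+1%:Z) * z1^-1 ^+ k.+1 - c (n - k%:Z) * z1^-1 ^+ k))); last first.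
  move=> k _; rewrite opprB (exprS z1^-1 k); congr (_ - _).
    by rewrite mulrCA [z1 * (_ * _)]mulrA divff // mul1r.
  by congr (c _ * _); clear; lia.
rewrite -(big_mkord xpredT (fun k => - (c (n - k.+1%:Z) * z1^-1 ^+ k.+1 - c (n - k%:Z) * z1^-1 ^+ k))).
rewrite sumrN telescope_sumr // (h (n - D.+1%:Z)); last by move: nn; clear; lia.
by rewrite mul0r sub0r opprK subr0 expr0 mulr1.
Qed.

Lemma trig_split0 D c x : trig D c x = c 0 + \sum_(k < D) (c k.+1%:Z * ex x ^+ k.+1 + c (- k.+1%:Z) * (ex x)^-1 ^+ k.+1).
Proof.
rewrite /trig; elim: D => [|D IH].
  by rewrite /zsum big_ord0 big_ord1 /= subrr mul0r ex0 mulr1 addr0.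
have a1 : ex (D.+1%:Z%:~R * x) = ex x ^+ D.+1 by rewrite exMn.
have a2 : ex ((- D.+1%:Z)%:~R * x) = (ex x)^-1 ^+ D.+1 by rewrite intrN mulNr exN a1 exprVn.
rewrite zsumS IH big_ord_recr /= a1 a2; move: (c _) (c _) (c _) (\sum_(_ < _) _) (ex x ^+ _) (_ ^-1 ^+ _) => *; ring.
Qed.

Lemma quot_rec0 D x1 c : csupp D c ->
  quot_coef D (ex x1) c (-1) - ex x1 * quot_coef D (ex x1) c 0 = c 0 - trig D c x1.
Proof.
move=> h; rewrite trig_split0 /quot_coef /= big_split /= big_ord_recr /=.
rewrite (h (-1 - D%:Z)); last by clear; lia.
rewrite mul0r addr0 mulr_sumr.
have e2 (a b b' a' c1 : C) : b = b' -> a = a' -> - a - b = c1 - (c1 + (b' + a')) by move=> -> ->; ring.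
apply: e2.
  apply: eq_bigr => k _; rewrite (exprS (ex x1) k) mulrCA; congr (c _ * _); clear; lia.
apply: eq_bigr => k _; congr (c _ * _); clear; lia.
Qed.

Lemma trig_quot D c x1 x : csupp D c ->
  trig D c x - trig D c x1 = (ex x - ex x1) * trig D (quot_coef D (ex x1) c) x.
Proof.
move=> h; set z1 := ex x1; set q := quot_coef D z1 c.
have z0 : z1 != 0 by exact: ex_neq0.
have sq : csupp D q by exact: quot_supp.
have qD : q D%:Z = 0.
  by rewrite /q /quot_coef /= big1 // => k _; rewrite h ?mul0r //; clear; lia.
have s1 : ex x * trig D q x = zsum D (fun n => q (n - 1) * ex (n%:~R * x)).
  rewrite -(@zsum_shift _ D (fun n => q (n - 1) * ex (n%:~R * x))).
  - rewrite /trig /zsum mulr_sumr; apply: eq_bigr => i _; rewrite addrK mulrCA; congr (_ * _).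
    have -> : (i%:Z - D%:Z + 1)%:~R * x = x + (i%:Z - D%:Z)%:~R * x by rewrite intrD; ring.
    by rewrite exD.
  - by rewrite sq ?mul0r //; clear; lia.
  - by rewrite addrK qD mul0r.
rewrite mulrBl s1.
have -> : z1 * trig D q x = zsum D (fun n => z1 * q n * ex (n%:~R * x)).
  by rewrite /trig /zsum mulr_sumr; apply: eq_bigr => i _; rewrite mulrA.
have -> : zsum D (fun n => q (n - 1) * ex (n%:~R * x)) - zsum D (fun n => z1 * q n * ex (n%:~R * x)) =
   zsum D (fun n => (c n - (if n == 0 then trig D c x1 else 0)) * ex (n%:~R * x)).
  rewrite /zsum -sumrB; apply: eq_bigr => i _; rewrite -mulrBl; congr (_ * _).
  case: eqP => [->|/eqP n0]; first by rewrite sub0r; exact: quot_rec0.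
  by rewrite subr0; exact: quot_rec.
have W1 : (D < (2 * D).+1)%N by clear; lia.
have -> : zsum D (fun n => (c n - (if n == 0 then trig D c x1 else 0)) * ex (n%:~R * x)) =
   trig D c x - zsum D (fun n => (if n == 0 then trig D c x1 else 0) * ex (n%:~R * x)).
  by rewrite /trig /zsum -sumrB; apply: eq_bigr => i _; rewrite mulrBl.
congr (_ - _); rewrite /zsum (bigD1 (Ordinal W1)) //= subrr eqxx mul0r ex0 mulr1 big1 ?addr0 // => i ne.
case: eqP; rewrite ?mul0r // => e; case/eqP: ne; apply/val_inj => /=; move: e; clear; lia.
Qed.

Definition rate1 : R := e1 / (1 - e1).
Definition rate2 : R := (1 - e1)^-1.

Lemma exp_nat (n : nat) : expR (- (kap * n%:R)) = e1 ^+ n.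
Proof. by rewrite /e1 -expRM_natl; congr expR; ring. Qed.

(** Each half is summed towards its own infinity, which keeps the rate. Division shifts indices by
    one, so a factor [e1] is gained for n >= 0 but not for n < 0. *)
Lemma quot_bound D z1 c (A B : R) : nrm z1 = 1 -> 0 <= A -> 0 <= B ->
  (forall n : nat, nrm (c n%:Z) <= A * e1 ^+ n) -> (forall n : nat, nrm (c (- n.+1%:Z)) <= B * e1 ^+ n.+1) ->
  (forall n : nat, nrm (quot_coef D z1 c n%:Z) <= A * rate1 * e1 ^+ n) /\
  (forall n : nat, nrm (quot_coef D z1 c (- n.+1%:Z)) <= B * rate2 * e1 ^+ n.+1).
Proof.
move=> z1n A0 B0 hA hB; have e0 := ltW e1_gt0; split=> n; rewrite /quot_coef /=.
  apply: le_trans (nrm_sum _ _ _) _.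
  apply: le_trans (_ : \sum_(k < D) A * e1 ^+ n * e1 * e1 ^+ k <= _).
    apply: ler_sum => k _; rewrite nrmM nrmX z1n expr1n mulr1.
    apply: le_trans (_ : A * e1 ^+ (n + 1 + k) <= _).
      by have := hA (n + 1 + k)%N; congr (nrm (c _) <= _); clear; lia.
    by rewrite !exprD expr1 !mulrA.
  rewrite -mulr_sumr; apply: le_trans (ler_wpM2l _ (geom_sum_le D)) _.
    by rewrite !mulr_ge0 ?exprn_ge0.
  by rewrite /rate1 le_eqVlt; apply/orP; left; apply/eqP; ring.
rewrite nrmN; apply: le_trans (nrm_sum _ _ _) _.
apply: le_trans (_ : \sum_(k < D.+1) B * e1 ^+ n.+1 * e1 ^+ k <= _).
  apply: ler_sum => k _; rewrite nrmM nrmX nrmV z1n invr1 expr1n mulr1.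
  apply: le_trans (_ : B * e1 ^+ (n + k).+1 <= _).
    by have := hB (n + k)%N; congr (nrm (c _) <= _); clear; lia.
  by rewrite -mulrA -exprD addSn.
rewrite -mulr_sumr; apply: le_trans (ler_wpM2l _ (geom_sum_le D.+1)) _.
  by rewrite !mulr_ge0 ?exprn_ge0.
by rewrite /rate2 le_eqVlt; apply/orP; left; apply/eqP; ring.
Qed.

Lemma trig_opp D c x : trig D (fun n => c (- n)) x = trig D c (- x).
Proof.
rewrite (trig_split0 D c (- x)) (trig_split0 D (fun n => c (- n)) x).
have E (a b b' : C) : b = b' -> a + b = a + b' by move=> ->.
apply: E; apply: eq_bigr => k _.
by rewrite (exN x) (invrK (ex x)) (opprK k.+1%:Z) addrC.
Qed.

Definition dec (M : R) c := forall n : int, nrm (c n) <= M * e1 ^+ `|n|.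

(** Dividing by e(x) - e(t0) gains [e1] on the nonnegative side; dividing the reflected series by
    e(-x) - e(-t1) gains it on the other. Both sides end with [rate1 * rate2]. *)
Lemma two_quot D c (M t0 t1 : R) : csupp D c -> 0 <= M -> dec M c ->
  exists c' c'', [/\ csupp D c'', dec (M * (rate1 * rate2)) c'',
    forall x, trig D c x - trig D c t0 = (ex x - ex t0) * trig D c' x &
    forall x, trig D c' x - trig D c' t1 = (ex (- x) - ex (- t1)) * trig D c'' x].
Proof.
move=> h M0 hc; pose c' := quot_coef D (ex t0) c.
have hc' : csupp D c' by exact: quot_supp.
pose cr n := c' (- n).
have hcr : csupp D cr by move=> n hn; apply: hc'; rewrite abszN.
pose cq := quot_coef D (ex (- t1)) cr; pose c'' n := cq (- n).
have hcq : csupp D cq by exact: quot_supp.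
have r0 : 0 <= rate1 by rewrite /rate1 divr_ge0 // ltW.
have r20 : 0 <= rate2 by rewrite /rate2 invr_ge0 ltW.
have r12 : rate1 <= rate2 by rewrite /rate1 -[rate2]mul1r ler_pM2r ?invr_gt0 // ltW.
have [b1 b2] := @quot_bound D (ex t0) c M M (nrm_ex _) M0 M0 (fun n => hc n%:Z)
   (fun n => ltac:(by have := hc (- n.+1%:Z); rewrite abszN)).
have [d1 d2] := @quot_bound D (ex (- t1)) cr (M * rate2) (M * rate1) (nrm_ex _) (mulr_ge0 M0 r20) (mulr_ge0 M0 r0)
   (fun n => ltac:(case: n => [|n]; [apply: le_trans (b1 0%N) _; rewrite !expr0 !mulr1 ler_wpM2l //|exact: b2]))
   (fun n => ltac:(rewrite /cr opprK; exact: b1)).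
exists c', c''; split.
- by move=> n hn; apply: hcq; rewrite abszN.
- have d1' (n : nat) : nrm (cq n%:Z) <= M * (rate1 * rate2) * e1 ^+ n.
    by have := d1 n; rewrite -[M * _ * _]mulrA [rate2 * _]mulrC.
  have d2' (n : nat) : nrm (cq (- n.+1%:Z)) <= M * (rate1 * rate2) * e1 ^+ n.+1.
    by have := d2 n; rewrite -[M * _ * _]mulrA.
  move=> [[|n]|n].
  + exact: (d1' 0%N).
  + exact: (d2' n).
  + exact: (d1' n.+1).
- by move=> x; exact: trig_quot.
- move=> x; have e y : trig D cr (- y) = trig D c' y by rewrite [LHS]trig_opp opprK.
  have e2 : trig D c'' x = trig D cq (- x) by exact: trig_opp.
  have key (a a' b b' u u' w : C) : a = a' -> b = b' -> u' = u -> a - b = w * u -> a' - b' = w * u'.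
    by move=> -> -> ->.
  exact: (key _ _ _ _ _ _ _ (e x) (e t1) e2 (trig_quot (- t1) (- x) hcr)).
Qed.

Lemma trig_le D c (M x : R) : 0 <= M -> dec M c -> nrm (trig D c x) <= M * (2 * rate2).
Proof.
move=> M0 hc; rewrite trig_split0; apply: le_trans (nrmD _ _) _.
apply: le_trans (_ : M * 1 + \sum_(k < D) (M * e1 * e1 ^+ k + M * e1 * e1 ^+ k) <= _).
  apply: lerD; first by have := hc 0; rewrite expr0.
  apply: le_trans (nrm_sum _ _ _) _; apply: ler_sum => k _; apply: le_trans (nrmD _ _) _.
  rewrite !nrmM !nrmX nrmV nrm_ex invr1 expr1n !mulr1.
  by apply: lerD; [have := hc k.+1%:Z|have := hc (- k.+1%:Z); rewrite abszN]; rewrite exprS mulrA.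
rewrite big_split -mulr_sumr /=; have g := geom_sum_le D.
have p : 0 <= M * e1 by rewrite mulr_ge0 // ltW.
have := ler_wpM2l p g; rewrite -/rate2 => h.
apply: le_trans (_ : M * 1 + (M * e1 * rate2 + M * e1 * rate2) <= _); first by rewrite lerD2l lerD.
have e : M * 1 = M * rate2 * (1 - e1) by rewrite -mulrA /rate2 mulVf ?gt_eqF.
rewrite e; have : 0 <= M * rate2 by rewrite mulr_ge0 // invr_ge0 ltW.
have : M * rate2 * e1 <= M * rate2 by rewrite ler_piMr ?mulr_ge0 ?invr_ge0 // ltW.
by move: rate2 => r2; lra.
Qed.

(** Induction on pairs of zeros, removed by [two_quot]. Zeros are approximate, up to [d]; the
    constant [L] depends on their number and separation but not on the polynomial, so [d] can be
    chosen after it. *)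
Lemma trig_zeros (s0 : R) k : 0 < s0 -> exists L, 0 <= L /\ forall D c (M d : R) (t : nat -> R),
  csupp D c -> 0 <= M -> dec M c -> 0 <= d ->
  (forall i j, (i < 2 * k)%N -> (j < 2 * k)%N -> i != j -> s0 <= sn (t i - t j)) ->
  (forall i, (i < 2 * k)%N -> nrm (trig D c (t i)) <= d) ->
  forall x, nrm (trig D c x) <= M * (2 * rate2) * (rate1 * rate2) ^+ k * \prod_(i < 2 * k) (2 * sn (x - t i)) + L * d.
Proof.
move=> s00; have r0 : 0 <= rate1 by rewrite /rate1 divr_ge0 // ltW.
have r20 : 0 <= rate2 by rewrite /rate2 invr_ge0 ltW.
elim: k => [|k [L [L0 IH]]].
  exists 0; split=> // D c M d t hs M0 hc d0 _ _ x.
  by rewrite expr0 big_ord0 mul0r addr0 !mulr1; exact: trig_le.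
exists (1 + 2 / s0 + 4 * (L / s0 ^+ 2)); split.
  have a1 : 0 <= 2 / s0 by apply: divr_ge0 => //; exact: ltW.
  have a2 : 0 <= L / s0 ^+ 2 by apply: divr_ge0 => //; apply: exprn_ge0; exact: ltW.
  by move: a1 a2; move: (2 / s0) (L / s0 ^+ 2) => *; lra.
move=> D c M d t hs M0 hc d0 sep hz x.
have [c' [c'' [hs'' hc'' q1 q2]]] := two_quot (t 0%N) (t 1%N) hs M0 hc.
have lt0 : (0 < 2 * k.+1)%N by []. have lt1 : (1 < 2 * k.+1)%N by clear; lia.
have c'b i : (i < 2 * k.+1)%N -> i != 0%N -> nrm (trig D c' (t i)) <= d / s0.
  move=> ik i0; rewrite ler_pdivlMr //.
  have := congr1 (@nrm R) (q1 (t i)); rewrite nrmM nrm_exB => e.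
  have h1 : nrm (trig D c (t i) - trig D c (t 0%N)) <= d + d.
    by apply: le_trans (nrmB _ _) _; apply: lerD; apply: hz.
  have h2 := sep i 0%N ik lt0 i0.
  have := ler_wpM2l (nrm_ge0 (trig D c' (t i))) h2; move: h1; rewrite e; lra.
have c''b i : (i < 2 * k)%N -> nrm (trig D c'' (t i.+2)) <= d / s0 ^+ 2.
  move=> ik; rewrite expr2 invfM mulrA ler_pdivlMr //.
  have ik2 : (i.+2 < 2 * k.+1)%N by move: ik; clear; lia.
  have := congr1 (@nrm R) (q2 (t i.+2)); rewrite nrmM nrm_exB => e.
  have h1 : nrm (trig D c' (t i.+2) - trig D c' (t 1%N)) <= d / s0 + d / s0.
    by apply: le_trans (nrmB _ _) _; apply: lerD; apply: c'b.
  have h2 : s0 <= sn (- t i.+2 - - t 1%N).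
    have := sep i.+2 1%N ik2 lt1 isT; rewrite -snN; by congr (_ <= sn _); ring.
  have := ler_wpM2l (nrm_ge0 (trig D c'' (t i.+2))) h2; move: h1; rewrite e; lra.
have IHx := IH D c'' (M * (rate1 * rate2)) (d / s0 ^+ 2) (fun i => t i.+2) hs'' (mulr_ge0 M0 (mulr_ge0 r0 r20)) hc''.
have {}IHx := IHx (divr_ge0 d0 (exprn_ge0 2 (ltW s00))).
have {}IHx := IHx (fun i j hi hj ij => sep i.+2 j.+2 ltac:(move: hi; clear; lia) ltac:(move: hj; clear; lia) ij) c''b x.
have e1' : trig D c x = trig D c (t 0%N) + (ex x - ex (t 0%N)) * (trig D c' (t 1%N) + (ex (- x) - ex (- t 1%N)) * trig D c'' x).
  have key (a b w u v w' z : C) : a - b = w * u -> u - v = w' * z -> a = b + w * (v + w' * z).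
    by move=> h1 <-; rewrite [v + _]addrC subrK -h1 addrC subrK.
  exact: key (q1 x) (q2 x).
rewrite e1'; apply: le_trans (nrmD _ _) _; rewrite nrmM nrm_exB.
have a1 := hz 0%N lt0; have a2 := c'b 1%N lt1 isT.
have a3 : nrm (trig D c' (t 1%N) + (ex (- x) - ex (- t 1%N)) * trig D c'' x) <= d / s0 + 2 * sn (x - t 1%N) * nrm (trig D c'' x).
  apply: le_trans (nrmD _ _) _; apply: lerD => //; rewrite nrmM nrm_exB -snN.
  by have -> : - (- x - - t 1%N) = x - t 1%N by ring.
have s1 := sn_ge0 (x - t 0%N); have s2 := sn_ge0 (x - t 1%N).
have s3 := sn_le1 (x - t 0%N); have s4 := sn_le1 (x - t 1%N).
have ds0 : 0 <= d / s0 by rewrite divr_ge0 // ltW.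
have Lds : 0 <= L * (d / s0 ^+ 2) by rewrite mulr_ge0 // divr_ge0 // exprn_ge0 // ltW.
have -> : (2 * k.+1 = (2 * k).+2)%N by clear; lia.
rewrite !big_ord_recl /=.
set P := \prod_(i < 2 * k) _.
have PE : \prod_(i < 2 * k) (2 * sn (x - t i.+2)) = P by apply: eq_bigr => i _; rewrite /= /bump !leq0n.
rewrite PE in IHx.
set X := M * (rate1 * rate2) * (2 * rate2) * (rate1 * rate2) ^+ k * P in IHx.
have -> : M * (2 * rate2) * (rate1 * rate2) ^+ k.+1 * (2 * sn (x - t 0%N) * (2 * sn (x - t (bump 0 0)) * P)) =
   2 * sn (x - t 0%N) * (2 * sn (x - t 1%N)) * X by rewrite /X (exprS _ k); ring.
apply: le_trans (lerD a1 (ler_wpM2l _ a3)) _; first by rewrite mulr_ge0.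
have b1 := ler_wpM2l (mulr_ge0 (mulr_ge0 (ler0n R 2) s1) (mulr_ge0 (ler0n R 2) s2)) IHx.
have b2 : 2 * sn (x - t 0%N) * (d / s0) <= 2 * (d / s0) by rewrite ler_wpM2r // ler_piMr.
have b3 : 2 * sn (x - t 0%N) * (2 * sn (x - t 1%N)) * (L * (d / s0 ^+ 2)) <= 4 * (L * (d / s0 ^+ 2)).
  apply: ler_wpM2r => //; have := ler_pM s1 s2 s3 s4; rewrite mulr1; lra.
move: b1 b2 b3; rewrite mulrDr.
have -> : (1 + 2 / s0 + 4 * (L / s0 ^+ 2)) * d = d + 2 * (d / s0) + 4 * (L * (d / s0 ^+ 2)) by ring.
move: (2 * sn (x - t 0%N)) (2 * sn (x - t 1%N)) => u v; rewrite mulrDr !mulrA; lra.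
Qed.

End Trig.

(** * Exponential decay of solutions of the dual equation *)

Section DualDecay.
Variable R : realType.
Local Notation C := (R[i]).
Implicit Types (phi : int -> C).

(** At the supremum s the hypothesis reads s <= (b + s) / 2. A perturbation is absorbed in this way
    as soon as some finite bound is known, whatever its size. *)
Lemma contract_ub (f : int -> R) (b S : R) : (forall n, f n <= S) ->
  (forall S', (forall n, f n <= S') -> forall n, f n <= (b + S') / 2) -> forall n, f n <= b.
Proof.
move=> h hc n; pose s := sup (range f).
have hs : has_sup (range f).
  by split; [exists (f 0); exists 0|exists S => _ [k _ <-]].
have fs k : f k <= s by apply: ub_le_sup; [case: hs|exists k].
have : s <= (b + s) / 2 by apply: ge_sup; [case: hs|move=> _ [k _ <-]; exact: hc].
by have := fs n; move: s {fs hs hc h} (f n) => s z; lra.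
Qed.

Lemma supp_ub phi W : (forall n, (W < `|n|)%N -> phi n = 0) -> exists S, forall n, nrm (phi n) <= S.
Proof.
move=> h; exists (zsum W (fun n => nrm (phi n))) => n.
have [nW|/h ->] := leqP `|n| W; last by rewrite nrm0 sumr_ge0 // => i _; exact: nrm_ge0.
have k1 : (`|(n + W%:Z)%R| < (2 * W).+1)%N by move: nW; clear; lia.
rewrite /zsum (bigD1 (Ordinal k1)) //=.
have -> : `|(n + W%:Z)%R|%N%:Z - W%:Z = n by move: nW; clear; lia.
by rewrite lerDl sumr_ge0 // => i _; exact: nrm_ge0.
Qed.

Definition sup_bounded (lam alpha E k : R) := forall theta phi (W : nat) (b : R), 0 <= b ->
  (forall n, (W < `|n|)%N -> phi n = 0) ->
  (forall n, nrm (resid1 lam E alpha theta phi n) <= k * b) -> forall n, nrm (phi n) <= b.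

Lemma sup_boundedI (lam alpha E k : R) : 0 < k ->
  (forall theta phi (W : nat), (forall n, (W < `|n|)%N -> phi n = 0) ->
    (forall n, nrm (resid1 lam E alpha theta phi n) <= k) -> forall n, nrm (phi n) <= 1) ->
  sup_bounded lam alpha E k.
Proof.
move=> k0 H theta phi W b b0 hs hr n; rewrite leNgt; apply/negP => lt.
have [b' bb' b'n] : exists2 b', b < b' & b' < nrm (phi n).
  by exists ((b + nrm (phi n)) / 2); move: lt; move: (nrm _) => z; lra.
have b'0 : 0 < b' by exact: le_lt_trans bb'.
have := H theta (fun n => (b'^-1)%:C%C * phi n) W _ _ n.
rewrite nrmM nrm_real ger0_norm ?invr_ge0 ?(ltW b'0) // ler_pdivrMl // mulr1 => q.
have /q : forall n0 : int, (W < `|n0|)%N -> (b'^-1)%:C%C * phi n0 = 0 by move=> m /hs ->; rewrite mulr0.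
suff h m : nrm (resid1 lam E alpha theta (fun n => (b'^-1)%:C%C * phi n) m) <= k.
  by move=> /(_ h); rewrite leNgt b'n.
have -> : resid1 lam E alpha theta (fun n => (b'^-1)%:C%C * phi n) m = (b'^-1)%:C%C * resid1 lam E alpha theta phi m.
  by rewrite /resid1; move: (Vx _ _ _ _) (_%:C%C) => v z; ring.
rewrite nrmM nrm_real ger0_norm ?invr_ge0 ?(ltW b'0) // ler_pdivrMl //.
by apply: le_trans (hr m) _; rewrite mulrC ler_wpM2r // ltW.
Qed.

Lemma VxE (b1 b2 E E' x : R) : Vx b1 b2 E x = Vx b1 b2 E' x + (E' - E)%:C%C.
Proof. by rewrite /Vx rmorphB /=; ring. Qed.

Lemma sup_bounded_perturb (lam alpha E0 E k : R) : 0 < k -> sup_bounded lam alpha E0 k ->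
  `|E - E0| <= k / 2 -> sup_bounded lam alpha E (k / 2).
Proof.
move=> k0 H hE theta phi W b b0 hs hr.
have [S hS] := supp_ub hs.
apply: (contract_ub hS) => S' hS'.
have S0 : 0 <= S' by apply: le_trans (hS' 0); exact: nrm_ge0.
apply: (H theta phi W) => //; first by apply: divr_ge0 => //; exact: addr_ge0.
move=> n.
have -> : resid1 lam E0 alpha theta phi n = resid1 lam E alpha theta phi n + (E - E0)%:C%C * phi n.
  by rewrite /resid1 (VxE 1 1 E0 E); move: (Vx _ _ _ _) (_%:C%C) => v z; ring.
apply: le_trans (nrmD _ _) _; rewrite nrmM nrm_real.
have := ler_pM (normr_ge0 _) (nrm_ge0 (phi n)) hE (hS' n); have := hr n.
by move: (`|_| * _) (nrm _) => *; lra.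
Qed.

(** Conjugation by the weight exp(z min(|n|, |l|)) with exp z = 1 + k / 4: the commutator with the
    hopping has relative size k / 2 and is absorbed by the lower bound. The weight stops at |l| so
    that it magnifies the errors [eps] by a bounded factor only. *)
Lemma combes_thomas (lam alpha E k : R) : 0 < k -> `|lam| <= 1 -> sup_bounded lam alpha E k ->
  forall theta phi (W : nat) (eps : R), 0 <= eps -> (forall n, (W < `|n|)%N -> phi n = 0) ->
  (forall n : int, n != 0 -> nrm (resid1 lam E alpha theta phi n) <= eps) ->
  nrm (resid1 lam E alpha theta phi 0) <= 1 + eps ->
  forall l : int, nrm (phi l) <= 2 / k * ((1 + eps) * expR (- (ln (1 + k / 4) * (`|l|)%:R)) + eps).
Proof.
move=> k0 lam1 H theta phi W eps eps0 hs hr hr0 l; set z := ln (1 + k / 4).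
have kp : 1 < 1 + k / 4 by rewrite ltrDl divr_gt0.
have zE : expR z = 1 + k / 4 by rewrite lnK // posrE; exact: lt_trans kp.
have z0 : 0 <= z by rewrite ln_ge0 // ltW.
pose L := `|l|%N; pose w (n : int) : R := expR (z * (minn `|n| L)%:R).
have w0 n : 0 < w n by exact: expR_gt0.
have wL n : w n <= expR (z * L%:R) by rewrite ler_expR ler_wpM2l // ler_nat geq_minr.
have zS (a c : nat) : (c <= a + 1)%N -> expR (z * c%:R) <= expR (z * a%:R) * (1 + k / 4).
  move=> ca; rewrite -zE -expRD ler_expR; apply: le_trans (_ : z * (a + 1)%:R <= _).
    by rewrite ler_wpM2l // ler_nat.
  by rewrite natrD; move: (a%:R) => y; lra.
have mS (n n' : int) (L0 : nat) : (`|n - n'| <= 1)%N -> (minn `|n'| L0 <= minn `|n| L0 + 1)%N by clear; lia.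
have wstep (n n' : int) : (`|n - n'| <= 1)%N -> `|w n - w n'| <= k / 4 * w n.
  move=> hn.
  have a1 : w n' <= w n * (1 + k / 4) by apply: zS; exact: mS.
  have a2 : w n <= w n' * (1 + k / 4) by apply: zS; apply: mS; move: hn; clear; lia.
  rewrite ler_norml; apply/andP; split; first by move: a1; lra.
  have [le|/ltW le] := lerP (w n) (w n').
    by apply: le_trans (_ : 0 <= _); [rewrite subr_le0|rewrite mulr_ge0 ?divr_ge0 // ltW].
  apply: le_trans (_ : k / 4 * w n' <= _); first by move: a2; lra.
  by rewrite ler_wpM2l // divr_ge0 // ltW.
pose psi n := (w n)%:C%C * phi n.
have hs' n : (W < `|n|)%N -> psi n = 0 by move=> /hs; rewrite /psi => ->; rewrite mulr0.
have [S hS] := supp_ub hs'.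
pose b := 2 / k * ((1 + eps) + eps * expR (z * L%:R)).
have b0 : 0 <= b.
  rewrite /b mulr_ge0 ?divr_ge0 //; first exact: ltW.
  by rewrite !addr_ge0 // mulr_ge0 // expR_ge0.
have hb : forall n, nrm (psi n) <= b.
  apply: (contract_ub hS) => S' hS'.
  have S0 : 0 <= S' by apply: le_trans (hS' 0); exact: nrm_ge0.
  apply: (H theta psi W) => //; first by apply: divr_ge0 => //; exact: addr_ge0.
  move=> n.
  have -> : resid1 lam E alpha theta psi n = (w n)%:C%C * resid1 lam E alpha theta phi n +
     lam%:C%C * ((w (n + 1) - w n)%:C%C * phi (n + 1) + (w (n - 1) - w n)%:C%C * phi (n - 1)).
    rewrite /resid1 /psi !rmorphB /=; move: (Vx _ _ _ _) ((w n)%:C%C) ((w (n + 1))%:C%C) ((w (n - 1))%:C%C) => *; ring.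
  have q (m : int) : (`|m - n| <= 1)%N -> nrm ((w m - w n)%:C%C * phi m) <= k / 4 * S'.
    move=> hm; rewrite nrmM nrm_real.
    apply: le_trans (_ : k / 4 * w m * nrm (phi m) <= _).
      by rewrite ler_wpM2r ?nrm_ge0 ?wstep.
    rewrite -mulrA ler_wpM2l ?divr_ge0 ?(ltW k0) //.
    by have := hS' m; rewrite /psi nrmM nrm_real ger0_norm // ltW.
  have q1 := q (n + 1) ltac:(clear; lia); have q2 := q (n - 1) ltac:(clear; lia).
  apply: le_trans (nrmD _ _) _; rewrite !nrmM !nrm_real.
  have q3 : `|lam| * nrm ((w (n + 1) - w n)%:C%C * phi (n + 1) + (w (n - 1) - w n)%:C%C * phi (n - 1)) <= k / 2 * S'.
    apply: le_trans (ler_wpM2r (nrm_ge0 _) lam1) _; rewrite mul1r.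
    apply: le_trans (nrmD _ _) _; move: q1 q2; move: (nrm _) (nrm _) => *; lra.
  have q4 : `|w n| * nrm (resid1 lam E alpha theta phi n) <= 1 + eps + eps * expR (z * L%:R).
    rewrite ger0_norm ?(ltW (w0 n)) //; have [->|n0] := eqVneq n 0.
      rewrite /w min0n mulr0 expR0 mul1r; apply: le_trans hr0 _.
      by rewrite lerDl mulr_ge0 // expR_ge0.
    apply: le_trans (ler_pM (ltW (w0 n)) (nrm_ge0 _) (wL n) (hr n n0)) _.
    by rewrite mulrC lerDr addr_ge0.
  apply: le_trans (lerD q4 q3) _.
  rewrite le_eqVlt; apply/orP; left; apply/eqP; rewrite /b; field; exact: lt0r_neq0.
have := hb l; rewrite /psi nrmM nrm_real ger0_norm ?(ltW (w0 l)) // /w minnn -/L => q.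
rewrite -(ler_pM2l (expR_gt0 (z * L%:R))); apply: le_trans q _.
rewrite /b le_eqVlt; apply/orP; left; apply/eqP; rewrite expRN; field.
by rewrite (lt0r_neq0 k0) (lt0r_neq0 (expR_gt0 _)).
Qed.

Lemma mnormD (M N : 'M[C]_2) : mnorm (M + N) <= mnorm M + mnorm N.
Proof.
rewrite !mnormE !mxE.
have := nrmD (M ord0 ord0) (N ord0 ord0); have := nrmD (M ord0 ord_max) (N ord0 ord_max).
have := nrmD (M ord_max ord0) (N ord_max ord0); have := nrmD (M ord_max ord_max) (N ord_max ord_max).
by do 12!move: (nrm _) => ?; lra.
Qed.

Lemma cocyc_lipschitz (lam alpha E0 : R) (n : nat) : exists K, 0 <= K /\ forall E x, `|E - E0| <= 1 ->
  mnorm (cocyc lam 1 1 E alpha n x - cocyc lam 1 1 E0 alpha n x) <= K * `|E - E0|.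
Proof.
elim: n => [|n [K [K0 IH]]].
  by exists 0; split=> // E x _; rewrite subrr mul0r mnormE !mxE nrm0 !addr0.
pose T := trans_const lam 1 1 E0 + 1; pose G := 2 * trans_const lam 1 1 E0 ^+ n.
have t1 := trans_const_ge1 lam 1 1 E0.
have T0 : 0 <= T by rewrite /T; move: t1; move: (trans_const _ _ _ _) => *; lra.
have G0 : 0 <= G by rewrite /G mulr_ge0 // exprn_ge0 // (le_trans ler01).
exists (T * K + G); split; first by rewrite addr_ge0 // mulr_ge0.
move=> E x hE; rewrite /=.
set A := trans _ _ _ E _; set A0 := trans _ _ _ E0 _; set X := cocyc _ _ _ E _ _ _; set X0 := cocyc _ _ _ E0 _ _ _.
have -> : A *m X - A0 *m X0 = A *m (X - X0) + (A - A0) *m X0.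
  by rewrite mulmxBr mulmxBl addrA subrK.
have hA : mnorm A <= T.
  apply: le_trans (mnorm_trans _ _ _ _ _) _; rewrite /T /trans_const.
  have : `|E| <= `|E0| + 1 by rewrite -lerBlDl; apply: le_trans hE; exact: lerB_dist.
  by lra.
have hA0 : mnorm (A - A0) <= `|E - E0|.
  rewrite mnormE !mxE /= /Vx.
  have -> : 1%:C%C * ex (x + n%:R * alpha) + 1%:C%C * ex (- (x + n%:R * alpha)) - E%:C%C
     - (1%:C%C * ex (x + n%:R * alpha) + 1%:C%C * ex (- (x + n%:R * alpha)) - E0%:C%C) = (E0 - E)%:C%C.
    by rewrite rmorphB /=; ring.
  by rewrite nrm_real !subrr nrm0 !addr0 distrC.
apply: le_trans (mnormD _ _) _; rewrite mulrDl; apply: lerD.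
  apply: le_trans (mnormM _ _) _; rewrite -mulrA.
  by apply: ler_pM => //; [exact: mnorm_ge0|exact: mnorm_ge0|exact: IH].
apply: le_trans (mnormM _ _) _; rewrite mulrC.
by apply: ler_pM => //; [exact: mnorm_ge0|exact: mnorm_ge0|exact: mnorm_cocyc_le].
Qed.

(** With v = h / 4096 and u = 512 v = h / 8 every condition is a numerical multiple of h: T must
    exceed 4481, A is chosen after T, and the conditions on [bt] then fix [delta]. *)
Lemma dual_decay_constants : exists (T A : nat) (delta : R), [/\ (0 < A)%N, 0 < delta &
  forall h bt : R, 0 < h -> bt <= delta * h -> exists v u,
   [/\ [/\ 0 < v, 32 * (16 * v) <= u & u < h / 6], 120 * bt <= h / 32 /\ 120 * bt <= 8 * v,
      h + 3 * u / 4 + v <= v * T%:R,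
      32 * v * T%:R + (h + 3 * u / 4) + v <= u / 4 * A%:R & bt * (3 * (2 * A) ^ 10)%:R <= v]].
Proof.
have [T hT] := archi_nat (4500 : R).
have [A hA] := archi_nat (32 * (T%:R / 128 + 2) : R).
have A0 : (0 < A)%N.
  by rewrite -(ltr_nat R); apply: le_lt_trans hA; have := ler0n R T; move: (T%:R) => t; lra.
pose P : R := (3 * (2 * A) ^ 10)%:R.
have P0 : 0 <= P by exact: ler0n.
have q : 0 < 4096 * (P + 64 * 120) :> R.
  by apply: mulr_gt0 (ltr0Sn R 4095) _; move: P P0 => p p0; lra.
exists T, A, (4096 * (P + 64 * 120))^-1; split; [exact: A0|by rewrite invr_gt0|].
move=> h bt h0 hbt; pose v := h / 4096; pose u := 512 * v; exists v, u.
have hb : bt * (4096 * (P + 64 * 120)) <= h by rewrite -ler_pdivlMr // mulrC.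
have vh : h = 4096 * v by rewrite /v mulrC (divfK (lt0r_neq0 (ltr0Sn R 4095))).
have v0 : 0 < v by exact: divr_gt0 h0 (ltr0Sn R 4095).
have hb2 : bt * (P + 64 * 120) <= v.
  by rewrite -(ler_pM2l (ltr0Sn R 4095)) -vh; apply: le_trans hb; rewrite mulrCA.
have bP : bt * P <= v /\ 64 * 120 * bt <= v.
  have [b0|b0] := lerP 0 bt.
    have := mulr_ge0 b0 P0; move: hb2; move: (P) => p; clear -b0; move=> *; split; lra.
  have := mulr_le0_ge0 (ltW b0) P0; move: v0; move: (P) => p; clear -b0; move=> *; split; lra.
have [bP1 bP2] := bP.
have uE : u = 512 * v by [].
move: u uE => u uE; split.
- by rewrite uE vh; split; clear -v0; lra.
- by split; rewrite ?vh; clear -bP2 v0; lra.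
- by rewrite uE vh; have := ler_wpM2l (ltW v0) (ltW hT); move: (v * T%:R) => z; clear -v0; lra.
- rewrite uE vh; have := ler_wpM2l (ltW v0) (ltW hA); rewrite mulrCA; move: (T%:R) (A%:R) => t a; clear -v0; lra.
- exact: bP1.
Qed.

(** The alternative is decided at [E0] and persists nearby: the lower bound is stable under
    perturbation, and slow growth at one length [j] is an open condition, with room between u and h
    / 6. In the fast case [D1 = 0], so the resolvent bound [M0] does not enter and an inexplicit
    rate does no harm; in the slow case [M0] enters and the rate must be explicit. *)
Lemma dual_decay : exists delta : R, 0 < delta /\
  forall alpha h lam bt E0 : R, not_rational alpha -> 0 < h -> `|lam| = expR (- h) ->
  0 <= bt -> bt <= delta * h -> beta_bound alpha bt ->
  exists kp D0 D1 r0 : R, [/\ [/\ 0 < kp, 0 <= D0, 0 <= D1 & 0 < r0], D1 = 0 \/ kp = h / 1024 &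
   forall E, `|E - E0| <= r0 -> forall l : int, exists Cl N1, 0 <= Cl /\
   forall (F : R -> int -> C) (M0 eps : R), 0 <= M0 -> 0 <= eps ->
    (forall t n, nrm (F t n) <= M0) ->
    (forall t, exists W : nat, forall n : int, (W < `|n|)%N -> F t n = 0) ->
    (forall t (n : int), n != 0 -> nrm (resid1 lam E alpha t (F t) n) <= eps) ->
    (forall t, nrm (resid1 lam E alpha t (F t) 0) <= 1 + eps) ->
    forall N, (N1 <= N)%N -> N%:R^-1 * (\sum_(i < N) nrm (F (i%:R / N%:R) l)) <=
      (D0 + M0 * D1) * expR (- (kp * (`|l|)%:R)) + Cl * eps].
Proof.
have [T [A [delta [A0 delta0 hc]]]] := dual_decay_constants.
exists delta; split=> // alpha h lam bt E0 irr h0 lamE bt0 hbt hb.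
have [v [u [[v0 u1 uh] [c1 c2] c3 c4 c5]]] := hc h bt h0 hbt.
have lam1 : `|lam| <= 1 by rewrite lamE -[leRHS]expR0 ler_expR oppr_le0 ltW.
have meanP (f : nat -> R) (b : R) (N : nat) : (0 < N)%N -> (forall i, f i <= b) -> N%:R^-1 * (\sum_(i < N) f i) <= b.
  move=> N0 hf; rewrite ler_pdivrMl ?ltr0n //; apply: le_trans (_ : \sum_(i < N) b <= _).
    by apply: ler_sum => i _; exact: hf.
  by rewrite sumr_const card_ord mulr_natl.
have [hA|] := pselect (forall j, (0 < j)%N -> expR (j%:R * u) <= growth lam 1 1 E0 alpha j).
  have [k [k0 hk]] := dual_bounded_below irr v0 (ltW h0) u1 bt0 c2 hb lamE c3 c4 A0 c5 hA.
  have hk' := sup_boundedI k0 hk.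
  have k20 : 0 < k / 2 by rewrite divr_gt0.
  have kk : 0 < 2 / (k / 2) by rewrite divr_gt0.
  exists (ln (1 + k / 2 / 4)), (2 / (k / 2)), 0, (k / 2); split.
  - by split=> //; [rewrite ln_gt0 // ltrDl divr_gt0|exact: ltW].
  - by left.
  - move=> E hE l; exists (2 * (2 / (k / 2))), 1%N; split; first by rewrite mulr_ge0 // ltW.
    move=> F M0 eps M00 eps0 FM Fs Fr Fr0 N N0; rewrite mulr0 addr0.
    apply: (meanP (fun i => nrm (F (i%:R / N%:R) l))) => // i; have [W hW] := Fs (i%:R / N%:R).
    have := combes_thomas k20 lam1 (sup_bounded_perturb k0 hk' hE) eps0 hW (Fr _) (Fr0 _) l.
    set X := expR _ => q; apply: le_trans q _.
    have X1 : X <= 1.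
      by rewrite /X -[leRHS]expR0 ler_expR oppr_le0 mulr_ge0 // ln_ge0 // lerDl divr_ge0 // ltW.
    have : eps * X <= eps by rewrite ler_piMr.
    move=> q; have := ler_wpM2l (ltW kk) q; move: (2 / (k / 2)) => y; lra.
move=> /existsNP [j /not_implyP [j0 /negP]]; rewrite -ltNge => hj.
have [K [K0 hK]] := cocyc_lipschitz lam alpha E0 j.
pose g := expR (j%:R * (h / 6)) - expR (j%:R * u).
have g0 : 0 < g by rewrite subr_gt0 ltr_expR ltr_pM2l // ltr0n.
have K10 : 0 < K + 1 by rewrite ltr_wpDl.
pose r0 := Num.min 1 (g / (K + 1)).
have r00 : 0 < r0 by rewrite lt_min ltr01 divr_gt0.
pose B := 4 * (trans_const lam 1 1 E0 + 1) ^+ j.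
have tc0 := trans_const_ge1 lam 1 1 E0.
have B1 : 1 <= B.
  have : 1 <= (trans_const lam 1 1 E0 + 1) ^+ j by rewrite exprn_ege1 // ler_wpDr.
  by rewrite /B; move: (_ ^+ j); clear => *; lra.
have [D [l0 [D0 hD]]] := small_growth_decay irr h0 bt0 c1 hb B1.
have kp0 : 0 < h / 1024 := divr_gt0 h0 (ltr0Sn R 1023).
(* The second term covers |l| < l0 by the trivial bound [M0]. *)
pose D1 := D + expR (h / 1024 * l0%:R).
exists (h / 1024), 0, D1, r0; split.
- by split; [exact: kp0|exact: lexx|rewrite /D1; exact: addr_ge0 D0 (expR_ge0 _)|exact: r00].
- by right.
move=> E hE l.
have E1 : `|E - E0| <= 1 by apply: le_trans hE _; rewrite ge_min lexx.
have gb x : mnorm (cocyc lam 1 1 E alpha j x) <= expR (j%:R * (h / 6)).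
  rewrite -[cocyc _ _ _ _ _ _ _](subrK (cocyc lam 1 1 E0 alpha j x)).
  apply: le_trans (mnormD _ _) _; apply: le_trans (lerD (hK E x E1) (le_growth _ _ _ _ _ _ _)) _.
  have h2 : K * `|E - E0| <= g.
    apply: le_trans (_ : (K + 1) * (g / (K + 1)) <= _); last by rewrite mulrC divfK // lt0r_neq0.
    apply: ler_pM => //; first by rewrite lerDl.
    by apply: le_trans hE _; rewrite ge_min lexx orbT.
  by move: h2 hj; rewrite /g; move: (K * _) (growth _ _ _ _ _ _); clear => *; lra.
have dtb n y : nrm (dt lam 1 1 E alpha n y) <= B * expR (n%:R * (h / 6)).
  apply: le_trans (dt_le_mnorm _ _ _ _ _ _ _) _.
  apply: le_trans (upper_of_one j0 (divr_ge0 (ltW h0) (ler0n R 6)) gb n y) _.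
  apply: ler_wpM2r; first exact: expR_ge0.
  rewrite /B; apply: ler_wpM2l => //.
  have tcE : trans_const lam 1 1 E <= trans_const lam 1 1 E0 + 1.
    rewrite /trans_const; have : `|E| <= `|E0| + 1.
      by rewrite -lerBlDl; apply: le_trans E1; exact: lerB_dist.
    by clear; lra.
  by apply: lerXn2r tcE; rewrite nnegrE; move: tc0 (trans_const_ge1 lam 1 1 E); clear => *; lra.
have [hl|hl] := leqP l0 `|l|.
  have [Cl [N1 [Cl0 hCl]]] := hD lam E lamE dtb l hl.
  exists Cl, N1; split=> // F M0 eps M00 eps0 FM _ Fr _ N hN.
  apply: le_trans (hCl F M0 eps M00 eps0 FM Fr N hN) _; rewrite add0r lerD2r.
  apply: ler_wpM2r; first exact: expR_ge0.
  by apply: ler_wpM2l => //; rewrite /D1 lerDl expR_ge0.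
exists 0, 1%N; split=> // F M0 eps M00 eps0 FM _ _ _ N hN.
apply: le_trans (meanP (fun i => nrm (F (i%:R / N%:R) l)) M0 N hN _) _; first by move=> i; exact: FM.
rewrite mul0r addr0 add0r -mulrA; apply: ler_peMr => //.
apply: le_trans (_ : expR (h / 1024 * l0%:R) * expR (- (h / 1024 * `|l|%:R)) <= _).
  rewrite -expRD -[leLHS]expR0 ler_expR subr_ge0 ler_wpM2l ?(ltW kp0) // ler_nat; exact: ltnW.
by rewrite ler_wpM2r ?expR_ge0 // /D1 lerDr.
Qed.

End DualDecay.

(** * Fourier coefficients of the Green function *)

Section Coefficients.
Variable R : realType.
Local Notation C := (R[i]).

Lemma trig_coef D (c : int -> C) (N : nat) (n : int) : (`|n| <= D)%N -> (2 * D < N)%N ->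
  \sum_(i < N) trig D c (- (i%:R / N%:R)) * ex (i%:R * (n%:~R / N%:R)) = N%:R * c n.
Proof.
move=> nD DN; have N0 : (0 < N)%N by exact: leq_ltn_trans DN.
rewrite /trig /zsum; under eq_bigr => i _ do rewrite mulr_suml.
rewrite exchange_big /=.
have W1 : (`|(n + D%:Z)%R| < (2 * D).+1)%N by move: nD; clear; lia.
have nE : `|(n + D%:Z)%R|%N%:Z - D%:Z = n by move: nD; clear; lia.
have inner (k : int) : (`|k| <= D)%N ->
   \sum_(i < N) c k * ex (k%:~R * (- (i%:R / N%:R))) * ex (i%:R * (n%:~R / N%:R)) = c k * (if n - k == 0 then N%:R else 0).
  move=> kD; rewrite -(@dft R N (n - k) N0); last by move: nD kD DN; clear; lia.
  rewrite mulr_sumr; apply: eq_bigr => i _; rewrite -mulrA -exD.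
  by congr (_ * ex _); rewrite intrB; ring.
rewrite (bigD1 (Ordinal W1)) //= nE inner // subrr eqxx.
rewrite big1 ?addr0; first by rewrite mulrC.
move=> i ne; rewrite inner; last by have := ltn_ord i; clear; lia.
case: eqP; rewrite ?mulr0 // => e; case/eqP: ne; apply/val_inj => /=.
by move: e nE; clear; lia.
Qed.

Lemma coef_le D (c : int -> C) (b : R) : (forall x, nrm (trig D c x) <= b) ->
  forall n : int, (`|n| <= D)%N -> nrm (c n) <= b.
Proof.
move=> h n nD; have N0 : (0 < (2 * D).+1)%N by [].
have := trig_coef c nD (ltnSn (2 * D)).
move/(congr1 (@nrm R)); rewrite nrmM nrm_nat => e.
rewrite -(ler_pM2l (_ : 0 < (2 * D).+1%:R :> R)) ?ltr0n // -e.
apply: le_trans (nrm_sum _ _ _) _; apply: le_trans (_ : \sum_(i < (2 * D).+1) b <= _).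
  by apply: ler_sum => i _; rewrite nrmM nrm_ex mulr1.
by rewrite sumr_const card_ord mulr_natl.
Qed.

Variables lam alpha E : R.
Implicit Types (c : int -> int -> C) (V : nat) (n l : int) (x : R).

(* The matrix c represents both the functions f_n(x) = sum_l c_{n,l} e(l (x + n alpha / 2)), on which
   the almost Mathieu operator acts in n, and F_l(t) = sum_n c_{n,l} e(- n (t + l alpha / 2)), on which
   its Aubry dual acts in l; both actions are given by [hop]. *)
Definition hop c n l : C :=
  ex (l%:~R * (alpha / 2)) * c (n + 1) l + ex (- (l%:~R * (alpha / 2))) * c (n - 1) l
  + lam%:C%C * (ex (n%:~R * (alpha / 2)) * c n (l - 1) + ex (- (n%:~R * (alpha / 2))) * c n (l + 1))
  - E%:C%C * c n l.

Definition supp2 V c := forall n l, (V < `|n|)%N || (V < `|l|)%N -> c n l = 0.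

Definition orig V c x n : C := trig V (c n) (x + n%:~R * (alpha / 2)).

Definition dual V c x l : C := trig V (fun n => c n l) (- (x + l%:~R * (alpha / 2))).

Lemma supp2_hop V c : supp2 V c -> supp2 V.+1 (hop c).
Proof.
move=> h n l /orP[] hl; rewrite /hop !h ?(mulr0, addr0, subr0) //; apply/orP; [left|left|left|left|left|right|right|right|right|right];
  move: hl; clear; lia.
Qed.

Lemma ex_add_neg x : ex x + ex (- x) = (2 * cos (2 * pi * x))%:C%C.
Proof. by rewrite /ex mulrN cosN sinN; apply/eqP; rewrite eq_complex /= addrN eqxx andbT; apply/eqP; ring. Qed.

Lemma zsum_up V (F : int -> C) : (forall n, (V < `|n|)%N -> F n = 0) ->
  zsum V.+1 (fun n => F (n + 1)) = zsum V.+1 F.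
Proof. by move=> h; apply: zsum_shift; apply: h; clear; lia. Qed.

Lemma zsum_down V (F : int -> C) : (forall n, (V < `|n|)%N -> F n = 0) ->
  zsum V.+1 (fun n => F (n - 1)) = zsum V.+1 F.
Proof.
move=> h; rewrite -(@zsum_shift _ V.+1 (fun n => F (n - 1))).
- by apply: eq_zsum => n _; rewrite addrK.
- by apply: h; clear; lia.
- by rewrite addrK; apply: h; clear; lia.
Qed.

Lemma trigD V (d d' : int -> C) x : trig V (fun n => d n + d' n) x = trig V d x + trig V d' x.
Proof. by rewrite /trig -zsumD; apply: eq_zsum => n _; rewrite mulrDl. Qed.

Lemma trigZ V (a : C) (d : int -> C) x : trig V (fun n => a * d n) x = a * trig V d x.
Proof. by rewrite /trig /zsum mulr_sumr; apply: eq_bigr => n _; rewrite mulrA. Qed.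

Lemma trigN V (d d' : int -> C) x : trig V (fun n => d n - d' n) x = trig V d x - trig V d' x.
Proof. by rewrite /trig /zsum -sumrB; apply: eq_bigr => n _; rewrite mulrBl. Qed.

Lemma trig_shift V (d : int -> C) x : (forall n, (V < `|n|)%N -> d n = 0) ->
  trig V.+1 (fun n => d (n - 1)) x = ex x * trig V.+1 d x /\
  trig V.+1 (fun n => d (n + 1)) x = ex (- x) * trig V.+1 d x.
Proof.
move=> h; rewrite -!trigZ /trig; split.
  rewrite -(@zsum_down V (fun n => ex x * d n * ex (n%:~R * x))); last by move=> n hn; rewrite h // mulr0 mul0r.
  apply: eq_zsum => n _; rewrite [ex x * _]mulrC -mulrA -exD; congr (_ * ex _).
  by rewrite intrB; ring.
rewrite -(@zsum_up V (fun n => ex (- x) * d n * ex (n%:~R * x))); last by move=> n hn; rewrite h // mulr0 mul0r.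
apply: eq_zsum => n _; rewrite [ex (- x) * _]mulrC -mulrA -exD; congr (_ * ex _).
by rewrite intrD; ring.
Qed.

Lemma trig_phase V (d : int -> C) x y : trig V (fun n => ex (n%:~R * y) * d n) x = trig V d (x + y).
Proof.
apply: eq_zsum => n _; rewrite mulrAC -exD mulrC; congr (_ * ex _); ring.
Qed.

Lemma orig_hop V c x n : supp2 V c -> orig V.+1 (hop c) x n =
  orig V.+1 c x (n + 1) + orig V.+1 c x (n - 1)
  + (2 * lam * cos (2 * pi * (x + n%:~R * alpha)) - E)%:C%C * orig V.+1 c x n.
Proof.
move=> h; rewrite /orig /hop trigN trigZ; set y := x + n%:~R * _.
rewrite trigD trigZ !trigD.
have [s1 s2] := @trig_shift V (c n) y (fun l hl => h n l (introT orP (or_intror hl))).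
rewrite (trigZ V.+1 (ex (n%:~R * (alpha / 2))) (fun l => c n (l - 1))) s1.
rewrite (trigZ V.+1 (ex (- (n%:~R * (alpha / 2)))) (fun l => c n (l + 1))) s2.
rewrite (trig_phase V.+1 (c (n + 1)) y (alpha / 2)).
have -> : trig V.+1 (fun l => ex (- (l%:~R * (alpha / 2))) * c (n - 1) l) y = trig V.+1 (c (n - 1)) (y + - (alpha / 2)).
  by rewrite -(trig_phase V.+1 (c (n - 1)) y (- (alpha / 2))); apply: eq_zsum => l _; rewrite mulrN.
have -> : y + alpha / 2 = x + (n + 1)%:~R * (alpha / 2) by rewrite /y intrD; ring.
have -> : y + - (alpha / 2) = x + (n - 1)%:~R * (alpha / 2) by rewrite /y intrB; ring.
have key (A B T e1 e2 f1 f2 L E' Q : C) : L * (e1 * f1 + e2 * f2) = Q ->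
   A + B + L * (e1 * (f1 * T) + e2 * (f2 * T)) - E' * T = A + B + (Q - E') * T by move=> <-; ring.
rewrite (_ : (_ - E)%:C%C = (2 * lam * cos (2 * pi * (x + n%:~R * alpha)))%:C%C - E%:C%C); last exact: rmorphB.
apply: key; rewrite -!exD.
have -> : - (n%:~R * (alpha / 2)) + - y = - (n%:~R * (alpha / 2) + y) by ring.
rewrite ex_add_neg -rmorphM /=; congr (_%:C%C).
have -> : x + n%:~R * alpha = n%:~R * (alpha / 2) + y by rewrite /y; field.
by ring.
Qed.

Lemma dual_hop V c x l : supp2 V c -> dual V.+1 (hop c) x l = resid1 lam E alpha x (dual V.+1 c x) l.
Proof.
move=> h; rewrite /dual /hop trigN trigZ; set y := - (x + l%:~R * _).
rewrite trigD trigZ !trigD.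
have [s1 s2] := @trig_shift V (fun n => c n l) y (fun n hn => h n l (introT orP (or_introl hn))).
rewrite (trigZ V.+1 (ex (l%:~R * (alpha / 2))) (fun n => c (n + 1) l)) s2.
rewrite (trigZ V.+1 (ex (- (l%:~R * (alpha / 2)))) (fun n => c (n - 1) l)) s1.
rewrite (trig_phase V.+1 (fun n => c n (l - 1)) y (alpha / 2)).
have -> : trig V.+1 (fun n => ex (- (n%:~R * (alpha / 2))) * c n (l + 1)) y = trig V.+1 (fun n => c n (l + 1)) (y + - (alpha / 2)).
  by rewrite -(trig_phase V.+1 (fun n => c n (l + 1)) y (- (alpha / 2))); apply: eq_zsum => n _; rewrite (mulrN n%:~R (alpha / 2)).
have -> : y + alpha / 2 = - (x + (l - 1)%:~R * (alpha / 2)) by rewrite /y intrB; ring.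
have -> : y + - (alpha / 2) = - (x + (l + 1)%:~R * (alpha / 2)) by rewrite /y intrD; ring.
rewrite /resid1 /Vx rmorph1 !mul1r.
have -> : x + l%:~R * alpha = l%:~R * (alpha / 2) + - y by rewrite /y; field.
have -> : - (l%:~R * (alpha / 2) + - y) = - (l%:~R * (alpha / 2)) + y by ring.
rewrite !exD -/y.
move: (ex (l%:~R * (alpha / 2))) (ex (- (l%:~R * (alpha / 2)))) (ex y) (ex (- y)) => a1 a2 a3 a4.
by ring.
Qed.

Lemma trig_widen V W (d : int -> C) x : (V <= W)%N -> csupp V d -> trig W d x = trig V d x.
Proof. by move=> VW h; apply: zsum_widen => // n hn; rewrite h // mul0r. Qed.

Lemma supp2W V W c : (V <= W)%N -> supp2 V c -> supp2 W c.
Proof. by move=> VW h n l /orP[] hn; apply: h; rewrite (leq_ltn_trans VW hn) ?orbT. Qed.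

Lemma supp2_row V c n : supp2 V c -> csupp V (c n).
Proof. by move=> h l hl; apply: h; rewrite hl orbT. Qed.

Lemma supp2_col V c l : supp2 V c -> csupp V (fun n => c n l).
Proof. by move=> h n hn; apply: h; rewrite hn. Qed.

Definition represents V c (f : R -> int -> R) := supp2 V c /\ forall x n, orig V c x n = (f x n)%:C%C.

Lemma representsW V W c f : (V <= W)%N -> represents V c f -> represents W c f.
Proof.
move=> VW [h1 h2]; split; first exact: supp2W h1.
by move=> x n; rewrite /orig (trig_widen _ VW (supp2_row n h1)); exact: h2.
Qed.

(** The Neumann series on arrays of Fourier coefficients: [Tar], [Bar], [barr], [uarr] mirror [Top],
    [Bop], [bvec], [uvec]. *)
Definition Tar c n l : C := (16^-1)%:C%C * hop c n l.
Definition Bar c n l : C := c n l - Tar (Tar c) n l.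
Definition dar (n l : int) : C := ((n == 0) && (l == 0))%:R.
Definition barr j := iter j Bar dar.
Definition uarr j n l : C := (16^-1)%:C%C * Tar (barr j) n l.

Lemma supp2_Z V (a : C) c : supp2 V c -> supp2 V (fun n l => a * c n l).
Proof. by move=> h n l hl; rewrite h // mulr0. Qed.

Lemma represents_Z V (a : R) c f : represents V c f -> represents V (fun n l => a%:C%C * c n l) (fun x n => a * f x n).
Proof.
move=> [h1 h2]; split; first exact: supp2_Z.
by move=> x n; rewrite /orig trigZ rmorphM /= -h2.
Qed.

Lemma represents_Tar V c f : represents V c f -> represents V.+1 (Tar c) (fun x => Top lam alpha E x (f x)).
Proof.
move=> [h1 h2]; have [_ h3] := representsW (leqnSn V) (conj h1 h2).
split; first exact: supp2_Z (supp2_hop h1).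
move=> x n; rewrite /orig trigZ -/(orig V.+1 (hop c) x n) orig_hop // !h3 TopE.
have key (a b d u v : R) : a%:C%C * (b%:C%C + d%:C%C + u%:C%C * v%:C%C) = (a * (b + d + u * v))%:C%C :> C.
  by rewrite !(rmorphM, rmorphD).
exact: key.
Qed.

Lemma represents_B V c c' f f' : represents V c f -> represents V c' f' ->
  represents V (fun n l => c n l - c' n l) (fun x n => f x n - f' x n).
Proof.
move=> [h1 h2] [h1' h2']; split; first by move=> n l hl; rewrite h1 // h1' // subr0.
by move=> x n; rewrite /orig trigN rmorphB /= -h2 -h2'.
Qed.

Lemma represents_bvec j : represents (2 * j) (barr j) (fun x => bvec lam alpha E j x).
Proof.
elim: j => [|j IH].
  split; first by move=> n l; rewrite !absz_gt0 /dar -negb_and => /negPf; rewrite /barr /= /dar => ->.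
  move=> x n; rewrite /orig /trig /zsum big_ord1 /= subr0 mul0r ex0 mulr1 /barr /= /dar andbT.
  by rewrite /bvec /= /delta0; case: (n == 0).
have -> : (2 * j.+1 = (2 * j).+2)%N by clear; lia.
have h := represents_Tar (represents_Tar IH).
have h0 : represents (2 * j).+2 (barr j) (fun x => bvec lam alpha E j x) by apply: representsW IH; clear; lia.
exact: represents_B h0 h.
Qed.

Lemma represents_uvec j : represents (2 * j).+1 (uarr j) (fun x => uvec lam alpha E j x).
Proof. exact: represents_Z (represents_Tar (represents_bvec j)). Qed.

Lemma represents_le V c f (b : R) : represents V c f -> (forall x n, `|f x n| <= b) ->
  forall n l, nrm (c n l) <= b.
Proof.
move=> [h1 h2] hf n l; have [lV|lV] := leqP `|l| V; last first.
  by rewrite h1 ?lV ?orbT // nrm0; exact: le_trans (normr_ge0 _) (hf 0 n).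
apply: (@coef_le V (c n)) => // y.
have := h2 (y - n%:~R * (alpha / 2)) n; rewrite /orig subrK => ->.
by rewrite nrm_real.
Qed.

Lemma hopD c c' n l : hop (fun n l => c n l + c' n l) n l = hop c n l + hop c' n l.
Proof. by rewrite /hop; move: (ex _) (ex _) (ex _) (ex _) => *; ring. Qed.

Lemma hopZ (a : C) c n l : hop (fun n l => a * c n l) n l = a * hop c n l.
Proof. by rewrite /hop; move: (ex _) (ex _) (ex _) (ex _) => *; ring. Qed.

Definition sarr J n l : C := \sum_(j < J) uarr j n l.

(** Read through [dual], the partial sums solve the dual equation with a source at l = 0, for every
    phase, up to the remainder [barr J]. *)
Lemma hop_sarr J n l : hop (sarr J) n l = dar n l - barr J n l.
Proof.
elim: J => [|J IH].
  by rewrite /barr /= subrr /hop /sarr !big_ord0 !(mulr0, addr0, subr0).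
have -> : sarr J.+1 = fun n l => sarr J n l + uarr J n l.
  by apply: funext => k; apply: funext => m; rewrite /sarr big_ord_recr.
rewrite hopD IH /uarr hopZ.
have -> : (16^-1)%:C%C * hop (Tar (barr J)) n l = Tar (Tar (barr J)) n l by [].
have -> : barr J.+1 n l = barr J n l - Tar (Tar (barr J)) n l by [].
by ring.
Qed.

Lemma supp2_sarr J : supp2 (2 * J) (sarr J).
Proof.
move=> n l hl; rewrite /sarr big1 // => j _; have [h _] := represents_uvec j.
by apply: (supp2W _ h) hl; have := ltn_ord j; clear; lia.
Qed.

Lemma dual_dar V x l : dual V dar x l = (l == 0)%:R.
Proof.
rewrite /dual (@trig_widen 0) // ?/trig ?/zsum ?big_ord1 /= ?subr0 ?mul0r ?ex0 ?mulr1 /dar //.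
by move=> n; rewrite absz_gt0 => /negPf ->.
Qed.

Lemma dual_le V c x l (b : R) : (forall n l, nrm (c n l) <= b) -> nrm (dual V c x l) <= (2 * V).+1%:R * b.
Proof. by move=> h; apply: nrm_zsum => n _; rewrite nrmM nrm_ex mulr1. Qed.

Lemma sum_arith_geom (r : R) J : 0 <= r -> r < 1 -> \sum_(j < J) j.+1%:R * r ^+ j <= (1 - r) ^- 2.
Proof.
move=> r0 r1; have p : 0 < (1 - r) ^+ 2 by rewrite exprn_gt0 // subr_gt0.
rewrite -[leRHS]mul1r ler_pdivlMr // mulrC.
have -> : (1 - r) ^+ 2 * \sum_(j < J) j.+1%:R * r ^+ j = 1 - r ^+ J * (1 + J%:R * (1 - r)).
  elim: J => [|J IH]; first by rewrite big_ord0 mulr0 expr0 mul0r addr0 mulr1 subrr.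
  rewrite big_ord_recr /= mulrDr IH (exprS r J) -natr1; ring.
by rewrite gerBl mulr_ge0 ?exprn_ge0 // addr_ge0 // mulr_ge0 // subr_ge0 ltW.
Qed.

Lemma pow_small (r e : R) : 0 <= r -> r < 1 -> 0 < e -> exists N, forall n : nat, (N <= n)%N -> r ^+ n < e.
Proof.
move=> r0 r1 e0; have c : (fun n : nat => r ^+ n) @ \oo --> (0 : R) by apply: cvg_expr; rewrite ger0_norm.
have [N hN] := cvg_dist c e0; exists N => n /hN.
by rewrite subr0 ger0_norm // exprn_ge0.
Qed.

Lemma linear_pow_small (r e : R) (a : nat) : 0 <= r -> r < 1 -> 0 < e ->
  exists N, forall n : nat, (N <= n)%N -> (a * n.+1)%:R * r ^+ n < e.
Proof.
(* Of the two factors in r^n = s^n s^n, one bounds n + 1 through the arithmetic-geometric sum and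
   the other tends to 0. *)
move=> r0 r1 e0; pose s := Num.sqrt r.
have s0 : 0 <= s by exact: sqrtr_ge0.
have s1 : s < 1 by rewrite -sqrtr1 ltr_sqrt.
have sE : r = s * s by rewrite -expr2 sqr_sqrtr.
pose K := a%:R * (1 - s) ^- 2 + 1 : R.
have a0 : 0 <= a%:R * (1 - s) ^- 2 by rewrite mulr_ge0 // invr_ge0 exprn_ge0 // subr_ge0 ltW.
have K0 : 0 < K by rewrite ltr_wpDl.
have [N hN] := pow_small s0 s1 (divr_gt0 e0 K0).
exists N => n hn.
have q : n.+1%:R * s ^+ n <= (1 - s) ^- 2.
  apply: le_trans (sum_arith_geom n.+1 s0 s1); rewrite big_ord_recr /= lerDr sumr_ge0 // => i _.
  by rewrite mulr_ge0 // exprn_ge0.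
have -> : (a * n.+1)%:R * r ^+ n = a%:R * (n.+1%:R * s ^+ n) * s ^+ n by rewrite natrM sE exprMn; ring.
apply: le_lt_trans (_ : a%:R * (1 - s) ^- 2 * s ^+ n < _).
  by rewrite ler_wpM2r ?exprn_ge0 // ler_wpM2l.
have h := hN n hn; rewrite ltr_pdivlMr // in h; apply: le_lt_trans h.
by rewrite mulrC ler_wpM2l ?exprn_ge0 // lerDl.
Qed.

End Coefficients.

(** * The Green function in a spectral gap *)

Lemma uniform_limit_continuous (R : realType) (f : R -> R) (F : nat -> R -> R) (d : nat -> R) :
  (forall J x, `|f x - F J x| <= d J) -> (forall e, 0 < e -> exists J, d J < e) ->
  (forall J, continuous (F J)) -> continuous f.
Proof.
move=> hd sd cF x; apply/cvgrPdist_lt => e e0.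
have e3 : 0 < e / 3 by rewrite divr_gt0.
have [J hJ] := sd _ e3.
have /cvgrPdist_lt/(_ _ e3) := cF J x; apply: filterS => y hy.
have -> : f x - f y = (f x - F J x) + ((F J x - F J y) - (f y - F J y)) by ring.
apply: le_lt_trans (ler_normD _ _) _.
have h1 := hd J x; have h2 := hd J y.
have h3 := ler_normB (F J x - F J y) (f y - F J y).
by move: h1 h2 h3 hy hJ; do 4!move: `|_| => ?; lra.
Qed.

Section GreenFunction.
Variables (R : realType) (lam alpha E kap : R).
Hypotheses (lam1 : `|lam| <= 1) (E4 : `|E| <= 4) (kap0 : 0 < kap) (kap4 : kap <= 4).
Hypothesis low : forall (phi : int -> R) (W : nat) (x : R), supp_in W phi ->
  kap ^+ 2 * zsum W.+1 (fun n => phi n ^+ 2) <=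
  zsum W.+1 (fun n => (almost_mathieu lam alpha x phi n - E * phi n) ^+ 2).
Local Notation C := (R[i]).
Local Notation r := (rate kap).
Local Notation u := (uvec lam alpha E).

Let r0 : 0 <= r. Proof. by apply: ltW; exact: rate_gt0. Qed.
Let r1 : r < 1. Proof. exact: rate_lt1. Qed.
Let r1B : 0 < 1 - r. Proof. by rewrite subr_gt0. Qed.
Let hu j x n : `|u j x n| <= r ^+ j. Proof. exact: (@uvec_le _ lam alpha E kap). Qed.

Definition tail J : R := r ^+ J / (1 - r).

Lemma tail_ge0 J : 0 <= tail J.
Proof. by rewrite divr_ge0 ?exprn_ge0 // ltW. Qed.

Lemma pow_le_tail J : r ^+ J <= tail J.
Proof. by rewrite /tail ler_pdivlMr // ler_piMr ?exprn_ge0 // gerBl. Qed.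

Lemma tail_small e : 0 < e -> exists N, forall n, (N <= n)%N -> (4 * n.+1)%:R * tail n < e.
Proof.
move=> e0; have [N hN] := linear_pow_small 4 r0 r1 (mulr_gt0 e0 r1B).
by exists N => n /hN; rewrite /tail mulrA ltr_pdivrMr.
Qed.

Lemma tail_lt e : 0 < e -> exists N, forall n, (N <= n)%N -> tail n < e.
Proof.
move=> e0; have [N hN] := tail_small e0; exists N => n /hN; apply: le_lt_trans.
by rewrite ler_peMl ?tail_ge0 // ler1n muln_gt0.
Qed.

Lemma tail_eq0 (z K : R) : (forall J, `|z| <= K * tail J) -> z = 0.
Proof.
move=> h; apply/eqP; rewrite -normr_eq0 eq_le normr_ge0 andbT leNgt; apply/negP => z0.
have K0 : 0 < `|K| + 1 by rewrite ltr_wpDl.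
have [N /(_ N (leqnn N)) hN] := tail_lt (divr_gt0 z0 K0).
rewrite ltr_pdivlMr // in hN; have := h N; rewrite leNgt => /negP; apply.
apply: le_lt_trans hN; rewrite mulrC ler_wpM2l ?tail_ge0 //.
by apply: le_trans (ler_norm K) _; rewrite lerDl.
Qed.

Lemma green_exists : exists g : int -> R -> R, [/\
  (forall n x, g (n + 1) x + g (n - 1) x +
    (2 * lam * cos (2 * pi * (x + n%:~R * alpha)) - E) * g n x = (n == 0)%:R) /\
    (forall n x, g n x = g (- n) (x + n%:~R * alpha)),
  forall x e, 0 < e -> exists N : nat, forall n : int, (N <= `|n|)%N -> `|g n x| <= e,
  forall n, continuous (g n),
  forall n x (k : int), g n (x + k%:~R) = g n x &
  forall n x J, `|g n x - \sum_(j < J) u j x n| <= tail J].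
Proof.
have hex (p : int * R) := geom_limit r0 r1 (fun j => hu j p.2 p.1).
have [G hG] := choice hex; pose g n x := G (n, x).
have gT n x J : `|g n x - \sum_(j < J) u j x n| <= tail J by exact: (hG (n, x) J).
have eq2 n x n' x' : (forall j, u j x n = u j x' n') -> g n x = g n' x'.
  move=> h; apply/eqP; rewrite -subr_eq0; apply/eqP; apply: (@tail_eq0 _ 2) => J.
  have e : \sum_(j < J) u j x n = \sum_(j < J) u j x' n' by apply: eq_bigr.
  have h1 := gT n x J; have := gT n' x' J; rewrite -e => h2.
  move: h1 h2; move: (\sum_(_ < _) _) => s h1 h2.
  have -> : g n x - g n' x' = (g n x - s) - (g n' x' - s) by ring.
  by apply: le_trans (ler_normB _ _) _; move: h1 h2; do 2!move: `|_| => ?; lra.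
exists g; split=> //.
- split; last by move=> n x; apply: eq2 => j; exact: (uvec_sym alpha lam1 E4 kap0 kap4).
  move=> n x; apply/eqP; rewrite -subr_eq0; apply/eqP; apply: (@tail_eq0 _ 9) => J.
  pose s k := \sum_(j < J) u j x k.
  have q : s (n + 1) + s (n - 1) + 2 * lam * cos (2 * pi * (x + n%:~R * alpha)) * s n - E * s n =
     (n == 0)%:R - bvec lam alpha E J x n by exact: uvec_eq.
  have h1 : `|g (n + 1) x - s (n + 1)| <= tail J by exact: gT.
  have h2 : `|g (n - 1) x - s (n - 1)| <= tail J by exact: gT.
  have h3 : `|g n x - s n| <= tail J by exact: gT.
  have hp : `|2 * lam * cos (2 * pi * (x + n%:~R * alpha)) - E| <= 6 by exact: potE.
  have hb : `|bvec lam alpha E J x n| <= tail J.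
    by apply: le_trans (pow_le_tail J); exact: (@bvec_le _ lam alpha E kap).
  have h4 := ler_pM (normr_ge0 _) (normr_ge0 _) hp h3.
  move: q h1 h2 h3 h4 hb; rewrite -normrM.
  move: (2 * lam * cos _) (s (n + 1)) (s (n - 1)) (s n) (g (n + 1) x) (g (n - 1) x) (g n x) (bvec _ _ _ _ _ _)
    => v s1 s2 s3 g1 g2 g3 b; move: ((n == 0)%:R) => dl q h1 h2 h3 h4 h5.
  have -> : g1 + g2 + (v - E) * g3 - dl = (g1 - s1) + ((g2 - s2) + ((v - E) * (g3 - s3) - b)) by move: q; lra.
  apply: le_trans (ler_normD _ _) _; apply: le_trans (lerD (lexx _) (ler_normD _ _)) _.
  apply: le_trans (lerD (lexx _) (lerD (lexx _) (ler_normB _ _))) _.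
  by move: h1 h2 h4 h5; do 4!move: `|_| => ?; move: (tail J) => t; lra.
- move=> x e e0; have [N hN] := tail_lt e0; exists (2 * N)%N.+1 => n hn.
  have := gT n x N; rewrite big1; first by rewrite subr0 => h; apply: le_trans h _; exact: ltW (hN N _).
  move=> j _; have jn : (2 * j + 1 < `|n|)%N.
    by apply: leq_ltn_trans hn; have : (j < N)%N := ltn_ord j; move: (nat_of_ord j) => a; clear; lia.
  exact: (uvec_supp alpha lam1 E4 kap0 kap4).
- move=> n; apply: (@uniform_limit_continuous _ _ (fun J x => \sum_(j < J) u j x n) tail).
  + by move=> J x; exact: gT.
  + by move=> e e0; have [N hN] := tail_lt e0; exists N; exact: hN.
  + elim=> [|J IH].
      have -> : (fun x => \sum_(j < 0) u j x n) = (fun=> 0) by apply: funext => x; rewrite big_ord0.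
      exact: cont_cst.
    have -> : (fun x => \sum_(j < J.+1) u j x n) = fun x => \sum_(j < J) u j x n + u J x n.
      by apply: funext => x; rewrite big_ord_recr.
    by apply: contD => //; exact: uvec_cont.
- by move=> n x k; apply: eq2 => j; exact: uvec_per.
Qed.

Local Notation S := (sarr lam alpha E).

Lemma sarr_dist J J' l : (J <= J')%N -> nrm (S J' 0 l - S J 0 l) <= tail J.
Proof.
move=> /subnKC <-; rewrite /sarr big_split_ord /= addrAC subrr add0r.
apply: le_trans (nrm_sum _ _ _) _; apply: le_trans (_ : \sum_(i < J' - J) r ^+ J * r ^+ i <= _).
  apply: ler_sum => i _; rewrite -exprD.
  by apply: (represents_le (represents_uvec lam alpha E (J + i))) => x n.
rewrite -mulr_sumr; apply: ler_wpM2l; first exact: exprn_ge0.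
rewrite -[leRHS]mul1r ler_pdivlMr // mulrC.
have := subrX1 r (J' - J); rewrite -opprB -[X in _ = X * _]opprB mulNr => /oppr_inj <-.
by rewrite gerBl exprn_ge0.
Qed.

Variables (kp D0 D1 : R).
Hypotheses (kp0 : 0 < kp) (D00 : 0 <= D0) (D10 : 0 <= D1).
Hypothesis decay : forall l : int, exists Cl N1, 0 <= Cl /\
   forall (F : R -> int -> C) (M0 eps : R), 0 <= M0 -> 0 <= eps ->
    (forall t n, nrm (F t n) <= M0) ->
    (forall t, exists W : nat, forall n : int, (W < `|n|)%N -> F t n = 0) ->
    (forall t (n : int), n != 0 -> nrm (resid1 lam E alpha t (F t) n) <= eps) ->
    (forall t, nrm (resid1 lam E alpha t (F t) 0) <= 1 + eps) ->
    forall N, (N1 <= N)%N -> N%:R^-1 * (\sum_(i < N) nrm (F (i%:R / N%:R) l)) <=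
      (D0 + M0 * D1) * expR (- (kp * (`|l|)%:R)) + Cl * eps.

(** Of order kap^{-4}: the j-th dual term is a sum of at most 4 (j + 1) coefficients of size r^j,
    and 1 - r = kap^2 / 256. *)
Let M0 : R := 4 * (1 - r) ^- 2.

Let M00 : 0 <= M0.
Proof. by rewrite mulr_ge0 // invr_ge0 exprn_ge0 // ltW. Qed.

Lemma dual_sarr_le J x l : nrm (dual alpha (2 * J).+1 (S J) x l) <= M0.
Proof.
have -> : dual alpha (2 * J).+1 (S J) x l = \sum_(j < J) dual alpha (2 * J).+1 (uarr lam alpha E j) x l.
  rewrite /dual /trig /zsum exchange_big /=; apply: eq_bigr => i _; by rewrite /sarr mulr_suml.
apply: le_trans (nrm_sum _ _ _) _.
apply: le_trans (_ : \sum_(j < J) 4 * (j.+1%:R * r ^+ j) <= _); last first.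
  by rewrite -mulr_sumr ler_wpM2l // sum_arith_geom.
apply: ler_sum => j _; have [s _] := represents_uvec lam alpha E j.
rewrite /dual (@trig_widen _ (2 * j).+1); [|by have := ltn_ord j; clear; lia|exact: supp2_col].
apply: le_trans (dual_le _ _ _ _ (represents_le (represents_uvec lam alpha E j) (fun x n => hu j x n))) _.
by rewrite mulrA -natrM ler_wpM2r ?exprn_ge0 // ler_nat; clear; lia.
Qed.

Lemma dual_sarr_resid J x l :
  nrm (resid1 lam E alpha x (dual alpha (2 * J).+1 (S J) x) l - (l == 0)%:R) <= (4 * J.+1)%:R * tail J.
Proof.
rewrite -dual_hop; last exact: supp2_sarr.
have -> : dual alpha (2 * J).+1 (hop lam alpha E (S J)) x l =
   dual alpha (2 * J).+1 (dar R) x l - dual alpha (2 * J).+1 (barr lam alpha E J) x l.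
  by rewrite /dual -trigN; apply: eq_zsum => n _; rewrite hop_sarr.
rewrite dual_dar addrAC subrr add0r nrmN.
rewrite /dual (@trig_widen _ (2 * J)) //; last first.
  by have [s _] := represents_bvec lam alpha E J; exact: supp2_col.
apply: le_trans (dual_le _ _ _ _ (represents_le (represents_bvec lam alpha E J) (b := r ^+ J) _)) _.
  by move=> y n; exact: (@bvec_le _ lam alpha E kap).
by apply: ler_pM; rewrite ?exprn_ge0 ?pow_le_tail // ler_nat; clear; lia.
Qed.

(** The coefficient at n = 0 is a mean of the dual function over phases, up to unimodular factors,
    and means are what [decay] controls. *)
Lemma dual_mean J l N : (2 * (2 * J).+1 < N)%N ->
  nrm (S J 0 l) <= N%:R^-1 * \sum_(i < N) nrm (dual alpha (2 * J).+1 (S J) (i%:R / N%:R) l).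
Proof.
move=> hN; have N0 : (0 < N)%N by exact: leq_ltn_trans hN.
pose d (n : int) : C := ex (n%:~R * (- (l%:~R * (alpha / 2)))) * S J n l.
have h0 : (`|0%R : int| <= (2 * J).+1)%N by [].
have d0E : d 0 = S J 0 l by rewrite /d mul0r ex0 mul1r.
have := trig_coef d h0 hN; rewrite d0E => /(congr1 (@nrm R)); rewrite nrmM nrm_nat => e.
rewrite ler_pdivlMl ?ltr0n // -e; apply: le_trans (nrm_sum _ _ _) _.
apply: ler_sum => i _; rewrite nrmM nrm_ex mulr1 le_eqVlt; apply/orP; left; apply/eqP.
by rewrite (trig_phase _ (fun n => S J n l)) /dual -opprD.
Qed.

(** [Cl] depends on [l] without control, so the order J' is chosen after [l] to make the residual
    negligible; returning from J' to J costs [tail J]. *)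
Lemma sarr_decay J l : nrm (S J 0 l) <= (D0 + M0 * D1) * expR (- (kp * (`|l|)%:R)) + tail J.
Proof.
have [Cl [N1 [Cl0 hCl]]] := decay l.
apply/ler_addgt0Pr => e e0.
have K0 : 0 < Cl + 1 by rewrite ltr_wpDl.
have [J1 hJ1] := tail_small (divr_gt0 e0 K0).
pose J' := maxn J J1; have JJ' : (J <= J')%N by exact: leq_maxl.
pose eps := (4 * J'.+1)%:R * tail J'.
have eps0 : 0 <= eps by rewrite mulr_ge0 // tail_ge0.
have epsE : Cl * eps <= e.
  have := hJ1 J' (leq_maxr _ _); rewrite -/eps ltr_pdivlMr // => h.
  by apply: le_trans (ltW h); rewrite mulrC ler_wpM2l // lerDl.
pose N := maxn N1 (2 * (2 * J').+1).+1.
have b1 := @dual_mean J' l N (leq_maxr _ _).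
have b2 := hCl (fun x => dual alpha (2 * J').+1 (S J') x) M0 eps M00 eps0 (dual_sarr_le J') _ _ _ N (leq_maxl _ _).
have {}b2 := le_trans b1 (b2 _ _ _).
have {}b2 : nrm (S J' 0 l) <= (D0 + M0 * D1) * expR (- (kp * (`|l|)%:R)) + Cl * eps.
  apply: b2.
  - move=> t; exists (2 * J')%N => n hn; rewrite /dual /trig /zsum big1 // => i _.
    by rewrite (@supp2_sarr _ lam alpha E J' _ n) ?hn ?orbT // mul0r.
  - by move=> t n n0; have := dual_sarr_resid J' t n; rewrite (negPf n0) subr0.
  - move=> t; have := dual_sarr_resid J' t 0; rewrite eqxx => h.
    rewrite -[X in nrm X](subrK 1) addrC; apply: le_trans (nrmD _ _) _; rewrite nrm1; exact: lerD.
have b3 := @sarr_dist J J' l JJ'.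
rewrite -[S J 0 l](subKr (S J' 0 l)); apply: le_trans (nrmB _ _) _.
by move: b2 b3 epsE; move: (_ * expR _) (Cl * eps) (nrm _) (nrm _) => *; lra.
Qed.

Let M := D0 + M0 * D1 + 1.

Let M_gt0 : 0 < M.
Proof. by rewrite ltr_wpDl // addr_ge0 // mulr_ge0. Qed.

(** Two orders are used: the support is cut at 2 J, but the coefficients are those of order J', so
    large that [tail J'] is below M exp(- 2 J kp). The decay constant is then independent of [d]. *)
Lemma green_trig (g : int -> R -> R) :
  (forall n x J, `|g n x - \sum_(j < J) u j x n| <= tail J) ->
  forall d, 0 < d -> exists D c, [/\ csupp D c, dec kp (2 * M) c &
    forall x, nrm ((g 0 x)%:C%C - trig D c x) <= d].
Proof.
move=> hg d d0; have d2 : 0 < d / 2 by rewrite divr_gt0.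
have [J hJ] := tail_small d2; have {}hJ := hJ J (leqnn J).
have q : 0 < M * expR (- kp) ^+ (2 * J) by rewrite mulr_gt0 // exprn_gt0 // expR_gt0.
have [J1 hJ1] := tail_lt q; pose J' := maxn J J1.
have {}hJ1 := hJ1 J' (leq_maxr _ _).
pose c (l : int) : C := if (`|l| <= 2 * J)%N then S J' 0 l else 0.
exists (2 * J)%N, c; split.
- by move=> l hl; rewrite /c leqNgt hl.
- move=> l; rewrite /c; case: leqP => hl; last first.
    by rewrite nrm0 mulr_ge0 ?exprn_ge0 ?expR_ge0 // mulr_ge0 // ltW.
  apply: le_trans (sarr_decay J' l) _; rewrite exp_nat.
  have e1 : expR (- kp) ^+ (2 * J) <= expR (- kp) ^+ `|l|.
    by apply: (ler_wiXn2l (expR_ge0 _) _ hl); rewrite -[leRHS]expR0 ler_expR oppr_le0 ltW.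
  have e2 := ler_wpM2l (ltW M_gt0) e1.
  have e3 : 0 <= expR (- kp) ^+ `|l| by rewrite exprn_ge0 // expR_ge0.
  move: hJ1 e2 e3; rewrite /M; move: (D0 + _) (expR _ ^+ `|l|) (_ * expR _ ^+ _) (tail J') => a b e t *; lra.
- move=> x.
  have [s hs] := (@supp2_sarr _ lam alpha E J, represents_uvec lam alpha E).
  have e1 : trig (2 * J) (S J 0) x = (\sum_(j < J) u j x 0)%:C%C.
    have -> : trig (2 * J) (S J 0) x = \sum_(j < J) trig (2 * J) (uarr lam alpha E j 0) x.
      by rewrite /trig /zsum exchange_big /=; apply: eq_bigr => i _; rewrite /sarr mulr_suml.
    rewrite rmorph_sum /=; apply: eq_bigr => j _; have [h1 h2] := hs j.
    rewrite (@trig_widen _ (2 * j).+1); [|by have := ltn_ord j; clear; lia|exact: supp2_row].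
    by rewrite -h2 /orig mul0r addr0.
  have -> : (g 0 x)%:C%C - trig (2 * J) c x = (g 0 x - \sum_(j < J) u j x 0)%:C%C - trig (2 * J) (fun l => c l - S J 0 l) x.
    by rewrite trigN e1 rmorphB /=; move: (_%:C%C) (_%:C%C) (trig _ _ _) => *; ring.
  apply: le_trans (nrmB _ _) _; rewrite nrm_real.
  have b1 := hg 0 x J.
  have b2 : nrm (trig (2 * J) (fun l => c l - S J 0 l) x) <= (2 * (2 * J)).+1%:R * tail J.
    apply: nrm_zsum => l hl; rewrite nrmM nrm_ex mulr1 /c hl.
    by apply: sarr_dist; exact: leq_maxl.
  have b3 : (2 * (2 * J)).+1%:R * tail J + tail J <= (4 * J.+1)%:R * tail J.
    rewrite -[X in _ + X]mul1r -mulrDl ler_wpM2r ?tail_ge0 // natr1 ler_nat; clear; lia.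
  have d3 : d / 2 <= d by move: d0; lra.
  move: b1 b2 b3 hJ d3; move: ((2 * (2 * J)).+1%:R * tail J) ((4 * J.+1)%:R * tail J) (tail J).
  by move: (nrm _) `|_| => *; lra.
Qed.

End GreenFunction.

(** * Gap lengths *)

Lemma common_lower_bound (R : realType) (T : Type) (s : seq T) (f : T -> R) :
  exists2 e, 0 < e & forall x, List.In x s -> 0 < f x -> e <= f x.
Proof.
elim: s => [|a s [e e0 IH]]; first by exists 1.
have [fa|fa] := lerP (f a) 0.
  by exists e => // x [<-|xs] fx; [move: fx; rewrite ltNge fa|exact: IH].
exists (Num.min e (f a)); first by rewrite lt_min e0.
by move=> x [<-|xs] fx; rewrite ge_min ?lexx ?orbT // IH.
Qed.

Lemma pairwise_lower_bound (R : realType) (n : nat) (f : nat -> nat -> R) :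
  exists2 e, 0 < e & forall i j, (i < n)%N -> (j < n)%N -> 0 < f i j -> e <= f i j.
Proof.
have [e e0 he] := common_lower_bound (enum {: 'I_n * 'I_n}) (fun p : 'I_n * 'I_n => f p.1 p.2).
exists e => // i j hi hj; apply: (he (Ordinal hi, Ordinal hj)).
have : (Ordinal hi, Ordinal hj) \in enum {: 'I_n * 'I_n} by rewrite mem_enum.
by elim: (enum _) => [//|a s IH]; rewrite in_cons => /orP[/eqP ->|/IH]; [left|right].
Qed.

(** * Zeros against decay inside one gap *)

Section Gap.
Variables (R : realType) (alpha lam E1 E2 : R) (m : int).
Hypotheses (irr : not_rational alpha) (lam1 : `|lam| <= 1) (m0 : m != 0) (E12 : E1 < E2).
Hypothesis hgap : forall E, E1 <= E <= E2 -> gap_set lam alpha m E.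
Local Notation E := ((E1 + E2) / 2).
Local Notation kap := ((E2 - E1) / 2).

Let kap0 : 0 < kap. Proof. by move: E12; lra. Qed.
Let gE1 : gap_set lam alpha m E1. Proof. by apply: hgap; rewrite lexx ltW. Qed.
Let gE2 : gap_set lam alpha m E2. Proof. by apply: hgap; rewrite lexx ltW. Qed.
Let gEm : gap_set lam alpha m E. Proof. by apply: hgap; move: E12; lra. Qed.
Let E4 : `|E| <= 4. Proof. exact: gap_energy_bound gEm. Qed.
Let kap4 : kap <= 4.
Proof.
have := gap_energy_bound irr m0 lam1 gE1; have := gap_energy_bound irr m0 lam1 gE2.
by rewrite !ler_norml; lra.
Qed.
Let low := gap_lower irr m0 E12 gE1 gE2.

Lemma gap_green : exists g : int -> R -> R, [/\
  forall n x J, `|g n x - \sum_(j < J) uvec lam alpha E j x n| <= tail kap J,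
  exists x, 1 / 100 <= `|g 0 x| &
  forall (p N k : nat) (z : R), (0 < p)%N ->
   (forall w, exists n (i : int), (n <= N)%N /\ `|w - n%:R * alpha - i%:~R| < p%:R^-1) ->
   (k + 2 * N + 2)%:R <= (`|m|)%:R / p%:R :> R ->
   exists t : nat -> R, [/\ forall i, (i < k)%N -> z <= t i <= z + 3 / p%:R,
     forall i, (i < k)%N -> g 0 (t i) = 0 &
     forall i i', (i < k)%N -> (i' < k)%N -> t i = t i' -> i = i']].
Proof.
have [g [[gE gS] gD gC gP gT]] := green_exists lam1 E4 kap0 kap4 low.
exists g; split=> //; first exact: green_large lam1 E4 gE gS gD gC.
have [y [cy yl yu]] := line_angle gE gS gD gC gP.
have [r [j [psi [_ _ rE hp lim]]]] := gap_rho irr m0 gEm.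
have ystep x : exists k : int, 2 * (y (x + alpha) - lmap psi x (y x)) = k%:~R.
  apply: yu; have := line_step gE gS gD (yl x).
  have [s s0 [-> e2]] := lift_eq hp x (y x); rewrite e2.
  have sn0 : s != 0 by rewrite gt_eqF.
  by move=> [h1 h2]; split; apply: (mulfI sn0); rewrite mulrCA ?h1 ?h2 mulrCA.
have yper x : exists k : int, 2 * (y (x + 1) - y x) = k%:~R.
  have [k hk] : exists k : int, 2 * (y x - y (x + 1)) = k%:~R.
    apply: yu; have := yl (x + 1).
    have eG n q : G2 alpha g (x + 1) n q = G2 alpha g x n q.
      by rewrite /G2 addrAC (gP _ _ 1).
    by rewrite /on_line !eG.
  by exists (- k); rewrite intrN -hk; ring.
move=> p N k z p0 hd hk.
have [t [t1 t2 t3]] := crossings irr hp lim rE cy ystep yper z p0 hd hk.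
exists t; split=> // i ik; have c0 := t2 i ik.
have [h _] := yl (t i); rewrite c0 mulr0 G2_00 in h.
have s0 : sin (2 * pi * y (t i)) != 0.
  by apply/eqP => s0; have := cos2Dsin2 (2 * pi * y (t i)); rewrite c0 s0 expr0n addr0 => /eqP; rewrite eq_sym oner_eq0.
by move/eqP: h; rewrite mulf_eq0 (negPf s0) orbF => /eqP.
Qed.

(** A point x with |g_0(x)| >= 1/100 is the left end of an interval of length 3 / p with 2k zeros:
    each factor 2 [sn] is at most 24 / p, and each pair of zeros also gives [rate1 * rate2]. *)
Lemma gap_bound (kp D0 D1 : R) (p N k : nat) : 0 < kp -> 0 <= D0 -> 0 <= D1 ->
  (forall l : int, exists Cl N1, 0 <= Cl /\
   forall (F : R -> int -> R[i]) (M0 eps : R), 0 <= M0 -> 0 <= eps ->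
    (forall t n, nrm (F t n) <= M0) ->
    (forall t, exists W : nat, forall n : int, (W < `|n|)%N -> F t n = 0) ->
    (forall t (n : int), n != 0 -> nrm (resid1 lam E alpha t (F t) n) <= eps) ->
    (forall t, nrm (resid1 lam E alpha t (F t) 0) <= 1 + eps) ->
    forall N, (N1 <= N)%N -> N%:R^-1 * (\sum_(i < N) nrm (F (i%:R / N%:R) l)) <=
      (D0 + M0 * D1) * expR (- (kp * (`|l|)%:R)) + Cl * eps) ->
  (6 <= p)%N ->
  (forall w, exists n (i : int), (n <= N)%N /\ `|w - n%:R * alpha - i%:~R| < p%:R^-1) ->
  (2 * k + 2 * N + 2)%:R <= (`|m|)%:R / p%:R :> R ->
  1 / 100 <= 2 * (D0 + 4 * (1 - rate kap) ^- 2 * D1 + 1) * (2 * rate2 kp) *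
     (rate1 kp * rate2 kp * (24 / p%:R) ^+ 2) ^+ k.
Proof.
move=> kp0 D00 D10 hdec p6 hd hk.
have p0 : (0 < p)%N by exact: leq_trans p6.
have pR : 6 <= p%:R :> R by rewrite ler_nat.
have pR0 : 0 < p%:R :> R by exact: lt_le_trans pR.
(* Distinct zeros in an interval of length at most 1/2 stay distinct on the circle; this is what p
   >= 6 is for. *)
have p3 : 3 / p%:R <= 1 / 2 :> R by rewrite ler_pdivrMr //; move: pR; lra.
have [g [gT [x hx] gz]] := gap_green.
have [t [t1 t2 t3]] := gz p N (2 * k)%N x p0 hd hk.
have [s0 s00 hs0] := pairwise_lower_bound (2 * k) (fun i j => sn (t i - t j)).
have sep i j : (i < 2 * k)%N -> (j < 2 * k)%N -> i != j -> s0 <= sn (t i - t j).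
  move=> hi hj ij; apply: hs0 => //.
  have tij : `|t i - t j| <= 1 / 2.
    by have := t1 i hi; have := t1 j hj; rewrite ler_norml; move: p3; move: (3 / _) => *; lra.
  apply: lt_le_trans (sn_ge tij); rewrite normr_gt0 subr_eq0; apply/eqP => e.
  by move/eqP: ij; apply; exact: t3.
have [L [L0 hL]] := trig_zeros kp0 k s00.
pose M := D0 + 4 * (1 - rate kap) ^- 2 * D1 + 1.
have M0 : 0 <= M.
  by rewrite !addr_ge0 // !mulr_ge0 // invr_ge0 exprn_ge0 // subr_ge0 ltW // rate_lt1.
have e1 : expR (- kp) < 1 by rewrite -[ltRHS]expR0 ltr_expR oppr_lt0.
have r10 : 0 <= rate1 kp by rewrite /rate1 divr_ge0 ?expR_ge0 // subr_ge0 ltW.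
have r20 : 0 <= rate2 kp by rewrite /rate2 invr_ge0 subr_ge0 ltW.
rewrite -/M; apply: le_trans hx _; apply/ler_addgt0Pr => e e0.
(* The approximation error is chosen after [L], which depends on the separation of the zeros. *)
pose d := e / (L + 1); have d0 : 0 < d by rewrite divr_gt0 // ltr_wpDl.
have dE : L * d + d = e by rewrite -[X in _ + X]mul1r -mulrDl /d mulrC divfK // gt_eqF // ltr_wpDl.
have [D [c [cs cdec ca]]] := green_trig lam1 E4 kap0 kap4 low kp0 D00 D10 hdec gT d0.
have czero i : (i < 2 * k)%N -> nrm (trig D c (t i)) <= d.
  by move=> hi; have := ca (t i); rewrite t2 // sub0r nrmN.
have := hL D c (2 * M) d t cs (mulr_ge0 (ler0n R 2) M0) cdec (ltW d0) sep czero x.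
set P := \prod_(_ < _) _ => h.
have hP : P <= (24 / p%:R) ^+ 2 ^+ k.
  rewrite -exprM -[X in _ ^+ X]card_ord -prodr_const; apply: ler_prod => i _.
  rewrite mulr_ge0 ?sn_ge0 //=; apply: le_trans (ler_wpM2l _ (sn_le _)) _ => //.
  have /andP[q1 q2] := t1 i (ltn_ord i).
  have : `|x - t i| <= 3 / p%:R by rewrite distrC ger0_norm ?subr_ge0 //; move: q2; lra.
  by rewrite -[24]/(8 * 3)%:R natrM -mulrA; move: (`|_|) (3 / _) => *; lra.
have hx2 : `|g 0 x| <= nrm (trig D c x) + d.
  rewrite -(nrm_real (g 0 x)) -[X in nrm X](subrK (trig D c x)) addrC.
  by apply: le_trans (nrmD _ _) _; rewrite lerD2l.
apply: le_trans hx2 _; rewrite -dE addrA lerD2r.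
apply: le_trans h _; rewrite lerD2r.
rewrite (_ : (rate1 kp * rate2 kp * _) ^+ k = (rate1 kp * rate2 kp) ^+ k * (24 / p%:R) ^+ 2 ^+ k); last exact: exprMn.
rewrite [leRHS]mulrA; apply: ler_wpM2l hP.
by rewrite mulr_ge0 ?exprn_ge0 ?(mulr_ge0 r10 r20) // mulr_ge0 ?mulr_ge0.
Qed.

(* Without the potential the Green function is constant, while the gap labelling forces it to vanish. *)
Lemma free_gap_bound (N : nat) : lam = 0 ->
  (forall w, exists n (i : int), (n <= N)%N /\ `|w - n%:R * alpha - i%:~R| < (1%:R : R)^-1) ->
  (2 * N + 3 <= `|m|)%N -> False.
Proof.
move=> l0 hd hm.
have [g [gT [x hx] gz]] := gap_green.
have hk : (1 + 2 * N + 2)%:R <= (`|m|)%:R / 1%:R :> R.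
  by rewrite divr1 ler_nat; move: hm; clear; lia.
have [t [_ t2 _]] := gz 1%N N 1%N 0 (ltn0Sn 0) hd hk.
have bE j n y : bvec lam alpha E j y n = bvec lam alpha E j 0 n.
  elim: j n => [//|j IH] n.
  have TE f f' : (forall n, f n = f' n) -> forall n, Top lam alpha E y f n = Top lam alpha E 0 f' n.
    by move=> h q; rewrite !TopE l0 !h !mulr0 !mul0r.
  have -> : bvec lam alpha E j.+1 y n = bvec lam alpha E j y n - Top lam alpha E y (Top lam alpha E y (bvec lam alpha E j y)) n by [].
  rewrite IH (TE _ (Top lam alpha E 0 (bvec lam alpha E j 0))) //.
  by apply: TE => q; exact: IH.
have uE j n y : uvec lam alpha E j y n = uvec lam alpha E j 0 n.
  by rewrite /uvec !TopE !(bE j _ y) l0 !mulr0 !mul0r.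
have gE y : g 0 y = g 0 0.
  apply/eqP; rewrite -subr_eq0; apply/eqP.
  apply: (@tail_eq0 R kap kap0 kap4 _ 2) => J.
  have e : \sum_(j < J) uvec lam alpha E j y 0 = \sum_(j < J) uvec lam alpha E j 0 0 by apply: eq_bigr.
  have h1 := gT 0 y J; have := gT 0 0 J; rewrite -e => h2.
  move: h1 h2; move: (\sum_(_ < _) _) => s h1 h2.
  have -> : g 0 y - g 0 0 = (g 0 y - s) - (g 0 0 - s) by ring.
  by apply: le_trans (ler_normB _ _) _; move: h1 h2; do 2!move: `|_| => ?; lra.
by move: hx; rewrite gE -(gE (t 0%N)) t2 // normr0; lra.
Qed.

End Gap.

(** * From beta to the final constants, uniformly in the label *)

Lemma irrational_not_rational (R : realType) (alpha : R) : irrational alpha -> not_rational alpha.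
Proof.
move=> irr n k n0; apply/eqP => h; apply: irr.
have nR : n%:R != 0 :> R by rewrite pnatr_eq0 -lt0n.
exists (k%:~R / n%:R) => //; rewrite fmorph_div /= ratr_int ratr_nat -h.
by rewrite mulrC mulKf.
Qed.

Lemma dist_to_int_ge (R : realType) (x : R) : sn x / 4 <= dist_to_int x.
Proof.
apply: lb_le_inf; first by exists `|x - 0%:~R|, 0.
move=> _ [k _ <-]; rewrite ler_pdivrMr // mulrC.
by have := sn_le (x - k%:~R); have := snDz x (- k); rewrite intrN => ->.
Qed.

Lemma dist_to_int_le (R : realType) (x : R) : dist_to_int x <= sn x.
Proof.
have [k hk] := nearest_int x; apply: le_trans (sn_near hk).
apply: ge_inf; last by exists k.
by exists 0 => _ [j _ <-].
Qed.

Lemma beta_bound_of_beta (R : realType) (alpha bt : R) : not_rational alpha ->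
  (beta alpha < bt%:E)%E -> beta_bound alpha bt.
Proof.
move=> irr /ereal_inf_lt[_ [V [T0 _ hV] <-] hsup].
exists (maxn T0 1) => t ht; have t0 : (0 < t)%N by exact: leq_trans (leq_maxr T0 1) ht.
have tT : (T0 <= t)%N by exact: leq_trans (leq_maxl T0 1) ht.
have : ((- ln (dist_to_int (t%:R * alpha)) / t%:R)%:E < bt%:E)%E.
  by apply: le_lt_trans hsup; apply: ereal_sup_ubound; exists t => //; apply: hV.
rewrite lte_fin ltr_pdivrMr ?ltr0n // => h.
apply: le_trans (dist_to_int_le _).
have d0 : 0 < dist_to_int (t%:R * alpha).
  by apply: lt_le_trans (dist_to_int_ge _); rewrite divr_gt0 // sn_gt0.
by rewrite -[leRHS]lnK ?posrE // ler_expR lerNl; exact: ltW.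
Qed.

(** The last factor is of order exp(- (kp + 1) k) with k about m / (2 p), and p kp <= 65 (1 + kp)
    turns this into exp(- kp m / 130) for small and large kp alike. If kap >= exp(- q m) / 2, the
    resolvent factor costs exp(4 q m), at most half of that decay; the other half absorbs the
    constants. *)
Lemma gap_asymptotics (R : realType) (kp D0 D1 q : R) (N p : nat) : 0 < kp -> 0 <= D0 -> 0 <= D1 ->
  D1 = 0 \/ 4 * q <= kp / 260 -> (0 < p)%N ->
  rate2 kp ^+ 2 * (24 / p%:R) ^+ 2 <= expR (-1) -> p%:R * kp <= 65 * (1 + kp) ->
  exists m0 : nat, forall (m : nat) (kap : R), (m0 <= m)%N -> 0 < kap -> expR (- (q * m%:R)) <= 2 * kap ->
  exists k : nat, (2 * k + 2 * N + 2)%:R <= m%:R / p%:R :> R /\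
   2 * (D0 + 4 * (1 - rate kap) ^- 2 * D1 + 1) * (2 * rate2 kp) *
     (rate1 kp * rate2 kp * (24 / p%:R) ^+ 2) ^+ k < 1 / 100.
Proof.
move=> kp0 D00 D10 hq p0 hp1 hp2.
have pR : 0 < p%:R :> R by rewrite ltr0n.
have e1 : expR (- kp) < 1 by rewrite -[ltRHS]expR0 ltr_expR oppr_lt0.
have r20 : 0 < rate2 kp by rewrite /rate2 invr_gt0 subr_gt0.
pose w := kp / 130; have w0 : 0 < w by rewrite divr_gt0.
pose A := expR ((kp + 1) * (N + 2)%:R); have A0 : 0 < A by exact: expR_gt0.
(* From 1 - rate = kap^2 / 16^2 and 1 / kap <= 2 exp(q m). *)
pose c16 := 4 * (16 ^+ 2 * 4) ^+ 2 : R.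
have c0 : 0 < c16 by apply: mulr_gt0 => //; apply: exprn_gt0; apply: mulr_gt0 => //; apply: exprn_gt0.
pose K := 2 * (D0 + c16 * D1 + 1) * (2 * rate2 kp) * A.
have [m1 hm1] := exp_dominates_poly (100 * K + 1) 0 (divr_gt0 w0 (ltr0Sn R 1)).
exists (maxn m1 (p * (2 * N + 4))) => m kap hm kap0 hkap.
have mm1 : (m1 <= m)%N by exact: leq_trans (leq_maxl _ _) hm.
have mp : (p * (2 * N + 4) <= m)%N by exact: leq_trans (leq_maxr _ _) hm.
pose k := ((m %/ p - (2 * N + 2))./2)%N.
have dv := divn_eq m p; have md := ltn_pmod m p0.
have dq : (2 * N + 4 <= m %/ p)%N by rewrite leq_divRL // mulnC.
have k1 : (2 * k + 2 * N + 2 <= m %/ p)%N by rewrite /k; move: dq; clear; lia.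
have k2 : (m %/ p < 2 * (k + N + 2))%N by rewrite /k; move: dq; clear; lia.
exists k; split.
  by rewrite ler_pdivlMr // -natrM ler_nat (leq_trans _ (leq_divM m p)) // leq_mul2r k1 orbT.
have k3 : (m < 2 * (k + N + 2) * p)%N.
  by rewrite {1}dv; apply: leq_trans (_ : (m %/ p).+1 * p <= _)%N; [rewrite mulSn addnC ltn_add2r|rewrite leq_mul2r k2 orbT].
have kR : m%:R <= 2 * (k%:R + (N + 2)%:R) * p%:R :> R.
  by rewrite -natrD -!natrM ler_nat addnA; exact: ltnW.
have base : rate1 kp * rate2 kp * (24 / p%:R) ^+ 2 <= expR (- (kp + 1)).
  have -> : rate1 kp * rate2 kp * (24 / p%:R) ^+ 2 = expR (- kp) * (rate2 kp ^+ 2 * (24 / p%:R) ^+ 2).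
    by rewrite /rate1 -/(rate2 kp); ring.
  by rewrite opprD expRD ler_wpM2l // expR_ge0.
have base0 : 0 <= rate1 kp * rate2 kp * (24 / p%:R) ^+ 2.
  by rewrite !mulr_ge0 ?(ltW r20) ?sqr_ge0 // /rate1 divr_ge0 ?expR_ge0 // subr_ge0 ltW.
have pk : (rate1 kp * rate2 kp * (24 / p%:R) ^+ 2) ^+ k <= A * expR (- (w * m%:R)).
  apply: le_trans (_ : expR (- (kp + 1)) ^+ k <= _); first by apply: lerXn2r; rewrite ?nnegrE ?expR_ge0.
  rewrite -expRM_natl /A -expRD ler_expR.
  have h1 : w * m%:R <= (kp + 1) * (k%:R + (N + 2)%:R).
    have h2 := ler_wpM2l (ltW w0) kR; apply: le_trans h2 _.
    have h3 : 0 <= k%:R + (N + 2)%:R :> R by rewrite addr_ge0.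
    have -> : w * (2 * (k%:R + (N + 2)%:R) * p%:R) = (k%:R + (N + 2)%:R) * (p%:R * kp / 65) by rewrite /w; field.
    rewrite [leRHS]mulrC; apply: ler_wpM2l => //; move: hp2; move: (p%:R * kp); clear => *; lra.
  by move: h1; move: (w * _) (k%:R) ((N + 2)%:R); clear => *; lra.
have kapE : 4 * (1 - rate kap) ^- 2 <= c16 * expR (4 * q * m%:R).
  have -> : 1 - rate kap = kap ^+ 2 / 16 ^+ 2 by rewrite /rate; ring.
  have i1 : kap^-1 <= 2 * expR (q * m%:R).
    have : kap^-1 <= (expR (- (q * m%:R)) / 2)^-1.
      by rewrite lef_pV2 ?posrE ?divr_gt0 ?expR_gt0 // ler_pdivrMr // [kap * 2]mulrC.
    by rewrite invf_div expRN invrK.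
  have -> : (kap ^+ 2 / 16 ^+ 2) ^- 2 = (16 ^+ 2 * kap^-1 ^+ 2) ^+ 2.
    by rewrite -[LHS]exprVn invf_div exprVn.
  have -> : expR (4 * q * m%:R) = (expR (q * m%:R) ^+ 2) ^+ 2.
    by rewrite -exprM -expRM_natl; congr expR; ring.
  rewrite /c16 -[leRHS]mulrA -(exprMn 2 (16 ^+ 2 * 4)); apply: ler_wpM2l => //.
  have sq : 0 <= 16 ^+ 2 :> R by exact: sqr_ge0.
  apply: lerXn2r; rewrite ?nnegrE; [exact: mulr_ge0 sq (sqr_ge0 _)|exact: mulr_ge0 (mulr_ge0 sq (ler0n R 4)) (sqr_ge0 _)|].
  rewrite -[leRHS]mulrA; apply: ler_wpM2l => //.
  have -> : 4 * expR (q * m%:R) ^+ 2 = (2 * expR (q * m%:R)) ^+ 2 by rewrite exprMn; congr (_ * _); ring.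
  by apply: lerXn2r i1; rewrite ?nnegrE ?invr_ge0 ?(ltW kap0) // mulr_ge0 // expR_ge0.
pose e := expR (- (w / 2 * m%:R)).
have we : expR (- (w * m%:R)) = e * e by rewrite /e -expRD; congr expR; field.
have e0 : 0 < e by exact: expR_gt0.
have le1 : e <= 1.
  by rewrite /e -[leRHS]expR0 ler_expR oppr_le0; apply: mulr_ge0 => //; apply: divr_ge0 => //; exact: ltW.
have D1e : D1 * expR (4 * q * m%:R) * e <= D1.
  case: hq => [->|hq]; first by rewrite !mul0r.
  rewrite -mulrA; apply: ler_piMr => //; rewrite /e -expRD -[leRHS]expR0 ler_expR -mulNr -mulrDl.
  by apply: mulr_le0_ge0 => //; move: hq; rewrite /w; clear; lra.
have Ke : K * e < 1 / 100.
  have := hm1 m mm1; rewrite expr0 mulr1 => h.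
  have eE : expR (w / 2 * m%:R) * e = 1 by rewrite /e -expRD subrr expR0.
  have := ler_wpM2r (ltW e0) h; rewrite eE mulrDl mul1r -mulrA; move: (K * e) e0; clear => *; lra.
apply: le_lt_trans Ke; set r2 := 2 * rate2 kp.
have r2p : 0 <= r2 by rewrite mulr_ge0 // ltW.
have X0 : 0 <= D0 + 4 * (1 - rate kap) ^- 2 * D1 + 1.
  by rewrite !addr_ge0 // mulr_ge0 // mulr_ge0 // invr_ge0 sqr_ge0.
apply: le_trans (ler_wpM2l _ pk) _; first by rewrite mulr_ge0 // mulr_ge0.
rewrite we.
have -> : 2 * (D0 + 4 * (1 - rate kap) ^- 2 * D1 + 1) * r2 * (A * (e * e)) =
   2 * r2 * A * e * ((D0 + 4 * (1 - rate kap) ^- 2 * D1 + 1) * e) by ring.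
have -> : K * e = 2 * r2 * A * e * (D0 + c16 * D1 + 1) by rewrite /K -/r2; ring.
apply: ler_wpM2l; first by rewrite mulr_ge0 ?(ltW e0) // mulr_ge0 ?(ltW A0) // mulr_ge0.
have Y0 : 0 <= D1 * e by rewrite mulr_ge0 // ltW.
have h1 := ler_wpM2r Y0 kapE.
have h2 : c16 * (D1 * expR (4 * q * m%:R) * e) <= c16 * D1 by rewrite ler_pM2l.
have h3 : (D0 + 1) * e <= D0 + 1 by rewrite ler_piMr // addr_ge0.
move: h1 h2 h3; move: (4 * _ ^- 2) (expR (4 * q * _)) => a b h1 h2 h3.
have -> : (D0 + a * D1 + 1) * e = (D0 + 1) * e + a * (D1 * e) by ring.
apply: le_trans (lerD h3 h1) _.
have -> : c16 * b * (D1 * e) = c16 * (D1 * b * e) by ring.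
by apply: le_trans (lerD (lexx _) h2) _; rewrite addrAC.
Qed.

(** Midpoints of gaps have modulus at most 4. The alternative on the dual growth, decided once at
    the cluster point, then serves violations with arbitrarily large labels. *)
Lemma long_gaps_cluster (R : realType) (alpha lam : R) (b : nat -> R) : not_rational alpha -> `|lam| <= 1 ->
  (forall n, 0 <= b n) ->
  ~ (exists m_star : nat, forall m : int, m != 0 -> (m_star <= `|m|)%N ->
       E_plus lam alpha m - E_minus lam alpha m <= b `|m|%N) ->
  exists E0, forall (e : R) (n : nat), 0 < e -> exists m : int, [/\ m != 0, (n <= `|m|)%N,
     b `|m|%N < E_plus lam alpha m - E_minus lam alpha m &
     `|(E_minus lam alpha m + E_plus lam alpha m) / 2 - E0| < e].
Proof.
move=> irr lam1 b0 H.
have hm (n : nat) : exists m : int, [/\ m != 0, (n <= `|m|)%N & b `|m|%N < E_plus lam alpha m - E_minus lam alpha m].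
  apply: contrapT => /forallNP h; apply: H; exists n => m m0 nm; rewrite leNgt; apply/negP => lt.
  by apply: (h m).
have [M hM] := choice hm.
have bd n : `|(E_minus lam alpha (M n) + E_plus lam alpha (M n)) / 2| <= 4.
  have [m0 _ lt] := hM n; have gp := le_lt_trans (b0 _) lt.
  apply: (gap_energy_bound irr m0 lam1); apply: (gap_edgesP gp).
  by move: gp; rewrite subr_gt0; move: (E_plus _ _ _) (E_minus _ _ _) => *; lra.
have [E0 hE0] := cluster_point bd.
exists E0 => e n e0; have [k [nk hk]] := hE0 e n e0.
exists (M k); have [h1 h2 h3] := hM k; split=> //; exact: leq_trans nk h2.
Qed.

(** Two gaps longer than 1 with midpoints within 1/4 of the same point would overlap. This serves
    |lambda| = 1, where the bound to prove is 1. *)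
Lemma gaps_le1 (R : realType) (alpha lam : R) : not_rational alpha -> `|lam| <= 1 ->
  exists m_star : nat, forall m : int, m != 0 -> (m_star <= `|m|)%N ->
       E_plus lam alpha m - E_minus lam alpha m <= 1.
Proof.
move=> irr lam1; apply: contrapT => /(long_gaps_cluster irr lam1 (fun=> ler01))[E0 hE0].
have q4 : 0 < 1 / 4 :> R by lra.
have [m1 [_ _ l1 c1]] := hE0 (1 / 4) 0%N q4.
have [m2 [_ m12 l2 c2]] := hE0 (1 / 4) (`|m1|.+1)%N q4.
have g1 : gap_set lam alpha m1 ((E_minus lam alpha m1 + E_plus lam alpha m1) / 2).
  by apply: gap_edgesP; [exact: lt_trans l1|move: l1; move: (E_plus _ _ _) (E_minus _ _ _) => *; lra].
have g2 : gap_set lam alpha m2 ((E_minus lam alpha m1 + E_plus lam alpha m1) / 2).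
  apply: gap_edgesP; first exact: lt_trans l2.
  move: l2 c1 c2; rewrite !ltr_norml.
  by move: (E_plus _ _ m1) (E_minus _ _ m1) (E_plus _ _ m2) (E_minus _ _ m2) => *; lra.
by move: m12; rewrite (gap_sets_disjoint irr g1 g2) ltnn.
Qed.

Lemma free_gaps (R : realType) (alpha : R) : not_rational alpha ->
  exists m_star : nat, forall m : int, m != 0 -> (m_star <= `|m|)%N ->
       E_plus 0 alpha m - E_minus 0 alpha m <= 0.
Proof.
move=> irr; have p1 : 0 < (1%:R : R)^-1 by rewrite invr1.
have [N hN] := dense_orbit irr p1.
exists (2 * N + 3)%N => m m0 hm; rewrite leNgt; apply/negP => gp.
have z1 : `|0 : R| <= 1 by rewrite normr0.
have lt : E_minus 0 alpha m < E_plus 0 alpha m by rewrite -subr_gt0.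
exact: (free_gap_bound irr z1 m0 lt (gap_edgesP gp) erefl hN hm).
Qed.

Lemma gaps_exponentially_small (R : realType) : exists2 delta : R, 0 < delta &
  forall alpha lam h q bt : R, not_rational alpha -> 0 < h -> `|lam| = expR (- h) -> 0 <= bt -> bt <= delta * h ->
   beta_bound alpha bt -> 4 * q <= h / 1024 / 260 ->
   exists m_star : nat, forall m : int, m != 0 -> (m_star <= `|m|)%N ->
       E_plus lam alpha m - E_minus lam alpha m <= expR (- (q * `|m|%:R)).
Proof.
have [delta [delta0 hd]] := dual_decay R; exists delta => // alpha lam h q bt irr h0 lamE bt0 btd hb hq.
have lam1 : `|lam| <= 1 by rewrite lamE -[leRHS]expR0 ler_expR oppr_le0 ltW.
apply: contrapT => H.
have [E0 hE0] := long_gaps_cluster (b := fun n => expR (- (q * n%:R))) irr lam1 (fun n => expR_ge0 _) H.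
have [kp [D0 [D1 [r0 [[kp0 D00 D10 r00] hD1 hdec]]]]] := hd alpha h lam bt E0 irr h0 lamE bt0 btd hb.
have e1 : expR (- kp) < 1 by rewrite -[ltRHS]expR0 ltr_expR oppr_lt0.
have r20 : 0 < rate2 kp by rewrite /rate2 invr_gt0 subr_gt0.
(* p is just above 64 [rate2]: then (24 rate2 / p)^2 is below 1 / e, and p kp <= 65 (1 + kp) because
   rate2 kp <= 1 + kp. *)
pose p := (Num.truncn (64 * rate2 kp)).+1.
have /andP[p1 p2] := truncn_itv (mulr_ge0 (ler0n R 64) (ltW r20)).
have p2' : 64 * rate2 kp < p%:R by exact: p2.
have p1' : p%:R <= 64 * rate2 kp + 1 by rewrite /p -natr1 lerD2r.
have p0 : 0 < p%:R :> R by rewrite ltr0n.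
have r21 : 1 <= rate2 kp by rewrite /rate2 invf_ge1 ?subr_gt0 // gerBl expR_ge0.
have p6 : (6 <= p)%N.
  by rewrite -(ler_nat R); apply: ltW; apply: le_lt_trans p2; move: r21; move: (rate2 _); clear => *; lra.
have c1 : rate2 kp ^+ 2 * (24 / p%:R) ^+ 2 <= expR (-1).
  have h1 : rate2 kp * (24 / p%:R) <= 1 / 2.
    rewrite mulrA ler_pdivrMr //; move: p2' r20; move: (p%:R) (rate2 _); clear => *; lra.
  have h2 : 1 / 2 <= expR (- (1 / 2)) :> R by apply: le_trans (expR_ge1Dx _); clear; lra.
  have -> : -1 = - (1 / 2) + - (1 / 2) :> R by field.
  rewrite expRD -expRD -exprMn expRD -expr2; apply: lerXn2r; rewrite ?nnegrE ?expR_ge0 //.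
    by rewrite mulr_ge0 ?(ltW r20) // divr_ge0 // ltW.
  exact: le_trans h1 h2.
have c2 : p%:R * kp <= 65 * (1 + kp).
  have h1 : rate2 kp * kp <= 1 + kp.
    rewrite /rate2 mulrC ler_pdivrMr ?subr_gt0 //.
    have h2 : (1 + kp) * expR (- kp) <= 1.
      have := expR_ge1Dx kp; rewrite -(ler_pM2r (expR_gt0 (- kp))) -expRD subrr expR0; done.
    by move: h2; move: (expR _); clear => *; lra.
  have := ler_wpM2r (ltW kp0) p1'; rewrite mulrDl mul1r -mulrA; move: (p%:R * kp) (rate2 kp * kp) h1 kp0; clear => *; lra.
have pV0 : 0 < p%:R^-1 :> R by rewrite invr_gt0.
have [N hN] := dense_orbit irr pV0.
have hq' : D1 = 0 \/ 4 * q <= kp / 260 by case: hD1 => [->|->]; [left|right].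
have [n hn] := gap_asymptotics N kp0 D00 D10 hq' (ltn0Sn _) c1 c2.
have [m [m0 nm lt cl]] := hE0 r0 n r00.
have gp := lt_trans (expR_gt0 _) lt.
have E12 : E_minus lam alpha m < E_plus lam alpha m by rewrite -subr_gt0.
have kap0 : 0 < (E_plus lam alpha m - E_minus lam alpha m) / 2 by rewrite divr_gt0.
have hk : expR (- (q * `|m|%:R)) <= 2 * ((E_plus lam alpha m - E_minus lam alpha m) / 2).
  by move: lt; move: (expR _) (E_plus _ _ _) (E_minus _ _ _); clear => *; lra.
have [k [k1 k2]] := hn `|m|%N _ nm kap0 hk.
have := gap_bound irr lam1 m0 E12 (gap_edgesP gp) kp0 D00 D10 (hdec _ (ltW cl)) p6 hN k1.
by rewrite leNgt k2.
Qed.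

Theorem theorem1p3 (R : realType) :
  exists C : R, 0 < C /\
    forall alpha : R, irrational alpha ->
      (0 <= beta alpha)%E -> (beta alpha < +oo)%E ->
      forall lambda : R, `|lambda| <= expR (- C * fine (beta alpha)) ->
        exists m_star : nat, forall m : int, m != 0 ->
          (m_star <= absz m)%N ->
          E_plus lambda alpha m - E_minus lambda alpha m
            <= `|lambda| `^ (C^-1 * (absz m)%:R).
Proof.
have [delta delta0 main] := gaps_exponentially_small R.
(* q = h / C has to satisfy 4 q <= kp / 260 with kp = h / 1024; the summand 2 / delta of C makes
   beta strictly smaller than delta h. *)
pose C0 := 4 * (1024 * 260) : R.
have C00 : 0 < C0 := mulr_gt0 (ltr0Sn R 3) (mulr_gt0 (ltr0Sn R 1023) (ltr0Sn R 259)).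
have d20 : 0 < 2 / delta by rewrite divr_gt0.
pose C := C0 + 2 / delta.
have Cp : 0 < C by rewrite addr_gt0.
exists C; split=> // alpha /irrational_not_rational irr b0 bfin lam hlam.
set b := fine (beta alpha) in hlam.
have bE : beta alpha = b%:E.
  by rewrite fineK // ge0_fin_numE.
have bp : 0 <= b by rewrite -lee_fin -bE.
have lam1 : `|lam| <= 1.
  by apply: le_trans hlam _; rewrite -[leRHS]expR0 ler_expR mulNr oppr_le0 mulr_ge0 // ltW.
(* Here the right-hand side is 0, so the gaps have to be closed. *)
have [l0|l0] := eqVneq lam 0.
  have [N hN] := free_gaps irr; exists N.+1 => m m0 hm; rewrite l0.
  by apply: le_trans (hN m m0 (ltnW hm)) _; exact: powR_ge0.
have lp : 0 < `|lam| by rewrite normr_gt0.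
(* |lam| = 1 can occur when beta vanishes; then h = 0 and no decay is available. *)
have [l1|l1] := eqVneq `|lam| 1.
  have [N hN] := gaps_le1 irr lam1; exists N => m m0 hm; rewrite l1 powR1; exact: hN.
pose h := - ln `|lam|.
have h0 : 0 < h by rewrite oppr_gt0 ln_lt0 // lp lt_neqAle l1.
have lamE : `|lam| = expR (- h) by rewrite opprK lnK.
have hb : C * b <= h by move: hlam; rewrite lamE ler_expR mulNr lerN2.
have bd : b < delta * h.
  have h1 : delta * (C * b) <= delta * h by rewrite ler_pM2l.
  have h2 : delta * (2 / delta) = 2 by rewrite mulrC divfK // gt_eqF.
  have h3 : 2 * b <= delta * (C * b).
    by rewrite mulrA ler_wpM2r // /C mulrDr h2 lerDr mulr_ge0 // ltW.
  have [bz|bz] := eqVneq b 0; first by rewrite bz mulr_gt0.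
  by have b1 : 0 < b; [rewrite lt_neqAle eq_sym bz|move: h1 h3 b1; move: (delta * h) (delta * _); clear => *; lra].
have bb : beta_bound alpha (delta * h) by apply: beta_bound_of_beta => //; rewrite bE lte_fin.
have hq : 4 * (h / C) <= h / 1024 / 260.
  have -> : h / 1024 / 260 = 4 * (h / C0).
    rewrite /C0 -mulrA -invfM [in RHS]invfM mulrCA [4 * _]mulrA divff ?mul1r //.
  rewrite ler_pM2l // ler_pM2l // lef_pV2 ?posrE //.
  by rewrite /C lerDl ltW.
have [N hN] := main alpha lam h (h / C) (delta * h) irr h0 lamE (ltW (mulr_gt0 delta0 h0)) (lexx _) bb hq.
exists N => m m0 hm; apply: le_trans (hN m m0 hm) _.
rewrite /powR gt_eqF // ler_expR.
have -> : ln `|lam| = - h by rewrite opprK.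
by rewrite le_eqVlt; apply/orP; left; apply/eqP; ring.
Qed.
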